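(* Let $(M,g)$ be the anti-self-dual Taub–NUT manifold with parameter $m\ge 0$ and its parallel two-forms $\Omega^1,\Omega^2,\Omega^3$. The conformal geodesic equation on $(M,g)$ is completely integrable in the Arnold–Liouville sense. That is: (1) it reduces to a geodesic equation in a self-dual magnetic field: a curve with unit tangent vector $u$ and acceleration $a=\nabla_u u$ satisfies the conformal geodesic equation if and only if there are a constant $e\ge 0$ and a constant unit vector $(c^1,c^2,c^3)\in\mathbb{R}^3$ such that $$u^b\nabla_b u^a=e\,F^a{}_b\,u^b,\qquad F=\sum_{i=1}^3 c^i\,\Omega^i ,$$ and then $e=|a|$; and for every such $e$ and $(c^1,c^2,c^3)$ the Hamiltonian system describing this motion (with Hamiltonian $\mathcal H=\tfrac12 g^{ab}P_aP_b$ and symplectic form $dP_a\wedge dq^a+eF$ on the eight-dimensional phase space $T^*M$) admits four functionally independent first integrals, one of which may be taken to be $\mathcal H$, which are in involution with respect to the corresponding Poisson bracket. (2) The associated Hamilton–Jacobi equation $$g^{ab}(\partial_a S-e\Phi_a)(\partial_b S-e\Phi_b)=\mu^2,\qquad d\Phi=F,$$ is separable, and the conformal geodesic equations on $(M,g)$ reduce to quadratures.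
   Context: The anti-self-dual (ASD) Taub–NUT metric is $$g=V\big(dr^2+r^2(d\theta^2+\sin^2\theta\, d\phi^2)\big)+V^{-1}(d\psi+m\cos\theta\, d\phi)^2,\qquad V=1+\frac{m}{r},$$ where $m$ is a non-negative constant; the apparent singularity at $r=0$ is removable. Let $(x^1,x^2,x^3)$ be the Cartesian coordinates on $\mathbb{R}^3$ with spherical polar coordinates $(r,\theta,\phi)$, and set $e^i=V^{1/2}dx^i$ for $i=1,2,3$, and $e^4=V^{-1/2}(d\psi+m\cos\theta\,d\phi)$. The hyper-Kähler structure of $g$ is given by the parallel two-forms $$\Omega^1=e^1\wedge e^4+e^2\wedge e^3,\quad \Omega^2=e^2\wedge e^4+e^3\wedge e^1,\quad \Omega^3=e^3\wedge e^4+e^1\wedge e^2,$$ which are self-dual for the orientation in which the Riemann tensor of $g$ is anti-self-dual; $g$ is Ricci-flat. Conformal geodesics: on an $n$-dimensional manifold ($n>2$) with metric $g$ and Levi-Civita connection $\nabla$, a curve with unit tangent vector $u$ (arc-length parametrisation) and acceleration $a=\nabla_u u$ is a conformal geodesic if $$\nabla_u a=-(|a|^2+L(u,u))u+L^\sharp(u),$$ where $L=\frac{1}{n-2}\big(R-\frac{1}{2(n-1)}Sg\big)$ is the Schouten tensor ($R$ the Ricci tensor, $S$ the Ricci scalar), and $g(L^\sharp(X),Y)=L(X,Y)$. For a Ricci-flat metric this is $\nabla_u a=-|a|^2u$, where $|a|^2=g(a,a)$ is constant along the curve. Notation: $q^a$ are local coordinates on $M$, $P_a$ are the corresponding fibre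 coordinates on $T^*M$, indices are raised and lowered with $g$, and $u^a=g^{ab}P_b$. Functions $\mathcal I_1,\dots,\mathcal I_4$ on phase space are in involution if all their pairwise Poisson brackets vanish; functional independence is understood on an open dense set. $\Phi$ is a (local) potential one-form for $F$. The Hamilton–Jacobi equation is called separable if, for a suitable choice of $\Phi$ and of local coordinates on $M$, it admits a complete integral $S$ which is a sum of functions each depending on a single coordinate (and on the separation constants). The equations ''reduce to quadratures'' if their general solution is obtained by finitely many algebraic operations, inversions of functions and integrations of known functions of one variable. *)

(* Defs.v *)
From HB Require Import structures.
From mathcomp Require Import all_boot all_order all_algebra.
From mathcomp Require Import all_classical all_reals all_analysis.
From mathcomp Require Import ring lra.

Set Implicit Arguments.
Unset Strict Implicit.
Unset Printing Implicit Defensive.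

Import Order.TTheory GRing.Theory Num.Theory.
Import numFieldNormedType.Exports.

Local Open Scope classical_set_scope.
Local Open Scope ring_scope.

Definition pd (R : realType) (n : nat) (W : normedModType R) (i : 'I_n)
    (f : 'rV[R]_n -> W) : 'rV[R]_n -> W :=
  'D_(delta_mx 0 i) f.

Definition differential (R : realType) (n : nat) (f : 'rV[R]_n -> R)
    (x : 'rV[R]_n) : 'rV[R]_n :=
  \row_i pd i f x.

(* Class C^k on the open set U, through iterated directional derivatives (for
   a finite-dimensional V this is the usual notion). *)
Fixpoint Ck_on (R : realType) (V W : normedModType R) (k : nat) (U : set V)
    (f : V -> W) : Prop :=
  (forall x, U x -> {for x, continuous f}) /\
  if k is k'.+1 then
    forall v, (forall x, U x -> derivable f x v) /\ Ck_on k' U ('D_v f)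
  else True.

Definition smooth_on (R : realType) (V W : normedModType R) (U : set V)
    (f : V -> W) : Prop :=
  forall k, Ck_on k U f.

Definition open_interval (R : realType) (J : set R) : Prop :=
  open J /\ is_interval J.

(* Tensors are fields on a global chart R^n: a metric is its matrix g_ab, a
   two-form its matrix F_ab with F = 1/2 F_ab dq^a /\ dq^b; vectors and
   covectors are rows of components. *)

Section Geometry.
Context {R : realType} {n : nat}.
Implicit Types (g : 'rV[R]_n -> 'M[R]_n) (q X Y : 'rV[R]_n) (t : R).

Definition inner g q X Y : R := (X *m g q *m Y^T) 0 0.

(* Gamma^k_ij *)
Definition christoffel g (k i j : 'I_n) q : R :=
  2^-1 * \sum_l invmx (g q) k l *
    (pd i (fun p => g p l j) q + pd j (fun p => g p l i) q
     - pd l (fun p => g p i j) q).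

(* R^k_lij, with R(X,Y)Z = nabla_X nabla_Y Z - nabla_Y nabla_X Z - nabla_[X,Y] Z
   and R(d_i, d_j) d_l = R^k_lij d_k. *)
Definition riemann g (k l i j : 'I_n) q : R :=
  pd i (christoffel g k j l) q - pd j (christoffel g k i l) q
  + \sum_p (christoffel g k i p q * christoffel g p j l q
            - christoffel g k j p q * christoffel g p i l q).

Definition ricci g q : 'M[R]_n :=
  \matrix_(l, j) \sum_i riemann g i l i j q.

Definition scalar_curvature g q : R :=
  \sum_i \sum_j invmx (g q) i j * ricci g q i j.

Definition schouten g q : 'M[R]_n :=
  (n%:R - 2)^-1 *:
    (ricci g q - (scalar_curvature g q / (2 * (n%:R - 1))) *: g q).

(* nabla_u X for a vector field X along the curve gamma, u = gamma'. *)
Definition cov_deriv g (gamma X : R -> 'rV[R]_n) t : 'rV[R]_n :=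
  derive1 X t + \row_k \sum_i \sum_j
    christoffel g k i j (gamma t) * (derive1 gamma t) 0 i * X t 0 j.

Definition acceleration g (gamma : R -> 'rV[R]_n) : R -> 'rV[R]_n :=
  cov_deriv g gamma (derive1 gamma).

Definition sharp g q (alpha : 'rV[R]_n) : 'rV[R]_n := alpha *m invmx (g q).

(* nabla_u a = - (|a|^2 + L(u,u)) u + L^#(u) along J *)
Definition conformal_geodesic g (J : set R) (gamma : R -> 'rV[R]_n) : Prop :=
  forall t, J t ->
    let q := gamma t in
    let u := derive1 gamma t in
    let a := acceleration g gamma t in
    cov_deriv g gamma (acceleration g gamma) t
    = - (inner g q a a + inner (schouten g) q u u) *: u
      + sharp g q (u *m schouten g q).

Definition unit_speed_curve g (J : set R) (gamma : R -> 'rV[R]_n) : Prop :=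
  Ck_on 3 J gamma /\
  forall t, J t -> inner g (gamma t) (derive1 gamma t) (derive1 gamma t) = 1.

(* u^b nabla_b u^a = e F^a_b u^b along J *)
Definition magnetic_geodesic g (F : 'rV[R]_n -> 'M[R]_n) (e : R) (J : set R)
    (gamma : R -> 'rV[R]_n) : Prop :=
  forall t, J t ->
    acceleration g gamma t
    = e *: sharp g (gamma t) (derive1 gamma t *m (F (gamma t))^T).

Definition ext_deriv (Phi : 'rV[R]_n -> 'rV[R]_n) q : 'M[R]_n :=
  \matrix_(a, b) (pd a (fun p => Phi p 0 b) q - pd b (fun p => Phi p 0 a) q).

Definition local_chart (U : set 'rV[R]_n) (kappa : 'rV[R]_n -> 'rV[R]_n) :
    Prop :=
  [/\ smooth_on U kappa, {in U &, injective kappa} &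
      forall q, U q -> (\matrix_(a, b) pd a kappa q 0 b) \in unitmx].

End Geometry.

Section PhaseSpace.
Context {R : realType} {n : nat}.
Implicit Types (g F : 'rV[R]_n -> 'M[R]_n) (e : R) (z : 'rV[R]_(n + n))
  (f h : 'rV[R]_(n + n) -> R).

(* A point z of T*M is row_mx q P. *)
Definition pos z : 'rV[R]_n := lsubmx z.
Definition mom z : 'rV[R]_n := rsubmx z.

(* Matrix of dP_a /\ dq^a + e F. *)
Definition symplectic_form F e z : 'M[R]_(n + n) :=
  block_mx (e *: F (pos z)) (- 1%:M) 1%:M 0.

(* The Hamiltonian vector field X_h of h: omega(X_h, .) = - dh. *)
Definition ham_vec F e h z : 'rV[R]_(n + n) :=
  - differential h z *m invmx (symplectic_form F e z).

(* {f, h} = df(X_h) *)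
Definition poisson F e f h z : R :=
  (differential f z *m (ham_vec F e h z)^T) 0 0.

Definition hamiltonian g z : R :=
  2^-1 * (mom z *m invmx (g (pos z)) *m (mom z)^T) 0 0.

Definition hamilton_equations F e h (J : set R) (z : R -> 'rV[R]_(n + n)) :
    Prop :=
  forall t, J t -> derive1 z t = ham_vec F e h (z t).

Definition first_integral F e h f : Prop := forall z, poisson F e f h z = 0.

Definition liouville_integrable F e h : Prop :=
  exists I : 'I_n -> 'rV[R]_(n + n) -> R,
    [/\ exists i0, I i0 = h,
        forall i, smooth_on [set: 'rV[R]_(n + n)] (I i)
                  /\ first_integral F e h (I i),
        forall i j z, poisson F e (I i) (I j) z = 0 &
        exists O : set 'rV[R]_(n + n), [/\ open O, dense O &
          forall z, O z -> row_free (\matrix_(i, a) differential (I i) z 0 a)]].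

(* A family S of solutions, depending on n constants, of
   g^ab (d_a S - e Phi_a) (d_b S - e Phi_b) = mu^2, on W; a point of W
   is row_mx q lam, and the constant lam^i0 is mu. *)
Definition complete_integral g e (Phi : 'rV[R]_n -> 'rV[R]_n) (i0 : 'I_n)
    (W : set 'rV[R]_(n + n)) (S : 'rV[R]_(n + n) -> R) : Prop :=
  [/\ Ck_on 2 W S,
      forall w, W w ->
        let p := \row_a pd (lshift n a) S w - e *: Phi (pos w) in
        (p *m invmx (g (pos w)) *m p^T) 0 0 = (mom w 0 i0) ^+ 2 &
      forall w, W w ->
        \det (\matrix_(a, b) pd (rshift n b) (pd (lshift n a) S) w) != 0].

(* Phi and the coordinates kappa are defined on an open dense set U, and for
   (q0, P0) in an open dense subset of T*U there is a complete integral
   S = \sum_i s_i (kappa^i, lam) near q0 whose member lam0 has momentum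
   P0 = dS - e Phi at q0. *)
Definition hj_separable g F e : Prop :=
  exists (U : set 'rV[R]_n) (Phi kappa : 'rV[R]_n -> 'rV[R]_n)
         (O : set 'rV[R]_(n + n)),
    [/\ open U /\ dense U,
        smooth_on U Phi /\ (forall q, U q -> ext_deriv Phi q = F q),
        local_chart U kappa,
        [/\ open O, dense O & forall z, O z -> U (pos z)] &
        forall z, O z ->
          exists (i0 : 'I_n) (lam0 : 'rV[R]_n) (W : set 'rV[R]_(n + n))
                 (s : 'I_n -> R -> 'rV[R]_n -> R),
            let S := fun w => \sum_i s i (kappa (pos w) 0 i) (mom w) in
            let w0 := row_mx (pos z) lam0 in
            [/\ open W, W w0, forall w, W w -> U (pos w),
                complete_integral g e Phi i0 W S &
                \row_a pd (lshift n a) S w0 - e *: Phi (pos z) = mom z]].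

End PhaseSpace.

(* A scheme prescribes finitely many algebraic operations, substitutions,
   integrations and inversions of functions of one variable. *)

Inductive scheme : Type :=
| SVar
| SConst of nat
| SOpp of scheme
| SAdd of scheme & scheme
| SMul of scheme & scheme
| SInv of scheme
| SRoot of nat & scheme
| SComp of scheme & scheme
| SPrim of scheme
| SInvf of scheme.

(* On the open interval I, f is obtained by the scheme t, the constants being
   the values of k. SPrim allows every primitive, i.e. every constant of
   integration. *)
Fixpoint by_scheme (R : realType) (k : nat -> R) (t : scheme) (I : set R)
    (f : R -> R) : Prop :=
  match t with
  | SVar => forall x, I x -> f x = x
  | SConst i => forall x, I x -> f x = k i
  | SOpp s => exists2 f1, by_scheme k s I f1 &
      forall x, I x -> f x = - f1 x
  | SAdd s1 s2 => exists f1 f2, [/\ by_scheme k s1 I f1, by_scheme k s2 I f2 &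
      forall x, I x -> f x = f1 x + f2 x]
  | SMul s1 s2 => exists f1 f2, [/\ by_scheme k s1 I f1, by_scheme k s2 I f2 &
      forall x, I x -> f x = f1 x * f2 x]
  | SInv s => exists2 f1, by_scheme k s I f1 &
      forall x, I x -> f1 x != 0 /\ f x = (f1 x)^-1
  | SRoot d s => exists2 f1, by_scheme k s I f1 &
      forall x, I x -> 0 <= f x /\ f x ^+ d.+1 = f1 x
  | SComp s1 s2 => exists (J : set R) (f1 f2 : R -> R),
      [/\ open_interval J, by_scheme k s1 J f1, by_scheme k s2 I f2 &
          forall x, I x -> J (f2 x) /\ f x = f1 (f2 x)]
  | SPrim s => exists2 f1, by_scheme k s I f1 &
      forall x, I x -> is_derive x 1 f (f1 x)
  | SInvf s => exists (J : set R) (f1 : R -> R),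
      [/\ open_interval J, by_scheme k s J f1, {in J &, injective f1} &
          forall x, I x -> J (f x) /\ f1 (f x) = x]
  end.

Section Quadratures.
Context {R : realType} {n : nat}.
Implicit Types (g : 'rV[R]_n -> 'M[R]_n).

(* Initial data (q, u, a) of unit-speed curves. *)
Definition initial_data g : set ('rV[R]_n * 'rV[R]_n * 'rV[R]_n) :=
  [set d | inner g d.1.1 d.1.2 d.1.2 = 1 /\ inner g d.1.1 d.1.2 d.2 = 0].

(* One scheme per coordinate, independent of the curve, gives all the conformal
   geodesics with initial data in a relatively open and dense set. *)
Definition conformal_geodesics_by_quadratures g : Prop :=
  exists (T : 'I_n -> scheme) (O : set ('rV[R]_n * 'rV[R]_n * 'rV[R]_n)),
    [/\ open O, initial_data g `<=` closure (initial_data g `&` O) &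
      forall (J : set R) (gamma : R -> 'rV[R]_n) (t0 : R),
        open_interval J -> unit_speed_curve g J gamma ->
        conformal_geodesic g J gamma -> J t0 ->
        O (gamma t0, derive1 gamma t0, acceleration g gamma t0) ->
        exists (k : nat -> R) (I : set R),
          [/\ open_interval I, I t0, I `<=` J &
              forall i, by_scheme k (T i) I (fun t => gamma t 0 i)]].

End Quadratures.

(* For m > 0, M = R^4 = C^2 with coordinates
      y^0 + i y^1 = 2 sqrt(m r) cos(theta/2) exp(i (psi/m + phi)/2),
      y^2 + i y^3 = 2 sqrt(m r) sin(theta/2) exp(i (psi/m - phi)/2)
   (lemmas tn_x_polar and tn_eta_polar), so that r = 0 is the origin and psi
   has period 4 pi m. For m = 0, M = R^3 x R with coordinates
   (x^1, x^2, x^3, psi). Indices start at 0. *)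

Section TaubNUT.
Context {R : realType}.
Implicit Types (m : R) (y : 'rV[R]_4).

(* The Cartesian coordinates x^i as functions on M (the Hopf map). *)
Definition tn_x m (i : 'I_3) y : R :=
  if m == 0 then y 0 (widen_ord (leqnSn 3) i) else
  [:: (y 0 0 * y 0 2 + y 0 1 * y 0 3) / (2 * m);
      (y 0 1 * y 0 2 - y 0 0 * y 0 3) / (2 * m);
      (y 0 0 ^+ 2 + y 0 1 ^+ 2 - y 0 2 ^+ 2 - y 0 3 ^+ 2) / (4 * m)]`_i.

Definition tn_r m y : R := Num.sqrt (\sum_i tn_x m i y ^+ 2).

Definition tn_V m y : R := 1 + m / tn_r m y.

(* d psi + m cos theta d phi, for r <> 0 *)
Definition tn_eta m y : 'rV[R]_4 :=
  if m == 0 then delta_mx 0 3 else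
  (2 * tn_r m y)^-1 *: \row_j [:: - y 0 1; y 0 0; - y 0 3; y 0 2]`_j.

Definition tn_e m (i : 'I_3) y : 'rV[R]_4 :=
  Num.sqrt (tn_V m y) *: differential (tn_x m i) y.

Definition tn_e4 m y : 'rV[R]_4 := (Num.sqrt (tn_V m y))^-1 *: tn_eta m y.

Definition wedge (alpha beta : 'rV[R]_4) : 'M[R]_4 :=
  alpha^T *m beta - beta^T *m alpha.

(* Extension by continuity over the removable singularity r = 0. *)
Definition extend_nut m (f : 'rV[R]_4 -> 'M[R]_4) y : 'M[R]_4 :=
  if tn_r m y == 0 then lim (f z @[z --> y^']) else f y.

Definition tn_metric m : 'rV[R]_4 -> 'M[R]_4 :=
  extend_nut m (fun y =>
    \sum_i (tn_e m i y)^T *m tn_e m i y + (tn_e4 m y)^T *m tn_e4 m y).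

(* Omega^i = e^i /\ e^4 + e^(i+1) /\ e^(i+2), addition in 'I_3 being mod 3. *)
Definition tn_Omega m (i : 'I_3) : 'rV[R]_4 -> 'M[R]_4 :=
  extend_nut m (fun y =>
    wedge (tn_e m i y) (tn_e4 m y) + wedge (tn_e m (i + 1) y) (tn_e m (i + 2) y)).

Definition tn_F m (c : 'rV[R]_3) y : 'M[R]_4 :=
  \sum_i c 0 i *: tn_Omega m i y.

Definition tn_polar m (r theta phi psi : R) : 'rV[R]_4 :=
  (2 * Num.sqrt (m * r)) *: \row_j
    [:: cos (theta / 2) * cos ((psi / m + phi) / 2);
        cos (theta / 2) * sin ((psi / m + phi) / 2);
        sin (theta / 2) * cos ((psi / m - phi) / 2);
        sin (theta / 2) * sin ((psi / m - phi) / 2)]`_j.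

End TaubNUT.

Lemma tn_x_polar (R : realType) (m r theta phi psi : R) (i : 'I_3) :
  0 < m -> 0 < r ->
  tn_x m i (tn_polar m r theta phi psi)
  = [:: r * sin theta * cos phi; r * sin theta * sin phi; r * cos theta]`_i.
Proof.
move=> m0 r0; have mN0 : m != 0 by rewrite gt_eqF.
have hs : Num.sqrt (m * r) ^+ 2 = m * r by rewrite sqr_sqrtr// mulr_ge0// ltW.
set a := (psi / m + phi) / 2; set b := (psi / m - phi) / 2.
have ephi : phi = a - b by rewrite /a /b; field.
have eth : theta = theta / 2 + theta / 2 by field.
have est : sin theta = 2 * (cos (theta / 2) * sin (theta / 2)).
  by rewrite [in LHS]eth sinD; ring.
have hc := cos2Dsin2 (theta / 2).
have ha := cos2Dsin2 a; have hb := cos2Dsin2 b.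
rewrite /tn_x (negbTE mN0).
case: i => [[|[|[|//]]]] Hi /=; rewrite !mxE/= -/a -/b.
- rewrite ephi est cosB.
  transitivity (4 * Num.sqrt (m * r) ^+ 2 *
    (cos (theta / 2) * sin (theta / 2) * (cos a * cos b + sin a * sin b)) / (2 * m));
    first by field.
  by rewrite hs; field.
- rewrite ephi est sinB.
  transitivity (4 * Num.sqrt (m * r) ^+ 2 *
    (cos (theta / 2) * sin (theta / 2) * (sin a * cos b - cos a * sin b)) / (2 * m));
    first by field.
  by rewrite hs; field.
- rewrite [in RHS]eth cosD.
  transitivity (4 * Num.sqrt (m * r) ^+ 2 *
    (cos (theta / 2) ^+ 2 * (cos a ^+ 2 + sin a ^+ 2)
     - sin (theta / 2) ^+ 2 * (cos b ^+ 2 + sin b ^+ 2)) / (4 * m));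
    first by field.
  by rewrite hs ha hb; field.
Qed.

Lemma tn_r_polar (R : realType) (m r theta phi psi : R) :
  0 < m -> 0 < r -> tn_r m (tn_polar m r theta phi psi) = r.
Proof.
move=> m0 r0; rewrite /tn_r; under eq_bigr do rewrite tn_x_polar//.
rewrite !big_ord_recl big_ord0/=.
transitivity (Num.sqrt (r ^+ 2)); last by rewrite sqrtr_sqr gtr0_norm.
congr Num.sqrt.
transitivity (r ^+ 2 * (sin theta ^+ 2 * (cos phi ^+ 2 + sin phi ^+ 2)
  + cos theta ^+ 2)); first by ring.
by rewrite cos2Dsin2 mulr1 addrC cos2Dsin2 mulr1.
Qed.

(* Along every curve, the one-form tn_eta is d psi + m cos theta d phi. *)
Lemma tn_eta_polar (R : realType) (m : R) (r theta phi psi : R -> R) (t : R) :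
  0 < m -> 0 < r t ->
  derivable r t 1 -> derivable theta t 1 ->
  derivable phi t 1 -> derivable psi t 1 ->
  let y := fun s => tn_polar m (r s) (theta s) (phi s) (psi s) in
  (derive1 y t *m (tn_eta m (y t))^T) 0 0
  = derive1 psi t + m * cos (theta t) * derive1 phi t.
Proof.
move=> m0 r0 dr dth dph dps y; have mN0 : m != 0 by rewrite gt_eqF.
have rN0 : r t != 0 by rewrite gt_eqF.
have hs : Num.sqrt (m * r t) ^+ 2 = m * r t.
  by rewrite sqr_sqrtr// mulr_ge0// ltW.
have comp_d (f g : R -> R) df dg : is_derive t 1 g dg ->
    is_derive (g t) 1 f df -> is_derive t 1 (fun s => f (g s)) (dg * df).
  by move=> dg' df'; have := @is_derive1_comp _ f g t df dg; rewrite mulrC; exact.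
have mul_d (f g : R -> R) df dg : is_derive t 1 f df -> is_derive t 1 g dg ->
    is_derive t 1 (fun s => f s * g s) (df * g t + f t * dg).
  move=> df' dg'; have -> : df * g t + f t * dg = f t *: dg + g t *: df.
    by rewrite /GRing.scale/= addrC (mulrC df).
  exact: is_deriveM.
have add_d (f g : R -> R) df dg : is_derive t 1 f df -> is_derive t 1 g dg ->
    is_derive t 1 (fun s => f s + g s) (df + dg).
  by move=> df' dg'; exact: is_deriveD.
have cst_d (k : R) : is_derive t 1 (fun=> k) 0 by exact: is_derive_cst.
move: dr dth dph dps => /derivableP Dr /derivableP Dth /derivableP Dph /derivableP Dps.
rewrite !derive1E.
set r' := 'D_1 r t in Dr *; set th' := 'D_1 theta t in Dth *.
set ph' := 'D_1 phi t in Dph *; set ps' := 'D_1 psi t in Dps *.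
pose a s := (psi s / m + phi s) / 2; pose b s := (psi s / m - phi s) / 2.
pose c s := theta s / 2.
have Da : is_derive t 1 a ((ps' / m + ph') / 2).
  have := mul_d _ _ _ _ (add_d _ _ _ _ (mul_d _ _ _ _ Dps (cst_d m^-1)) Dph) (cst_d 2^-1).
  by rewrite !mulr0 !addr0.
have Db : is_derive t 1 b ((ps' / m - ph') / 2).
  have Dn : is_derive t 1 (fun s => - phi s) (- ph') by exact: is_deriveN.
  have := mul_d _ _ _ _ (add_d _ _ _ _ (mul_d _ _ _ _ Dps (cst_d m^-1)) Dn) (cst_d 2^-1).
  by rewrite !mulr0 !addr0.
have Dc : is_derive t 1 c (th' / 2).
  by have := mul_d _ _ _ _ Dth (cst_d 2^-1); rewrite mulr0 addr0.
pose A s := 2 * Num.sqrt (m * r s).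
have [A' DA] : exists A', is_derive t 1 A A'.
  have Dm := mul_d _ _ _ _ (cst_d m) Dr.
  have Ds := comp_d Num.sqrt _ _ _ Dm (is_derive1_sqrt _).
  eexists; apply: (mul_d (fun=> 2) (fun s => Num.sqrt (m * r s)) _ _ (cst_d 2)).
  by apply: Ds; rewrite mulr_gt0.
have cos_d f f' : is_derive t 1 f f' ->
    is_derive t 1 (fun s => cos (f s)) (f' * - sin (f t)).
  by move=> df; exact: (@comp_d cos f).
have sin_d f f' : is_derive t 1 f f' ->
    is_derive t 1 (fun s => sin (f s)) (f' * cos (f t)).
  by move=> df; exact: (@comp_d sin f).
have y0E s : y s 0 0 = A s * (cos (c s) * cos (a s)) by rewrite !mxE.
have y1E s : y s 0 1 = A s * (cos (c s) * sin (a s)) by rewrite !mxE.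
have y2E s : y s 0 2 = A s * (sin (c s) * cos (b s)) by rewrite !mxE.
have y3E s : y s 0 3 = A s * (sin (c s) * sin (b s)) by rewrite !mxE.
have D0 := mul_d _ _ _ _ DA (mul_d _ _ _ _ (cos_d _ _ Dc) (cos_d _ _ Da)).
have D1 := mul_d _ _ _ _ DA (mul_d _ _ _ _ (cos_d _ _ Dc) (sin_d _ _ Da)).
have D2 := mul_d _ _ _ _ DA (mul_d _ _ _ _ (sin_d _ _ Dc) (cos_d _ _ Db)).
have D3 := mul_d _ _ _ _ DA (mul_d _ _ _ _ (sin_d _ _ Dc) (sin_d _ _ Db)).
rewrite -(funext y0E) in D0; rewrite -(funext y1E) in D1.
rewrite -(funext y2E) in D2; rewrite -(funext y3E) in D3.
have Dy : derivable y t 1.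
  apply/derivable_mxP => i j; rewrite ord1.
  case: j => [[|[|[|[|//]]]] Hj].
  - by rewrite (_ : Ordinal Hj = 0); [exact: ex_derive|exact/val_inj].
  - by rewrite (_ : Ordinal Hj = 1); [exact: ex_derive|exact/val_inj].
  - by rewrite (_ : Ordinal Hj = 2); [exact: ex_derive|exact/val_inj].
  - by rewrite (_ : Ordinal Hj = 3); [exact: ex_derive|exact/val_inj].
have lift1 : lift ord0 (ord0 : 'I_3) = 1 :> 'I_4 by exact/val_inj.
have lift2 : lift ord0 (lift ord0 (ord0 : 'I_2)) = 2 :> 'I_4 by exact/val_inj.
have lift3 : lift ord0 (lift ord0 (lift ord0 (ord0 : 'I_1))) = 3 :> 'I_4.
  exact/val_inj.
rewrite /tn_eta (negbTE mN0) [y t]/y tn_r_polar// -/(y t) derive_mx//.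
rewrite mxE !big_ord_recl big_ord0 lift1 lift2 lift3 !mxE/=.
rewrite !derive_val.
rewrite -/(A t) -/(c t) -/(a t) -/(b t).
have hA : A t ^+ 2 = 4 * (m * r t) by rewrite /A exprMn hs; ring.
have hc := cos2Dsin2 (c t).
have ha := cos2Dsin2 (a t); have hb := cos2Dsin2 (b t).
have eth : cos (theta t) = cos (c t) ^+ 2 - sin (c t) ^+ 2.
  by rewrite (_ : theta t = c t + c t) ?cosD// /c; field.
rewrite eth.
transitivity ((2 * r t)^-1 * (A t ^+ 2 *
  (cos (c t) ^+ 2 * ((ps' / m + ph') / 2) * (cos (a t) ^+ 2 + sin (a t) ^+ 2)
   + sin (c t) ^+ 2 * ((ps' / m - ph') / 2) * (cos (b t) ^+ 2 + sin (b t) ^+ 2))));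
  first by field; rewrite rN0 mN0.
rewrite ha hb hA.
transitivity (ps' * (cos (c t) ^+ 2 + sin (c t) ^+ 2)
  + m * (cos (c t) ^+ 2 - sin (c t) ^+ 2) * ph'); last by rewrite hc mulr1.
by field; rewrite rN0 mN0.
Qed.

(* Main.v *)
(* In the coordinates y the metric is a rational deformation of the flat metric
   of R^4, and every two-form F = sum c_i Omega_i becomes Omega_3 in a suitable
   orthonormal frame, in which two commuting rotations preserve both g and F.

   (1) The Omega_i are parallel, so the curvature commutes with the
   quaternions they generate and g is Ricci-flat; a conformal geodesic then
   satisfies nabla_u a = - |a|^2 u, and the coefficients of a on the parallel
   orthonormal vectors J_i u are constant, which is the magnetic equation.
   With n_1 = y_0^2 + y_1^2, n_2 = y_2^2 + y_3^2 and w = 1 + kappa (n_1 + n_2),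
   the energy is 2 w H = h_1 + h_2, where h_i depends only on n_i, its radial
   momentum and the two conserved angular momenta L_1, L_2.  Hence
   K = 2 kappa n_1 H - h_1 is a fourth integral.

   (2) The same splitting separates the Hamilton-Jacobi equation: the radial
   actions are integrals of square roots of polynomials in n_i, differentiated
   under the integral sign.  In the time tau with dtau = dt / w both n_i obey
   (dn_i / dtau)^2 = 4 Q_i(n_i) with Q_i a quartic, so that n_i(tau), then
   t(tau), then the two polar angles are obtained by quadratures. *)
From HB Require Import structures.
Require Import Defs.
From mathcomp Require Import all_boot all_order all_algebra.
From mathcomp Require Import all_classical all_reals all_analysis.
From mathcomp Require Import ring lra.

Set Implicit Arguments.
Unset Strict Implicit.
Unset Printing Implicit Defensive.

Import Order.TTheory GRing.Theory Num.Theory.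
Import numFieldNormedType.Exports.

Local Open Scope classical_set_scope.
Local Open Scope ring_scope.

(** * Elementary expressions *)

Section Expr.
Context {R : realType}.

(** Every function to be differentiated is the interpretation of a syntax tree whose derivative is
    again a tree. Brackets, Christoffel symbols and Hessians thus become identities between real
    numbers within reach of [field], and C^k regularity becomes an induction on k. The constant is
    kappa = 1/(4 m^2): since |y|^2 = 4 m r, one has w = 1 + kappa |y|^2 = 1 + r/m, and the poles of
    the coframe at r = 0 cancel. The flat case m = 0 is the same model at kappa = 0 after a signed
    permutation of the coordinates; no limit in m is taken. The splitting of the energy appears only
    for the canonical momentum P + e Phi, where Phi is a potential invariant under both rotations:
    the products n_1 n_2 then cancel. A conformal geodesic does not come with c; c is read off its
    acceleration, so the adapted frame varies from curve to curve. Genericity is therefore a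
    polynomial condition on (q, u, a) that does not mention c, and the frame enters the quadratures
    only through numerical constants, which leaves a single scheme per coordinate. *)

Inductive expr : Type :=
| EVar of nat
| ECst of R
| EAdd of expr & expr
| EOpp of expr
| EMul of expr & expr
| EInv of expr
| ESqrt of expr
| EAtan of expr.

Fixpoint interp (v : nat -> R) (E : expr) : R :=
  match E with
  | EVar i => v i
  | ECst c => c
  | EAdd a b => interp v a + interp v b
  | EOpp a => - interp v a
  | EMul a b => interp v a * interp v b
  | EInv a => (interp v a)^-1
  | ESqrt a => Num.sqrt (interp v a)
  | EAtan a => atan (interp v a)
  end.

(** The points at which the tree is smooth: square roots are taken only at strictly positive
    arguments, where they are differentiable. *)
Fixpoint valid (v : nat -> R) (E : expr) : Prop :=
  match E with
  | EVar _ | ECst _ => True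
  | EAdd a b | EMul a b => valid v a /\ valid v b
  | EOpp a | EAtan a => valid v a
  | EInv a => valid v a /\ interp v a != 0
  | ESqrt a => valid v a /\ 0 < interp v a
  end.

(** The differential in the direction [d]. The direction is frozen into constants and the result is
    an expression in the same variables, so it can be differentiated again. *)
Fixpoint D (d : nat -> R) (E : expr) : expr :=
  match E with
  | EVar i => ECst (d i)
  | ECst _ => ECst 0
  | EAdd a b => EAdd (D d a) (D d b)
  | EOpp a => EOpp (D d a)
  | EMul a b => EAdd (EMul (D d a) b) (EMul a (D d b))
  | EInv a => EOpp (EMul (D d a) (EMul (EInv a) (EInv a)))
  | ESqrt a => EMul (D d a) (EInv (EMul (ECst 2) (ESqrt a)))
  | EAtan a => EMul (D d a) (EInv (EAdd (ECst 1) (EMul a a)))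
  end.

Lemma valid_D d v E : valid v E -> valid v (D d E).
Proof.
elim: E => //= [a IHa b IHb|a IHa b IHb|a IHa|a IHa|a IHa].
- by case=> /IHa ? /IHb.
- by case=> va vb; split; split; auto.
- by case=> va a0; split; auto.
- case=> va a0; split; [exact: IHa|split=> //].
  by rewrite mulf_neq0// gt_eqF// sqrtr_gt0.
- move=> va; split; [exact: IHa|split=> //].
  by rewrite gt_eqF// -expr2 ltr_pwDl// sqr_ge0.
Qed.

(** A formal identity: both sides are the same rational expression in the interpretations of the
    subtrees and their derivatives, so the symmetry of second derivatives calls for no analysis. *)
Lemma D_D d d' v E : interp v (D d (D d' E)) = interp v (D d' (D d E)).
Proof.
elim: E => //= [a -> b ->|a ->|a -> b ->|a ->|a ->|a ->] //; ring.
Qed.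

Lemma D_linear (a b : R) d d' v E :
  interp v (D (fun i => a * d i + b * d' i) E)
  = a * interp v (D d E) + b * interp v (D d' E).
Proof.
elim: E => //= [c|c -> e ->|c ->|c -> e ->|c ->|c ->|c ->]; ring.
Qed.

Lemma D_eq d d' v E : d =1 d' -> interp v (D d E) = interp v (D d' E).
Proof. by move=> h; elim: E => //= [a -> b ->|a ->|a -> b ->|a ->|a ->|a ->]. Qed.

Lemma interp_eq v v' E : v =1 v' -> interp v E = interp v' E.
Proof. by move=> h; elim: E => //= [a -> b ->|a ->|a -> b ->|a ->|a ->|a ->]. Qed.

Lemma D_sum (I : finType) (c : I -> R) (d : I -> nat -> R) v E :
  interp v (D (fun j => \sum_i c i * d i j) E) = \sum_i c i * interp v (D (d i) E).
Proof.
elim: E => [//|//= _|a IHa b IHb|a IHa|a IHa b IHb|a IHa|a IHa|a IHa] /=.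
- by rewrite big1// => i _; rewrite mulr0.
- by rewrite IHa IHb -big_split; apply: eq_bigr => i _; rewrite /= mulrDr.
- by rewrite IHa -sumrN; apply: eq_bigr => i _; rewrite /= mulrN.
- rewrite IHa IHb mulr_suml mulr_sumr -big_split.
  by apply: eq_bigr => i _ /=; ring.
- by rewrite IHa mulr_suml -sumrN; apply: eq_bigr => i _ /=; ring.
- by rewrite IHa mulr_suml; apply: eq_bigr => i _ /=; ring.
- by rewrite IHa mulr_suml; apply: eq_bigr => i _ /=; ring.
Qed.

Definition rval n (x : 'rV[R]_n) (i : nat) : R :=
  if insub i is Some j then x 0 j else 0.

Lemma rvalE n (x : 'rV[R]_n) (j : 'I_n) : rval x j = x 0 j.
Proof. by rewrite /rval valK. Qed.

Lemma is_diff_rval n (x : 'rV[R]_n) i :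
  is_diff x (fun y : 'rV[R]_n => rval y i) (fun y => rval y i).
Proof.
rewrite /rval; case: insubP => [j _ _|_]; last exact: is_diff_cst.
have h : differentiable (fun N : 'rV[R]_n => N 0 j : R^o) x.
  exact: differentiable_coord.
apply: DiffDef => //.
have lc : linear (fun N : 'rV[R]_n => N 0 j : R^o).
  by move=> a u v; rewrite !mxE.
pose L := GRing.isLinear.Build _ _ _ _ _ lc.
pose f : {linear 'rV[R]_n -> R^o} := HB.pack (fun N : 'rV[R]_n => N 0 j : R^o) L.
have := @diff_lin R _ _ f x; apply.
by move=> y; exact: coord_continuous.
Qed.

(** The link between syntax and analysis, with one differentiation rule per constructor; square root
    and arctangent enter through their one-variable derivatives and the chain rule. *)
Lemma is_diff_interp n (x : 'rV[R]_n) E : valid (rval x) E ->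
  is_diff x (fun y : 'rV[R]_n => interp (rval y) E)
    (fun v => interp (rval x) (D (rval v) E)).
Proof.
elim: E => /= [i _|c _|a IHa b IHb [/IHa ha /IHb hb]|a IHa /IHa ha|
   a IHa b IHb [/IHa ha /IHb hb]|a IHa [/IHa ha a0]|a IHa [/IHa ha a0]|a IHa /IHa ha].
- exact: is_diff_rval.
- exact: is_diff_cst.
- exact: is_diffD.
- exact: is_diffN.
- apply: (is_diff_eq (is_diffM ha hb)); apply/funext => v /=.
  by rewrite fctE/= /GRing.scale/= addrC mulrC.
- have [h1 h2] := ha.
  apply: DiffDef; first exact: differentiableV.
  rewrite diffV// h2; apply/funext => v /=.
  by move: (interp _ a) (interp _ (D _ a)) => p r; rewrite /GRing.scale/=; rewrite expr2 invfM; ring.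
- have h : is_derive (interp (rval x) a) 1 Num.sqrt _ := is_derive1_sqrt a0.
  have hs : is_diff (interp (rval x) a) (Num.sqrt : R -> R)
      (fun v : R => v * (2 * Num.sqrt (interp (rval x) a))^-1).
    apply: DiffDef; first by apply/derivable1_diffP; case: h.
    by rewrite diff1E; [rewrite derive1E; case: h => _ ->|
       apply/derivable1_diffP; case: h].
  exact: (is_diff_comp ha hs).
- have h : is_derive (interp (rval x) a) 1 atan _ := is_derive1_atan _.
  have hs : is_diff (interp (rval x) a) (atan : R -> R)
      (fun v : R => v * (1 + interp (rval x) a * interp (rval x) a)^-1).
    apply: DiffDef; first by apply/derivable1_diffP; case: h.
    rewrite diff1E; first by rewrite derive1E -expr2; case: h => _ ->.
    by apply/derivable1_diffP; case: h.
  exact: (is_diff_comp ha hs).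
Qed.

Lemma derivable_interp n (x v : 'rV[R]_n) E : valid (rval x) E ->
  derivable (fun y : 'rV[R]_n => interp (rval y) E) x v.
Proof. by move=> /is_diff_interp[h _]; exact: diff_derivable. Qed.

Lemma derive_interp n (x v : 'rV[R]_n) E : valid (rval x) E ->
  'D_v (fun y : 'rV[R]_n => interp (rval y) E) x = interp (rval x) (D (rval v) E).
Proof. by move=> /is_diff_interp[h e]; rewrite deriveE// e. Qed.

Lemma continuous_interp n (x : 'rV[R]_n) E : valid (rval x) E ->
  {for x, continuous (fun y : 'rV[R]_n => interp (rval y) E)}.
Proof. by move=> /is_diff_interp[h _]; exact: differentiable_continuous. Qed.

Definition kron (i k : nat) : R := if k == i then 1 else 0.

Lemma rval_delta n (i : 'I_n) : rval (delta_mx 0 i : 'rV[R]_n) =1 (fun k =>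
  if (k < n)%N then kron i k else 0).
Proof.
move=> k; rewrite /rval; case: insubP => [j -> <-|/negbTE-> //].
by rewrite mxE eqxx /kron /= -val_eqE; case: eqP.
Qed.

(** Two directions that agree below [n] give the same derivative. This replaces the truncated
    direction [rval (delta_mx 0 i)] by [kron i], on which [D] computes. *)
Fixpoint vars_below (n : nat) (E : expr) : bool :=
  match E with
  | EVar i => (i < n)%N
  | ECst c => true
  | EAdd a b | EMul a b => vars_below n a && vars_below n b
  | EOpp a | EInv a | ESqrt a | EAtan a => vars_below n a
  end.

Lemma D_eq_below n d d' v E : vars_below n E ->
  (forall i, (i < n)%N -> d i = d' i) -> interp v (D d E) = interp v (D d' E).
Proof.
move=> + h; elim: E => /= [i /h //|//|a IHa b IHb|a IHa|a IHa b IHb|a IHa|a IHa|a IHa];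
  by [move=> /andP[/IHa-> /IHb->]|move=> /IHa->].
Qed.

Lemma pd_interp n (x : 'rV[R]_n) (i : 'I_n) E : valid (rval x) E ->
  pd i (fun y : 'rV[R]_n => interp (rval y) E) x = interp (rval x) (D (rval (delta_mx 0 i : 'rV[R]_n)) E).
Proof. exact: derive_interp. Qed.

Lemma pd_interp_below n (x : 'rV[R]_n) (i : 'I_n) E :
  vars_below n E -> valid (rval x) E ->
  pd i (fun y : 'rV[R]_n => interp (rval y) E) x = interp (rval x) (D (kron i) E).
Proof.
move=> b /pd_interp->; apply: D_eq_below b _ => k kn.
by rewrite rval_delta kn.
Qed.

Lemma open_valid n E : open [set x : 'rV[R]_n | valid (rval x) E].
Proof.
elim: E => [i|c|a IHa b IHb|a IHa|a IHa b IHb|a IHa|a IHa|a IHa] /=;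
  try exact: openT; try exact: openI; try exact: IHa.
- rewrite openE => x [va a0]; rewrite /interior.
  have h1 : \forall y \near x, valid (rval y) a by exact: open_nbhs_nbhs.
  have h2 : \forall y \near x, interp (rval y) a != 0.
    exact: (cvgr_neq0 _ (continuous_interp va) a0).
  by near=> y; split; near: y.
- rewrite openE => x [va a0]; rewrite /interior.
  have h1 : \forall y \near x, valid (rval y) a by exact: open_nbhs_nbhs.
  have h2 : \forall y \near x, 0 < interp (rval y) a.
    exact: (cvgr_gt _ (continuous_interp va) _ a0).
  by near=> y; split; near: y.
Unshelve. all: by end_near. Qed.

(* Class C^k is a local property, and 'D_v only sees germs. *)
Lemma eq_on_derive (V W : normedModType R) (U : set V) (f h : V -> W) :
  open U -> (forall x, U x -> f x = h x) ->
  forall v x, U x -> 'D_v f x = 'D_v h x /\ (derivable f x v <-> derivable h x v).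
Proof.
move=> oU e v x Ux.
have ne : {near x, f =1 h}.
  by near=> y; apply: e; near: y; exact: open_nbhs_nbhs.
have ne' : {near x, h =1 f} by near=> y; apply/esym; near: y.
split.
  by apply: near_eq_derive.
by split; apply: near_eq_derivable.
Unshelve. all: by end_near. Qed.

Lemma Ck_on_eq (V W : normedModType R) k (U : set V) (f h : V -> W) :
  open U -> (forall x, U x -> f x = h x) -> Ck_on k U f -> Ck_on k U h.
Proof.
move=> oU; elim: k f h => [|k IH] f h e [cf].
  move=> _; split=> // x Ux.
  have ne : {near x, f =1 h}.
    by near=> y; apply: e; near: y; exact: open_nbhs_nbhs.
  rewrite /prop_for /continuous_at -(e x Ux); apply: cvg_trans (cf x Ux).
  exact: near_eq_cvg.
move=> df; split.
  move=> x Ux; rewrite /prop_for /continuous_at -(e x Ux); apply: cvg_trans (cf x Ux).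
  apply: near_eq_cvg.
  by near=> y; apply: e; near: y; exact: open_nbhs_nbhs.
move=> v; have [d1 d2] := df v; split.
  by move=> x Ux; apply/(eq_on_derive oU e v Ux).2; exact: d1.
by apply: IH d2 => x Ux; exact: (eq_on_derive oU e v Ux).1.
Unshelve. all: by end_near. Qed.

Lemma Ck_on_interp n k (U : set 'rV[R]_n) E : open U ->
  (forall x, U x -> valid (rval x) E) ->
  Ck_on k U (fun x => interp (rval x) E).
Proof.
move=> oU; elim: k E => [|k IH] E vE; split=> //.
- by move=> x /vE; exact: continuous_interp.
- by move=> x /vE; exact: continuous_interp.
- move=> v; split; first by move=> x /vE; exact: derivable_interp.
  apply: (@Ck_on_eq _ _ _ _ (fun x => interp (rval x) (D (rval v) E))) => //.
    by move=> x /vE ?; rewrite derive_interp.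
  by apply: IH => x /vE; exact: valid_D.
Qed.

Lemma Ck_onD (V W : normedModType R) k (U : set V) (f h : V -> W) :
  open U -> Ck_on k U f -> Ck_on k U h -> Ck_on k U (fun x => f x + h x).
Proof.
move=> oU; elim: k f h => [|k IH] f h [cf df] [ch dh].
  by split=> // x Ux; apply: cvgD; [exact: cf|exact: ch].
split; first by move=> x Ux; apply: cvgD; [exact: cf|exact: ch].
move=> v; have [df1 df2] := df v; have [dh1 dh2] := dh v; split.
  by move=> x Ux; apply: derivableD; [exact: df1|exact: dh1].
apply: Ck_on_eq (IH _ _ df2 dh2) => // x Ux.
by rewrite deriveD//; [exact: df1|exact: dh1].
Qed.

Lemma cvg_mx (T : Type) (F : set_system T) m n (f : T -> 'M[R]_(m, n)) (l : 'M[R]_(m, n)) :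
  Filter F -> (forall i j, (fun x => f x i j) @ F --> l i j) -> f @ F --> l.
Proof.
move=> FF h; apply/cvgrPdist_le => /= e e0; near=> x.
rewrite /Num.Def.normr/= mx_normrE (bigmax_le _ (ltW e0))//= => i _.
rewrite !mxE/=.
move: i; near: x; apply: filter_forall => /= i.
exact: ((cvgrPdist_le _ _).1 (h i.1 i.2)).
Unshelve. all: by end_near. Qed.

Lemma Ck_on_mx (V : normedModType R) n k (U : set V) (f : V -> 'rV[R]_n) :
  open U -> (forall i, Ck_on k U (fun x => f x 0 i)) -> Ck_on k U f.
Proof.
move=> oU; elim: k f => [|k IH] f hf.
  split=> // x Ux; apply: cvg_mx => i j; rewrite ord1.
  by have [h _] := hf j; exact: h.
have df x v : U x -> derivable f x v.
  move=> Ux; apply/derivable_mxP => i j; rewrite ord1.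
  by have [_ /(_ v)[h _]] := hf j; exact: h.
split.
  move=> x Ux; apply: cvg_mx => i j; rewrite ord1.
  by have [h _] := hf j; exact: h.
move=> v; split=> [x|]; first exact: df.
apply: IH => i; have [_ /(_ v)[_ h]] := hf i.
apply: Ck_on_eq h => // x Ux.
by rewrite derive_mx ?mxE//; exact: df.
Qed.

Lemma is_derive_rV (V : normedModType R) n (f : V -> 'rV[R]_n) t v (l : 'rV[R]_n) :
  (forall i, is_derive t v (fun x => f x 0 i) (l 0 i)) -> is_derive t v f l.
Proof.
move=> h; have d : derivable f t v.
  by apply/derivable_mxP => i j; rewrite ord1; have [] := h j.
apply: DeriveDef => //; rewrite derive_mx//; apply/rowP => i; rewrite mxE.
by have [_ ->] := h i.
Qed.

Lemma is_derive_coord (V : normedModType R) n (f : V -> 'rV[R]_n) t v (l : 'rV[R]_n) i :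
  is_derive t v f l -> is_derive t v (fun x => f x 0 i) (l 0 i).
Proof.
move=> [d e]; apply: DeriveDef; first by move/derivable_mxP : d.
by rewrite -e derive_mx// mxE.
Qed.

Lemma is_derive_interp_curve n (f : R -> 'rV[R]_n) (t : R) (l : 'rV[R]_n) E :
  is_derive t (1 : R) f l -> valid (rval (f t)) E ->
  is_derive t (1 : R) (fun s => interp (rval (f s)) E) (interp (rval (f t)) (D (rval l) E)).
Proof.
move=> [df dl] /is_diff_interp[hE eE].
have df' : differentiable f t by apply/derivable1_diffP.
have dc : differentiable ((fun y : 'rV[R]_n => interp (rval y) E) \o f) t.
  exact: differentiable_comp.
apply: DeriveDef; first exact: diff_derivable.
rewrite (_ : (fun s : R => interp (rval (f s)) E) =
  (fun y : 'rV[R]_n => interp (rval y) E) \o f)// deriveE//.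
by rewrite diff_comp//= eE -deriveE// dl.
Qed.

(* Polynomials in the variables: their non-vanishing is an open dense
   condition, tested at a single point. *)
Fixpoint polynomial (E : expr) : bool :=
  match E with
  | EVar _ | ECst _ => true
  | EAdd a b | EMul a b => polynomial a && polynomial b
  | EOpp a => polynomial a
  | _ => false
  end.

Lemma polynomial_valid v E : polynomial E -> valid v E.
Proof. by elim: E => //= [a IHa b IHb|a IHa b IHb] /andP[/IHa ? /IHb]. Qed.

Lemma polynomial_line (v d : nat -> R) E : polynomial E ->
  exists p : {poly R}, forall s, p.[s] = interp (fun i => v i + s * d i) E.
Proof.
elim: E => //= [i _|c _|a IHa b IHb /andP[/IHa[p hp] /IHb[r hr]]|a IHa /IHa[p hp]|
  a IHa b IHb /andP[/IHa[p hp] /IHb[r hr]]].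
- by exists ((v i)%:P + d i *: 'X) => s; rewrite !hornerE mulrC.
- by exists c%:P => s; rewrite hornerC.
- by exists (p + r) => s; rewrite hornerD hp hr.
- by exists (- p) => s; rewrite hornerN hp.
- by exists (p * r) => s; rewrite hornerM hp hr.
Qed.

(** After the highest power of X is divided out, the quotient is non-zero at 0, hence near 0 by
    continuity. *)
Lemma poly_neq0_near0 (p : {poly R}) : p != 0 -> \forall s \near 0^', p.[s] != 0.
Proof.
move=> p0; have [k [r r0 ->]] : exists k, exists2 r : {poly R}, r.[0] != 0 & p = r * 'X ^+ k.
  have [k [r]] := multiplicity_XsubC p 0; rewrite p0 /root /= => r0 ->.
  by exists k; exists r; rewrite // polyC0 subr0.
have h : \forall s \near 0, r.[s] != 0.
  exact: (cvgr_neq0 _ (@continuous_horner R r 0) r0).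
near=> s; rewrite hornerM hornerXn mulf_neq0// ?expf_neq0//.
  by near: s; exact: nbhs_dnbhs.
by near: s; exact: nbhs_dnbhs_neq.
Unshelve. all: by end_near. Qed.

(** Along a line the expression is a polynomial in [s]. It is non-zero at [s = 1], so it is not the
    zero polynomial and its zeros are isolated. *)
Lemma polynomial_near (v d : nat -> R) E : polynomial E ->
  interp (fun i => v i + d i) E != 0 ->
  \forall s \near 0^', interp (fun i => v i + s * d i) E != 0.
Proof.
move=> /(polynomial_line v d)[p hp] h.
have p0 : p != 0.
  apply: contra_neq h => p0; have := hp 1; rewrite p0 horner0 => /esym <-.
  by apply: interp_eq => i; rewrite mul1r.
by have := poly_neq0_near0 p0; apply: filterS => s; rewrite hp.
Qed.

Lemma open_neq0 n E : polynomial E ->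
  open [set x : 'rV[R]_n | interp (rval x) E != 0].
Proof.
move=> pE; have := @open_valid n (EInv E).
congr open; apply/seteqP; split=> x /=; first by case.
by split=> //; exact: polynomial_valid.
Qed.

Lemma rval_lin n (x y : 'rV[R]_n) a : rval (x + a *: y) =1 (fun i => rval x i + a * rval y i).
Proof.
by move=> i; rewrite /rval; case: insubP => [j _ _|_]; rewrite ?mxE ?mulr0 ?addr0.
Qed.

Lemma dense_neq0 n E (x1 : 'rV[R]_n) : polynomial E ->
  interp (rval x1) E != 0 -> dense [set x : 'rV[R]_n | interp (rval x) E != 0].
Proof.
move=> pE E1 O [x0 Ox0] oO.
have h : \forall s \near 0^', interp (fun i => rval x0 i + s * rval (x1 - x0) i) E != 0.
  apply: polynomial_near => //.
  rewrite (@interp_eq _ (rval x1))// => i.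
  by have := rval_lin x0 (x1 - x0) 1 i; rewrite scale1r addrC subrK mul1r => ->.
have c : (fun s : R => x0 + s *: (x1 - x0)) @ 0^' --> x0.
  rewrite -[X in _ --> X]addr0; apply: cvgD; first exact: cvg_cst.
  rewrite -[X in _ --> X](scale0r (x1 - x0)); apply: cvgZr_tmp.
  by move=> A; exact: nbhs_dnbhs.
have o : \forall s \near (0 : R)^', O (x0 + s *: (x1 - x0)).
  by apply: c; exact: open_nbhs_nbhs.
have [s [h1 h2]] := filter_ex (filterI h o).
exists (x0 + s *: (x1 - x0)); split => //=.
by rewrite (@interp_eq _ (fun i => rval x0 i + s * rval (x1 - x0) i))// => i; rewrite rval_lin.
Qed.

End Expr.

(** * The Taub-NUT metric in the coordinates y *)

Lemma addmxE (R : realType) k l (A B : 'M[R]_(k, l)) i j : (A + B) i j = A i j + B i j.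
Proof. by rewrite mxE. Qed.

Lemma oppmxE (R : realType) k l (A : 'M[R]_(k, l)) i j : (- A) i j = - A i j.
Proof. by rewrite mxE. Qed.

Lemma submxE (R : realType) k l (A B : 'M[R]_(k, l)) i j : (A - B) i j = A i j - B i j.
Proof. by rewrite !mxE. Qed.

Section Model.
Context {R : realType}.
Implicit Types (kappa : R) (J S : 'M[R]_4) (q y : 'rV[R]_4).

Definition sqn q : R := (q *m q^T) 0 0.
Definition wfun kappa q : R := 1 + kappa * sqn q.

(** The result of substituting |y|^2 = 4 m r in V dx^2 + V^-1 eta^2. The row [q *m J] is the
    velocity of the rotation along the Hopf fibre. [J] stays a parameter because an orthogonal
    change of coordinates conjugates it. *)
Definition gmod kappa J q : 'M[R]_4 :=
  wfun kappa q *: 1%:M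
  - (kappa * (wfun kappa q + 1) / wfun kappa q) *: ((q *m J)^T *m (q *m J)).

Definition gmodV kappa J q : 'M[R]_4 :=
  (wfun kappa q)^-1 *: (1%:M
    + (kappa * (wfun kappa q + 1)) *: ((q *m J)^T *m (q *m J))).

Definition Fmod kappa J S q : 'M[R]_4 :=
  wfun kappa q *: (J *m S) - kappa *: wedge (q *m S) (q *m J).

Definition mx4 (l : seq (seq R)) : 'M[R]_4 := \matrix_(i, j) (nth [::] l i)`_j.

Definition J4 : 'M[R]_4 := mx4
  [:: [:: 0; 1; 0; 0]; [:: -1; 0; 0; 0]; [:: 0; 0; 0; 1]; [:: 0; 0; -1; 0]].

(** The Pauli matrices on C^2, with [J4] as multiplication by the imaginary unit: symmetric
    anticommuting involutions that commute with [J4]. The Hopf map is [x_i = q S4_i q^T / (4 m)]. *)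
Definition S4 (i : 'I_3) : 'M[R]_4 := mx4 (nth [::]
  [:: [:: [:: 0; 0; 1; 0]; [:: 0; 0; 0; 1]; [:: 1; 0; 0; 0]; [:: 0; 1; 0; 0]];
      [:: [:: 0; 0; 0; -1]; [:: 0; 0; 1; 0]; [:: 0; 1; 0; 0]; [:: -1; 0; 0; 0]];
      [:: [:: 1; 0; 0; 0]; [:: 0; 1; 0; 0]; [:: 0; 0; -1; 0]; [:: 0; 0; 0; -1]]] i).

Lemma sqnE q : sqn q = rval q 0 ^+ 2 + rval q 1 ^+ 2 + rval q 2 ^+ 2 + rval q 3 ^+ 2.
Proof.
rewrite /sqn mxE !big_ord_recl big_ord0 !mxE -!rvalE /=.
by ring.
Qed.

Lemma sqn_ge0 q : 0 <= sqn q.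
Proof. by rewrite sqnE !addr_ge0// sqr_ge0. Qed.

Lemma sqn_eq0 q : sqn q = 0 -> q = 0.
Proof.
rewrite sqnE => h; apply/rowP => i; rewrite !mxE -rvalE.
have h4 k : (k < 4)%N -> rval q k = 0.
  have := (sqr_ge0 (rval q 0), sqr_ge0 (rval q 1), sqr_ge0 (rval q 2), sqr_ge0 (rval q 3)).
  by case=> [[[a b] c] d]; case: k => [|[|[|[|//]]]] _; apply/eqP; rewrite -sqrf_eq0; apply/eqP; lra.
by apply: h4.
Qed.

Lemma wfun_gt0 kappa q : 0 <= kappa -> 0 < wfun kappa q.
Proof. by move=> k0; rewrite ltr_pwDl// mulr_ge0// sqn_ge0. Qed.

Lemma mulJE q j : (q *m J4) 0 j = [:: - rval q 1; rval q 0; - rval q 3; rval q 2]`_j.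
Proof.
rewrite mxE !big_ord_recl big_ord0 !mxE -!rvalE /=.
by case: j => [[|[|[|[|//]]]] Hj] /=; ring.
Qed.

Lemma mulSE q i j : (q *m S4 i) 0 j = (nth [::]
  [:: [:: rval q 2; rval q 3; rval q 0; rval q 1];
      [:: - rval q 3; rval q 2; rval q 1; - rval q 0];
      [:: rval q 0; rval q 1; - rval q 2; - rval q 3]] i)`_j.
Proof.
rewrite mxE !big_ord_recl big_ord0 !mxE -!rvalE /=.
by case: i => [[|[|[|//]]] Hi]; case: j => [[|[|[|[|//]]]] Hj] /=; ring.
Qed.

Lemma scalemxE a (A : 'M[R]_4) i j : (a *: A) i j = a * A i j.
Proof. by rewrite mxE. Qed.

Lemma scalerowE a (u : 'rV[R]_4) j : (a *: u) 0 j = a * u 0 j.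
Proof. by rewrite mxE. Qed.

Lemma idmxE i j : (1%:M : 'M[R]_4) i j = if i == j :> nat then 1 else 0.
Proof. by rewrite mxE -val_eqE; case: eqP. Qed.

Lemma mul_rowT (a b : 'rV[R]_4) i j : (a^T *m b) i j = a 0 i * b 0 j.
Proof. by rewrite mxE big_ord1 !mxE. Qed.

(** The rows [q *m S4 i] and [q *m J4] are pairwise orthogonal and all have squared length |q|^2,
    which gives a resolution of the identity. *)
Lemma sum_dx q : \sum_i (q *m S4 i)^T *m (q *m S4 i)
  = sqn q *: 1%:M - (q *m J4)^T *m (q *m J4).
Proof.
apply/matrixP => i j; rewrite summxE !big_ord_recl big_ord0.
rewrite submxE scalemxE idmxE !mul_rowT !mulSE !mulJE sqnE.
case: i => [[|[|[|[|//]]]] Hi]; case: j => [[|[|[|[|//]]]] Hj] /=; ring.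
Qed.

Lemma JS4E i k l : (J4 *m S4 i) k l = nth 0 (nth [::] (nth [::]
  [:: [:: [:: 0; 0; 0; 1]; [:: 0; 0; -1; 0]; [:: 0; 1; 0; 0]; [:: -1; 0; 0; 0]];
      [:: [:: 0; 0; 1; 0]; [:: 0; 0; 0; 1]; [:: -1; 0; 0; 0]; [:: 0; -1; 0; 0]];
      [:: [:: 0; 1; 0; 0]; [:: -1; 0; 0; 0]; [:: 0; 0; 0; -1]; [:: 0; 0; 1; 0]]] i) k) l.
Proof.
rewrite mxE !big_ord_recl big_ord0 !mxE /=.
by case: i => [[|[|[|//]]] Hi]; case: k => [[|[|[|[|//]]]] Hk];
  case: l => [[|[|[|[|//]]]] Hl] /=; ring.
Qed.

Lemma wedgeE (a b : 'rV[R]_4) i j : wedge a b i j = a 0 i * b 0 j - b 0 i * a 0 j.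
Proof. by rewrite /wedge submxE !mul_rowT. Qed.

(** The constant form [J4 *m S4 i] is self-dual, hence |q|^2 times it is a sum of two wedges in the
    orthogonal frame above. Exchanging one wedge for the other cancels the pole 1/|q|^2 in
    [Omega^i]. *)
Lemma wedge_dx q (i : 'I_3) : wedge (q *m S4 (i + 1)) (q *m S4 (i + 2))
  = sqn q *: (J4 *m S4 i) - wedge (q *m S4 i) (q *m J4).
Proof.
apply/matrixP => k l; rewrite wedgeE submxE wedgeE.
rewrite scalemxE JS4E !mulSE !mulJE sqnE.
by case: i => [[|[|[|//]]] Hi]; case: k => [[|[|[|[|//]]]] Hk];
  case: l => [[|[|[|[|//]]]] Hl] /=; ring.
Qed.

(** The value 0 at [m = 0] is not a limit: the metric is then flat, and flat space is the model at
    kappa = 0, so that both cases share the same computations. *)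
Definition kap (m : R) : R := if m == 0 then 0 else (4 * m ^+ 2)^-1.

Lemma kap_ge0 m : 0 <= kap m.
Proof. by rewrite /kap; case: ifP => // _; rewrite invr_ge0 mulr_ge0// sqr_ge0. Qed.

Definition xE (m : R) (i : 'I_3) : expr :=
  EMul (ECst (4 * m)^-1) (nth (ECst 0)
  [:: EMul (ECst 2) (EAdd (EMul (EVar 0) (EVar 2)) (EMul (EVar 1) (EVar 3)));
      EMul (ECst 2) (EAdd (EMul (EVar 1) (EVar 2)) (EOpp (EMul (EVar 0) (EVar 3))));
      EAdd (EAdd (EMul (EVar 0) (EVar 0)) (EMul (EVar 1) (EVar 1)))
          (EOpp (EAdd (EMul (EVar 2) (EVar 2)) (EMul (EVar 3) (EVar 3))))] i).

Lemma tn_xE m i : m != 0 -> tn_x m i = (fun y => interp (rval y) (xE m i)).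
Proof.
move=> m0; apply/funext => y; rewrite /tn_x (negbTE m0).
by case: i => [[|[|[|//]]] Hi] /=; rewrite -!rvalE /=; field.
Qed.

Lemma differential_x m i y : m != 0 ->
  differential (tn_x m i) y = (2 * m)^-1 *: (y *m S4 i).
Proof.
move=> m0; apply/rowP => j; rewrite scalerowE mulSE mxE tn_xE// pd_interp_below.
- case: i => [[|[|[|//]]] Hi]; case: j => [[|[|[|[|//]]]] Hj];
    by rewrite /= /kron /=; field.
- by case: i => [[|[|[|//]]] Hi].
- by case: i => [[|[|[|//]]] Hi].
Qed.

Lemma tn_rE m y : 0 < m -> tn_r m y = sqn y / (4 * m).
Proof.
move=> m0; have mN0 : m != 0 by rewrite gt_eqF.
have h0 : 0 <= sqn y / (4 * m) by rewrite divr_ge0 ?sqn_ge0// mulr_ge0// ltW.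
rewrite /tn_r -[RHS]ger0_norm// -sqrtr_sqr; congr Num.sqrt.
rewrite !big_ord_recl big_ord0 !tn_xE// sqnE /=.
by field.
Qed.

Lemma tn_eta_mod m y : m != 0 -> tn_eta m y = (2 * tn_r m y)^-1 *: (y *m J4).
Proof.
move=> m0; rewrite /tn_eta (negbTE m0); congr (_ *: _).
by apply/rowP => j; rewrite mulJE mxE -!rvalE.
Qed.

Lemma wedgeZl a (u v : 'rV[R]_4) : wedge (a *: u) v = a *: wedge u v.
Proof. by apply/matrixP => i j; rewrite scalemxE !wedgeE !mxE; ring. Qed.

Lemma wedgeZr a (u v : 'rV[R]_4) : wedge u (a *: v) = a *: wedge u v.
Proof. by apply/matrixP => i j; rewrite scalemxE !wedgeE !mxE; ring. Qed.

Lemma trZmul a b (u v : 'rV[R]_4) : (a *: u)^T *m (b *: v) = (a * b) *: (u^T *m v).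
Proof. by rewrite [(a *: u)^T]linearZ -scalemxAl -scalemxAr scalerA. Qed.

Section away.
Variables (m : R) (y : 'rV[R]_4).
Hypotheses (m0 : 0 < m) (y0 : y != 0).
Let mN0 : m != 0. Proof. by rewrite gt_eqF. Qed.
Let N0 : 0 < sqn y.
Proof. by rewrite lt_neqAle sqn_ge0 andbT eq_sym; apply: contra_neq y0 => /sqn_eq0. Qed.

Let VE : tn_V m y = (sqn y + 4 * m ^+ 2) / sqn y.
Proof. by rewrite /tn_V tn_rE//; field; rewrite mN0 gt_eqF. Qed.

Let V0 : 0 < tn_V m y.
Proof. by rewrite VE divr_gt0// addr_gt0// mulr_gt0// exprn_gt0. Qed.

Let sV : Num.sqrt (tn_V m y) * Num.sqrt (tn_V m y) = tn_V m y.
Proof. by rewrite -expr2 sqr_sqrtr// ltW. Qed.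

Let sV0 : Num.sqrt (tn_V m y) != 0.
Proof. by rewrite gt_eqF// sqrtr_gt0. Qed.

Let wE : wfun (kap m) y = (sqn y + 4 * m ^+ 2) / (4 * m ^+ 2).
Proof. by rewrite /wfun /kap (negbTE mN0); field. Qed.

Lemma tn_metric_away :
  \sum_i (tn_e m i y)^T *m tn_e m i y + (tn_e4 m y)^T *m tn_e4 m y
  = gmod (kap m) J4 y.
Proof.
under eq_bigr do rewrite /tn_e differential_x// scalerA trZmul.
rewrite -scaler_sumr sum_dx /tn_e4 tn_eta_mod// scalerA trZmul /gmod.
rewrite -!invfM; set s := Num.sqrt _; set A := (y *m J4)^T *m _.
have -> : s / (2 * m) * (s / (2 * m)) = tn_V m y / (4 * m ^+ 2).
  by rewrite -sV -/s; field.
have -> : (s * (2 * tn_r m y) * (s * (2 * tn_r m y))) = tn_V m y * (4 * tn_r m y ^+ 2).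
  by rewrite -sV -/s; ring.
apply/matrixP => i j; rewrite !(addmxE, oppmxE, scalemxE).
rewrite wE /kap (negbTE mN0) VE tn_rE//.
have h : sqn y + 4 * m ^+ 2 != 0 by rewrite gt_eqF// addr_gt0// mulr_gt0// exprn_gt0.
have NN : sqn y != 0 by rewrite gt_eqF.
move: (A i j) ((1%:M : 'M[R]_4) i j) => a b.
by field; rewrite h NN mN0.
Qed.

Lemma tn_Omega_away i :
  wedge (tn_e m i y) (tn_e4 m y) + wedge (tn_e m (i + 1) y) (tn_e m (i + 2) y)
  = Fmod (kap m) J4 (S4 i) y.
Proof.
rewrite /tn_e !differential_x// /tn_e4 tn_eta_mod// !scalerA !wedgeZl !wedgeZr !scalerA.
rewrite wedge_dx /Fmod.
apply/matrixP => k l; rewrite !(addmxE, oppmxE, scalemxE).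
move: (wedge (y *m S4 i) (y *m J4) k l) ((J4 *m S4 i) k l) => a b.
have NN : sqn y != 0 by rewrite gt_eqF.
have sV' : Num.sqrt (tn_V m y) ^+ 2 = tn_V m y by rewrite expr2.
move: sV' sV0; set s := Num.sqrt _ => sV' s0.
have -> : s / (2 * m) * (s / (2 * m)) = tn_V m y / (4 * m ^+ 2) by rewrite -sV'; field.
have -> : s / (2 * m) * (s^-1 / (2 * tn_r m y)) = (sqn y)^-1.
  by rewrite tn_rE//; field; rewrite NN mN0 s0.
rewrite wE /kap (negbTE mN0) VE.
by field; rewrite NN mN0.
Qed.

End away.

(** Syntactic copies of the entries of [gmod], [gmodV] and [Fmod]; smoothness and derivatives of the
    fields are read off them. *)
Definition NE : expr := EAdd (EAdd (EMul (EVar 0) (EVar 0)) (EMul (EVar 1) (EVar 1)))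
  (EAdd (EMul (EVar 2) (EVar 2)) (EMul (EVar 3) (EVar (3 : nat)))) : @expr R.
Definition wE (kappa : R) : expr := EAdd (ECst 1) (EMul (ECst kappa) NE).
Definition AE (i : nat) : @expr R :=
  nth (ECst 0) [:: EOpp (EVar 1); EVar 0; EOpp (EVar 3); EVar 2] i.
Definition deltaE (i j : nat) : @expr R := ECst (if i == j then 1 else 0).

Definition gE (kappa : R) (i j : nat) : expr :=
  EAdd (EMul (wE kappa) (deltaE i j))
    (EOpp (EMul (EMul (EMul (ECst kappa) (EAdd (wE kappa) (ECst 1))) (EInv (wE kappa)))
      (EMul (AE i) (AE j)))).
Definition gVE (kappa : R) (i j : nat) : expr :=
  EMul (EInv (wE kappa)) (EAdd (deltaE i j)
    (EMul (EMul (ECst kappa) (EAdd (wE kappa) (ECst 1))) (EMul (AE i) (AE j)))).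

Definition SE (i : nat) (j : nat) : @expr R := nth (ECst 0) (nth [::]
  [:: [:: EVar 2; EVar 3; EVar 0; EVar 1];
      [:: EOpp (EVar 3); EVar 2; EVar 1; EOpp (EVar 0)];
      [:: EVar 0; EVar 1; EOpp (EVar 2); EOpp (EVar 3)]] i) j.
Definition JSE (i k l : nat) : @expr R := ECst (nth 0 (nth [::] (nth [::]
  [:: [:: [:: 0; 0; 0; 1]; [:: 0; 0; -1; 0]; [:: 0; 1; 0; 0]; [:: -1; 0; 0; 0]];
      [:: [:: 0; 0; 1; 0]; [:: 0; 0; 0; 1]; [:: -1; 0; 0; 0]; [:: 0; -1; 0; 0]];
      [:: [:: 0; 1; 0; 0]; [:: -1; 0; 0; 0]; [:: 0; 0; 0; -1]; [:: 0; 0; 1; 0]]] i) k) l).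

Definition FE (kappa : R) (i k l : nat) : expr :=
  EAdd (EMul (wE kappa) (JSE i k l))
    (EOpp (EMul (ECst kappa) (EAdd (EMul (SE i k) (AE l)) (EOpp (EMul (AE k) (SE i l)))))).

Lemma interp_NE q : interp (rval q) NE = sqn q.
Proof. by rewrite sqnE /=; ring. Qed.

Lemma interp_wE kappa q : interp (rval q) (wE kappa) = wfun kappa q.
Proof. by rewrite /wfun -interp_NE. Qed.

Lemma interp_AE q (j : 'I_4) : interp (rval q) (AE j) = (q *m J4) 0 j.
Proof. by rewrite mulJE; case: j => [[|[|[|[|//]]]] Hj]. Qed.

Lemma interp_SE q (i : 'I_3) (j : 'I_4) : interp (rval q) (SE i j) = (q *m S4 i) 0 j.
Proof. by rewrite mulSE; case: i => [[|[|[|//]]] Hi]; case: j => [[|[|[|[|//]]]] Hj]. Qed.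

Lemma interp_gE kappa q (i j : 'I_4) : interp (rval q) (gE kappa i j) = gmod kappa J4 q i j.
Proof.
rewrite /gmod submxE !scalemxE idmxE mul_rowT -!interp_AE -!interp_wE.
by rewrite /gE; move: (AE _) (AE _) (wE _) => /= *.
Qed.

Lemma interp_gVE kappa q (i j : 'I_4) : interp (rval q) (gVE kappa i j) = gmodV kappa J4 q i j.
Proof.
rewrite /gmodV scalemxE addmxE scalemxE idmxE mul_rowT -!interp_AE -!interp_wE.
by rewrite /gVE; move: (AE _) (AE _) (wE _) => /= *.
Qed.

Lemma interp_FE kappa q (i : 'I_3) (k l : 'I_4) :
  interp (rval q) (FE kappa i k l) = Fmod kappa J4 (S4 i) q k l.
Proof.
rewrite /Fmod submxE !scalemxE wedgeE JS4E -!interp_AE -!interp_SE -!interp_wE.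
by rewrite /FE; move: (AE _) (AE _) (SE _ _) (SE _ _) (wE _) => /= *.
Qed.

Lemma valid_AE v j : valid v (AE j).
Proof. by apply: polynomial_valid; case: j => [|[|[|[|[|j]]]]]. Qed.

Lemma valid_SE v i j : valid v (SE i j).
Proof.
by apply: polynomial_valid; case: i => [|[|[|[|i]]]];
  case: j => [|[|[|[|[|j]]]]].
Qed.

Lemma valid_gE kappa q i j : 0 <= kappa -> valid (rval q) (gE kappa i j).
Proof.
move=> k0; do 9?[split=> //]; try exact: valid_AE.
by have := lt0r_neq0 (wfun_gt0 q k0); rewrite -interp_wE.
Qed.

Lemma valid_gVE kappa q i j : 0 <= kappa -> valid (rval q) (gVE kappa i j).
Proof.
move=> k0; do 9?[split=> //]; try exact: valid_AE.
by have := lt0r_neq0 (wfun_gt0 q k0); rewrite -interp_wE.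
Qed.

Lemma valid_FE kappa q i k l : valid (rval q) (FE kappa i k l).
Proof. by do 9?[split=> //]; first [exact: valid_AE|exact: valid_SE]. Qed.

Lemma continuous_gmod kappa q i j : 0 <= kappa ->
  {for q, continuous (fun z => gmod kappa J4 z i j)}.
Proof.
move=> k0; rewrite (_ : (fun z => _) = (fun z => interp (rval z) (gE kappa i j))).
  by apply: continuous_interp; exact: valid_gE.
by apply/funext => z; rewrite interp_gE.
Qed.

Lemma continuous_Fmod kappa i q k l :
  {for q, continuous (fun z => Fmod kappa J4 (S4 i) z k l)}.
Proof.
rewrite (_ : (fun z => _) = (fun z => interp (rval z) (FE kappa i k l))).
  by apply: continuous_interp; exact: valid_FE.
by apply/funext => z; rewrite interp_FE.
Qed.

(** The limit over punctured neighbourhoods is determined only if this filter is proper; the points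
    [y + (r / 2) *: delta_mx 0 0] show that [y] is not isolated. *)
Lemma lim_dnbhs (f h : 'rV[R]_4 -> 'M[R]_4) y :
  (forall z, z != y -> f z = h z) ->
  (forall i j, {for y, continuous (fun z => h z i j)}) -> lim (f z @[z --> y^']) = h y.
Proof.
move=> e c.
have PF : ProperFilter (y^').
  apply: Build_ProperFilter_ex => A.
  rewrite /dnbhs => /nbhs_ballP[r /= r0 hr].
  pose z := y + (r / 2) *: delta_mx 0 0.
  exists z; apply: hr.
    rewrite -ball_normE /= /z opprD addrA subrr sub0r normrN normrZ.
    rewrite gtr0_norm ?divr_gt0//.
    have -> : `|delta_mx 0 0 : 'rV[R]_4| = 1.
      rewrite /Num.Def.normr/= mx_normrE; apply/eqP; rewrite eq_le; apply/andP; split.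
        by apply: bigmax_le => // i _; rewrite mxE; case: eqP; case: eqP; rewrite /= ?normr1 ?normr0.
      apply: le_trans (le_bigmax _ _ (0, 0)) => /=.
      by rewrite mxE !eqxx normr1.
    by rewrite mulr1 ltr_pdivrMr// ltr_pMr// ltr1n.
  rewrite /z; apply/eqP => /(congr1 (fun u => (u - y) 0 0)).
  rewrite [_ + _ - y]addrC addKr subrr !mxE !eqxx mulr1 => /eqP.
  by rewrite mulf_eq0 invr_eq0 pnatr_eq0 orbF gt_eqF.
apply: cvg_lim => //.
apply: cvg_mx => i j.
have : h z i j @[z --> y^'] --> h y i j.
  by apply: cvg_trans (c i j); apply: cvg_app; exact: nbhs_dnbhs.
apply: cvg_trans; apply: near_eq_cvg.
near=> z; rewrite e//; near: z; exact: nbhs_dnbhs_neq.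
Unshelve. all: by end_near. Qed.

Lemma lim_dnbhs_cst (M : 'M[R]_4) y : lim ((fun=> M) z @[z --> y^']) = M.
Proof.
rewrite (@lim_dnbhs _ (fun=> M))// => i j.
exact: (@cst_continuous _ _ (M i j) y).
Qed.

(* For m = 0 the chart is (x^1, x^2, x^3, psi); this signed permutation takes
   it to the chart of the case m > 0 at kappa = 0. *)
Definition frame0 (m : R) : 'M[R]_4 := if m == 0 then mx4
  [:: [:: 0; 0; 1; 0]; [:: 0; 0; 0; -1]; [:: 1; 0; 0; 0]; [:: 0; 1; 0; 0]]
  else 1%:M.

Lemma mulmx4E (A B : 'M[R]_4) i j : (A *m B) i j =
  A i 0 * B 0 j + A i 1 * B 1 j + A i 2 * B 2 j + A i 3 * B 3 j.
Proof.
rewrite mxE !big_ord_recl big_ord0 addr0 !addrA.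
by congr (_ + A i _ * B _ j + A i _ * B _ j + A i _ * B _ j); apply/val_inj.
Qed.

Lemma mulrow4E (u : 'rV[R]_4) (B : 'M[R]_4) j : (u *m B) 0 j =
  rval u 0 * B 0 j + rval u 1 * B 1 j + rval u 2 * B 2 j + rval u 3 * B 3 j.
Proof.
rewrite mxE !big_ord_recl big_ord0 addr0 !addrA -!rvalE.
by congr (_ + _ * B _ j + _ * B _ j + _ * B _ j); apply/val_inj.
Qed.

Lemma frame0_orth m : frame0 m *m (frame0 m)^T = 1%:M.
Proof.
rewrite /frame0; case: eqP => _; last by rewrite trmx1 mulmx1.
apply/matrixP => i j; rewrite mulmx4E idmxE !mxE /=.
by case: i => [[|[|[|[|//]]]] Hi]; case: j => [[|[|[|[|//]]]] Hj] /=; ring.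
Qed.

Lemma tn_x0 i y : tn_x 0 i y = interp (rval y) (EVar i).
Proof. by rewrite /tn_x eqxx /= -rvalE. Qed.

Lemma differential_x0 i y :
  differential (tn_x 0 i) y = delta_mx 0 (widen_ord (leqnSn 3) i).
Proof.
apply/rowP => j; rewrite !mxE (funext (tn_x0 i)) pd_interp_below//=; last first.
  by apply: leq_trans (ltn_ord i) _.
by rewrite /kron -val_eqE /= eq_sym; case: eqP.
Qed.

Lemma tn_V0 y : tn_V 0 y = 1.
Proof. by rewrite /tn_V mul0r addr0. Qed.

Lemma extend_nutE m (f h : 'rV[R]_4 -> 'M[R]_4) q : 0 < m ->
  (forall z, z != 0 -> f z = h z) ->
  (forall i j, {for 0, continuous (fun z => h z i j)}) ->
  extend_nut m f q = h q.
Proof.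
move=> m0 e c; rewrite /extend_nut tn_rE//; case: ifPn => [|h0]; last first.
  by apply: e; apply: contra_neq h0 => ->; rewrite /sqn mul0mx mxE mul0r.
have -> : (sqn q / (4 * m) == 0) = (sqn q == 0).
  by rewrite mulf_eq0 invr_eq0 [4 * m == 0]gt_eqF ?orbF// mulr_gt0.
by move=> /eqP/sqn_eq0->; exact: lim_dnbhs.
Qed.

Lemma tn_metricE m q : 0 <= m ->
  tn_metric m q = frame0 m *m gmod (kap m) J4 (q *m frame0 m) *m (frame0 m)^T.
Proof.
rewrite le_eqVlt => /predU1P[<-|m0]; last first.
  have mN0 : m != 0 by rewrite gt_eqF.
  rewrite /frame0 (negbTE mN0) mulmx1 mul1mx trmx1 mulmx1.
  apply: extend_nutE => //; first by move=> z z0; exact: tn_metric_away.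
  by move=> i j; apply: continuous_gmod; exact: kap_ge0.
rewrite /kap eqxx /gmod /wfun !mul0r scale0r subr0 addr0 scale1r mulmx1 frame0_orth.
rewrite /tn_metric.
rewrite (_ : (fun y => _) = (fun=> 1%:M)).
  by rewrite /extend_nut; case: ifP => // _; exact: lim_dnbhs_cst.
apply/funext => y; rewrite /tn_e4 /tn_e tn_V0 sqrtr1 invr1 !scale1r /tn_eta eqxx.
under eq_bigr do rewrite scale1r differential_x0.
apply/matrixP => i j.
rewrite !big_ord_recl big_ord0 addr0 !addmxE !mul_rowT !mxE /= -!val_eqE /=.
by case: i => [[|[|[|[|//]]]] Hi]; case: j => [[|[|[|[|//]]]] Hj] /=; ring.
Qed.

Lemma tn_OmegaE m i q : 0 <= m -> tn_Omega m i q =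
  frame0 m *m Fmod (kap m) J4 (S4 i) (q *m frame0 m) *m (frame0 m)^T.
Proof.
rewrite le_eqVlt => /predU1P[<-|m0]; last first.
  have mN0 : m != 0 by rewrite gt_eqF.
  rewrite /frame0 (negbTE mN0) mulmx1 mul1mx trmx1 mulmx1.
  apply: extend_nutE => //; first by move=> z z0; exact: tn_Omega_away.
  by move=> k l; exact: continuous_Fmod.
rewrite /kap eqxx /Fmod /wfun !mul0r scale0r subr0 addr0 scale1r.
rewrite /tn_Omega; set K := frame0 0 *m _ *m _.
rewrite (_ : (fun y => _) = (fun=> K)).
  by rewrite /extend_nut; case: ifP => // _; exact: lim_dnbhs_cst.
apply/funext => y; rewrite /tn_e4 /tn_e tn_V0 sqrtr1 invr1 !scale1r /tn_eta eqxx.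
rewrite !differential_x0.
apply/matrixP => k l; rewrite addmxE !wedgeE /K {K} /frame0 eqxx !mulmx4E !mxE /= -!val_eqE /=.
by case: i => [[|[|[|//]]] Hi]; case: k => [[|[|[|[|//]]]] Hk];
  case: l => [[|[|[|[|//]]]] Hl] /=; ring.
Qed.

Definition Scomb (c : 'rV[R]_3) : 'M[R]_4 := \sum_i c 0 i *: S4 i.

Lemma wedge_suml (I : finType) (u : I -> 'rV[R]_4) v :
  wedge (\sum_i u i) v = \sum_i wedge (u i) v.
Proof.
apply/matrixP => k l; rewrite wedgeE !summxE mulr_suml mulr_sumr -sumrB.
by apply: eq_bigr => i _; rewrite wedgeE.
Qed.

Lemma Fmod_comb kappa J (c : 'rV[R]_3) q :
  \sum_i c 0 i *: Fmod kappa J (S4 i) q = Fmod kappa J (Scomb c) q.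
Proof.
rewrite /Fmod /Scomb mulmx_sumr scaler_sumr mulmx_sumr wedge_suml scaler_sumr -sumrB.
apply: eq_bigr => i _.
rewrite -!scalemxAr wedgeZl scalerBr !scalerA; congr (_ *: _ - _ *: _); ring.
Qed.

Lemma tn_FE m c q : 0 <= m -> tn_F m c q =
  frame0 m *m Fmod (kap m) J4 (Scomb c) (q *m frame0 m) *m (frame0 m)^T.
Proof.
move=> m0; rewrite /tn_F; under eq_bigr do rewrite tn_OmegaE// scalemxAl scalemxAr.
by rewrite -mulmx_suml -mulmx_sumr Fmod_comb.
Qed.

Lemma JJ4 : J4 *m J4 = - 1%:M.
Proof.
apply/matrixP => i j; rewrite mulmx4E oppmxE idmxE !mxE /=.
by case: i => [[|[|[|[|//]]]] Hi]; case: j => [[|[|[|[|//]]]] Hj] /=; ring.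
Qed.

Lemma trJ4 : J4^T = - J4.
Proof.
apply/matrixP => i j; rewrite !mxE /=.
by case: i => [[|[|[|[|//]]]] Hi]; case: j => [[|[|[|[|//]]]] Hj] /=; ring.
Qed.

Lemma trScomb c : (Scomb c)^T = Scomb c.
Proof.
apply/matrixP => i j; rewrite mxE !summxE; apply: eq_bigr => k _; rewrite !mxE.
by case: i => [[|[|[|[|//]]]] Hi]; case: j => [[|[|[|[|//]]]] Hj];
  case: k => [[|[|[|//]]] Hk].
Qed.

Lemma JScomb c : J4 *m Scomb c = Scomb c *m J4.
Proof.
rewrite mulmx_sumr mulmx_suml; apply: eq_bigr => i _.
rewrite -scalemxAr -scalemxAl; congr (_ *: _).
apply/matrixP => k l; rewrite JS4E mulmx4E !mxE /=.
by case: i => [[|[|[|//]]] Hi]; case: k => [[|[|[|[|//]]]] Hk];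
  case: l => [[|[|[|[|//]]]] Hl] /=; ring.
Qed.

Lemma SScomb c : Scomb c *m Scomb c = (\sum_i c 0 i ^+ 2) *: 1%:M.
Proof.
apply/matrixP => k l; rewrite mulmx4E scalemxE idmxE !summxE !big_ord_recl !big_ord0 !mxE /=.
rewrite -!rvalE /=.
by case: k => [[|[|[|[|//]]]] Hk]; case: l => [[|[|[|[|//]]]] Hl] /=; ring.
Qed.

(** The matrix [(q *m J)^T *m (q *m J)] squares to |q|^2 times itself, so the inverse is found in
    its span with the identity. *)
Lemma gmodE kappa J q : J *m J^T = 1%:M -> 0 <= kappa ->
  gmod kappa J q *m gmodV kappa J q = 1%:M.
Proof.
move=> JJ k0; have w0 := lt0r_neq0 (wfun_gt0 q k0).
have AA : (q *m J) *m (q *m J)^T = (sqn q)%:M.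
  rewrite trmx_mul mulmxA -(mulmxA q) JJ mulmx1; apply/matrixP => i j.
  by rewrite !ord1 [RHS]mxE eqxx mulr1n.
have AAAA : ((q *m J)^T *m (q *m J)) *m ((q *m J)^T *m (q *m J))
   = sqn q *: ((q *m J)^T *m (q *m J)).
  by rewrite mulmxA -(mulmxA (_^T)) AA mul_mx_scalar -scalemxAl.
rewrite /gmod /gmodV -scalemxAr mulmxDr mulmx1 mulmxBl.
rewrite -!scalemxAl -!scalemxAr mul1mx AAAA.
apply/matrixP => i j; rewrite !(addmxE, oppmxE, scalemxE).
move: (((q *m J)^T *m (q *m J)) i j) ((1%:M : 'M[R]_4) i j) => a b.
(* For kappa non-zero, |q|^2 is eliminated in favour of w, which requires dividing by kappa. *)
case: (eqVneq kappa 0) => [->|kN0].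
  by rewrite /wfun !mul0r !addr0; field.
have -> : sqn q = (wfun kappa q - 1) / kappa by rewrite /wfun; field.
by field; rewrite w0 kN0.
Qed.

Lemma gmod_unit kappa J q : J *m J^T = 1%:M -> 0 <= kappa ->
  gmod kappa J q \in unitmx /\ invmx (gmod kappa J q) = gmodV kappa J q.
Proof.
move=> JJ k0; have h := gmodE q JJ k0; have [u _] := mulmx1_unit h.
by split=> //; rewrite -[RHS]mul1mx -(mulVmx u) -mulmxA h mulmx1.
Qed.

(** The metric depends on [q] only through |q|^2 and [q *m J]; an orthogonal [B] preserves the first
    and conjugates the matrix in the second. *)
Lemma gmod_frame kappa J (B : 'M[R]_4) q : B *m B^T = 1%:M ->
  gmod kappa J q = B *m gmod kappa (B^T *m J *m B) (q *m B) *m B^T.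
Proof.
move=> BB; have sq : sqn (q *m B) = sqn q.
  by rewrite /sqn trmx_mul mulmxA -(mulmxA q) BB mulmx1.
have e : q *m B *m (B^T *m J *m B) = q *m J *m B.
  by rewrite !mulmxA -(mulmxA q) BB mulmx1.
rewrite /gmod /wfun sq e mulmxBr mulmxBl -!scalemxAr -!scalemxAl mulmx1 BB.
congr (_ - _ *: _); rewrite [(q *m J *m B)^T]trmx_mul !mulmxA BB mul1mx.
by rewrite -!mulmxA BB mulmx1.
Qed.

Lemma Fmod_frame kappa J S (B : 'M[R]_4) q : B *m B^T = 1%:M ->
  Fmod kappa J S q = B *m Fmod kappa (B^T *m J *m B) (B^T *m S *m B) (q *m B) *m B^T.
Proof.
move=> BB; have sq : sqn (q *m B) = sqn q.
  by rewrite /sqn trmx_mul mulmxA -(mulmxA q) BB mulmx1.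
have e J' : q *m B *m (B^T *m J' *m B) = q *m J' *m B.
  by rewrite !mulmxA -(mulmxA q) BB mulmx1.
rewrite /Fmod /wfun sq !e mulmxBr mulmxBl -!scalemxAr -!scalemxAl.
congr (_ *: _ - _ *: _).
  rewrite !mulmxA BB mul1mx -(mulmxA J) BB mulmx1 -(mulmxA _ B) BB mulmx1 //.
have w u v : B *m ((u *m B)^T *m (v *m B)) *m B^T = u^T *m v.
  by rewrite [(u *m B)^T]trmx_mul !mulmxA BB mul1mx -!mulmxA BB mulmx1.
by rewrite /wedge mulmxBr mulmxBl !w.
Qed.

End Model.

(** * Frames adapted to a self-dual form *)

Section Frame.
Context {R : realType}.
Implicit Types (u v p : 'rV[R]_4) (c : 'rV[R]_3).
Local Notation J4 := (@J4 R).
Local Notation S4 := (@S4 R).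

Definition dot u v : R := (u *m v^T) 0 0.

Lemma dotC u v : dot u v = dot v u.
Proof. by rewrite /dot -[in LHS](trmxK u) -trmx_mul mxE. Qed.

Lemma dotDl u v w : dot (u + v) w = dot u w + dot v w.
Proof. by rewrite /dot mulmxDl mxE. Qed.

Lemma dotNl u v : dot (- u) v = - dot u v.
Proof. by rewrite /dot mulNmx mxE. Qed.

Lemma dotZl a u v : dot (a *: u) v = a * dot u v.
Proof. by rewrite /dot -scalemxAl mxE. Qed.

Lemma dotDr u v w : dot w (u + v) = dot w u + dot w v.
Proof. by rewrite dotC dotDl !(dotC w). Qed.

Lemma dotNr u v : dot v (- u) = - dot v u.
Proof. by rewrite dotC dotNl (dotC v). Qed.

Lemma dotZr a u v : dot v (a *: u) = a * dot v u.
Proof. by rewrite dotC dotZl (dotC v). Qed.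

Lemma dotMl u v (A : 'M[R]_4) : dot (u *m A) v = dot u (v *m A^T).
Proof. by rewrite /dot trmx_mul trmxK mulmxA. Qed.

Lemma dotJl u v : dot (u *m J4) v = - dot u (v *m J4).
Proof. by rewrite dotMl trJ4 mulmxN dotNr. Qed.

Lemma dotJJ u v : dot (u *m J4) (v *m J4) = dot u v.
Proof. by rewrite dotJl -mulmxA JJ4 mulmxN mulmx1 dotNr opprK. Qed.

Lemma dotJ0 u : dot u (u *m J4) = 0.
Proof. by apply/eqP; rewrite -eqNr -dotJl dotC. Qed.

Lemma dotSl c u v : dot (u *m Scomb c) v = dot u (v *m Scomb c).
Proof. by rewrite dotMl trScomb. Qed.

Lemma dot4E u v : dot u v = rval u 0 * rval v 0 + rval u 1 * rval v 1
  + rval u 2 * rval v 2 + rval u 3 * rval v 3.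
Proof. by rewrite /dot !mxE !big_ord_recl big_ord0 !mxE -!rvalE /=; ring. Qed.

Lemma dot_Scomb c u v : dot u (v *m Scomb c) = \sum_i c 0 i * dot u (v *m S4 i).
Proof.
rewrite /dot /Scomb mulmx_sumr linear_sum /= mulmx_sumr summxE.
by apply: eq_bigr => i _; rewrite -scalemxAr linearZ /= -scalemxAr mxE.
Qed.

Lemma rvalS4 u i k : rval (u *m S4 i) k = (nth [::]
  [:: [:: rval u 2; rval u 3; rval u 0; rval u 1];
      [:: - rval u 3; rval u 2; rval u 1; - rval u 0];
      [:: rval u 0; rval u 1; - rval u 2; - rval u 3]] i)`_k.
Proof.
have [k4|k4] := ltnP k 4; first by rewrite -(mulSE u i (Ordinal k4)) -rvalE.
rewrite {1}/rval insubF; last by rewrite ltnNge k4.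
by case: i => [[|[|[|//]]] Hi] /=; rewrite nth_default.
Qed.

Lemma row_matrix4 (f : 'I_4 -> 'rV[R]_4) i : row i (\matrix_(k < 4) f k) = f i.
Proof. exact: rowK. Qed.

Lemma mul_row_4 u (A : 'M[R]_4) : u *m A =
  u 0 0 *: row 0 A + u 0 1 *: row 1 A + u 0 2 *: row 2 A + u 0 3 *: row 3 A.
Proof.
rewrite mulmx_sum_row !big_ord_recl big_ord0 addr0 !addrA.
by congr (_ + u 0 _ *: row _ A + u 0 _ *: row _ A + u 0 _ *: row _ A); apply/val_inj.
Qed.

Section adapted.
Variables (c : 'rV[R]_3) (p : 'rV[R]_4).
Hypothesis c1 : \sum_i c 0 i ^+ 2 = 1.
Hypothesis hp : dot p (p *m Scomb c) ^+ 2 < dot p p ^+ 2.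
Local Notation S := (Scomb c).

Let SS : S *m S = 1%:M. Proof. by rewrite SScomb c1 scale1r. Qed.

Let pp0 : 0 <= dot p p. Proof. exact: sqn_ge0. Qed.

Let hm : dot p (p *m S) < dot p p /\ - dot p (p *m S) < dot p p.
Proof.
by move: hp pp0; move: (dot p _) (dot p p) => x y h1 h2; split; nra.
Qed.
(** For [s] equal to 1 or -1, twice the projection of [p] on that eigenspace of the involution
    [Scomb c]. By [hp] the point is not an eigenvector, so neither projection vanishes. *)
Let f s : 'rV[R]_4 := p + s *: (p *m S).
Let nrm s := Num.sqrt (dot (f s) (f s)).
Let fn s := (nrm s)^-1 *: f s.

Let ffE s : s ^+ 2 = 1 -> dot (f s) (f s) = 2 * (dot p p + s * dot p (p *m S)).
Proof.
move=> s1; rewrite /f !(dotDl, dotDr, dotZl, dotZr) [dot (p *m S) p]dotC.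
rewrite [dot (p *m S) (p *m S)]dotSl -mulmxA SS mulmx1 mulrA -expr2 s1; ring.
Qed.

Let ff0 s : s ^+ 2 = 1 -> 0 < dot (f s) (f s).
Proof.
move=> s1; rewrite ffE// mulr_gt0//.
have /orP[/eqP->|/eqP->] : (s == 1) || (s == -1) by rewrite -eqf_sqr s1 expr1n.
  by have := hm; lra.
by have := hm; lra.
Qed.

Let nrm0 s : s ^+ 2 = 1 -> 0 < nrm s.
Proof. by move=> /ff0; rewrite sqrtr_gt0. Qed.

Let fn1 s : s ^+ 2 = 1 -> dot (fn s) (fn s) = 1.
Proof.
move=> s1; have n0 := lt0r_neq0 (nrm0 s1).
rewrite /fn dotZl dotZr; have <- : nrm s ^+ 2 = dot (f s) (f s).
  by rewrite sqr_sqrtr// ltW// ff0.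
by field.
Qed.

Let fnS s : s ^+ 2 = 1 -> fn s *m S = s *: fn s.
Proof.
move=> s1; rewrite /fn -scalemxAl scalerA mulrC -scalerA; congr (_ *: _).
by rewrite /f mulmxDl -scalemxAl -mulmxA SS mulmx1 scalerDr scalerA -expr2 s1 scale1r addrC.
Qed.

Let fn12 : dot (fn 1) (fn (-1)) = 0.
Proof.
have : dot (fn 1 *m S) (fn (-1)) = - dot (fn 1) (fn (-1)).
  by rewrite dotSl fnS ?sqrrN ?expr1n// scaleN1r dotNr.
by rewrite fnS ?expr1n// scale1r; lra.
Qed.

Let fn12J : dot (fn 1) (fn (-1) *m J4) = 0.
Proof.
have : dot (fn 1 *m S) (fn (-1) *m J4) = - dot (fn 1) (fn (-1) *m J4).
  rewrite dotSl -mulmxA JScomb mulmxA fnS ?sqrrN ?expr1n// scaleN1r.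
  by rewrite mulNmx dotNr.
by rewrite fnS ?expr1n// scale1r; lra.
Qed.

Let M : 'M[R]_4 := \matrix_(i < 4)
  nth 0 [:: fn 1; fn 1 *m J4; fn (-1); fn (-1) *m J4] i.

Let MMT : M *m M^T = 1%:M.
Proof.
have e1 : (1 : R) ^+ 2 = 1 by rewrite expr1n.
have e2 : (-1 : R) ^+ 2 = 1 by rewrite sqrrN expr1n.
apply/matrixP => i j; rewrite idmxE.
have -> : (M *m M^T) i j = dot (row i M) (row j M).
  by rewrite /dot !mxE; apply: eq_bigr => k _; rewrite !mxE.
rewrite !row_matrix4.
by case: i => [[|[|[|[|//]]]] Hi]; case: j => [[|[|[|[|//]]]] Hj] /=;
  rewrite ?dotJJ ?fn1 ?dotJ0 ?dotJl ?dotJ0 ?fn12 ?fn12J ?oppr0 //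
    1?dotC ?dotJl ?dotJ0 ?fn12 ?fn12J ?oppr0 // 1?dotC ?fn12 ?fn12J ?oppr0.
Qed.

Let MJ : M *m J4 = J4 *m M.
Proof.
apply/row_matrixP => i; rewrite !row_mul row_matrix4 [in RHS]mul_row_4 !row_matrix4 !mxE.
by case: i => [[|[|[|[|//]]]] Hi] /=;
  rewrite -?mulmxA ?JJ4 ?mulmxN ?mulmx1 ?(scale0r, scale1r, scaleN1r, addr0, add0r).
Qed.

Let MS : M *m S = S4 ord_max *m M.
Proof.
have e1 : (1 : R) ^+ 2 = 1 by rewrite expr1n.
have e2 : (-1 : R) ^+ 2 = 1 by rewrite sqrrN expr1n.
apply/row_matrixP => i; rewrite !row_mul row_matrix4 [in RHS]mul_row_4 !row_matrix4 !mxE.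
by case: i => [[|[|[|[|//]]]] Hi] /=;
  rewrite -?mulmxA ?JScomb ?mulmxA ?fnS ?(scale0r, scale1r, scaleN1r, addr0, add0r, mulNmx).
Qed.

Let pfn s : s ^+ 2 = 1 -> 0 < dot p (fn s) /\ dot p (fn s *m J4) = 0.
Proof.
move=> s1; split.
  rewrite /fn dotZr mulr_gt0// ?invr_gt0 ?nrm0// /f dotDr dotZr.
  by have := ff0 s1; rewrite ffE//; lra.
rewrite /fn /f -scalemxAl dotZr mulmxDl -scalemxAl dotDr dotJ0 dotZr add0r.
suff -> : dot p (p *m S *m J4) = 0 by rewrite !mulr0.
have h1 : dot p (p *m S *m J4) = - dot (p *m J4) (p *m S) by rewrite dotJl opprK.
have h2 : dot (p *m J4) (p *m S) = dot p (p *m S *m J4).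
  by rewrite dotC dotSl -mulmxA JScomb mulmxA.
lra.
Qed.

(** The columns of [B] are the two normalised projections of [p] and their images under [J4]. They
    are orthonormal because [Scomb c] is symmetric and commutes with [J4]. Since [p] has positive
    inner product with both projections, the coordinates 0 and 2 of [p] are positive in this
    frame. *)
Lemma adapted_frame : exists B : 'M[R]_4,
  [/\ B *m B^T = 1%:M, B^T *m J4 *m B = J4, B^T *m S *m B = S4 ord_max &
      0 < rval (p *m B) 0 /\ 0 < rval (p *m B) 2].
Proof.
exists M^T; rewrite trmxK.
have MTM : M^T *m M = 1%:M by apply: mulmx1C.
have e1 : (1 : R) ^+ 2 = 1 by rewrite expr1n.
have e2 : (-1 : R) ^+ 2 = 1 by rewrite sqrrN expr1n.
have pB (k : 'I_4) : rval (p *m M^T) k = dot p (row k M).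
  by rewrite rvalE /dot !mxE; apply: eq_bigr => l _; rewrite !mxE.
have [a1 a2] := pfn e1; have [b1 b2] := pfn e2.
split=> //.
- by rewrite MJ -mulmxA MMT mulmx1.
- by rewrite MS -mulmxA MMT mulmx1.
- by split; [rewrite (pB (Ordinal (isT : 0 < 4)%N))|rewrite (pB (Ordinal (isT : 2 < 4)%N))]; rewrite row_matrix4.
Qed.

End adapted.

(** The first basis vector works unless c is plus or minus the third axis; then it is an eigenvector
    of [Scomb c], and (1, 0, 1, 0) is taken. *)
Lemma adapted_point c : \sum_i c 0 i ^+ 2 = 1 ->
  exists p : 'rV[R]_4, dot p (p *m Scomb c) ^+ 2 < dot p p ^+ 2.
Proof.
rewrite !big_ord_recl big_ord0 addr0 -!rvalE /= => c1.
have dE (a b : R) : let p : 'rV[R]_4 := \row_i [:: a; 0; b; 0]`_i in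
    dot p p = a ^+ 2 + b ^+ 2 /\
    dot p (p *m Scomb c) = 2 * rval c 0 * a * b + rval c 2 * (a ^+ 2 - b ^+ 2).
  move=> p; have pE (k : 'I_4) : rval p k = [:: a; 0; b; 0]`_k by rewrite rvalE mxE.
  have p0 : rval p 0 = a by rewrite (pE ord0).
  have p1 : rval p 1 = 0 by rewrite (pE (Ordinal (isT : 1 < 4)%N)).
  have p2 : rval p 2 = b by rewrite (pE (Ordinal (isT : 2 < 4)%N)).
  have p3 : rval p 3 = 0 by rewrite (pE (Ordinal (isT : 3 < 4)%N)).
  split; first by rewrite [dot p p]sqnE p0 p1 p2 p3; ring.
  rewrite dot_Scomb !big_ord_recl big_ord0 !dot4E -!rvalE.
  by rewrite !rvalS4 /= p0 p1 p2 p3; ring.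
case: (eqVneq (rval c 2 ^+ 2) 1) => [c2|c2].
  exists (\row_i [:: 1; 0; 1; 0]`_i); have [-> ->] := dE 1 1.
  have -> : rval c 0 = 0 by apply/eqP; rewrite -sqrf_eq0; apply/eqP; have := (sqr_ge0 (rval c 0), sqr_ge0 (rval c 1)); case; lra.
  by rewrite mulr0 !mul0r add0r subrr mulr0 expr0n /= exprn_gt0// addr_gt0 ?exprn_gt0.
exists (\row_i [:: 1; 0; 0; 0]`_i); have [-> ->] := dE 1 0.
rewrite !mulr0 add0r expr0n /= expr1n subr0 addr0 mulr1 expr1n lt_neqAle c2 /=.
by have := (sqr_ge0 (rval c 0), sqr_ge0 (rval c 1)); case; lra.
Qed.

(** Composing [frame0 m] with an adapted frame reduces every pair (m, c) to the model with the third
    form. The point [p] is kept because later arguments place a prescribed initial point in the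
    half-spaces [y_0 > 0] and [y_2 > 0]. *)
Lemma tn_adapted m c p : 0 <= m -> \sum_i c 0 i ^+ 2 = 1 ->
  let q := p *m frame0 m in dot q (q *m Scomb c) ^+ 2 < dot q q ^+ 2 ->
  exists B : 'M[R]_4, [/\ B *m B^T = 1%:M,
    forall q, tn_metric m q = B *m gmod (kap m) J4 (q *m B) *m B^T,
    forall q, tn_F m c q = B *m Fmod (kap m) J4 (S4 ord_max) (q *m B) *m B^T,
    frame0 m *m Scomb c *m (frame0 m)^T = B *m S4 ord_max *m B^T &
    0 < rval (p *m B) 0 /\ 0 < rval (p *m B) 2].
Proof.
move=> m0 c1 p' hp; have [B [BB BJ BS b02]] := adapted_frame c1 hp.
exists (frame0 m *m B); split.
- by rewrite trmx_mul mulmxA -(mulmxA _ B) BB mulmx1 frame0_orth.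
- by move=> q; rewrite tn_metricE// (gmod_frame _ _ _ BB) BJ trmx_mul !mulmxA.
- by move=> q; rewrite tn_FE// (Fmod_frame _ _ _ _ BB) BJ BS trmx_mul !mulmxA.
- by rewrite -BS trmx_mul !mulmxA -(mulmxA _ B) BB mulmx1 -(mulmxA _ B) BB mulmx1.
- by rewrite mulmxA.
Qed.

End Frame.

(** * Matrices of elementary functions *)

Section Elementary.
Context {R : realType} {n : nat}.
Implicit Types (f h : 'rV[R]_n -> R) (q v : 'rV[R]_n).

(** One expression valid at every point, hence smoothness on the whole chart and stability under
    partial derivatives. *)
Definition elementary f :=
  exists E : expr, forall q, valid (rval q) E /\ f q = interp (rval q) E.

Lemma elementary_cst c : elementary (fun=> c).
Proof. by exists (ECst c). Qed.

Lemma elementaryD f h : elementary f -> elementary h -> elementary (fun q => f q + h q).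
Proof.
move=> [E HE] [H HH]; exists (EAdd E H) => q.
by have [? ->] := HE q; have [? ->] := HH q.
Qed.

Lemma elementaryM f h : elementary f -> elementary h -> elementary (fun q => f q * h q).
Proof.
move=> [E HE] [H HH]; exists (EMul E H) => q.
by have [? ->] := HE q; have [? ->] := HH q.
Qed.

Lemma elementaryN f : elementary f -> elementary (fun q => - f q).
Proof. by move=> [E HE]; exists (EOpp E) => q; have [? ->] := HE q. Qed.

Lemma elementary_sum (I : Type) (r : seq I) (F : I -> 'rV[R]_n -> R) :
  (forall i, elementary (F i)) -> elementary (fun q => \sum_(i <- r) F i q).
Proof.
move=> h; elim: r => [|i r IH].
  by exists (ECst 0) => q; rewrite big_nil.
have [E HE] := elementaryD (h i) IH.
by exists E => q; have [? <-] := HE q; rewrite big_cons.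
Qed.

Lemma elementary_derive f v q : elementary f -> derivable f q v.
Proof.
move=> [E HE]; rewrite (_ : f = fun q => interp (rval q) E).
  by apply: derivable_interp; have [] := HE q.
by apply/funext => p; have [] := HE p.
Qed.

Lemma elementary_D f v : elementary f -> elementary ('D_v f).
Proof.
move=> [E HE]; rewrite (_ : f = fun q => interp (rval q) E).
  exists (D (rval v) E) => q; have [vE _] := HE q.
  by split; [exact: valid_D|rewrite derive_interp].
by apply/funext => p; have [] := HE p.
Qed.

Lemma elementary_pd i f : elementary f -> elementary (pd i f).
Proof. exact: elementary_D. Qed.

Lemma pd_comm i j f q : elementary f -> pd i (pd j f) q = pd j (pd i f) q.
Proof.
move=> [E HE]; rewrite (_ : f = fun q => interp (rval q) E); last first.
  by apply/funext => p; have [] := HE p.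
have e (k : 'I_n) : pd k (fun q => interp (rval q) E) = (fun q => interp (rval q)
    (D (rval (delta_mx 0 k : 'rV[R]_n)) E)).
  by apply/funext => p; rewrite pd_interp//; have [] := HE p.
have e2 a b : pd a (pd b (fun q => interp (rval q) E)) q = interp (rval q)
    (D (rval (delta_mx 0 a : 'rV[R]_n)) (D (rval (delta_mx 0 b : 'rV[R]_n)) E)).
  by rewrite (e b) pd_interp//; apply: valid_D; have [] := HE q.
by rewrite (e2 i j) (e2 j i) D_D.
Qed.

Lemma derive_sum_pd f v q : elementary f -> 'D_v f q = \sum_i v 0 i * pd i f q.
Proof.
move=> [E HE]; rewrite (_ : f = fun q => interp (rval q) E); last first.
  by apply/funext => p; have [] := HE p.
have [vE _] := HE q.
under eq_bigr do rewrite pd_interp//.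
rewrite derive_interp// -D_sum; apply: D_eq => k.
rewrite {1}[v]row_sum_delta /rval; case: insubP => [j _ _|_]; last first.
  by rewrite big1// => i _; rewrite mulr0.
by rewrite summxE; apply: eq_bigr => i _; rewrite mxE.
Qed.

Lemma elementary_curve f (gamma : R -> 'rV[R]_n) (t : R) (l : 'rV[R]_n) :
  elementary f -> is_derive t (1 : R) gamma l ->
  is_derive t (1 : R) (fun s => f (gamma s)) (\sum_i l 0 i * pd i f (gamma t)).
Proof.
move=> Ef dg; rewrite -derive_sum_pd//; move: Ef => [E HE].
rewrite (_ : f = fun q => interp (rval q) E); last first.
  by apply/funext => p; have [] := HE p.
have [vE _] := HE (gamma t).
by rewrite derive_interp//; exact: is_derive_interp_curve.
Qed.

Lemma pdM i f h q : elementary f -> elementary h ->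
  pd i (fun p => f p * h p) q = pd i f q * h q + f q * pd i h q.
Proof.
move=> Ef Eh; rewrite /pd deriveM; [|exact: elementary_derive..].
by rewrite addrC /GRing.scale/= mulrC.
Qed.

Lemma pd_eq i f h q : f =1 h -> pd i f q = pd i h q.
Proof. by move=> /funext->. Qed.

Lemma pdD i f h q : elementary f -> elementary h ->
  pd i (fun p => f p + h p) q = pd i f q + pd i h q.
Proof. by move=> Ef Eh; rewrite /pd deriveD//; exact: elementary_derive. Qed.

Lemma pdN i f q : elementary f -> pd i (fun p => - f p) q = - pd i f q.
Proof. by move=> Ef; rewrite /pd deriveN//; exact: elementary_derive. Qed.

Lemma pd_sum (I : Type) (r : seq I) (F : I -> 'rV[R]_n -> R) i q :
  (forall k, elementary (F k)) ->
  pd i (fun p => \sum_(k <- r) F k p) q = \sum_(k <- r) pd i (F k) q.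
Proof.
move=> h; elim: r => [|k r IH].
  rewrite big_nil (_ : (fun p => _) = cst 0); first exact: derive_cst.
  by apply/funext => p; rewrite big_nil.
rewrite big_cons -IH -pdD//; last exact: elementary_sum.
by congr ('D_ _ _ q); apply/funext => p; rewrite big_cons.
Qed.

Lemma pd_cst i (c : R) q : pd i (fun=> c) q = 0.
Proof. exact: derive_cst. Qed.

Definition elementary_mx k l (X : 'rV[R]_n -> 'M[R]_(k, l)) :=
  forall i j, elementary (fun q => X q i j).

Definition dmx k l (a : 'I_n) (X : 'rV[R]_n -> 'M[R]_(k, l)) q : 'M[R]_(k, l) :=
  \matrix_(i, j) pd a (fun p => X p i j) q.

Lemma elementary_mxM k l m (X : 'rV[R]_n -> 'M[R]_(k, l)) (Y : 'rV[R]_n -> 'M[R]_(l, m)) :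
  elementary_mx X -> elementary_mx Y -> elementary_mx (fun q => X q *m Y q).
Proof.
move=> EX EY i j; rewrite (_ : (fun q => _) = fun q => \sum_p X q i p * Y q p j).
  by apply: elementary_sum => p; exact: elementaryM.
by apply/funext => q; rewrite mxE.
Qed.

Lemma elementary_mxN k l (X : 'rV[R]_n -> 'M[R]_(k, l)) :
  elementary_mx X -> elementary_mx (fun q => - X q).
Proof.
move=> EX i j; rewrite (_ : (fun q => _) = fun q => - X q i j); first exact: elementaryN.
by apply/funext => q; rewrite mxE.
Qed.

Lemma elementary_mxT k l (X : 'rV[R]_n -> 'M[R]_(k, l)) :
  elementary_mx X -> elementary_mx (fun q => (X q)^T).
Proof.
move=> EX i j; rewrite (_ : (fun q => _) = fun q => X q j i); first exact: EX.
by apply/funext => q; rewrite mxE.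
Qed.

Lemma dmxM k l m a (X : 'rV[R]_n -> 'M[R]_(k, l)) (Y : 'rV[R]_n -> 'M[R]_(l, m)) q :
  elementary_mx X -> elementary_mx Y ->
  dmx a (fun p => X p *m Y p) q = dmx a X q *m Y q + X q *m dmx a Y q.
Proof.
move=> EX EY; apply/matrixP => i j; rewrite !mxE -big_split.
rewrite (_ : (fun p => _) = fun p => \sum_k X p i k * Y p k j); last first.
  by apply/funext => p; rewrite mxE.
rewrite pd_sum; last by move=> p; exact: elementaryM.
by apply: eq_bigr => p _; rewrite !mxE pdM.
Qed.

Lemma dmxD k l a (X Y : 'rV[R]_n -> 'M[R]_(k, l)) q :
  elementary_mx X -> elementary_mx Y ->
  dmx a (fun p => X p + Y p) q = dmx a X q + dmx a Y q.
Proof.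
move=> EX EY; apply/matrixP => i j; rewrite !mxE.
rewrite -pdD//; try exact: EX; try exact: EY.
by congr ('D_ _ _ q); apply/funext => p; rewrite mxE.
Qed.

Lemma dmxN k l a (X : 'rV[R]_n -> 'M[R]_(k, l)) q :
  elementary_mx X -> dmx a (fun p => - X p) q = - dmx a X q.
Proof.
move=> EX; apply/matrixP => i j; rewrite !mxE.
rewrite -pdN; last exact: EX.
by congr ('D_ _ _ q); apply/funext => p; rewrite mxE.
Qed.

Lemma dmxT k l a (X : 'rV[R]_n -> 'M[R]_(k, l)) q :
  dmx a (fun p => (X p)^T) q = (dmx a X q)^T.
Proof.
apply/matrixP => i j; rewrite !mxE; congr ('D_ _ _ q).
by apply/funext => p; rewrite mxE.
Qed.

Lemma dmx_cst k l a (A : 'M[R]_(k, l)) q : dmx a (fun=> A) q = 0.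
Proof. by apply/matrixP => i j; rewrite !mxE pd_cst. Qed.

Lemma dmx_comm k l a b (X : 'rV[R]_n -> 'M[R]_(k, l)) q : elementary_mx X ->
  dmx a (dmx b X) q = dmx b (dmx a X) q.
Proof.
move=> EX; apply/matrixP => i j.
have e c d : dmx c (dmx d X) q i j = pd c (pd d (fun p => X p i j)) q.
  by rewrite mxE; congr ('D_ _ _ q); apply/funext => p; rewrite mxE.
by apply: etrans (e a b) (etrans _ (esym (e b a))); exact: pd_comm (EX i j).
Qed.

End Elementary.

Lemma entry_BDB (R : realType) k l (A B C E : 'M[R]_(k, l)) i j :
  (A - B + C - E) i j = A i j - B i j + C i j - E i j.
Proof. by rewrite !mxE. Qed.

(** * Levi-Civita connection and curvature as matrices *)

Section Connection.
Context {R : realType} {n : nat}.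
Variable (g : 'rV[R]_n -> 'M[R]_n).
Hypotheses (g_elem : elementary_mx g) (gV_elem : elementary_mx (fun q => invmx (g q))).
Hypotheses (g_sym : forall q, (g q)^T = g q) (g_unit : forall q, g q \in unitmx).

(* The connection matrices act on row vectors: nabla_a X = d_a X + X C_a. *)
Definition conn (a : 'I_n) (q : 'rV[R]_n) : 'M[R]_n :=
  \matrix_(j, k) christoffel g k a j q.

Lemma conn_elem a : elementary_mx (conn a).
Proof.
move=> j k; rewrite (_ : (fun q => _) = christoffel g k a j); last first.
  by apply/funext => q; rewrite mxE.
apply: elementaryM; first exact: elementary_cst.
apply: elementary_sum => l; apply: elementaryM; first exact: gV_elem.
by apply: elementaryD; [apply: elementaryD|apply: elementaryN]; exact: elementary_pd.
Qed.

Lemma g_symE q i j : g q i j = g q j i.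
Proof. by rewrite -{1}g_sym mxE. Qed.

(** Lowering the index removes the inverse metric and leaves the Christoffel symbols of the first
    kind; the verification of parallelism is carried out on these. *)
Lemma conn_lower a q : conn a q *m g q = \matrix_(j, l) (2^-1 *
  (pd a (fun p => g p l j) q + pd j (fun p => g p l a) q - pd l (fun p => g p a j) q)).
Proof.
rewrite (_ : conn a q = (\matrix_(j, l) (2^-1 *
  (pd a (fun p => g p l j) q + pd j (fun p => g p l a) q - pd l (fun p => g p a j) q)))
  *m invmx (g q)); first by rewrite -mulmxA mulVmx// mulmx1.
apply/matrixP => j k; rewrite !mxE /christoffel mulr_sumr; apply: eq_bigr => l _.
have gs : (invmx (g q))^T = invmx (g q) by rewrite trmx_inv g_sym.
have -> : invmx (g q) k l = invmx (g q) l k by rewrite -[in LHS]gs mxE.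
by rewrite mxE; ring.
Qed.

Lemma conn_symm a j k q : conn a q j k = conn j q a k.
Proof.
rewrite !mxE /christoffel; congr (_ * _); apply: eq_bigr => l _; congr (_ * _).
rewrite [X in X - _]addrC; congr (_ - _).
by congr ('D_ _ _ q); apply/funext => p; rewrite g_symE.
Qed.

Lemma metric_parallel a q : dmx a g q = conn a q *m g q + g q *m (conn a q)^T.
Proof.
have -> : g q *m (conn a q)^T = (conn a q *m g q)^T by rewrite trmx_mul g_sym.
rewrite conn_lower; apply/matrixP => j l; rewrite !mxE.
have e k l' m : pd m (fun p => g p k l') q = pd m (fun p => g p l' k) q.
  by congr ('D_ _ _ q); apply/funext => p; rewrite g_symE.
rewrite (e l j a) (e l a j) (e j a l).
by move: (pd a _ q) (pd j _ q) (pd l _ q) => x y z; lra.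
Qed.

(** Connection matrices multiply row vectors on the right, which is why the quadratic terms appear
    in the order [C_j C_i - C_i C_j]. *)
Definition curv (i j : 'I_n) (q : 'rV[R]_n) : 'M[R]_n :=
  dmx i (conn j) q - dmx j (conn i) q + conn j q *m conn i q - conn i q *m conn j q.

Lemma curvE i j q l k : curv i j q l k = riemann g k l i j q.
Proof.
rewrite /riemann /curv !mxE.
have e a b c : (fun p => conn a p b c) = christoffel g c a b.
  by apply/funext => p; rewrite mxE.
rewrite !e -addrA; congr (_ + _); rewrite -sumrB; apply: eq_bigr => p _.
by rewrite !mxE; ring.
Qed.

Lemma curv_skew i j q : curv i j q = - curv j i q.
Proof.
rewrite /curv; move: (dmx _ _ _) (dmx _ _ _) (_ *m _) (_ *m _) => A B C E.
by apply/matrixP => k l; rewrite !mxE; ring.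
Qed.

(* Stated for abstract arrays: rewriting with concrete curvature entries makes
   the unifier compare them by unfolding. *)
Lemma bianchi_array (c d P : 'I_n -> 'I_n -> 'I_n -> R) :
  (forall x y z, c x y z = d x y z - d y x z + P y x z - P x y z) ->
  (forall x y z, d x y z = d x z y) -> (forall x y z, P x y z = P z y x) ->
  forall i j l, c i j l + c j l i + c l i j = 0.
Proof.
move=> cE dS PS i j l.
rewrite !cE (dS i j l) (dS j i l) (dS l j i) (PS j i l) (PS i j l) (PS j l i).
ring.
Qed.

Lemma bianchi i j l k q : curv i j q l k + curv j l q i k + curv l i q j k = 0.
Proof.
apply: (@bianchi_array (fun x y z => curv x y q z k)
  (fun x y z => dmx x (conn y) q z k) (fun x y z => (conn x q *m conn y q) z k)).
- by move=> x y z; exact: entry_BDB.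
- by move=> x y z; rewrite [LHS]mxE [RHS]mxE; apply: pd_eq => p; exact: conn_symm.
- move=> x y z; rewrite [LHS]mxE [RHS]mxE; apply: eq_bigr => p _.
  by congr (_ * _); exact: conn_symm.
Qed.

(** The integrability condition of [dX = C X + X E], from the equality of mixed derivatives of [X].
    With [X] a parallel endomorphism and [E = - C] it says that the curvature commutes with [X];
    with [X = g] and [E = C^T], that the curvature is skew for g. *)
Lemma curv_commute (X : 'rV[R]_n -> 'M[R]_n) (EE : 'I_n -> 'rV[R]_n -> 'M[R]_n) i j q :
  elementary_mx X -> (forall a, elementary_mx (EE a)) ->
  (forall a q, dmx a X q = conn a q *m X q + X q *m EE a q) ->
  curv i j q *m X q
  + X q *m (dmx i (EE j) q - dmx j (EE i) q + EE i q *m EE j q - EE j q *m EE i q) = 0.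
Proof.
move=> eX eE h.
have dd a b : dmx a (dmx b X) q = dmx a (conn b) q *m X q
   + conn b q *m (conn a q *m X q + X q *m EE a q)
   + ((conn a q *m X q + X q *m EE a q) *m EE b q + X q *m dmx a (EE b) q).
  rewrite (_ : dmx b X = fun p => conn b p *m X p + X p *m EE b p); last first.
    by apply/funext => p; rewrite h.
  have ec := conn_elem b.
  rewrite dmxD; [|exact: elementary_mxM..].
  by rewrite !dmxM// h.
have := etrans (esym (dd i j)) (etrans (dmx_comm i j q eX) (dd j i)).
rewrite /curv {dd}; move: (dmx _ _ _) (dmx _ _ _) (dmx _ _ _) (dmx _ _ _).
move: (conn i q) (conn j q) (X q) (EE i q) (EE j q) => Ci Cj Y Ei Ej dC dE dC' dE'.
rewrite !(mulmxDl, mulmxDr, mulmxBl, mulmxBr, mulNmx, mulmxN) !mulmxA.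
move=> /eqP; rewrite -subr_eq0 => /eqP <-.
apply/matrixP => a b; rewrite !mxE; ring.
Qed.

End Connection.

(** * Conformal geodesics on a hyper-Kaehler 4-manifold *)

Section Curves.
Context {R : realType}.

Lemma is_derive_mxP k l (X : R -> 'M[R]_(k, l)) (t : R) (X' : 'M[R]_(k, l)) :
  is_derive t (1 : R) X X' <->
  forall i j, is_derive t (1 : R) (fun s => X s i j) (X' i j).
Proof.
split=> [[d e] i j|h].
  apply: DeriveDef; first by move/derivable_mxP : d.
  by rewrite -e derive_mx// mxE.
have d : derivable X t (1 : R) by apply/derivable_mxP => i j; have [] := h i j.
apply: DeriveDef => //; rewrite derive_mx//; apply/matrixP => i j; rewrite mxE.
by have [_ ->] := h i j.
Qed.

Lemma is_derive_sumr n (F : 'I_n -> R -> R) (F' : 'I_n -> R) (t : R) :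
  (forall i, is_derive t (1 : R) (F i) (F' i)) ->
  is_derive t (1 : R) (fun s => \sum_i F i s) (\sum_i F' i).
Proof.
move=> h; have : is_derive t (1 : R) (\sum_i F i) (\sum_i F' i).
  exact: is_derive_sum.
by rewrite (_ : \sum_i F i = fun s => \sum_i F i s)//; apply/funext => s; rewrite fct_sumE.
Qed.

Lemma is_deriveMr (f h : R -> R) (t f' h' : R) :
  is_derive t (1 : R) f f' -> is_derive t (1 : R) h h' ->
  is_derive t (1 : R) (fun s => f s * h s) (f' * h t + f t * h').
Proof.
move=> df dh; have -> : f' * h t + f t * h' = f t *: h' + h t *: f'.
  by rewrite /GRing.scale/= addrC (mulrC f').
exact: is_deriveM.
Qed.

Lemma is_derive_mulmx k l m (X : R -> 'M[R]_(k, l)) (Y : R -> 'M[R]_(l, m)) (t : R) X' Y' :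
  is_derive t (1 : R) X X' -> is_derive t (1 : R) Y Y' ->
  is_derive t (1 : R) (fun s => X s *m Y s) (X' *m Y t + X t *m Y').
Proof.
move=> /is_derive_mxP hX /is_derive_mxP hY; apply/is_derive_mxP => i j.
rewrite !mxE -big_split/=.
rewrite (_ : (fun s => _) = fun s => \sum_p X s i p * Y s p j); last first.
  by apply/funext => s; rewrite mxE.
by apply: is_derive_sumr => p; exact: is_deriveMr.
Qed.

Lemma is_deriveT k l (X : R -> 'M[R]_(k, l)) (t : R) X' :
  is_derive t (1 : R) X X' -> is_derive t (1 : R) (fun s => (X s)^T) (X'^T).
Proof.
move=> /is_derive_mxP hX; apply/is_derive_mxP => i j; rewrite mxE.
rewrite (_ : (fun s => _) = fun s => X s j i)//.
by apply/funext => s; rewrite mxE.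
Qed.

Lemma derive1P (V : normedModType R) (f : R -> V) (t : R) :
  derivable f t 1 -> is_derive t (1 : R) f (derive1 f t).
Proof. by move=> d; apply: DeriveDef => //; rewrite derive1E. Qed.

Lemma zero_derive_constant (J : set R) (f : R -> R) :
  open_interval J -> (forall t, J t -> is_derive t (1 : R) f 0) ->
  forall s t, J s -> J t -> f s = f t.
Proof.
move=> [oJ iJ] df.
have lt s t : s < t -> J s -> J t -> f s = f t.
  move=> st Js Jt.
  have sJ x : x \in `[s, t] -> J x.
    by rewrite in_itv/= => /andP[sx xt]; apply: (iJ s t) => //; rewrite sx xt.
  have hd x : x \in `]s, t[ -> is_derive x (1 : R) f ((fun=> 0) x).
    by move=> /subset_itv_oo_cc/sJ; exact: df.
  have cf : {within `[s, t], continuous f}.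
    apply: derivable_within_continuous => x /sJ/df[d _]; exact: d.
  have [x _ /eqP] := MVT st hd cf.
  by rewrite mul0r subr_eq0 => /eqP.
move=> s t Js Jt; case: (ltgtP s t) => [h|h|->//]; first exact: lt.
by apply/esym/lt.
Qed.

Lemma Ck_on_curve k (J : set R) n (gamma : R -> 'rV[R]_n) : open J ->
  Ck_on k.+1 J gamma ->
  Ck_on k J (derive1 gamma) /\ forall t, J t -> is_derive t (1 : R) gamma (derive1 gamma t).
Proof.
move=> oJ [_ /(_ 1)[d c]]; split; last by move=> t /d/derive1P.
by apply: Ck_on_eq c => // t _; rewrite derive1E.
Qed.

Lemma curve_dmx n k l (M : 'rV[R]_n -> 'M[R]_(k, l)) (gamma : R -> 'rV[R]_n) (t : R) u :
  elementary_mx M -> is_derive t (1 : R) gamma u ->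
  is_derive t (1 : R) (fun s => M (gamma s)) (\sum_a u 0 a *: dmx a M (gamma t)).
Proof.
move=> eM dg; apply/is_derive_mxP => i j.
have := elementary_curve (eM i j) dg.
rewrite (_ : \sum_i0 _ = (\sum_a u 0 a *: dmx a M (gamma t)) i j)//.
by rewrite summxE; apply: eq_bigr => a _; rewrite !mxE.
Qed.

Lemma cov_deriv_conn n (g : 'rV[R]_n -> 'M[R]_n) (gamma X : R -> 'rV[R]_n) t :
  cov_deriv g gamma X t
  = derive1 X t + X t *m (\sum_a derive1 gamma t 0 a *: conn g a (gamma t)).
Proof.
congr (_ + _); apply/rowP => k; rewrite !mxE exchange_big; apply: eq_bigr => j _.
rewrite mulrC summxE mulr_suml; apply: eq_bigr => i _ /=.
by rewrite !mxE; ring.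
Qed.

End Curves.

Section Hyperkahler.
Context {R : realType}.
Local Notation n := 4%N.
Variable (g : 'rV[R]_n -> 'M[R]_n).
Hypotheses (g_elem : elementary_mx g) (gV_elem : elementary_mx (fun q => invmx (g q))).
Hypotheses (g_sym : forall q, (g q)^T = g q) (g_unit : forall q, g q \in unitmx).
Variables (Om : 'I_3 -> 'rV[R]_n -> 'M[R]_n) (s : R).
Hypotheses (Om_elem : forall i, elementary_mx (Om i))
  (Om_skew : forall i q, (Om i q)^T = - Om i q)
  (Om_par : forall i a q,
     dmx a (Om i) q = conn g a q *m Om i q + Om i q *m (conn g a q)^T).
Variable A : 'I_3 -> 'rV[R]_n -> 'M[R]_n.
Hypotheses (AE : forall i q, A i q = - (Om i q *m invmx (g q)))
  (A_sq : forall i q, A i q *m A i q = - 1%:M)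
  (A_anti : forall i j q, i != j -> A i q *m A j q = - (A j q *m A i q))
  (A_prod : forall q, A 0 q *m A 1 q = s *: A 2 q) (s0 : s != 0).

Let Ag i q : A i q *m g q = - Om i q.
Proof. by rewrite AE mulNmx -mulmxA mulVmx// mulmx1. Qed.

Let gVs q : (invmx (g q))^T = invmx (g q).
Proof. by rewrite trmx_inv g_sym. Qed.

Let A_elem i : elementary_mx (A i).
Proof. by rewrite (funext (AE i)); apply: elementary_mxN; apply: elementary_mxM. Qed.

(** Differentiate [A g = - Om] and use that g and [Om] are parallel; the terms with the transposed
    connection cancel. *)
Lemma endo_parallel i a q : dmx a (A i) q = conn g a q *m A i q - A i q *m conn g a q.
Proof.
have e : dmx a (A i) q *m g q + A i q *m dmx a g q = - dmx a (Om i) q.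
  rewrite -dmxM// -dmxN//; congr (dmx a _ q); apply/funext => p; exact: Ag.
rewrite (metric_parallel g_sym g_unit) Om_par mulmxDr [A i q *m (g q *m _)]mulmxA Ag in e.
have : dmx a (A i) q *m g q = (conn g a q *m A i q - A i q *m conn g a q) *m g q.
  rewrite mulmxBl -!(mulmxA _ _ (g q)) Ag mulmxN.
  move: e; move: (dmx a _ q *m _) (A i q *m _) (conn g a q *m Om i q) => U V W.
  rewrite mulNmx opprD addrA => /(canRL (addrK _)) /(canRL (addrK _)) ->.
  by rewrite opprK addrNK.
move=> h; rewrite -[LHS]mulmx1 -(mulmxV (g_unit q)) mulmxA h -mulmxA mulmxV//.
by rewrite mulmx1.
Qed.

Lemma curv_endo i a b q : curv g a b q *m A i q = A i q *m curv g a b q.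
Proof.
have eC c : elementary_mx (fun q => - conn g c q).
  by apply: elementary_mxN; exact: conn_elem.
have par c p : dmx c (A i) p = conn g c p *m A i p + A i p *m - conn g c p.
  by rewrite endo_parallel mulmxN.
have := curv_commute g_elem gV_elem a b q (A_elem i) eC par.
have ec c := conn_elem g_elem gV_elem c.
rewrite !dmxN// => /eqP; rewrite addr_eq0 -mulmxN => /eqP ->; congr (_ *m _).
rewrite /curv !(mulNmx, mulmxN) !opprK.
move: (dmx _ _ _) (dmx _ _ _) (_ *m _) (_ *m _) => U V W X.
by apply/matrixP => k l; rewrite !mxE; ring.
Qed.

(** The curvature is skew with respect to g, so its trace equals its own negative. *)
Lemma tr_curv a b q : \tr (curv g a b q) = 0.
Proof.
have eC c : elementary_mx (fun q => (conn g c q)^T).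
  by apply: elementary_mxT; exact: conn_elem.
have := curv_commute g_elem gV_elem a b q g_elem eC (metric_parallel g_sym g_unit).
rewrite !dmxT -!trmx_mul -!linearB/= -linearD/= -linearB/= -/(curv g a b q).
move=> /eqP; rewrite addr_eq0 => /eqP e.
have : \tr (curv g a b q *m g q *m invmx (g q)) = - \tr (curv g a b q).
  rewrite e mulNmx linearN/= -mulmxA mxtrace_mulC -mulmxA mulVmx// mulmx1.
  by rewrite mxtrace_tr.
rewrite -mulmxA mulmxV// mulmx1; lra.
Qed.

(** For [j] different from [i], the curvature commutes with [A_j] while [A_i] anticommutes with it,
    so conjugation by [A_j] reverses the sign of the trace. In other words, the curvature has no
    component along the forms [Om i]. *)
Let tr_Acurv i a b q : \tr (A i q *m curv g a b q) = 0.
Proof.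
have [j ij] : exists j : 'I_3, i != j.
  by exists (if i == 0 then 1 else 0); case: i => [[|[|[|//]]] Hi].
have : \tr (A i q *m curv g a b q *m A j q *m A j q)
     = - \tr (A i q *m curv g a b q *m A j q *m A j q).
  rewrite [LHS]mxtrace_mulC !mulmxA A_anti; last by rewrite eq_sym.
  rewrite !mulNmx linearN/=; congr (- \tr (_ *m _)).
  by rewrite -!mulmxA; congr (_ *m _); rewrite -curv_endo.
by rewrite -mulmxA A_sq mulmxN mulmx1 linearN/=; lra.
Qed.

Let bianchi2 x y l k q :
  curv g l x q y k - curv g l y q x k = curv g y x q l k.
Proof.
have real (a b c d : R) : a + b + c = 0 -> c = - d -> d - a = b by lra.
have sk := congr1 (fun M : 'M[R]_n => M y k) (curv_skew g x l q).
exact: real (bianchi g_sym l y x k q) (etrans sk (oppmxE _ _ _)).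
Qed.

Let ric q : 'M[R]_n := \matrix_(l, j) \sum_i curv g i j q l i.

Let A_ricE i q x y : (A i q *m ric q) x y = \sum_l \sum_k curv g l y q x k * A i q k l.
Proof.
rewrite mxE; under eq_bigr do rewrite mxE mulr_sumr.
rewrite exchange_big; apply: eq_bigr => l _.
transitivity ((A i q *m curv g l y q) x l); first by rewrite mxE.
by rewrite -curv_endo mxE.
Qed.

(** By the first Bianchi identity the skew part of [A_i Ric] contracts to the trace of the curvature
    against [A_i], which is zero. *)
Let A_ric_sym i q : (A i q *m ric q)^T = A i q *m ric q.
Proof.
apply/matrixP => x y; rewrite mxE; apply/eqP; rewrite -subr_eq0 !A_ricE -sumrB.
apply/eqP; transitivity (\tr (curv g y x q *m A i q)); last first.
  by rewrite mxtrace_mulC tr_Acurv.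
apply: eq_bigr => l _; rewrite mxE -sumrB; apply: eq_bigr => k _.
by rewrite -mulrBl; congr (_ * _); exact: bianchi2.
Qed.

Let ric_sym q : (ric q)^T = ric q.
Proof.
apply/matrixP => x y; rewrite mxE; apply/eqP; rewrite -subr_eq0.
rewrite [ric q y x]mxE [ric q x y]mxE -sumrB.
apply/eqP; transitivity (\tr (curv g y x q)); last exact: tr_curv.
by apply: eq_bigr => l _; exact: bianchi2.
Qed.

(* Ric g^-1 anticommutes with each A_i, hence commutes with A_0 A_1 = s A_2
   and also anticommutes with it. *)
Lemma ricci_flat q : ricci g q = 0.
Proof.
have -> : ricci g q = ric q.
  apply/matrixP => x y; rewrite [LHS]mxE [RHS]mxE; apply: eq_bigr => i _.
  exact/esym/curvE.
have [T TE] : exists T, T = ric q *m invmx (g q) by eexists.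
have AT i : A i q *m T = - (T *m A i q).
  have tA : (A i q)^T *m invmx (g q) = - (invmx (g q) *m A i q).
    by rewrite AE linearN/= trmx_mul gVs Om_skew !mulmxN !opprK mulmxA.
  by rewrite TE mulmxA -A_ric_sym trmx_mul ric_sym -[LHS]mulmxA tA mulmxN mulmxA.
have h : A 0 q *m A 1 q *m T = T *m (A 0 q *m A 1 q).
  by rewrite -mulmxA AT mulmxN [A 0 q *m (_ *m _)]mulmxA AT mulNmx opprK mulmxA.
have T2 : T *m A 2 q = 0.
  move: h; rewrite A_prod -scalemxAl -scalemxAr => /(scalerI s0).
  rewrite AT => /eqP; rewrite eq_sym -addr_eq0 => /eqP e.
  move: (T *m A 2 q) e => X e.
  apply/matrixP => i j; have := congr1 (fun M : 'M[R]_n => M i j) e.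
  by rewrite !mxE; lra.
have : T *m A 2 q *m A 2 q *m g q = 0 by rewrite T2 !mul0mx.
rewrite -(mulmxA T) A_sq mulmxN mulmx1 mulNmx TE -mulmxA mulVmx// mulmx1.
by move/eqP; rewrite oppr_eq0 => /eqP.
Qed.

Lemma schouten_flat q : schouten g q = 0.
Proof.
rewrite /schouten ricci_flat /scalar_curvature.
rewrite big1 ?mul0r ?scale0r ?subr0 ?scaler0// => i _.
by rewrite big1// => j _; rewrite ricci_flat mxE mulr0.
Qed.

Section curve.
Variables (J : set R) (gamma : R -> 'rV[R]_n).
Hypotheses (oJ : open_interval J).
Local Notation u := (derive1 gamma).
Let C t := \sum_a u t 0 a *: conn g a (gamma t).

Lemma cov_derivE X t : cov_deriv g gamma X t = derive1 X t + X t *m C t.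
Proof. exact: cov_deriv_conn. Qed.

(** The Leibniz rule for a bilinear form along the curve; a parallel form contributes no derivative
    of its own. It is applied to g and to the [Om i]. *)
Lemma curve_form (M : 'rV[R]_n -> 'M[R]_n) X Y t : elementary_mx M ->
  (forall a q, dmx a M q = conn g a q *m M q + M q *m (conn g a q)^T) ->
  is_derive t (1 : R) gamma (u t) ->
  is_derive t (1 : R) X (derive1 X t) -> is_derive t (1 : R) Y (derive1 Y t) ->
  is_derive t (1 : R) (fun s => (X s *m M (gamma s) *m (Y s)^T) 0 0)
    ((cov_deriv g gamma X t *m M (gamma t) *m (Y t)^T) 0 0
     + (X t *m M (gamma t) *m (cov_deriv g gamma Y t)^T) 0 0).
Proof.
move=> eM pM dg dX dY; have dM := curve_dmx eM dg.
have := (is_derive_mxP _ _ _).1 (is_derive_mulmx (is_derive_mulmx dX dM) (is_deriveT dY)) 0 0.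
have e : \sum_a u t 0 a *: dmx a M (gamma t) =
    C t *m M (gamma t) + M (gamma t) *m (C t)^T.
  rewrite /C mulmx_suml linear_sum/= mulmx_sumr -big_split; apply: eq_bigr => a _ /=.
  by rewrite pM scalerDr linearZ/= -scalemxAl -scalemxAr.
rewrite e; congr is_derive; rewrite -addmxE; congr (fun_of_matrix _ 0 0).
rewrite !cov_derivE [(_ + _)^T]linearD/= trmx_mul !mulmxDl !mulmxDr !mulmxDl !mulmxA.
by rewrite -!addrA; congr (_ + (_ + _)); exact: addrC.
Qed.

Lemma curve_endo i t : is_derive t (1 : R) gamma (u t) ->
  is_derive t (1 : R) (fun s => A i (gamma s)) (C t *m A i (gamma t) - A i (gamma t) *m C t).
Proof.
move=> dg; have := curve_dmx (A_elem i) dg; congr is_derive.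
rewrite /C mulmx_suml mulmx_sumr -sumrB; apply: eq_bigr => a _.
by rewrite endo_parallel scalerBr -scalemxAl -scalemxAr.
Qed.

Hypothesis (Cg : Ck_on 3 J gamma).

Let du t : J t -> is_derive t (1 : R) gamma (u t).
Proof. by move=> Jt; exact: (Ck_on_curve oJ.1 Cg).2. Qed.

Let ddu t : J t -> is_derive t (1 : R) u (derive1 u t).
Proof.
move=> Jt; have C2 := (Ck_on_curve oJ.1 Cg).1.
by exact: (Ck_on_curve oJ.1 C2).2.
Qed.

Let dddu t : J t -> is_derive t (1 : R) (derive1 u) (derive1 (derive1 u) t).
Proof.
move=> Jt; have C2 := (Ck_on_curve oJ.1 Cg).1.
have C1 := (Ck_on_curve oJ.1 C2).1.
by exact: (Ck_on_curve oJ.1 C1).2.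
Qed.

Let dC t : J t -> exists C', is_derive t (1 : R) C C'.
Proof.
move=> Jt; pose C' := \matrix_(i, j) \sum_a (derive1 u t 0 a * conn g a (gamma t) i j
   + u t 0 a * \sum_b u t 0 b * pd b (fun q => conn g a q i j) (gamma t)).
exists C'; apply/is_derive_mxP => i j; rewrite mxE.
rewrite (_ : (fun s => C s i j) = (fun s => \sum_a u s 0 a * conn g a (gamma s) i j)).
  apply: is_derive_sumr => a; apply: is_deriveMr; first exact: is_derive_coord (ddu Jt).
  exact: (elementary_curve (conn_elem g_elem gV_elem a i j) (du Jt)).
by apply/funext => x; rewrite /C summxE; apply: eq_bigr => a _; rewrite mxE.
Qed.

Local Notation acc := (acceleration g gamma).

Let accE t : acc t = derive1 u t + u t *m C t.
Proof. exact: cov_derivE. Qed.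

Lemma acceleration_derivable t : J t -> is_derive t (1 : R) acc (derive1 acc t).
Proof.
move=> Jt; have [C' hC] := dC Jt; apply: derive1P.
rewrite (funext accE); have [d _] := is_deriveD (dddu Jt) (is_derive_mulmx (ddu Jt) hC).
exact: d.
Qed.

Hypothesis unit_u : forall t, J t -> inner g (gamma t) (u t) (u t) = 1.

Lemma inner_sym q X Y : inner g q X Y = inner g q Y X.
Proof.
by rewrite /inner -[in LHS](trmxK X) -[in LHS](g_sym q) -!trmx_mul mxE mulmxA.
Qed.

Let locally_constant (f : R -> R) c (t l : R) :
  (forall t, J t -> f t = c) -> J t -> is_derive t (1 : R) f l -> l = 0.
Proof.
move=> fc Jt [_ <-].
have [-> _] := eq_on_derive oJ.1 (h := cst c) fc 1 Jt.
exact: derive_cst.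
Qed.

Lemma acceleration_orthogonal t : J t -> inner g (gamma t) (u t) (acc t) = 0.
Proof.
move=> Jt; have h := curve_form g_elem (metric_parallel g_sym g_unit) (du Jt) (ddu Jt) (ddu Jt).
have := locally_constant (c := 1) unit_u Jt h.
rewrite -![(_ *m _ *m _) 0 0]/(inner _ _ _ _) -/(acceleration g gamma t) inner_sym.
lra.
Qed.

Variable F : 'rV[R]_3 -> 'rV[R]_n -> 'M[R]_n.
Hypothesis FE : forall c q, F c q = \sum_i c 0 i *: Om i q.

Let Ac (c : 'rV[R]_3) q : 'M[R]_n := \sum_i c 0 i *: A i q.

Let sharpF e c q v : e *: sharp g q (v *m (F c q)^T) = e *: (v *m Ac c q).
Proof.
congr (_ *: _); rewrite /sharp FE /Ac -mulmxA; congr (_ *m _).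
rewrite linear_sum/= mulmx_suml; apply: eq_bigr => i _.
by rewrite linearZ/= -scalemxAl Om_skew AE mulNmx.
Qed.

Let Ac_sq (c : 'rV[R]_3) q : \sum_i c 0 i ^+ 2 = 1 -> Ac c q *m Ac c q = - 1%:M.
Proof.
move=> c1.
have a10 : A 1 q *m A 0 q = - (A 0 q *m A 1 q) by rewrite A_anti.
have a20 : A 2 q *m A 0 q = - (A 0 q *m A 2 q) by rewrite A_anti.
have a21 : A 2 q *m A 1 q = - (A 1 q *m A 2 q) by rewrite A_anti.
have S3 (V : zmodType) (f : 'I_3 -> V) : \sum_i f i = f 0 + f 1 + f 2.
  rewrite !big_ord_recl big_ord0 addr0 addrA.
  by congr (_ + f _ + f _); apply/val_inj.
move: c1; rewrite /Ac !S3 => c1.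
rewrite !mulmxDl !mulmxDr -!scalemxAl -!scalemxAr !A_sq a10 a20 a21.
move: (A 0 q *m _) (A 0 q *m _) (A 1 q *m _) => X Y Z.
apply/matrixP => i j; rewrite !mxE; move: (X i j) (Y i j) (Z i j) ((i == j)%:R : R) => x y z d.
transitivity (- ((c 0 0 ^+ 2 + c 0 1 ^+ 2 + c 0 2 ^+ 2) * d)); first by ring.
by rewrite c1 mul1r.
Qed.

Let A_g i q X Y : inner g q X (Y *m A i q) = (X *m Om i q *m Y^T) 0 0.
Proof.
rewrite /inner trmx_mul !mulmxA -(mulmxA X).
by rewrite -[g q *m _]trmxK trmx_mul trmxK g_sym Ag linearN/= Om_skew opprK.
Qed.

Let skew0 i q (X : 'rV[R]_n) : (X *m Om i q *m X^T) 0 0 = 0.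
Proof.
have e : (X *m Om i q *m X^T)^T = - (X *m Om i q *m X^T).
  by rewrite !trmx_mul trmxK Om_skew mulNmx mulmxN mulmxA.
have := congr1 (fun M : 'M[R]_1 => M 0 0) e; rewrite [LHS]mxE [RHS]mxE; lra.
Qed.

Let A_A i j q X : inner g q (X *m A i q) (X *m A j q) = - inner g q (X *m A i q *m A j q) X.
Proof.
by rewrite A_g /inner -[in RHS](mulmxA _ (A j q)) Ag mulmxN mulNmx [in RHS]mxE opprK.
Qed.

(** The vectors [U] and [U *m A i q] are orthonormal, because the [A i] are anticommuting skew
    isometries of square -1. The coefficients then follow by inverting [M g M^T = 1] from the other
    side. *)
Let frame_expansion q (U v : 'rV[R]_n) : inner g q U U = 1 ->
  v = inner g q v U *: U + \sum_i (v *m Om i q *m U^T) 0 0 *: (U *m A i q).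
Proof.
move=> U1.
have d i : inner g q (U *m A i q) (U *m A i q) = 1.
  by rewrite A_A -mulmxA A_sq mulmxN mulmx1 /inner !mulNmx mxE opprK.
have o i j : i != j -> inner g q (U *m A i q) (U *m A j q) = 0.
  move=> ij; have h : inner g q (U *m A i q) (U *m A j q) = - inner g q (U *m A j q) (U *m A i q).
    by rewrite !A_A -!mulmxA A_anti// mulmxN /inner !mulNmx mxE.
  by move: h; rewrite [inner g q (U *m A j q) _]inner_sym; lra.
have z i : inner g q U (U *m A i q) = 0 by rewrite A_g skew0.
have z' i : inner g q (U *m A i q) U = 0 by rewrite inner_sym z.
pose M : 'M[R]_n := \matrix_(k < 4)
  nth 0 [:: U; U *m A 0 q; U *m A 1 q; U *m A 2 q] k.
have ME (X : 'rV[R]_n) k : (X *m (g q *m M^T)) 0 k = inner g q X (row k M).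
  by rewrite mulmxA /inner !mxE; apply: eq_bigr => l _; rewrite !mxE.
have MM : M *m (g q *m M^T) = 1%:M.
  apply/row_matrixP => i; rewrite row_mul; apply/rowP => j; rewrite ME !rowK row1.
  rewrite [RHS]mxE /=.
  by case: i => [[|[|[|[|//]]]] Hi]; case: j => [[|[|[|[|//]]]] Hj];
    rewrite /= ?U1 ?z ?z' ?d ?o.
have {1}-> : v = v *m (g q *m M^T) *m M.
  by rewrite -mulmxA (mulmx1C MM) mulmx1.
rewrite mulmx_sum_row [in LHS]big_ord_recl ME rowK; congr (_ + _).
apply: eq_bigr => i _; rewrite ME rowK -A_g.
by case: i => [[|[|[|//]]] Hi] /=; congr (inner _ _ _ (_ *m A _ _) *: (_ *m A _ _)); apply/val_inj.
Qed.

Let Acg c q : Ac c q *m g q = - F c q.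
Proof.
rewrite /Ac FE mulmx_suml -sumrN; apply: eq_bigr => i _.
by rewrite -scalemxAl Ag scalerN.
Qed.

Let F_skew c q : (F c q)^T = - F c q.
Proof.
rewrite FE linear_sum/= -sumrN; apply: eq_bigr => i _.
by rewrite linearZ/= Om_skew scalerN.
Qed.

Lemma magnetic_acceleration e (c : 'rV[R]_3) : \sum_i c 0 i ^+ 2 = 1 ->
  magnetic_geodesic g (F c) e J gamma ->
  forall t, J t -> inner g (gamma t) (acc t) (acc t) = e ^+ 2.
Proof.
move=> c1 mg t Jt; rewrite mg// sharpF; have := unit_u Jt.
set U := u t; set q := gamma t => U1.
have h X Y : inner g q (X *m Ac c q) Y = - inner g q X (Y *m Ac c q).
  have e1 : g q *m (Ac c q)^T = F c q.
    by rewrite -[LHS]trmxK trmx_mul trmxK g_sym Acg linearN/= F_skew opprK.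
  by rewrite /inner trmx_mul !mulmxA -(mulmxA X _ (_^T)) e1 -(mulmxA X) Acg mulmxN mulNmx mxE.
have -> : inner g q (e *: (U *m Ac c q)) (e *: (U *m Ac c q))
   = e ^+ 2 * inner g q (U *m Ac c q) (U *m Ac c q).
  by rewrite /inner linearZ/= -!scalemxAl -scalemxAr scalerA [LHS]mxE -expr2.
rewrite h -mulmxA Ac_sq// mulmxN mulmx1.
have -> : inner g q U (- U) = - inner g q U U.
  by rewrite /inner linearN/= mulmxN mxE.
by rewrite opprK U1 mulr1.
Qed.

Let curve_Ac (c : 'rV[R]_3) t : J t -> is_derive t (1 : R) (fun x => Ac c (gamma x))
  (C t *m Ac c (gamma t) - Ac c (gamma t) *m C t).
Proof.
move=> Jt; pose f (i : 'I_3) x := c 0 i *: A i (gamma x).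
have df i : is_derive t (1 : R) (f i) (c 0 i *: (C t *m A i (gamma t) - A i (gamma t) *m C t)).
  by apply: is_deriveZ; exact: curve_endo (du Jt).
have : is_derive t (1 : R) (\sum_i f i)
  (\sum_i c 0 i *: (C t *m A i (gamma t) - A i (gamma t) *m C t)).
  exact: is_derive_sum.
have -> : \sum_i f i = fun x => Ac c (gamma x).
  by apply/funext => x; rewrite fct_sumE.
congr is_derive; rewrite /Ac; move: (C t) => Ct.
rewrite mulmx_suml mulmx_sumr -sumrB; apply: eq_bigr => i _.
by rewrite scalerBr -scalemxAl -scalemxAr.
Qed.

Let derive1_eq_on (V : normedModType R) (f h : R -> V) t l : J t ->
  (forall x, J x -> f x = h x) -> is_derive t (1 : R) h l -> derive1 f t = l.
Proof.
move=> Jt e [_ <-]; rewrite derive1E.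
by have [-> _] := eq_on_derive oJ.1 e 1 Jt.
Qed.

(** The structure [Ac c] is parallel with square -1, so a = e u [Ac] gives nabla_u a = e a [Ac] = -
    e^2 u, and e^2 = |a|^2. *)
Lemma magnetic_conformal e (c : 'rV[R]_3) : \sum_i c 0 i ^+ 2 = 1 ->
  magnetic_geodesic g (F c) e J gamma -> conformal_geodesic g J gamma.
Proof.
move=> c1 mg t Jt /=.
rewrite (magnetic_acceleration c1 mg Jt) /inner /sharp schouten_flat.
have z : (0 : 'M[R]_1) 0 0 = 0 by rewrite mxE.
rewrite mulmx0 !mul0mx z !addr0 cov_derivE.
have accA x : J x -> acc x = e *: (u x *m Ac c (gamma x)).
  by move=> Jx; rewrite mg// sharpF.
have dd : is_derive t (1 : R) (fun x => e *: (u x *m Ac c (gamma x)))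
    (e *: (derive1 u t *m Ac c (gamma t)
           + u t *m (C t *m Ac c (gamma t) - Ac c (gamma t) *m C t))).
  have h := is_derive_mulmx (ddu Jt) (curve_Ac c Jt); exact: is_deriveZ.
rewrite (derive1_eq_on Jt accA dd) accA//.
transitivity (e *: ((derive1 u t + u t *m C t) *m Ac c (gamma t))).
  rewrite -scalemxAl -scalerDr; congr (_ *: _).
  by rewrite mulmxDl mulmxBr !mulmxA -addrA addrNK.
rewrite -accE accA// -scalemxAl -mulmxA Ac_sq// mulmxN mulmx1 scalerA.
by rewrite scalerN -expr2 scaleNr.
Qed.

Lemma conformal_magnetic : conformal_geodesic g J gamma ->
  exists e (c : 'rV[R]_3), [/\ 0 <= e, \sum_i c 0 i ^+ 2 = 1 &
    magnetic_geodesic g (F c) e J gamma].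
Proof.
(* The constants are read off at a time [t0]; on an empty interval any e and c will do. *)
move=> cg; have [[t0 Jt0]|J0] := pselect (exists t0, J t0); last first.
  exists 0, (delta_mx 0 0); split=> // [|t Jt]; last by case: J0; exists t.
  by rewrite !big_ord_recl big_ord0 !mxE /=; ring.
(* These are the components of the acceleration on the vectors [u *m A i]. The derivative of [b i]
   is [Om i] evaluated on (nabla_u a, u) plus on (a, a); both vanish by skewness, since nabla_u a is
   a multiple of u once the Schouten tensor is zero. *)
pose b i t := (acc t *m Om i (gamma t) *m (u t)^T) 0 0.
have bc i s' t : J s' -> J t -> b i s' = b i t.
  apply: (zero_derive_constant oJ) => x Jx.
  have := curve_form (Om_elem i) (Om_par i) (du Jx) (acceleration_derivable Jx) (ddu Jx).
  congr is_derive; rewrite -/(acceleration g gamma x) skew0 addr0 cg//.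
  rewrite /sharp schouten_flat mulmx0 mul0mx addr0 -!scalemxAl mxE skew0 mulr0 //.
have accE2 t : J t -> acc t = \sum_i b i t *: (u t *m A i (gamma t)).
  move=> Jt; rewrite {1}(frame_expansion (acc t) (unit_u Jt)) inner_sym.
  by rewrite acceleration_orthogonal// scale0r add0r.
pose e := Num.sqrt (\sum_i b i t0 ^+ 2).
have b2 : 0 <= \sum_i b i t0 ^+ 2 by apply: sumr_ge0 => i _; exact: sqr_ge0.
have e2 : e ^+ 2 = \sum_i b i t0 ^+ 2 by rewrite sqr_sqrtr.
pose c : 'rV[R]_3 := if e == 0 then delta_mx 0 0 else \row_i (b i t0 / e).
have ec i : e * c 0 i = b i t0.
  rewrite /c; case: eqP => [e0|/eqP e0]; last by rewrite mxE mulrC divfK.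
  rewrite e0 mul0r; have := e2; rewrite e0 expr0n/= => /esym/eqP.
  rewrite psumr_eq0; last by move=> j _; exact: sqr_ge0.
  by move=> /allP/(_ i (mem_index_enum i)); rewrite sqrf_eq0 => /eqP.
exists e, c; split.
- exact: sqrtr_ge0.
- rewrite /c; case: eqP => [e0|/eqP e0]; first by rewrite !big_ord_recl big_ord0 !mxE /=; ring.
  under eq_bigr do rewrite mxE expr_div_n.
  by rewrite -mulr_suml -e2 divff// expf_neq0.
- move=> t Jt; rewrite sharpF accE2// /Ac mulmx_sumr scaler_sumr; apply: eq_bigr => i _.
  by rewrite -scalemxAr scalerA ec (bc i _ _ Jt Jt0).
Qed.

End curve.
End Hyperkahler.

(** * The hyper-Kaehler structure of Taub-NUT *)

Lemma ord3_ind (P : 'I_3 -> Prop) : P 0 -> P 1 -> P 2 -> forall i, P i.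
Proof.
move=> p0 p1 p2 [[|[|[|//]]] Hi].
- by rewrite (_ : Ordinal Hi = 0)//; exact/val_inj.
- by rewrite (_ : Ordinal Hi = 1)//; exact/val_inj.
- by rewrite (_ : Ordinal Hi = 2)//; exact/val_inj.
Qed.

Section ModelInstance.
Context {R : realType}.
Variable (kappa : R).
Hypothesis k0 : 0 <= kappa.
Implicit Types q : 'rV[R]_4.
Local Notation J4 := (@J4 R).
Local Notation S4 := (@S4 R).
Local Notation g := (gmod kappa J4).
Local Notation Om := (fun i => Fmod kappa J4 (S4 i)).
Local Notation w := (wfun kappa).

Lemma w_neq0 q : w q != 0.
Proof. by rewrite gt_eqF// wfun_gt0. Qed.

Lemma J4_orth : J4 *m J4^T = 1%:M.
Proof. by rewrite trJ4 mulmxN JJ4 opprK. Qed.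

Lemma gmod_elementary : elementary_mx g.
Proof. by move=> i j; exists (gE kappa i j) => q; split; [exact: valid_gE|rewrite interp_gE]. Qed.

Lemma gmodV_elementary : elementary_mx (fun q => invmx (g q)).
Proof.
move=> i j; exists (gVE kappa i j) => q; split; first exact: valid_gVE.
by rewrite interp_gVE (gmod_unit q J4_orth k0).2.
Qed.

Lemma Fmod_elementary i : elementary_mx (Om i).
Proof. by move=> k l; exists (FE kappa i k l) => q; split; [exact: valid_FE|rewrite interp_FE]. Qed.

Lemma gmod_symm q : (g q)^T = g q.
Proof.
apply/matrixP => i j; rewrite mxE -!interp_gE /=.
by rewrite /deltaE /= eq_sym (mulrC (interp _ (AE i))).
Qed.

Lemma Fmod_skew i q : (Om i q)^T = - Om i q.
Proof.
apply/matrixP => k l; rewrite mxE oppmxE -!interp_FE.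
case: i => [[|[|[|//]]] Hi]; case: k => [[|[|[|[|//]]]] Hk];
  case: l => [[|[|[|[|//]]]] Hl] /=; ring.
Qed.

(** The closed form of [- Om g^-1], polynomial in [q] except for one factor 1/w; it is recognised
    through [endo_g], without inverting the metric. *)
Definition endo (i : 'I_3) q : 'M[R]_4 :=
  - (J4 *m S4 i + (kappa / w q) *: ((q *m J4)^T *m (q *m S4 i))
     + kappa *: ((q *m S4 i)^T *m (q *m J4))).

(** Entries of [q *m J4], [q *m S4 i] and of the constant matrices, as tables indexed by naturals:
    after a case split on the indices the entrywise identities compute and are left to [field]. *)
Definition av q (k : nat) : R := [:: - rval q 1; rval q 0; - rval q 3; rval q 2]`_k.
Definition sv q (i k : nat) : R := (nth [::]
  [:: [:: rval q 2; rval q 3; rval q 0; rval q 1];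
      [:: - rval q 3; rval q 2; rval q 1; - rval q 0];
      [:: rval q 0; rval q 1; - rval q 2; - rval q 3]] i)`_k.
Definition Kv (i k l : nat) : R := nth 0 (nth [::] (nth [::]
  [:: [:: [:: 0; 0; 0; 1]; [:: 0; 0; -1; 0]; [:: 0; 1; 0; 0]; [:: -1; 0; 0; 0]];
      [:: [:: 0; 0; 1; 0]; [:: 0; 0; 0; 1]; [:: -1; 0; 0; 0]; [:: 0; -1; 0; 0]];
      [:: [:: 0; 1; 0; 0]; [:: -1; 0; 0; 0]; [:: 0; 0; 0; -1]; [:: 0; 0; 1; 0]]] i) k) l.
Definition Jv (k l : nat) : R := (nth [::]
  [:: [:: 0; 1; 0; 0]; [:: -1; 0; 0; 0]; [:: 0; 0; 0; 1]; [:: 0; 0; -1; 0]] k)`_l.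
Definition Sv (i k l : nat) : R := (nth [::] (nth [::]
  [:: [:: [:: 0; 0; 1; 0]; [:: 0; 0; 0; 1]; [:: 1; 0; 0; 0]; [:: 0; 1; 0; 0]];
      [:: [:: 0; 0; 0; -1]; [:: 0; 0; 1; 0]; [:: 0; 1; 0; 0]; [:: -1; 0; 0; 0]];
      [:: [:: 1; 0; 0; 0]; [:: 0; 1; 0; 0]; [:: 0; 0; -1; 0]; [:: 0; 0; 0; -1]]] i) k)`_l.

Lemma endoE i q (k l : 'I_4) : endo i q k l =
  - (Kv i k l + kappa / w q * (av q k * sv q i l) + kappa * (sv q i k * av q l)).
Proof. by rewrite oppmxE !addmxE JS4E !scalemxE !mul_rowT !mulJE !mulSE. Qed.

Lemma gmod_entry q (k l : 'I_4) : g q k l =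
  w q * (if k == l :> nat then 1 else 0) - (kappa + kappa / w q) * (av q k * av q l).
Proof.
rewrite /gmod submxE !scalemxE idmxE mul_rowT !mulJE.
by rewrite -/(av q k) -/(av q l); field; exact: w_neq0.
Qed.

Lemma Fmod_entry i q (k l : 'I_4) : Om i q k l =
  w q * Kv i k l - kappa * (sv q i k * av q l - av q k * sv q i l).
Proof. by rewrite /Fmod submxE !scalemxE JS4E wedgeE !mulSE !mulJE. Qed.

Lemma endo_g i q : endo i q *m g q = - Om i q.
Proof.
apply/matrixP => k l; rewrite oppmxE mulmx4E !endoE !gmod_entry Fmod_entry.
have := w_neq0 q; rewrite /wfun sqnE /av /sv /Kv /=.
move: (rval q 0) (rval q 1) (rval q 2) (rval q 3) => a b c d w0.
by case: i => [[|[|[|//]]] Hi]; case: k => [[|[|[|[|//]]]] Hk];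
  case: l => [[|[|[|[|//]]]] Hl] /=; field.
Qed.

Lemma endo_Fmod i q : endo i q = - (Om i q *m invmx (g q)).
Proof.
have [u _] := gmod_unit q J4_orth k0.
by rewrite -mulNmx -endo_g -mulmxA mulmxV// mulmx1.
Qed.

Lemma endo_sq i q : endo i q *m endo i q = - 1%:M.
Proof.
apply/matrixP => k l; rewrite oppmxE mulmx4E !endoE idmxE.
have := w_neq0 q; rewrite /wfun sqnE /av /sv /Kv /=.
move: (rval q 0) (rval q 1) (rval q 2) (rval q 3) => a b c d w0.
by case: i => [[|[|[|//]]] Hi]; case: k => [[|[|[|[|//]]]] Hk];
  case: l => [[|[|[|[|//]]]] Hl] /=; field.
Qed.

Lemma endo_prod q : endo 0 q *m endo 1 q = 1 *: endo 2 q.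
Proof.
apply/matrixP => k l; rewrite scale1r mulmx4E !endoE.
have := w_neq0 q; rewrite /wfun sqnE /av /sv /Kv /=.
move: (rval q 0) (rval q 1) (rval q 2) (rval q 3) => a b c d w0.
by case: k => [[|[|[|[|//]]]] Hk];
  case: l => [[|[|[|[|//]]]] Hl] /=; field.
Qed.

Lemma endo_anti01 q : endo 1 q *m endo 0 q = - (endo 0 q *m endo 1 q).
Proof.
rewrite endo_prod; apply/matrixP => k l; rewrite oppmxE scale1r mulmx4E !endoE.
have := w_neq0 q; rewrite /wfun sqnE /av /sv /Kv /=.
move: (rval q 0) (rval q 1) (rval q 2) (rval q 3) => a b c d w0.
by case: k => [[|[|[|[|//]]]] Hk];
  case: l => [[|[|[|[|//]]]] Hl] /=; field.
Qed.

(** Only the pair (0, 1) is verified entrywise; the other pairs follow algebraically from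
    [endo 2 = endo 0 *m endo 1]. *)
Lemma endo_anti i j q : i != j -> endo i q *m endo j q = - (endo j q *m endo i q).
Proof.
have e2 : endo 2 q = endo 0 q *m endo 1 q by rewrite endo_prod scale1r.
have a01 := endo_anti01 q.
have s0 := endo_sq 0 q; have s1 := endo_sq 1 q.
have a02 : endo 0 q *m endo 2 q = - (endo 2 q *m endo 0 q).
  by apply/esym; rewrite e2 -mulmxA a01 (mulmxN _ (endo 0 q *m endo 1 q)) opprK.
have a12 : endo 1 q *m endo 2 q = - (endo 2 q *m endo 1 q).
  by rewrite e2 mulmxA a01 mulNmx.
have flip (A B : 'M[R]_4) : A = - B -> B = - A by move/esym; exact: (canRL (@opprK _)).
move: i j; apply: ord3_ind; apply: ord3_ind => /eqP ij.
- by case: ij.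
- exact: flip a01.
- exact: a02.
- exact: a01.
- by case: ij.
- exact: a12.
- exact: flip a02.
- exact: flip a12.
- by case: ij.
Qed.

Lemma pd_gmod a (k l : 'I_4) q : pd a (fun p => g p k l) q =
  2 * kappa * rval q a * (if k == l :> nat then 1 else 0)
  + 2 * kappa ^+ 2 * rval q a / (w q) ^+ 2 * (av q k * av q l)
  - (kappa + kappa / w q) * (Jv a k * av q l + av q k * Jv a l).
Proof.
rewrite (_ : (fun p => _) = (fun p => interp (rval p) (gE kappa k l))); last first.
  by apply/funext => p; rewrite interp_gE.
rewrite pd_interp_below; last exact: valid_gE; last first.
  by case: k => [[|[|[|[|//]]]] Hk]; case: l => [[|[|[|[|//]]]] Hl].
have := w_neq0 q; rewrite /wfun sqnE /av /Jv /= /kron /=.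
move: (rval q) => f w0.
have w1 : 1 + kappa * (f 0 * f 0 + f 1 * f 1 + (f 2 * f 2 + f 3 * f 3)) != 0.
  by move: w0; congr (_ != 0); ring.
by case: a => [[|[|[|[|//]]]] Ha]; case: k => [[|[|[|[|//]]]] Hk];
  case: l => [[|[|[|[|//]]]] Hl] /=; field; rewrite ?w0 ?w1.
Qed.

Lemma pd_Fmod i a (k l : 'I_4) q : pd a (fun p => Om i p k l) q =
  2 * kappa * rval q a * Kv i k l
  - kappa * (Sv i a k * av q l + sv q i k * Jv a l - Jv a k * sv q i l - av q k * Sv i a l).
Proof.
rewrite (_ : (fun p => _) = (fun p => interp (rval p) (FE kappa i k l))); last first.
  by apply/funext => p; rewrite interp_FE.
rewrite pd_interp_below; last exact: valid_FE; last first.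
  by case: i => [[|[|[|//]]] Hi]; case: k => [[|[|[|[|//]]]] Hk];
    case: l => [[|[|[|[|//]]]] Hl].
rewrite /av /sv /Sv /Jv /Kv /= /kron /=.
move: (rval q) => f.
by case: i => [[|[|[|//]]] Hi]; case: a => [[|[|[|[|//]]]] Ha];
  case: k => [[|[|[|[|//]]]] Hk]; case: l => [[|[|[|[|//]]]] Hl] /=; ring.
Qed.

Definition sum4 (f : 'I_4 -> R) := f 0 + f 1 + f 2 + f 3.

Lemma sum4_big f : \sum_i f i = sum4 f.
Proof.
rewrite !big_ord_recl big_ord0 addr0 !addrA.
by congr (_ + f _ + f _ + f _); apply/val_inj.
Qed.

Lemma Jv_skew k l : Jv k l = - Jv l k.
Proof.
by case: k => [|[|[|[|k]]]]; case: l => [|[|[|[|l]]]];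
  rewrite /Jv /= ?nth_nil ?oppr0 ?opprK.
Qed.

Lemma endo_q i q (k : 'I_4) : sum4 (fun l => rval q l * endo i q k l)
  = - (sum4 (fun l => rval q l * Kv i k l)
       + kappa / w q * av q k * sum4 (fun l => rval q l * sv q i l)).
Proof.
rewrite /sum4 !endoE; move: (kappa / w q) => r; rewrite /av /sv /Kv /=.
move: (rval q) => f.
by case: i => [[|[|[|//]]] Hi]; case: k => [[|[|[|[|//]]]] Hk] /=; ring.
Qed.

Lemma endo_av i q (k : 'I_4) : sum4 (fun l => av q l * endo i q k l) = - w q * sv q i k.
Proof.
rewrite /sum4 !endoE; have := w_neq0 q; rewrite /wfun sqnE /av /sv /Kv /=.
move: (rval q) => f w0.
by case: i => [[|[|[|//]]] Hi]; case: k => [[|[|[|[|//]]]] Hk] /=; field.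
Qed.

Lemma endo_Jv i q (j k : 'I_4) : sum4 (fun l => Jv j l * endo i q k l)
  = - (sum4 (fun l => Jv j l * Kv i k l)
       + kappa / w q * av q k * sum4 (fun l => Jv j l * sv q i l)
       + kappa * sv q i k * rval q j).
Proof.
rewrite /sum4 !endoE; move: (kappa / w q) => r; rewrite /av /sv /Kv /Jv /=.
move: (rval q) => f.
by case: i => [[|[|[|//]]] Hi]; case: k => [[|[|[|[|//]]]] Hk];
  case: j => [[|[|[|[|//]]]] Hj] /=; ring.
Qed.

Lemma sum4_delta (j : 'I_4) (f : 'I_4 -> R) :
  sum4 (fun l => (if l == j :> nat then 1 else 0) * f l) = f j.
Proof.
rewrite -sum4_big (bigD1 j)//= eqxx mul1r big1 ?addr0// => l.
by rewrite -val_eqE => /negbTE ->; rewrite mul0r.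
Qed.

End ModelInstance.

(** * Parallelism of the two-forms of the model *)

Section ModelInstance2.
Context {R : realType}.
Variable (kappa : R).
Hypothesis k0 : 0 <= kappa.
Implicit Types q : 'rV[R]_4.
Local Notation J4 := (@J4 R).
Local Notation S4 := (@S4 R).
Local Notation g := (gmod kappa J4).
Local Notation Om := (fun i => Fmod kappa J4 (S4 i)).
Local Notation w := (wfun kappa).
Local Notation endo := (endo kappa).
Local Notation av := (@av R).
Local Notation sv := (@sv R).
Local Notation Jv := (@Jv R).
Local Notation Kv := (@Kv R).
Local Notation Sv := (@Sv R).

(* The lowered connection matrix of g, contracted with the almost complex
   structure; the sums over l collapse by endo_av. *)
Lemma lowered_endo i a q (j k : 'I_4) :
  (\matrix_(j, l) (2^-1 * (pd a (fun p => g p l j) q + pd j (fun p => g p l a) q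
     - pd l (fun p => g p a j) q)) *m (endo i q)^T) j k =
    kappa * (rval q a * endo i q k j + rval q j * endo i q k a
             - (if a == j :> nat then 1 else 0) * sum4 (fun l => rval q l * endo i q k l))
    + kappa ^+ 2 / (w q) ^+ 2 * ((rval q a * av q j + rval q j * av q a)
             * sum4 (fun l => av q l * endo i q k l)
             - av q a * av q j * sum4 (fun l => rval q l * endo i q k l))
    - (kappa + kappa / w q) * (av q j * sum4 (fun l => Jv a l * endo i q k l)
             + av q a * sum4 (fun l => Jv j l * endo i q k l)).
Proof.
rewrite -(sum4_delta j (endo i q k)) -(sum4_delta a (endo i q k)) -!sum4_big.
rewrite !mulr_sumr -!sumrN -!big_split /= !mulr_sumr -!sumrN -!big_split /=.
rewrite mxE; apply: eq_bigr => l _.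
rewrite [(endo i q)^T l k]mxE [X in X * _ = _]mxE !(pd_gmod k0).
rewrite (Jv_skew j a) (Jv_skew l a) (Jv_skew l j).
have := w_neq0 k0 q; move: (endo i q k l) (w q) => X r r0.
move: (Jv a l) (Jv j l) (Jv a j) (av q l) (av q j) (av q a) (rval q a) (rval q j) (rval q l) => b1 b2 b3 b4 b5 b6 b7 b8 b9.
case: (nat_of_ord l == j); case: (nat_of_ord l == a); case: (nat_of_ord a == j); by field.
Qed.

(** Both sides of the parallelism equation are skew, which leaves six entries to verify instead of
    sixteen. *)
Lemma skew_mxP n (A B : 'M[R]_n) : A^T = - A -> B^T = - B ->
  (forall i j : 'I_n, (i < j)%N -> A i j = B i j) -> A = B.
Proof.
have flip (C : 'M[R]_n) i j : C^T = - C -> C i j = - C j i.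
  by move=> Cs; have := congr1 (fun D : matrix R n n => D j i) Cs; rewrite !mxE.
move=> As Bs AB; apply/matrixP => i j; have [ij|ji|/val_inj ->] := ltngtP i j.
- exact: AB.
- by rewrite (flip A)// (flip B)// AB.
- have diag (C : 'M[R]_n) : C^T = - C -> C j j = 0.
    by move=> Cs; have := flip C j j Cs; lra.
  by rewrite !diag.
Qed.

(** Let C be the connection, L = C g and A = [endo i q]. From [g A^T = Om] one gets [C Om = L A^T],
    so the right-hand side is [L A^T - (L A^T)^T]. The inverse metric contained in the Christoffel
    symbols has disappeared, and the remaining contractions are those of [lowered_endo]. *)
Lemma Fmod_parallel i a q :
  dmx a (Om i) q = conn g a q *m Om i q + Om i q *m (conn g a q)^T.
Proof.
have [u _] := gmod_unit q (@J4_orth R) k0.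
have [L Ldef] : exists L : 'M[R]_4, L = conn g a q *m g q by eexists.
have LE : L = \matrix_(j, l) (2^-1 * (pd a (fun p => g p l j) q
    + pd j (fun p => g p l a) q - pd l (fun p => g p a j) q)).
  by rewrite Ldef; exact: (conn_lower (gmod_symm kappa) (fun p => (gmod_unit p (@J4_orth R) k0).1)).
have CO : conn g a q *m Om i q = L *m (endo i q)^T.
  have e : g q *m (endo i q)^T = Om i q.
    by rewrite -{1}(gmod_symm kappa q) -trmx_mul endo_g// linearN/= Fmod_skew opprK.
  by rewrite Ldef -mulmxA e.
have -> : Om i q *m (conn g a q)^T = - (L *m (endo i q)^T)^T.
  by rewrite -CO trmx_mul Fmod_skew mulNmx opprK.
have dsk : (dmx a (Om i) q)^T = - dmx a (Om i) q.
  rewrite -dmxT -dmxN; last exact: Fmod_elementary.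
  apply: (congr1 (fun X => dmx a X q)); apply/funext => p; exact: Fmod_skew.
rewrite CO; apply: skew_mxP => //; first by rewrite linearB/= trmxK opprB.
move=> k l kl.
have LX (j k' : 'I_4) := lowered_endo i a q j k'; rewrite -LE in LX.
rewrite [RHS]addmxE [X in _ + X]oppmxE [X in _ - X]mxE [LHS]mxE pd_Fmod.
rewrite (LX k l) (LX l k) !endo_q !(endo_av k0) !endo_Jv !endoE {LX LE CO Ldef dsk}.
have := w_neq0 k0 q; rewrite /sum4 /wfun sqnE /av /sv /Sv /Jv /Kv /=.
move: (rval q) => f w0.
case: i => [[|[|[|//]]] Hi]; case: a => [[|[|[|[|//]]]] Ha] /=;
  (move: k kl => [[|[|[|[|//]]]] Hk]; case: l => [[|[|[|[|//]]]] Hl] //= _;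
   field; exact: w0).
Qed.

End ModelInstance2.

(** * Transfer from the model to the Taub-NUT metric *)

Section TaubNUTInstance.
Context {R : realType}.
Variable (m : R).
Hypothesis m0 : 0 <= m.
Implicit Types q : 'rV[R]_4.
Local Notation J4 := (@J4 R).
Local Notation S4 := (@S4 R).
Local Notation B := (frame0 m).
Local Notation kappa := (kap m).
Let k0 : 0 <= kappa := kap_ge0 m.
Let BB : B *m B^T = 1%:M := frame0_orth m.
Let BB' : B^T *m B = 1%:M := mulmx1C BB.

Let conjM (X Y : 'M[R]_4) : (B *m X *m B^T) *m (B *m Y *m B^T) = B *m (X *m Y) *m B^T.
Proof. by rewrite !mulmxA -(mulmxA _ B^T) BB' mulmx1. Qed.

Lemma tn_metric_unit q : tn_metric m q \in unitmx /\
  invmx (tn_metric m q) = B *m gmodV kappa J4 (q *m B) *m B^T.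
Proof.
have h : tn_metric m q *m (B *m gmodV kappa J4 (q *m B) *m B^T) = 1%:M.
  by rewrite tn_metricE// conjM gmodE ?J4_orth// mulmx1 BB.
have [u _] := mulmx1_unit h; split=> //.
by apply: (can_inj (mulKmx u)); rewrite (mulmxV u) h.
Qed.

Lemma tn_metric_sym q : (tn_metric m q)^T = tn_metric m q.
Proof. by rewrite tn_metricE// !trmx_mul trmxK gmod_symm mulmxA. Qed.

Lemma tn_Omega_skew i q : (tn_Omega m i q)^T = - tn_Omega m i q.
Proof. by rewrite tn_OmegaE// !trmx_mul trmxK Fmod_skew !(mulNmx, mulmxN) mulmxA. Qed.

Definition tn_endo i q : 'M[R]_4 := B *m endo kappa i (q *m B) *m B^T.

Lemma tn_endoE i q : tn_endo i q = - (tn_Omega m i q *m invmx (tn_metric m q)).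
Proof.
rewrite (tn_metric_unit q).2 tn_OmegaE// conjM /tn_endo endo_Fmod//.
by rewrite (gmod_unit _ (@J4_orth R) k0).2 mulmxN mulNmx.
Qed.

Lemma tn_endo_sq i q : tn_endo i q *m tn_endo i q = - 1%:M.
Proof. by rewrite conjM endo_sq// mulmxN mulmx1 mulNmx BB. Qed.

Lemma tn_endo_anti i j q : i != j -> tn_endo i q *m tn_endo j q = - (tn_endo j q *m tn_endo i q).
Proof. by move=> ij; rewrite !conjM endo_anti// mulmxN mulNmx. Qed.

Lemma tn_endo_prod q : tn_endo 0 q *m tn_endo 1 q = 1 *: tn_endo 2 q.
Proof. by rewrite conjM endo_prod// !scale1r. Qed.

Lemma tn_F_skew c q : (tn_F m c q)^T = - tn_F m c q.
Proof.
rewrite /tn_F linear_sum/= -sumrN; apply: eq_bigr => i _.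
by rewrite linearZ/= tn_Omega_skew scalerN.
Qed.

Lemma elementary_mx_cst k l (M : 'M[R]_(k, l)) : elementary_mx (fun _ : 'rV[R]_4 => M).
Proof. by move=> i j; exact: elementary_cst. Qed.

Lemma tn_elementary : [/\ elementary_mx (tn_metric m),
  elementary_mx (fun q => invmx (tn_metric m q)),
  forall i, elementary_mx (tn_Omega m i) &
  forall i a q, dmx a (tn_Omega m i) q = conn (tn_metric m) a q *m tn_Omega m i q
    + tn_Omega m i q *m (conn (tn_metric m) a q)^T].
Proof.
have [m00|mN0] := eqVneq m 0.
  have gE q : tn_metric m q = 1%:M.
    rewrite tn_metricE// /kap m00 eqxx /gmod /wfun !mul0r scale0r subr0 addr0.
    by rewrite scale1r mulmx1 frame0_orth.
  have OE i q : tn_Omega m i q = B *m (J4 *m S4 i) *m B^T.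
    rewrite tn_OmegaE// /kap m00 eqxx /Fmod /wfun !mul0r scale0r subr0 addr0.
    by rewrite scale1r.
  split.
  - by rewrite (funext gE); exact: elementary_mx_cst.
  - by under eq_fun do rewrite gE; exact: elementary_mx_cst.
  - by move=> i; rewrite (funext (OE i)); exact: elementary_mx_cst.
  - move=> i a q; rewrite (funext (OE i)) dmx_cst.
    have -> : conn (tn_metric m) a q = 0.
      apply/matrixP => j k; rewrite !mxE /christoffel (funext gE) big1 ?mulr0// => l _.
      by rewrite !pd_cst addr0 subr0 mulr0.
    by rewrite trmx0 mul0mx mulmx0 addr0.
have B1 : B = 1%:M by rewrite /frame0 (negbTE mN0).
have gE q : tn_metric m q = gmod kappa J4 q.
  by rewrite tn_metricE// B1 trmx1 mul1mx !mulmx1.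
have OE i q : tn_Omega m i q = Fmod kappa J4 (S4 i) q.
  by rewrite tn_OmegaE// B1 trmx1 mul1mx !mulmx1.
rewrite (funext gE); split.
- exact: gmod_elementary.
- exact: gmodV_elementary.
- by move=> i; rewrite (funext (OE i)); exact: Fmod_elementary.
- by move=> i a q; rewrite (funext (OE i)); exact: Fmod_parallel.
Qed.

Lemma tn_FsumE c q : tn_F m c q = \sum_i c 0 i *: tn_Omega m i q.
Proof. by []. Qed.

Lemma conformal_geodesic_iff (J : set R) (gamma : R -> 'rV[R]_4) :
  open_interval J -> unit_speed_curve (tn_metric m) J gamma ->
  (conformal_geodesic (tn_metric m) J gamma <->
   exists (e : R) (c : 'rV[R]_3), [/\ 0 <= e, \sum_i c 0 i ^+ 2 = 1 &
     magnetic_geodesic (tn_metric m) (tn_F m c) e J gamma])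
  /\ (forall (e : R) (c : 'rV[R]_3), 0 <= e -> \sum_i c 0 i ^+ 2 = 1 ->
        magnetic_geodesic (tn_metric m) (tn_F m c) e J gamma ->
        forall t, J t ->
          let a := acceleration (tn_metric m) gamma t in
          e = Num.sqrt (inner (tn_metric m) (gamma t) a a)).
Proof.
move=> oJ [C3 un]; have [e1 e2 e3 e4] := tn_elementary.
have gu q := (tn_metric_unit q).1.
split; first split.
- apply: (conformal_magnetic e1 e2 tn_metric_sym gu e3 tn_Omega_skew e4 tn_endoE
    tn_endo_sq tn_endo_anti tn_endo_prod (oner_neq0 _) oJ C3 un tn_FsumE).
- move=> [e [c [e0 c1 mg]]].
  exact: (magnetic_conformal e1 e2 tn_metric_sym gu e3 tn_Omega_skew e4 tn_endoE
    tn_endo_sq tn_endo_anti tn_endo_prod (oner_neq0 _) oJ C3 un tn_FsumE c1 mg).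
- move=> e c e0 c1 mg t Jt /=.
  rewrite (magnetic_acceleration tn_metric_sym gu tn_Omega_skew tn_endoE
    tn_endo_sq tn_endo_anti un tn_FsumE c1 mg Jt).
  by rewrite sqrtr_sqr ger0_norm.
Qed.

End TaubNUTInstance.

(** * Hamiltonian form of the magnetic geodesics *)

Section Lines.
Context {R : realType}.

(** Turns a directional derivative into the derivative of a curve at 0, where the product rules for
    curves are available. *)
Lemma is_derive_line (V W : normedModType R) (f : V -> W) z v l :
  is_derive z v f l <-> is_derive 0 (1 : R) (fun s : R => f (s *: v + z)) l.
Proof.
have e : (fun h : R => h^-1 *: (((fun s : R => f (s *: v + z)) \o shift 0) (h *: 1)
     - f (0 *: v + z))) = (fun h => h^-1 *: ((f \o shift z) (h *: v) - f z)).
  by apply/funext => h; rewrite /= addr0 [h *: 1]mulr1 scale0r add0r.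
by split=> -[d dl]; apply: DeriveDef; move: d dl; rewrite /derivable /derive e.
Qed.

Lemma derive_linear (V V' W : normedModType R) (L : V -> V') (f : V' -> W) z v :
  (forall (s : R) x y, L (s *: x + y) = s *: L x + L y) ->
  'D_v (f \o L) z = 'D_(L v) f (L z) /\ (derivable (f \o L) z v <-> derivable f (L z) (L v)).
Proof.
move=> lin.
have e : (fun h : R => h^-1 *: (((f \o L) \o shift z) (h *: v) - (f \o L) z)) =
  (fun h => h^-1 *: ((f \o shift (L z)) (h *: L v) - f (L z))).
  by apply/funext => h; rewrite /= lin.
by rewrite /derive /derivable e.
Qed.

Lemma is_derive_affine (V : normedModType R) (x y : V) (t : R) :
  is_derive t (1 : R) (fun s : R => s *: x + y) x.
Proof.
have h : is_derive t (1 : R) (fun s : R => s *: x) x.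
  have := @is_diff_scalel R V t x => -[d e].
  apply: DeriveDef; first exact: diff_derivable.
  by rewrite deriveE// e scale1r.
by rewrite -[X in is_derive _ _ _ X]addr0; exact: is_deriveD.
Qed.

End Lines.

Section Hamilton.
Context {R : realType} {n : nat}.
Variables (g F : 'rV[R]_n -> 'M[R]_n) (e : R).
Hypotheses (g_elem : elementary_mx g) (gV_elem : elementary_mx (fun q => invmx (g q))).
Hypotheses (g_sym : forall q, (g q)^T = g q) (g_unit : forall q, g q \in unitmx).
Hypothesis F_skew : forall q, (F q)^T = - F q.

Lemma pos_lin (s : R) (x y : 'rV[R]_(n + n)) : pos (s *: x + y) = s *: pos x + pos y.
Proof. by rewrite /pos linearP. Qed.

Lemma mom_lin (s : R) (x y : 'rV[R]_(n + n)) : mom (s *: x + y) = s *: mom x + mom y.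
Proof. by rewrite /mom linearP. Qed.

Lemma invmx_symplectic (z : 'rV[R]_(n + n)) :
  invmx (symplectic_form F e z) = block_mx 0 1%:M (- 1%:M) (e *: F (pos z)).
Proof.
have h : symplectic_form F e z *m block_mx 0 1%:M (- 1%:M) (e *: F (pos z)) = 1%:M.
  rewrite /symplectic_form mulmx_block !mulmx0 !mul0mx !mulmx1 !mulmxN !mulNmx !mulmx1 !mul1mx.
  by rewrite opprK !add0r ?addr0 subrr -scalar_mx_block.
have [u _] := mulmx1_unit h.
by apply: (can_inj (mulKmx u)); rewrite (mulmxV u) h.
Qed.

Lemma ham_vecE (h : 'rV[R]_(n + n) -> R) z : ham_vec F e h z =
  row_mx (\row_b pd (rshift n b) h z)
    (- (\row_a pd (lshift n a) h z) - e *: ((\row_b pd (rshift n b) h z) *m F (pos z))).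
Proof.
rewrite /ham_vec invmx_symplectic.
have -> : differential h z = row_mx (\row_a pd (lshift n a) h z) (\row_b pd (rshift n b) h z).
  apply/rowP => i; rewrite !mxE; case: splitP => j ij; rewrite mxE; congr (pd _ h z);
    by apply/val_inj.
rewrite mulNmx mul_row_block !mulmx0 add0r mulmxN !mulmx1 opp_row_mx opprK opprD.
by rewrite scalemxAr.
Qed.

Lemma inv_parallel a q :
  dmx a (fun q => invmx (g q)) q = - (invmx (g q) *m dmx a g q *m invmx (g q)).
Proof.
have : dmx a (fun q => g q *m invmx (g q)) q = 0.
  by under eq_fun do rewrite mulmxV//; exact: dmx_cst.
rewrite dmxM// => /eqP; rewrite addrC addr_eq0 => /eqP h.
apply: (can_inj (mulKmx (g_unit q))); rewrite h mulmxN !mulmxA mulmxV//.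
by rewrite mul1mx.
Qed.

Let gVs q : (invmx (g q))^T = invmx (g q).
Proof. by rewrite trmx_inv g_sym. Qed.

Lemma derive_hamiltonian (z v : 'rV[R]_(n + n)) (p := mom z *m invmx (g (pos z))) :
  is_derive z v (hamiltonian g) ((mom v *m p^T) 0 0
    - 2^-1 * \sum_a pos v 0 a * (p *m dmx a g (pos z) *m p^T) 0 0).
Proof.
apply/is_derive_line.
have dP : is_derive (0 : R) (1 : R) (fun s : R => mom (s *: v + z)) (mom v).
  by under eq_fun do rewrite mom_lin; exact: is_derive_affine.
have dq : is_derive (0 : R) (1 : R) (fun s : R => pos (s *: v + z)) (pos v).
  by under eq_fun do rewrite pos_lin; exact: is_derive_affine.
have := is_derive_mulmx (is_derive_mulmx dP (curve_dmx gV_elem dq)) (is_deriveT dP).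
move=> /is_derive_mxP/(_ 0 0) h.
apply: (is_derive_eq (is_deriveZ 2^-1 h)); rewrite {h} !scale0r !add0r.
have -> : \sum_a pos v 0 a *: dmx a (fun q => invmx (g q)) (pos z)
    = - (invmx (g (pos z)) *m (\sum_a pos v 0 a *: dmx a g (pos z)) *m invmx (g (pos z))).
  rewrite mulmx_sumr mulmx_suml -sumrN; apply: eq_bigr => a _.
  by rewrite inv_parallel scalerN -scalemxAr -scalemxAl.
have pT : p^T = invmx (g (pos z)) *m (mom z)^T by rewrite /p trmx_mul gVs.
have tr00 (M : 'M[R]_1) : M 0 0 = M^T 0 0 by rewrite mxE.
have e2 : (p *m (mom v)^T) 0 0 = (mom v *m p^T) 0 0 by rewrite [RHS]tr00 trmx_mul trmxK.
have e3 : (\sum_a pos v 0 a * (p *m dmx a g (pos z) *m p^T) 0 0)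
    = (p *m (\sum_a pos v 0 a *: dmx a g (pos z)) *m p^T) 0 0.
  rewrite mulmx_sumr mulmx_suml summxE; apply: eq_bigr => a _.
  by rewrite -scalemxAr -scalemxAl [RHS]mxE.
rewrite e3 mulmxDl addmxE addmxE !mulmxN !mulNmx oppmxE.
move: (\sum_a _) => X; rewrite !mulmxA -/p -(mulmxA (p *m X)) -pT.
rewrite -(mulmxA (mom v)) -pT e2 /GRing.scale/=.
by field.
Qed.

Lemma hamiltonian_pdq (z : 'rV[R]_(n + n)) (p := mom z *m invmx (g (pos z))) a :
  pd (lshift n a) (hamiltonian g) z = - 2^-1 * (p *m dmx a g (pos z) *m p^T) 0 0.
Proof.
have [_ e1] := derive_hamiltonian z (delta_mx 0 (lshift n a)).
rewrite /pd e1.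
have -> : mom (delta_mx 0 (lshift n a) : 'rV[R]_(n + n)) = 0.
  by apply/rowP => j; rewrite !mxE eqxx /= eq_rlshift.
rewrite mul0mx mxE add0r (bigD1 a)//= big1 => [|b ba].
  by rewrite addr0 !mxE !eqxx mul1r mulNr.
by rewrite !mxE eqxx /= (inj_eq (@lshift_inj _ _)) (negbTE ba) mul0r.
Qed.

Lemma hamiltonian_pdp (z : 'rV[R]_(n + n)) b :
  pd (rshift n b) (hamiltonian g) z = (mom z *m invmx (g (pos z))) 0 b.
Proof.
have [_ e1] := derive_hamiltonian z (delta_mx 0 (rshift n b)).
rewrite /pd e1.
have -> : mom (delta_mx 0 (rshift n b) : 'rV[R]_(n + n)) = delta_mx 0 b.
  by apply/rowP => j; rewrite !mxE eqxx /= (inj_eq (@rshift_inj _ _)).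
rewrite -rowE [X in X - _]mxE [X in X - _]mxE big1 ?mulr0 ?subr0// => a _.
by rewrite !mxE eqxx /= eq_lrshift mul0r.
Qed.

(** Contracted twice with the same vector, the first two terms of the Christoffel symbol coincide:
    together they give the derivative of g along [U], and the third gives half the gradient of the
    kinetic energy. *)
Lemma conn_velocity q (U : 'rV[R]_n) :
  U *m (\sum_a U 0 a *: conn g a q) *m g q
  = U *m (\sum_a U 0 a *: dmx a g q) - 2^-1 *: \row_b (U *m dmx b g q *m U^T) 0 0.
Proof.
apply/rowP => l; rewrite [RHS]mxE [X in _ = _ + X]mxE [X in _ - X]mxE [(\row_b _) 0 l]mxE.
have A1 : (U *m (\sum_a U 0 a *: conn g a q) *m g q) 0 l = \sum_a \sum_j U 0 a * U 0 j *
  (2^-1 * (pd a (fun p => g p l j) q + pd j (fun p => g p l a) q - pd l (fun p => g p a j) q)).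
  rewrite mulmx_sumr mulmx_suml summxE; apply: eq_bigr => a _.
  rewrite -scalemxAr -scalemxAl -mulmxA conn_lower// [LHS]mxE [X in _ * X]mxE mulr_sumr.
  by apply: eq_bigr => j _; rewrite [X in _ * (_ * X)]mxE mulrA.
have A2 : (U *m (\sum_a U 0 a *: dmx a g q)) 0 l =
   \sum_a \sum_j U 0 a * U 0 j * pd a (fun p => g p l j) q.
  rewrite mulmx_sumr summxE; apply: eq_bigr => a _.
  rewrite -scalemxAr [LHS]mxE [X in _ * X]mxE mulr_sumr.
  apply: eq_bigr => j _; rewrite [X in _ * (_ * X)]mxE mulrA; congr (_ * _).
  by apply: pd_eq => p; rewrite (g_symE g_sym).
have A3 : (U *m dmx l g q *m U^T) 0 0 = \sum_a \sum_j U 0 a * U 0 j * pd l (fun p => g p a j) q.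
  rewrite mxE exchange_big /=; apply: eq_bigr => j _; rewrite [X in X * _]mxE mulr_suml.
  by apply: eq_bigr => a _; rewrite [(_^T) _ _]mxE [dmx _ _ _ _ _]mxE; ring.
have A4 : \sum_a \sum_j U 0 a * U 0 j * pd a (fun p => g p l j) q =
   \sum_a \sum_j U 0 a * U 0 j * pd j (fun p => g p l a) q.
  rewrite exchange_big; apply: eq_bigr => a _; apply: eq_bigr => j _.
  by rewrite (mulrC (U 0 a)).
rewrite A1 A3 A2.
transitivity (2^-1 * (\sum_a \sum_j U 0 a * U 0 j * pd a (fun p => g p l j) q)
  + 2^-1 * (\sum_a \sum_j U 0 a * U 0 j * pd j (fun p => g p l a) q)
  - 2^-1 * (\sum_a \sum_j U 0 a * U 0 j * pd l (fun p => g p a j) q)).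
  rewrite !mulr_sumr -big_split -sumrB; apply: eq_bigr => a _ /=.
  rewrite !mulr_sumr -big_split -sumrB; apply: eq_bigr => j _ /=; ring.
by rewrite -A4; move: (\sum_a _) (\sum_a _) => X Y; lra.
Qed.

Section curve.
Variables (J : set R) (z : R -> 'rV[R]_(n + n)).
Hypotheses (oJ : open_interval J)
  (dz : forall t, J t -> is_derive t (1 : R) z (derive1 z t)).
Let q t := pos (z t).
Let P t := mom (z t).

Let dq t : J t -> is_derive t (1 : R) q (pos (derive1 z t)).
Proof.
move=> Jt; apply: is_derive_rV => i.
have h := is_derive_coord (lshift n i) (dz Jt).
have e1 : (fun x => q x 0 i) = (fun x => z x 0 (lshift n i)).
  by apply/funext => x; rewrite /q /pos mxE.
rewrite e1; have -> : pos (derive1 z t) 0 i = derive1 z t 0 (lshift n i).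
  by rewrite /pos mxE.
exact: h.
Qed.

Let dP t : J t -> is_derive t (1 : R) P (mom (derive1 z t)).
Proof.
move=> Jt; apply: is_derive_rV => i.
have h := is_derive_coord (rshift n i) (dz Jt).
have e1 : (fun x => P x 0 i) = (fun x => z x 0 (rshift n i)).
  by apply/funext => x; rewrite /P /mom mxE.
rewrite e1; have -> : mom (derive1 z t) 0 i = derive1 z t 0 (rshift n i).
  by rewrite /mom mxE.
exact: h.
Qed.

Let is_derive1V (V : normedModType R) (f : R -> V) (t : R) l :
  is_derive t (1 : R) f l -> derive1 f t = l.
Proof. by move=> [_ <-]; rewrite derive1E. Qed.

(** If P = g u on the whole interval, the derivative of P is u' g plus u times the derivative of g
    along the curve. By [conn_velocity] the equation for P is the acceleration equation lowered by
    g; the sign of the Lorentz term comes from the skewness of F. *)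
Let momentum_equation t : J t -> (forall s, J s -> derive1 q s = sharp g (q s) (P s)) ->
  (mom (derive1 z t) = 2^-1 *: \row_b (derive1 q t *m dmx b g (q t) *m (derive1 q t)^T) 0 0
     - e *: (derive1 q t *m F (q t)) <->
   acceleration g q t = e *: sharp g (q t) (derive1 q t *m (F (q t))^T)).
Proof.
move=> Jt qP; pose U := derive1 q.
have dU : derivable U t 1.
  have d := is_derive_mulmx (dP Jt) (curve_dmx gV_elem (dq Jt)).
  have e1 s : J s -> P s *m invmx (g (q s)) = U s by move=> /qP; rewrite /U => ->.
  by have [_ <-] := eq_on_derive oJ.1 e1 1 Jt; case: d.
have dUg := is_derive_mulmx (derive1P dU) (curve_dmx g_elem (dq Jt)).
have mE : mom (derive1 z t) = derive1 U t *m g (q t)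
    + U t *m \sum_a U t 0 a *: dmx a g (q t).
  have e1 s : J s -> U s *m g (q s) = P s.
    by move=> /qP; rewrite /U => ->; rewrite /sharp -mulmxA mulVmx// mulmx1.
  have [h _] := eq_on_derive oJ.1 e1 1 Jt.
  have [_ <-] := dP Jt; rewrite -h; have [_ ->] := dUg.
  by rewrite -(is_derive1V (dq Jt)).
have aE : acceleration g q t *m g (q t) = derive1 U t *m g (q t)
    + U t *m (\sum_a U t 0 a *: conn g a (q t)) *m g (q t).
  have -> : acceleration g q t = derive1 U t + U t *m (\sum_a U t 0 a *: conn g a (q t)).
    exact: cov_deriv_conn.
  exact: mulmxDl.
have sE : (e *: sharp g (q t) (U t *m (F (q t))^T)) *m g (q t) = - (e *: (U t *m F (q t))).
  by rewrite /sharp -scalemxAl -mulmxA mulVmx// mulmx1 F_skew mulmxN scalerN.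
rewrite conn_velocity in aE.
have alg (m a s' X D Y f : 'rV[R]_n) : m = X + D -> a = X + (D - Y) -> s' = - f ->
    (m = Y - f <-> a = s').
  move=> -> -> ->; split=> [h|h].
    by rewrite addrA h addrAC subrr add0r.
  by move: h; rewrite addrA => /(canRL (subrK _)) ->; rewrite addrC.
have gi (X Y : 'rV[R]_n) : X *m g (q t) = Y *m g (q t) -> X = Y.
  by move=> h; rewrite -[X]mulmx1 -(mulmxV (g_unit (q t))) mulmxA h -mulmxA mulmxV// mulmx1.
have [h1 h2] := alg _ _ _ _ _ _ _ mE aE sE.
by split=> [/h1/gi//|h]; apply: h2; rewrite h.
Qed.

Lemma hamilton_equations_iff :
  hamilton_equations F e (hamiltonian g) J z <->
  (forall t, J t -> derive1 q t = sharp g (q t) (P t)) /\ magnetic_geodesic g F e J q.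
Proof.
have hv t : ham_vec F e (hamiltonian g) (z t) = row_mx (sharp g (q t) (P t))
    (2^-1 *: \row_b (sharp g (q t) (P t) *m dmx b g (q t) *m (sharp g (q t) (P t))^T) 0 0
     - e *: (sharp g (q t) (P t) *m F (q t))).
  rewrite ham_vecE; congr row_mx.
    by apply/rowP => b; rewrite mxE hamiltonian_pdp.
  have -> : (\row_b pd (rshift n b) (hamiltonian g) (z t)) = sharp g (q t) (P t).
    by apply/rowP => b; rewrite mxE hamiltonian_pdp.
  congr (_ - _); apply/rowP => b; rewrite [LHS]mxE [X in - X]mxE hamiltonian_pdq.
  by rewrite [RHS]mxE [X in _ = _ * X]mxE mulNr opprK.
have dq1 t : J t -> derive1 q t = pos (derive1 z t) by move=> /dq/is_derive1V.
split=> [h|[qP mg] t Jt].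
  have qP t : J t -> derive1 q t = sharp g (q t) (P t).
    by move=> Jt; rewrite dq1// h// hv /pos row_mxKl.
  split=> // t Jt; apply/(momentum_equation Jt qP).
  by rewrite h// hv /mom row_mxKr qP.
have /(momentum_equation Jt qP) h := mg t Jt.
rewrite hv -[derive1 z t]hsubmxK -/(pos _) -/(mom _) h -dq1// qP//.
Qed.

End curve.
End Hamilton.

(** * Substitution into expressions *)

Section Substitution.
Context {R : realType}.

Fixpoint subst (s : nat -> @expr R) (E : expr) : expr :=
  match E with
  | EVar i => s i
  | ECst c => ECst c
  | EAdd a b => EAdd (subst s a) (subst s b)
  | EOpp a => EOpp (subst s a)
  | EMul a b => EMul (subst s a) (subst s b)
  | EInv a => EInv (subst s a)
  | ESqrt a => ESqrt (subst s a)
  | EAtan a => EAtan (subst s a)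
  end.

Lemma interp_subst v s E : interp v (subst s E) = interp (fun i => interp v (s i)) E.
Proof. by elim: E => //= [a -> b ->|a ->|a -> b ->|a ->|a ->|a ->]. Qed.

Lemma valid_subst v s E : (forall i, valid v (s i)) ->
  valid (fun i => interp v (s i)) E -> valid v (subst s E).
Proof.
move=> vs; elim: E => //= [a IHa b IHb|a IHa b IHb|a IHa|a IHa].
- by case=> /IHa ? /IHb.
- by case=> /IHa ? /IHb.
- by case=> /IHa ?; rewrite interp_subst.
- by case=> /IHa ?; rewrite interp_subst.
Qed.

Lemma valid_eq (v v' : nat -> R) E : v =1 v' -> valid v E -> valid v' E.
Proof.
move=> e; elim: E => //= [a IHa b IHb|a IHa b IHb|a IHa|a IHa].
- by case=> /IHa ? /IHb.
- by case=> /IHa ? /IHb.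
- by case=> /IHa ?; rewrite (interp_eq _ e).
- by case=> /IHa ?; rewrite (interp_eq _ e).
Qed.

Lemma elementary_comp n k (T : 'rV[R]_n -> 'rV[R]_k) f :
  (forall i, elementary (fun z => T z 0 i)) -> elementary f ->
  elementary (fun z => f (T z)).
Proof.
move=> /choice[s hs] [E hE].
pose S i := if insub i is Some j then s j else ECst 0.
have TS z : rval (T z) =1 fun i => interp (rval z) (S i).
  by move=> i; rewrite /rval /S; case: insubP => [j _ _|//]; have [_ <-] := hs j z.
exists (subst S E) => z; have [vE ->] := hE (T z); split; last first.
  by rewrite interp_subst; apply: interp_eq; exact: TS.
apply: valid_subst; last exact: valid_eq (TS z) vE.
by move=> i; rewrite /S; case: insubP => [j _ _|//]; have [] := hs j z.
Qed.

Lemma elementary_coord n i : elementary (fun z : 'rV[R]_n => z 0 i).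
Proof. by exists (EVar i) => z; rewrite /= rvalE. Qed.

Lemma elementary_mul_row n k (A : 'M[R]_(n, k)) j : elementary (fun z : 'rV[R]_n => (z *m A) 0 j).
Proof.
rewrite (_ : (fun z => _) = fun z : 'rV[R]_n => \sum_i z 0 i * A i j).
  apply: elementary_sum => i; apply: elementaryM; first exact: elementary_coord.
  exact: elementary_cst.
by apply/funext => z; rewrite mxE.
Qed.

Lemma elementary_smooth n (f : 'rV[R]_n -> R) (U : set 'rV[R]_n) :
  open U -> elementary f -> smooth_on U f.
Proof.
move=> oU [E hE] k; apply: (@Ck_on_eq _ _ _ _ _ (fun z => interp (rval z) E)) => //.
  by move=> z _; have [_ ->] := hE z.
by apply: Ck_on_interp => // z _; have [] := hE z.
Qed.

Lemma elementary_continuous n k (T : 'rV[R]_n -> 'rV[R]_k) :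
  (forall i, elementary (fun z => T z 0 i)) -> continuous T.
Proof.
move=> eT z; apply: (@cvg_mx _ _ (nbhs z)) => i j; rewrite ord1.
have [h _] := elementary_smooth openT (eT j) 0%N.
exact: h.
Qed.

End Substitution.

Section Poisson.
Context {R : realType} {n : nat}.
Implicit Types (F : 'rV[R]_n -> 'M[R]_n) (e : R) (z : 'rV[R]_(n + n))
  (f h : 'rV[R]_(n + n) -> R).

Definition gradq f z : 'rV[R]_n := \row_a pd (lshift n a) f z.
Definition gradp f z : 'rV[R]_n := \row_a pd (rshift n a) f z.

Lemma differentialE f z : differential f z = row_mx (gradq f z) (gradp f z).
Proof.
apply/rowP => i; rewrite !mxE; case: splitP => j ij; rewrite mxE; congr (pd _ f z);
  by apply/val_inj.
Qed.

Lemma poissonE F e f h z : poisson F e f h z =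
  (gradq f z *m (gradp h z)^T) 0 0 - (gradp f z *m (gradq h z)^T) 0 0
  - e * (gradp h z *m F (pos z) *m (gradp f z)^T) 0 0.
Proof.
rewrite /poisson ham_vecE differentialE tr_row_mx mul_row_col mxE -/(gradp h z) -/(gradq h z).
rewrite -[RHS]addrA; congr (_ + _).
rewrite [(- _ - _)^T]linearB/= [(- _)^T]linearN/= mulmxBr mulmxN [LHS]mxE [X in X + _]mxE.
congr (_ + _); rewrite [LHS]mxE; congr (- _).
rewrite linearZ/= -scalemxAr [LHS]mxE; congr (_ * _).
have tr00 (M : 'M[R]_1) : M 0 0 = M^T 0 0 by rewrite mxE.
by rewrite [LHS]tr00 [in LHS]trmx_mul trmxK.
Qed.

End Poisson.

(** * Transport along an orthogonal change of coordinates *)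

Section Transport.
Context {R : realType} {n : nat}.
Variables (g g' F F' : 'rV[R]_n -> 'M[R]_n) (e : R) (B : 'M[R]_n).
Hypotheses (BB : B *m B^T = 1%:M)
  (gE : forall q, g q = B *m g' (q *m B) *m B^T)
  (FE : forall q, F q = B *m F' (q *m B) *m B^T)
  (gU : forall q, g' q \in unitmx).

Let BB' : B^T *m B = 1%:M := mulmx1C BB.

Lemma invmx_transport q : invmx (g q) = B *m invmx (g' (q *m B)) *m B^T.
Proof.
have h : g q *m (B *m invmx (g' (q *m B)) *m B^T) = 1%:M.
  rewrite gE !mulmxA -(mulmxA _ B^T) BB' mulmx1 -(mulmxA B) mulmxV// mulmx1.
  exact: BB.
have [u _] := mulmx1_unit h.
by apply: (can_inj (mulKmx u)); rewrite (mulmxV u) h.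
Qed.

(** Momenta transform by the inverse transpose of the matrix acting on positions; for an orthogonal
    [B] this is again [B]. *)
Definition lift_frame (z : 'rV[R]_(n + n)) : 'rV[R]_(n + n) :=
  row_mx (pos z *m B) (mom z *m B).

Lemma pos_lift z : pos (lift_frame z) = pos z *m B.
Proof. by rewrite /pos row_mxKl. Qed.

Lemma mom_lift z : mom (lift_frame z) = mom z *m B.
Proof. by rewrite /mom row_mxKr. Qed.

Lemma lift_frame_lin (s : R) x y :
  lift_frame (s *: x + y) = s *: lift_frame x + lift_frame y.
Proof. by rewrite /lift_frame pos_lin mom_lin !mulmxDl -!scalemxAl scale_row_mx add_row_mx. Qed.

Lemma lift_frame_elementary i : elementary (fun z => lift_frame z 0 i).
Proof.
rewrite (_ : (fun z => _) = fun z => (z *m block_mx B 0 0 B) 0 i).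
  exact: elementary_mul_row.
apply/funext => z; rewrite /lift_frame -{3}[z]hsubmxK mul_row_block !mulmx0 addr0 add0r.
by [].
Qed.

Lemma hamiltonian_lift z : hamiltonian g z = hamiltonian g' (lift_frame z).
Proof.
by rewrite /hamiltonian pos_lift mom_lift invmx_transport !trmx_mul !mulmxA.
Qed.

Lemma pd_lift (f : 'rV[R]_(n + n) -> R) z i : elementary f ->
  pd i (f \o lift_frame) z = \sum_j lift_frame (delta_mx 0 i) 0 j * pd j f (lift_frame z).
Proof.
move=> ef; rewrite /pd.
have [-> _] := derive_linear f z (delta_mx 0 i) lift_frame_lin.
exact: derive_sum_pd.
Qed.

Lemma gradq_lift f z : elementary f ->
  gradq (f \o lift_frame) z = gradq f (lift_frame z) *m B^T.
Proof.
move=> ef; apply/rowP => a; rewrite [LHS]mxE pd_lift// big_split_ord /=.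
rewrite [X in _ + X]big1 => [|b _]; last first.
  rewrite /lift_frame row_mxEr [mom _](_ : _ = 0) ?mul0mx ?mxE ?mul0r//.
  by apply/rowP => j; rewrite !mxE eqxx /= eq_rlshift.
rewrite addr0 mxE; apply: eq_bigr => b _; rewrite mulrC [gradq _ _ _ _]mxE; congr (_ * _); rewrite [RHS]mxE.
rewrite /lift_frame row_mxEl.
have -> : pos (delta_mx 0 (lshift n a) : 'rV[R]_(n + n)) = delta_mx 0 a.
  by apply/rowP => j; rewrite !mxE eqxx /= (inj_eq (@lshift_inj _ _)).
by rewrite -rowE mxE.
Qed.

Lemma gradp_lift f z : elementary f ->
  gradp (f \o lift_frame) z = gradp f (lift_frame z) *m B^T.
Proof.
move=> ef; apply/rowP => a; rewrite [LHS]mxE pd_lift// big_split_ord /=.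
rewrite [X in X + _]big1 => [|b _]; last first.
  rewrite /lift_frame row_mxEl [pos _](_ : _ = 0) ?mul0mx ?mxE ?mul0r//.
  by apply/rowP => j; rewrite !mxE eqxx /= eq_lrshift.
rewrite add0r mxE; apply: eq_bigr => b _; rewrite mulrC [gradp _ _ _ _]mxE; congr (_ * _); rewrite [RHS]mxE.
rewrite /lift_frame row_mxEr.
have -> : mom (delta_mx 0 (rshift n a) : 'rV[R]_(n + n)) = delta_mx 0 a.
  by apply/rowP => j; rewrite !mxE eqxx /= (inj_eq (@rshift_inj _ _)).
by rewrite -rowE mxE.
Qed.

Lemma poisson_lift f h z : elementary f -> elementary h ->
  poisson F e (f \o lift_frame) (h \o lift_frame) z = poisson F' e f h (lift_frame z).
Proof.
move=> ef eh; rewrite !poissonE (gradq_lift _ ef) (gradq_lift _ eh) (gradp_lift _ ef) (gradp_lift _ eh) pos_lift FE.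
have c (X Y : 'rV[R]_n) : X *m B^T *m (Y *m B^T)^T = X *m Y^T.
  by rewrite trmx_mul trmxK mulmxA -(mulmxA X) BB' mulmx1.
rewrite !c; congr (_ - _ * _).
by rewrite trmx_mul trmxK !mulmxA -(mulmxA _ B^T) BB' mulmx1 -(mulmxA _ B^T) BB' mulmx1.
Qed.

Lemma dense_lift (O : set 'rV[R]_(n + n)) : open O -> dense O ->
  open (lift_frame @^-1` O) /\ dense (lift_frame @^-1` O).
Proof.
move=> oO dO; have cT := elementary_continuous lift_frame_elementary.
split; first by apply: open_comp => // x _; exact: cT.
move=> U [x Ux] oU.
pose T' (z : 'rV[R]_(n + n)) : 'rV[R]_(n + n) := row_mx (pos z *m B^T) (mom z *m B^T).
have TT' z : lift_frame (T' z) = z.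
  rewrite /lift_frame /T' /pos /mom row_mxKl row_mxKr -!mulmxA BB' !mulmx1.
  exact: hsubmxK.
have T'T z : T' (lift_frame z) = z.
  rewrite /lift_frame /T' /pos /mom row_mxKl row_mxKr -!mulmxA BB !mulmx1.
  exact: hsubmxK.
have cT' : continuous T'.
  apply: elementary_continuous => i.
  rewrite (_ : (fun z => _) = fun z => (z *m block_mx B^T 0 0 B^T) 0 i).
    exact: elementary_mul_row.
  apply/funext => z; rewrite /T' -{3}[z]hsubmxK mul_row_block !mulmx0 addr0 add0r.
  by [].
have oU' : open (T' @^-1` U) by apply: open_comp => // y _; exact: cT'.
have [|y [U'y Oy]] := dO (T' @^-1` U) _ oU'.
  by exists (lift_frame x); rewrite /= T'T.
by exists (T' y); split=> //=; rewrite TT'.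
Qed.

Lemma liouville_lift (I : 'I_n -> 'rV[R]_(n + n) -> R) (O : set 'rV[R]_(n + n)) :
  (exists i0, I i0 = hamiltonian g') -> (forall i, elementary (I i)) ->
  (forall i j z, poisson F' e (I i) (I j) z = 0) -> open O -> dense O ->
  (forall z, O z -> row_free (\matrix_(i, a) differential (I i) z 0 a)) ->
  liouville_integrable F e (hamiltonian g).
Proof.
move=> [i0 Ii0] eI inv oO dO fr; exists (fun i => I i \o lift_frame).
have hE : I i0 \o lift_frame = hamiltonian g.
  by apply/funext => z; rewrite /= Ii0 -hamiltonian_lift.
have PI i j z : poisson F e (I i \o lift_frame) (I j \o lift_frame) z = 0.
  by rewrite poisson_lift.
split=> //; first by exists i0.
  move=> i; split.
    by apply: elementary_smooth; [exact: openT|apply: elementary_comp => // j; exact: lift_frame_elementary].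
  by move=> z; rewrite -hE.
have [oO' dO'] := dense_lift oO dO.
exists (lift_frame @^-1` O); split=> // z Oz.
have -> : \matrix_(i, a) differential (I i \o lift_frame) z 0 a
   = (\matrix_(i, a) differential (I i) (lift_frame z) 0 a) *m block_mx B^T 0 0 B^T.
  apply/row_matrixP => i; rewrite row_mul.
  have rE (f : 'I_n -> 'rV[R]_(n + n)) k : row k (\matrix_(i, a) f i 0 a) = f k.
    by apply/rowP => a; rewrite !mxE.
  rewrite !rE !differentialE gradq_lift// gradp_lift// mul_row_block !mulmx0.
  by rewrite addr0 add0r.
have u : block_mx B^T 0 0 B^T \in unitmx :> bool.
  have : block_mx B^T 0 0 B^T *m block_mx B 0 0 B = 1%:M.
    by rewrite mulmx_block !mulmx0 !mul0mx !addr0 !add0r BB' -scalar_mx_block.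
  by move=> /mulmx1_unit[].
by rewrite /row_free mxrankMfree ?row_free_unit//; exact: fr.
Qed.

End Transport.

(** * Separation of the energy *)

Section Generators.
Context {R : realType}.
Variables (kappa e : R).
Implicit Types (v f h : nat -> R).

Definition grad v (E : expr) : nat -> R := fun i => interp v (D (kron i) E).

Definition FvE v (a b : nat) : R := interp v (FE kappa 2 a b).

(* The bracket of dP /\ dq + e F in terms of gradients; the coordinates q_a
   have index a and the momenta P_a index 4 + a. *)
Definition bracket v f h : R :=
  (f 0%N * h 4%N - f 4%N * h 0%N) + (f 1%N * h 5%N - f 5%N * h 1%N)
  + (f 2%N * h 6%N - f 6%N * h 2%N) + (f 3%N * h 7%N - f 7%N * h 3%N)
  - e * (FvE v 0 1 * (h 4%N * f 5%N - h 5%N * f 4%N)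
       + FvE v 0 2 * (h 4%N * f 6%N - h 6%N * f 4%N)
       + FvE v 0 3 * (h 4%N * f 7%N - h 7%N * f 4%N)
       + FvE v 1 2 * (h 5%N * f 6%N - h 6%N * f 5%N)
       + FvE v 1 3 * (h 5%N * f 7%N - h 7%N * f 5%N)
       + FvE v 2 3 * (h 6%N * f 7%N - h 7%N * f 6%N)).

Definition sq (E : expr) : @expr R := EMul E E.
Definition Sub (a b : expr) : @expr R := EAdd a (EOpp b).

Definition N1 := EAdd (sq (EVar 0)) (sq (EVar 1)).
Definition N2 := EAdd (sq (EVar 2)) (sq (EVar 3)).
Definition J1 := Sub (EMul (EVar 0) (EVar 5)) (EMul (EVar 1) (EVar 4)).
Definition J2 := Sub (EMul (EVar 2) (EVar 7)) (EMul (EVar 3) (EVar 6)).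
(** Coefficients of the potential Phi = [half1] (y_0 dy_1 - y_1 dy_0) - [half2] (y_2 dy_3 - y_3
    dy_2) of the third form. The coefficient in each plane depends on the radius of the other
    plane. *)
Definition half1 := EAdd (ECst (2^-1)) (EMul (ECst (kappa / 2)) N2).
Definition half2 := EAdd (ECst (2^-1)) (EMul (ECst (kappa / 2)) N1).
(** Values of the canonical momentum P + e Phi on the two rotation fields; as Phi is invariant under
    the rotations, these are their Noether integrals. In the sum the products N_1 N_2 cancel: L_1 +
    L_2 = J_1 + J_2 + (e / 2) (N_1 - N_2). *)
Definition L1 := EAdd J1 (EMul (ECst e) (EMul N1 half1)).
Definition L2 := Sub J2 (EMul (ECst e) (EMul N2 half2)).
(** Squared length of P + e Phi in each plane. Functions of canonical variables from different
    planes commute, and rotation-invariant functions commute with L_1 and L_2: this is why all the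
    brackets listed next vanish. *)
Definition E1 := EAdd (EAdd (sq (EVar 4)) (sq (EVar 5)))
  (EMul (ECst e) (EMul half1 (EAdd L1 J1))).
Definition E2 := Sub (EAdd (sq (EVar 6)) (sq (EVar 7)))
  (EMul (ECst e) (EMul half2 (EAdd L2 J2))).

Ltac bracket0 := rewrite /bracket /grad /FvE /= /kron /=; by field.

Lemma N1_N2 v : bracket v (grad v N1) (grad v N2) = 0. Proof. bracket0. Qed.
Lemma N1_L1 v : bracket v (grad v N1) (grad v L1) = 0. Proof. bracket0. Qed.
Lemma N1_L2 v : bracket v (grad v N1) (grad v L2) = 0. Proof. bracket0. Qed.
Lemma N2_L1 v : bracket v (grad v N2) (grad v L1) = 0. Proof. bracket0. Qed.
Lemma N2_L2 v : bracket v (grad v N2) (grad v L2) = 0. Proof. bracket0. Qed.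
Lemma L1_L2 v : bracket v (grad v L1) (grad v L2) = 0. Proof. bracket0. Qed.
Lemma E1_N2 v : bracket v (grad v E1) (grad v N2) = 0. Proof. bracket0. Qed.
Lemma E1_L1 v : bracket v (grad v E1) (grad v L1) = 0. Proof. bracket0. Qed.
Lemma E1_L2 v : bracket v (grad v E1) (grad v L2) = 0. Proof. bracket0. Qed.
Lemma E2_N1 v : bracket v (grad v E2) (grad v N1) = 0. Proof. bracket0. Qed.
Lemma E2_L1 v : bracket v (grad v E2) (grad v L1) = 0. Proof. bracket0. Qed.
Lemma E2_L2 v : bracket v (grad v E2) (grad v L2) = 0. Proof. bracket0. Qed.
Lemma E1_E2 v : bracket v (grad v E1) (grad v E2) = 0. Proof. bracket0. Qed.

Lemma bracket_comb v (x1 x2 x3 x4 x5 x6 f h : nat -> R)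
  (a1 a2 a3 a4 a5 a6 b1 b2 b3 b4 b5 b6 : R) :
  (forall i, f i = a1 * x1 i + a2 * x2 i + a3 * x3 i + a4 * x4 i + a5 * x5 i + a6 * x6 i) ->
  (forall i, h i = b1 * x1 i + b2 * x2 i + b3 * x3 i + b4 * x4 i + b5 * x5 i + b6 * x6 i) ->
  bracket v f h =
    (a1 * b2 - a2 * b1) * bracket v x1 x2 + (a1 * b3 - a3 * b1) * bracket v x1 x3
  + (a1 * b4 - a4 * b1) * bracket v x1 x4 + (a1 * b5 - a5 * b1) * bracket v x1 x5
  + (a1 * b6 - a6 * b1) * bracket v x1 x6 + (a2 * b3 - a3 * b2) * bracket v x2 x3
  + (a2 * b4 - a4 * b2) * bracket v x2 x4 + (a2 * b5 - a5 * b2) * bracket v x2 x5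
  + (a2 * b6 - a6 * b2) * bracket v x2 x6 + (a3 * b4 - a4 * b3) * bracket v x3 x4
  + (a3 * b5 - a5 * b3) * bracket v x3 x5 + (a3 * b6 - a6 * b3) * bracket v x3 x6
  + (a4 * b5 - a5 * b4) * bracket v x4 x5 + (a4 * b6 - a6 * b4) * bracket v x4 x6
  + (a5 * b6 - a6 * b5) * bracket v x5 x6.
Proof.
move=> hf hh; rewrite /bracket.
move: (FvE v 0 1) (FvE v 0 2) (FvE v 0 3) (FvE v 1 2) (FvE v 1 3) (FvE v 2 3).
move=> F01 F02 F03 F12 F13 F23.
rewrite !hf !hh; ring.
Qed.

(* Spans of the gradients of E1, E2, N1, N2, L1, L2, whose only nonzero mutual
   brackets are those of E1 with N1 and of E2 with N2. *)
Definition spanned v (f : nat -> R) (a1 a2 b1 b2 c1 c2 : R) := forall i,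
  f i = a1 * grad v E1 i + a2 * grad v E2 i + b1 * grad v N1 i + b2 * grad v N2 i
    + c1 * grad v L1 i + c2 * grad v L2 i.

(** Only the brackets of E_1 with N_1 and of E_2 with N_2 survive; their coefficients are the two
    minors that the last hypotheses set to zero. *)
Lemma bracket_spanned v f h a1 a2 b1 b2 c1 c2 a1' a2' b1' b2' c1' c2' :
  spanned v f a1 a2 b1 b2 c1 c2 -> spanned v h a1' a2' b1' b2' c1' c2' ->
  a1 * b1' = b1 * a1' -> a2 * b2' = b2 * a2' -> bracket v f h = 0.
Proof.
move=> hf hh e1 e2; rewrite (bracket_comb v hf hh).
rewrite E1_E2 E1_N2 E1_L1 E1_L2 E2_N1 E2_L1 E2_L2 N1_N2 N1_L1 N1_L2 N2_L1 N2_L2 L1_L2.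
by rewrite e1 e2 !subrr !(mulr0, mul0r, addr0).
Qed.

Section Separated.
Variables (A1 A2 M1 M2 K1 K2 : @expr R).

Definition ssum := EAdd K1 K2.
(** What h_1 contains besides E_1 once P is replaced by the canonical momentum. Since J_1 + J_2 =
    L_1 + L_2 - (e / 2) (N_1 - N_2), the mixed terms of kappa (w + 1) (J_1 + J_2)^2 cancel against
    those of |P|^2. Each remaining term goes to its plane, and 2 kappa (L_1 + L_2)^2 is assigned to
    [tau2]. The arguments are abstract because they will be phase-space functions here and
    separation constants later. *)
Definition tau1 : expr :=
  EAdd (EAdd (EAdd (EMul (ECst (- e)) K1) (EMul (ECst (kappa * e)) (EMul K2 M1)))
    (EAdd (EMul (ECst (e ^+ 2 / 4)) M1) (EMul (ECst (kappa ^+ 2)) (EMul M1 (sq ssum)))))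
  (EAdd (EMul (ECst (- e)) (EMul ssum (EAdd (EMul (ECst (kappa ^+ 2)) (sq M1))
       (EMul (ECst (2 * kappa)) M1))))
    (EMul (ECst (e ^+ 2 / 4)) (EMul (sq M1) (EAdd (EMul (ECst (kappa ^+ 2)) M1) (ECst (2 * kappa)))))).
Definition tau2 : expr :=
  EAdd (EAdd (EAdd (EMul (ECst e) K2) (EMul (ECst (- (kappa * e))) (EMul K1 M2)))
    (EAdd (EMul (ECst (e ^+ 2 / 4)) M2) (EMul (ECst (kappa ^+ 2)) (EMul M2 (sq ssum)))))
  (EAdd (EMul (ECst e) (EMul ssum (EAdd (EMul (ECst (kappa ^+ 2)) (sq M2))
       (EMul (ECst (2 * kappa)) M2))))
    (EAdd (EMul (ECst (e ^+ 2 / 4)) (EMul (sq M2) (EAdd (EMul (ECst (kappa ^+ 2)) M2) (ECst (2 * kappa)))))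
      (EMul (ECst (2 * kappa)) (sq ssum)))).
Definition wE8 : expr := EAdd (ECst 1) (EMul (ECst kappa) (EAdd M1 M2)).
Definition HsepE : expr :=
  EMul (ECst (2^-1)) (EMul (EInv wE8) (EAdd (EAdd A1 tau1) (EAdd A2 tau2))).
Definition KsepE : expr :=
  Sub (EMul (ECst (2 * kappa)) (EMul M1 HsepE)) (EAdd A1 tau1).

(** The coefficients are the partial derivatives of H and K in the six arguments: [T1], [T2] are
    those of [tau1], [tau2] in their radius, and [u1], [u2] those in the sum [ssum]. The last two
    equations say that the coefficients of H and K on each pair (A_i, M_i) are proportional; this is
    the commutation of H and K. *)
Lemma grad_separated v : interp v wE8 != 0 ->
  exists a b1 b2 c1 c2 a1' a2' b1' b2' c1' c2' : R, [/\
    a = (2 * interp v wE8)^-1 /\ (a1' = 2 * kappa * interp v M1 * a - 1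
      /\ a2' = 2 * kappa * interp v M1 * a),
    forall d, interp v (D d HsepE) = a * interp v (D d A1) + a * interp v (D d A2)
      + b1 * interp v (D d M1) + b2 * interp v (D d M2)
      + c1 * interp v (D d K1) + c2 * interp v (D d K2),
    forall d, interp v (D d KsepE) = a1' * interp v (D d A1) + a2' * interp v (D d A2)
      + b1' * interp v (D d M1) + b2' * interp v (D d M2)
      + c1' * interp v (D d K1) + c2' * interp v (D d K2),
    a * b1' = b1 * a1' & a * b2' = b2 * a2'].
Proof.
set m1 := interp v M1; set m2 := interp v M2; set k1 := interp v K1; set k2 := interp v K2.
set w := interp v wE8 => w0; set h := interp v HsepE; set s := k1 + k2.
pose T1 := kappa * e * k2 + e ^+ 2 / 4 + kappa ^+ 2 * s ^+ 2
  - e * s * (2 * kappa ^+ 2 * m1 + 2 * kappa)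
  + e ^+ 2 / 4 * (3 * kappa ^+ 2 * m1 ^+ 2 + 4 * kappa * m1).
pose T2 := - (kappa * e * k1) + e ^+ 2 / 4 + kappa ^+ 2 * s ^+ 2
  + e * s * (2 * kappa ^+ 2 * m2 + 2 * kappa)
  + e ^+ 2 / 4 * (3 * kappa ^+ 2 * m2 ^+ 2 + 4 * kappa * m2).
pose u1 := 2 * kappa ^+ 2 * m1 * s - e * (kappa ^+ 2 * m1 ^+ 2 + 2 * kappa * m1).
pose u2 := 2 * kappa ^+ 2 * m2 * s + e * (kappa ^+ 2 * m2 ^+ 2 + 2 * kappa * m2) + 4 * kappa * s.
pose a := (2 * w)^-1.
pose b1 := T1 * a - h * kappa / w. pose b2 := T2 * a - h * kappa / w.
pose c1 := (- e + u1 - kappa * e * m2 + u2) * a.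
pose c2 := (kappa * e * m1 + u1 + e + u2) * a.
have hE d : interp v (D d HsepE) = a * interp v (D d A1) + a * interp v (D d A2)
      + b1 * interp v (D d M1) + b2 * interp v (D d M2)
      + c1 * interp v (D d K1) + c2 * interp v (D d K2).
  rewrite /b1 /b2 /c1 /c2 /a /T1 /T2 /u1 /u2 /s /h /=.
  move: w0; rewrite /w /= -/m1 -/m2 -/k1 -/k2.
  clear c2 c1 b2 b1 a u2 u1 T2 T1 s h w.
  move: m1 m2 k1 k2 (interp v A1) (interp v A2) => n1 n2 l1 l2 x1 x2.
  move: (interp v (D d A1)) (interp v (D d A2)) (interp v (D d M1)) (interp v (D d M2))
    (interp v (D d K1)) (interp v (D d K2)) => d1 d2 d3 d4 d5 d6 w0.
  by field.
exists a, b1, b2, c1, c2, (2 * kappa * m1 * a - 1), (2 * kappa * m1 * a),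
  (2 * kappa * h + 2 * kappa * m1 * b1 - T1), (2 * kappa * m1 * b2),
  (2 * kappa * m1 * c1 - (- e + u1)), (2 * kappa * m1 * c2 - (kappa * e * m1 + u1)).
split=> //.
- move=> d; have -> : interp v (D d KsepE) = 2 * kappa * (interp v (D d M1) * h
    + m1 * interp v (D d HsepE)) - interp v (D d A1) - interp v (D d tau1).
    rewrite /h /m1 /KsepE; move: HsepE => H' /=; ring.
  rewrite hE; rewrite /T1 /u1 /s.
  have -> : interp v (D d tau1) = T1 * interp v (D d M1)
      + (- e + u1) * interp v (D d K1) + (kappa * e * m1 + u1) * interp v (D d K2).
    by rewrite /T1 /u1 /s /m1 /k1 /k2 /=; field.
  rewrite /T1 /u1 /s; ring.
- by rewrite /b1 /a; field.
- by rewrite /b2 /a; field.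
Qed.

End Separated.
End Generators.

(** * Involution and independence of the four integrals *)

Section ModelIntegrals.
Context {R : realType}.
Variables (kappa e : R).
Hypothesis k0 : 0 <= kappa.
Implicit Types z : 'rV[R]_(4 + 4).
Local Notation J4 := (@J4 R).
Local Notation S4 := (@S4 R).
Local Notation g := (gmod kappa J4).
Local Notation F := (Fmod kappa J4 (S4 ord_max)).

Lemma interp_below n (v v' : nat -> R) E : vars_below n E ->
  (forall i, (i < n)%N -> v i = v' i) -> interp v E = interp v' E.
Proof.
move=> + h; elim: E => /= [i /h //|//|a IHa b IHb|a IHa|a IHa b IHb|a IHa|a IHa|a IHa];
  by [move=> /andP[/IHa-> /IHb->]|move=> /IHa->].
Qed.

Lemma rval_pos z i : (i < 4)%N -> rval (pos z) i = rval z i.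
Proof.
move=> i4; rewrite -[i]/(nat_of_ord (Ordinal i4)) rvalE mxE -rvalE.
by [].
Qed.

Lemma rval_mom z i : (i < 4)%N -> rval (mom z) i = rval z (4 + i).
Proof.
move=> i4; rewrite -[X in rval (mom z) X]/(nat_of_ord (Ordinal i4)) rvalE mxE -rvalE.
by [].
Qed.

Lemma kinetic (q P : 'rV[R]_4) : (P *m gmodV kappa J4 q *m P^T) 0 0
  = (wfun kappa q)^-1 * (dot P P + kappa * (wfun kappa q + 1) * dot P (q *m J4) ^+ 2).
Proof.
rewrite /gmodV -scalemxAr -scalemxAl [LHS]mxE mulmxDr mulmx1 mulmxDl addmxE; congr (_ * (_ + _)).
rewrite -scalemxAr -scalemxAl [LHS]mxE; congr (_ * _).
move: (q *m J4) => A.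
rewrite (mulmxA P) -(mulmxA (P *m _)) [LHS]mxE big_ord1 expr2.
by congr (_ * _); exact: dotC.
Qed.

Definition HE := HsepE kappa e (E1 kappa e) (E2 kappa e) N1 N2 (L1 kappa e) (L2 kappa e).
Definition KE := KsepE kappa e (E1 kappa e) (E2 kappa e) N1 N2 (L1 kappa e) (L2 kappa e).

Lemma interp_w8 z : interp (rval z) (wE8 kappa N1 N2) = wfun kappa (pos z).
Proof. by rewrite /wfun sqnE !rval_pos//=; ring. Qed.

Lemma w8_neq0 z : interp (rval z) (wE8 kappa N1 N2) != 0.
Proof. by rewrite interp_w8 gt_eqF// wfun_gt0. Qed.

Lemma valid_HE z : valid (rval z) HE.
Proof. by do ?[split=> //]; exact: w8_neq0. Qed.

Lemma valid_KE z : valid (rval z) KE.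
Proof. by do ?[split=> //]; exact: w8_neq0. Qed.

Lemma rval_mulJ (q : 'rV[R]_4) k : (k < 4)%N ->
  rval (q *m J4) k = [:: - rval q 1; rval q 0; - rval q 3; rval q 2]`_k.
Proof. by move=> k4; rewrite -[X in rval _ X]/(nat_of_ord (Ordinal k4)) rvalE mulJE. Qed.

Lemma hamiltonian_HE z : hamiltonian g z = interp (rval z) HE.
Proof.
rewrite /hamiltonian (gmod_unit _ (@J4_orth R) k0).2 kinetic !dot4E !rval_mulJ//.
rewrite !rval_mom// !rval_pos//= -interp_w8.
have := w8_neq0 z; rewrite /=; move: (rval z) => f w0.
by field.
Qed.

Lemma poisson_bracket E E' z : vars_below 8 E -> vars_below 8 E' ->
  valid (rval z) E -> valid (rval z) E' ->
  poisson F e (fun z => interp (rval z) E) (fun z => interp (rval z) E') z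
  = bracket kappa e (rval z) (grad (rval z) E) (grad (rval z) E').
Proof.
move=> b b' vE vE'.
have gq G k : vars_below 8 G -> valid (rval z) G -> (k < 4)%N ->
    rval (gradq (fun z => interp (rval z) G) z) k = grad (rval z) G k.
  move=> bG vG k4; rewrite -[X in rval _ X]/(nat_of_ord (Ordinal k4)) rvalE mxE.
  exact: (pd_interp_below (lshift 4 (Ordinal k4)) bG vG).
have gp G k : vars_below 8 G -> valid (rval z) G -> (k < 4)%N ->
    rval (gradp (fun z => interp (rval z) G) z) k = grad (rval z) G (4 + k)%N.
  move=> bG vG k4; rewrite -[X in rval _ X]/(nat_of_ord (Ordinal k4)) rvalE mxE.
  exact: (pd_interp_below (rshift 4 (Ordinal k4)) bG vG).
have aux (u u' p p' : 'rV[R]_4) (f h : nat -> R) :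
    (forall k, (k < 4)%N -> rval u k = f k) -> (forall k, (k < 4)%N -> rval p k = f (4 + k)%N) ->
    (forall k, (k < 4)%N -> rval u' k = h k) -> (forall k, (k < 4)%N -> rval p' k = h (4 + k)%N) ->
    (u *m p'^T) 0 0 - (p *m u'^T) 0 0 - e * (p' *m F (pos z) *m p^T) 0 0
    = bracket kappa e (rval z) f h.
  move=> hu hp hu' hp'; rewrite -!/(dot _ _) !dot4E.
  have mF k (k4 : (k < 4)%N) : rval (p' *m F (pos z)) k =
      rval p' 0 * FvE kappa (rval z) 0 k + rval p' 1 * FvE kappa (rval z) 1 k
      + rval p' 2 * FvE kappa (rval z) 2 k + rval p' 3 * FvE kappa (rval z) 3 k.
    rewrite -[X in rval _ X]/(nat_of_ord (Ordinal k4)) rvalE mulrow4E -!interp_FE.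
    have h1 a : (a < 4)%N -> interp (rval (pos z)) (FE kappa 2 a k) = FvE kappa (rval z) a k.
      move=> a4; apply: (@interp_below 4); last by move=> i i4; exact: rval_pos.
      by move: a k a4 k4 => [|[|[|[|//]]]] [|[|[|[|//]]]].
    by rewrite -!h1.
  rewrite !mF// !hu// !hp// !hu'// !hp'// /bracket /FvE /=.
  move: (rval z) => v; ring.
rewrite poissonE; apply: aux => k k4; [exact: gq|exact: gp|exact: gq|exact: gp].
Qed.

Definition integralE (i : nat) : expr := nth HE [:: HE; L1 kappa e; L2 kappa e; KE] i.

Lemma valid_integral i z : valid (rval z) (integralE i).
Proof.
rewrite /integralE; case: i => [|[|[|[|i]]]].
- exact: valid_HE.
- exact: polynomial_valid.
- exact: polynomial_valid.
- exact: valid_KE.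
- by rewrite nth_default//; exact: valid_HE.
Qed.

Lemma integral_below i : (i < 4)%N -> vars_below 8 (integralE i).
Proof. by case: i => [|[|[|[|//]]]]. Qed.

Lemma integrals_involution i j z : (i < 4)%N -> (j < 4)%N ->
  bracket kappa e (rval z) (grad (rval z) (integralE i)) (grad (rval z) (integralE j)) = 0.
Proof.
have [a [b1 [b2 [c1 [c2 [a1' [a2' [b1' [b2' [c1' [c2' [_ hH hK r1 r2]]]]]]]]]]]] :=
  grad_separated e (E1 kappa e) (E2 kappa e) (L1 kappa e) (L2 kappa e) (w8_neq0 z).
have sH : spanned kappa e (rval z) (grad (rval z) HE) a a b1 b2 c1 c2 by move=> k; exact: hH.
have sK : spanned kappa e (rval z) (grad (rval z) KE) a1' a2' b1' b2' c1' c2' by move=> k; exact: hK.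
have sL1 : spanned kappa e (rval z) (grad (rval z) (L1 kappa e)) 0 0 0 0 1 0.
  by move=> k; rewrite !mul0r mul1r !add0r addr0.
have sL2 : spanned kappa e (rval z) (grad (rval z) (L2 kappa e)) 0 0 0 0 0 1.
  by move=> k; rewrite !mul0r mul1r !add0r.
have sp i' : (i' < 4)%N -> exists x1 x2 y1 y2 w1 w2 : R,
    spanned kappa e (rval z) (grad (rval z) (integralE i')) x1 x2 y1 y2 w1 w2 /\
    ([\/ [/\ x1 = 0, x2 = 0, y1 = 0 & y2 = 0], [/\ x1 = a, x2 = a, y1 = b1 & y2 = b2] |
         [/\ x1 = a1', x2 = a2', y1 = b1' & y2 = b2']]).
  case: i' => [|[|[|[|//]]]] _.
  - by exists a, a, b1, b2, c1, c2; split; [exact: sH|constructor 2].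
  - by exists 0, 0, 0, 0, 1, 0; split; [exact: sL1|constructor 1].
  - by exists 0, 0, 0, 0, 0, 1; split; [exact: sL2|constructor 1].
  - by exists a1', a2', b1', b2', c1', c2'; split; [exact: sK|constructor 3].
move=> /sp[x1 [x2 [y1 [y2 [w1 [w2 [hf cf]]]]]]] /sp[x1' [x2' [y1' [y2' [w1' [w2' [hh ch]]]]]]].
apply: (bracket_spanned hf hh);
  by case: cf => -[f1 f2 f3 f4]; case: ch => -[g1 g2 g3 g4];
    rewrite ?f1 ?f2 ?f3 ?f4 ?g1 ?g2 ?g3 ?g4; move: r1 r2; lra.
Qed.

(** Radius times radial momentum in the plane. Phi has no radial component, so P and P + e Phi give
    the same value. *)
Definition radial1 : @expr R := EAdd (EMul (EVar 0) (EVar 4)) (EMul (EVar 1) (EVar 5)).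
Definition radial2 : @expr R := EAdd (EMul (EVar 2) (EVar 6)) (EMul (EVar 3) (EVar 7)).

(** Varying the momentum along the position of one plane changes, among the six generators, only the
    energy of that plane; varying it along the rotation changes the angular momentum by N_i. These
    four directions are the test vectors for independence. *)
Lemma radial_E d (v : nat -> R) :
  d = (fun i => nth 0 [:: 0; 0; 0; 0; v 0%N; v 1%N; 0; 0] i) ->
  [/\ interp v (D d (E1 kappa e)) = 2 * interp v radial1, interp v (D d (E2 kappa e)) = 0,
      interp v (D d N1) = 0 /\ interp v (D d N2) = 0 &
      interp v (D d (L1 kappa e)) = 0 /\ interp v (D d (L2 kappa e)) = 0].
Proof. by move=> -> /=; do ?split; by field. Qed.

Lemma radial_E' d (v : nat -> R) :
  d = (fun i => nth 0 [:: 0; 0; 0; 0; 0; 0; v 2%N; v 3%N] i) ->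
  [/\ interp v (D d (E2 kappa e)) = 2 * interp v radial2, interp v (D d (E1 kappa e)) = 0,
      interp v (D d N1) = 0 /\ interp v (D d N2) = 0 &
      interp v (D d (L1 kappa e)) = 0 /\ interp v (D d (L2 kappa e)) = 0].
Proof. by move=> -> /=; do ?split; by field. Qed.

Lemma angular_L d (v : nat -> R) :
  d = (fun i => nth 0 [:: 0; 0; 0; 0; - v 1%N; v 0%N; 0; 0] i) ->
  interp v (D d (L1 kappa e)) = interp v N1 /\ interp v (D d (L2 kappa e)) = 0.
Proof. by move=> -> /=; split; by field. Qed.

Lemma angular_L' d (v : nat -> R) :
  d = (fun i => nth 0 [:: 0; 0; 0; 0; 0; 0; - v 3%N; v 2%N] i) ->
  interp v (D d (L2 kappa e)) = interp v N2 /\ interp v (D d (L1 kappa e)) = 0.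
Proof. by move=> -> /=; split; by field. Qed.

Definition radial : @expr R := EMul radial1 radial2.

(** Evaluate a vanishing combination of the gradients on the four test directions. On the radial
    ones H contributes (a, a) and K contributes (2 kappa n_1 a - 1, 2 kappa n_1 a); the difference
    of the two equations removes K, then H. The rotations remove L_1 and L_2. *)
Lemma integrals_independent z : interp (rval z) radial != 0 ->
  row_free (\matrix_(i < 4, a < 4 + 4) differential (fun z => interp (rval z) (integralE i)) z 0 a).
Proof.
rewrite /= mulf_eq0 negb_or => /andP[r1 r2].
apply: inj_row_free => c hc.
have comb (d : nat -> R) : \sum_(k < 4) c 0 k * interp (rval z) (D d (integralE k)) = 0.
  transitivity (\sum_(k < 4) c 0 k * \sum_(a < 4 + 4) d a * interp (rval z) (D (kron a) (integralE k))).
    apply: eq_bigr => k _; congr (_ * _); rewrite -D_sum.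
    apply: (D_eq_below _ (integral_below (ltn_ord k))) => i i8.
    rewrite (bigD1 (Ordinal i8 : 'I_(4 + 4)))//= /kron eqxx mulr1 big1 ?addr0// => j.
    by rewrite -val_eqE /= eq_sym => /negbTE ->; rewrite mulr0.
  under eq_bigr do rewrite mulr_sumr.
  rewrite exchange_big big1// => a _.
  transitivity (d a * (c *m (\matrix_(i < 4, a < 4 + 4) differential (fun z => interp (rval z) (integralE i)) z 0 a)) 0 a).
    rewrite mxE mulr_sumr; apply: eq_bigr => k _; rewrite [in RHS]mxE mulrCA; congr (_ * (_ * _)).
    rewrite mxE; apply/esym/pd_interp_below; last exact: valid_integral.
    exact: integral_below (ltn_ord k).
  by rewrite hc mxE mulr0.
have [a [b1 [b2 [c1 [c2 [a1' [a2' [b1' [b2' [c1' [c2' [[aE [a1E a2E]] hH hK _ _]]]]]]]]]]]] :=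
  grad_separated e (E1 kappa e) (E2 kappa e) (L1 kappa e) (L2 kappa e) (w8_neq0 z).
have a0 : a != 0 by rewrite aE invr_eq0 mulf_neq0// w8_neq0.
have C (d : nat -> R) : rval c 0 * interp (rval z) (D d HE)
    + rval c 1 * interp (rval z) (D d (L1 kappa e)) + rval c 2 * interp (rval z) (D d (L2 kappa e))
    + rval c 3 * interp (rval z) (D d KE) = 0.
  by rewrite -[RHS](comb d) !big_ord_recl big_ord0 -!rvalE addr0 !addrA.
have q1 : rval c 0 * a + rval c 3 * a1' = 0.
  have := C (fun i => nth 0 [:: 0; 0; 0; 0; rval z 0; rval z 1; 0; 0] i).
  rewrite hH hK; have [-> -> [-> ->] [-> ->]] := @radial_E _ (rval z) (erefl _).
  move: r1; set r := interp _ radial1 => r0 h.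
  have t0 : 2 * r != 0 by rewrite mulf_neq0 ?pnatr_eq0.
  by apply: (mulIf t0); rewrite mul0r -[RHS]h; ring.
have q2 : rval c 0 * a + rval c 3 * a2' = 0.
  have := C (fun i => nth 0 [:: 0; 0; 0; 0; 0; 0; rval z 2; rval z 3] i).
  rewrite hH hK; have [-> -> [-> ->] [-> ->]] := @radial_E' _ (rval z) (erefl _).
  move: r2; set r := interp _ radial2 => r0 h.
  have t0 : 2 * r != 0 by rewrite mulf_neq0 ?pnatr_eq0.
  by apply: (mulIf t0); rewrite mul0r -[RHS]h; ring.
have c3 : rval c 3 = 0 by move: q1 q2; rewrite a1E a2E; lra.
have c0 : rval c 0 = 0.
  by move: q2; rewrite c3 mul0r addr0 => /eqP; rewrite mulf_eq0 (negbTE a0) orbF => /eqP.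
have N1n : interp (rval z) N1 != 0.
  apply: contra_neq r1 => /= h.
  have [x0 x1] : rval z 0 = 0 /\ rval z 1 = 0.
    by have := (sqr_ge0 (rval z 0), sqr_ge0 (rval z 1)); case=> s1 s2; split; apply/eqP;
      rewrite -sqrf_eq0; apply/eqP; lra.
  by rewrite x0 x1 !mul0r addr0.
have N2n : interp (rval z) N2 != 0.
  apply: contra_neq r2 => /= h.
  have [x0 x1] : rval z 2 = 0 /\ rval z 3 = 0.
    by have := (sqr_ge0 (rval z 2), sqr_ge0 (rval z 3)); case=> s1 s2; split; apply/eqP;
      rewrite -sqrf_eq0; apply/eqP; lra.
  by rewrite x0 x1 !mul0r addr0.
have cc1 : rval c 1 = 0.
  have := C (fun i => nth 0 [:: 0; 0; 0; 0; - rval z 1; rval z 0; 0; 0] i).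
  rewrite c0 c3 !mul0r; have [-> ->] := @angular_L _ (rval z) (erefl _).
  by rewrite mulr0 addr0 addr0 add0r => /eqP; rewrite mulf_eq0 (negbTE N1n) orbF => /eqP.
have cc2 : rval c 2 = 0.
  have := C (fun i => nth 0 [:: 0; 0; 0; 0; 0; 0; - rval z 3; rval z 2] i).
  rewrite c0 c3 !mul0r; have [-> ->] := @angular_L' _ (rval z) (erefl _).
  by rewrite mulr0 addr0 !add0r => /eqP; rewrite mulf_eq0 (negbTE N2n) orbF => /eqP.
apply/rowP => i; rewrite [RHS]mxE -rvalE.
by case: i => [[|[|[|[|//]]]] Hi].
Qed.

End ModelIntegrals.

Lemma tn_liouville (R : realType) (m e : R) (c : 'rV[R]_3) : 0 <= m ->
  \sum_i c 0 i ^+ 2 = 1 -> liouville_integrable (tn_F m c) e (hamiltonian (tn_metric m)).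
Proof.
move=> m0 c1; have [p hp] := adapted_point c1.
have [|B [BB gE FE _ _]] := @tn_adapted R m c (p *m (frame0 m)^T) m0 c1.
  have -> : p *m (frame0 m)^T *m frame0 m = p.
    by rewrite -mulmxA (mulmx1C (frame0_orth m)) mulmx1.
  exact: hp.
have k0 := kap_ge0 m.
have gU q := (gmod_unit q (@J4_orth R) k0).1.
have r1 : interp (rval (row_mx (const_mx 1) (const_mx 1) : 'rV[R]_(4 + 4))) radial != 0.
  have o k : (k < 8)%N -> rval (row_mx (const_mx 1) (const_mx 1) : 'rV[R]_(4 + 4)) k = 1.
    move=> k8; rewrite -[k]/(nat_of_ord (Ordinal k8 : 'I_(4 + 4))) rvalE mxE.
    by case: splitP => j _; rewrite mxE.
  by rewrite /= !o// mulf_neq0//; rewrite mulr1 -natrD pnatr_eq0.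
apply: (liouville_lift BB gE FE gU
  (I := fun i z => interp (rval z) (integralE (kap m) e i))
  (O := [set z : 'rV[R]_(4 + 4) | interp (rval z) radial != 0])).
- by exists 0; apply/funext => z; rewrite (hamiltonian_HE e k0).
- by move=> i; exists (integralE (kap m) e i) => z; split=> //; exact: valid_integral.
- move=> i j z; rewrite poisson_bracket ?integral_below ?ltn_ord//; try exact: valid_integral.
  by apply: integrals_involution; rewrite ?ltn_ord.
- exact: open_neq0.
- exact: (@dense_neq0 R _ radial (row_mx (const_mx 1) (const_mx 1))).
- by move=> z; exact: integrals_independent.
Qed.

(** * Integrals depending on a parameter *)

Section ParametricIntegral.
Context {R : realType}.

Lemma interp_cvg (T : Type) (G : set_system T) (FG : Filter G) (V : T -> nat -> R)
    (v : nat -> R) (E : expr) :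
  (forall i, (fun t => V t i) @ G --> v i) -> valid v E ->
  (fun t => interp (V t) E) @ G --> interp v E.
Proof.
move=> hV; elim: E => /= [i _|c _|a IHa b IHb [/IHa ha /IHb hb]|a IHa /IHa ha|
   a IHa b IHb [/IHa ha /IHb hb]|a IHa [/IHa ha a0]|a IHa [/IHa ha a0]|a IHa /IHa ha].
- exact: hV.
- exact: cvg_cst.
- exact: cvgD.
- exact: cvgN.
- exact: cvgM.
- exact: cvgV.
- by apply: (cvg_comp _ _ ha); exact: sqrt_continuous.
- by apply: (cvg_comp _ _ ha); exact: continuous_atan.
Qed.

Lemma near_valid (T : Type) (G : set_system T) (FG : Filter G) (V : T -> nat -> R)
    (v : nat -> R) (E : expr) :
  (forall i, (fun t => V t i) @ G --> v i) -> valid v E ->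
  \forall t \near G, valid (V t) E.
Proof.
move=> hV; elim: E => /= [i _|c _|a IHa b IHb [/IHa ha /IHb hb]|a IHa /IHa ha|
   a IHa b IHb [/IHa ha /IHb hb]|a IHa [va a0]|a IHa [va a0]|a IHa /IHa ha] //.
- exact: nearW.
- exact: nearW.
- exact: filterI.
- exact: filterI.
- apply: filterI; first exact: IHa.
  exact: cvgr_neq0 _ (interp_cvg FG hV va) a0.
- apply: filterI; first exact: IHa.
  exact: cvgr_gt _ (interp_cvg FG hV va) _ a0.
Qed.

Lemma D_subst v d s (E : @expr R) : interp v (D d (subst s E))
  = interp (fun i => interp v (s i)) (D (fun i => interp v (D d (s i))) E).
Proof.
elim: E => //= [a -> b ->|a ->|a -> b ->|a ->|a ->|a ->] //;
  by rewrite ?interp_subst.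
Qed.

Context {n : nat}.
Implicit Types (x v : 'rV[R]_n) (s : R) (E : @expr R).

(* The variable n is the parameter of integration. *)
Definition ival x s : nat -> R := fun i => if i == n then s else rval x i.
Definition idir v : nat -> R := fun i => if i == n then 0 else rval v i.
Definition freeze s : nat -> @expr R := fun i => if i == n then ECst s else EVar i.

Lemma interp_freeze x s E : interp (rval x) (subst (freeze s) E) = interp (ival x s) E.
Proof. by rewrite interp_subst; apply: interp_eq => i; rewrite /freeze /ival; case: eqP. Qed.

Lemma D_freeze x v s E :
  interp (rval x) (D (rval v) (subst (freeze s) E)) = interp (ival x s) (D (idir v) E).
Proof.
rewrite D_subst; transitivity (interp (ival x s)
    (D (fun i => interp (rval x) (D (rval v) (freeze s i))) E)).
  by apply: interp_eq => i; rewrite /freeze /ival; case: eqP.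
by apply: D_eq => i; rewrite /freeze /idir; case: eqP.
Qed.

Lemma valid_freeze x s E : valid (ival x s) E -> valid (rval x) (subst (freeze s) E).
Proof.
move=> h; apply: valid_subst; first by move=> i; rewrite /freeze; case: eqP.
by apply: valid_eq h => i; rewrite /freeze /ival; case: eqP.
Qed.

Lemma ival_cvg x s i :
  (fun p : R * 'rV[R]_n => ival p.2 p.1 i) @ filter_prod (nbhs s) (nbhs x) --> ival x s i.
Proof.
rewrite /ival; case: eqP => _; first exact: cvg_fst.
rewrite /rval; case: insubP => [j _ _|_]; last exact: cvg_cst.
have h : (fun p : R * 'rV[R]_n => p.2) @ filter_prod (nbhs s) (nbhs x) --> x by exact: cvg_snd.
by apply: (@cvg_comp _ _ _ _ (fun y : 'rV[R]_n => y 0 j) _ _ _ h); exact: coord_continuous.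
Qed.

Local Arguments ival_cvg : clear implicits.

Lemma ival_cvgl x s i : (fun r : R => ival x r i) @ s --> ival x s i.
Proof. by rewrite /ival; case: eqP => _; [exact: cvg_id|exact: cvg_cst]. Qed.

Local Arguments ival_cvgl : clear implicits.

Definition unit_itv : set R := `[0, 1]%classic.

Definition good E x := forall s, unit_itv s -> valid (ival x s) E.

Definition integral_interp E x : R :=
  (\int[lebesgue_measure]_(s in unit_itv) interp (ival x s) E)%R.

Lemma unit_itv_near_covering : near_covering unit_itv.
Proof. exact/compact_near_coveringP/segment_compact. Qed.

(** Validity is open jointly in the point and in the parameter; compactness of [0, 1] makes it
    uniform in the parameter. *)
Lemma good_near E x : good E x -> \forall y \near x, good E y.
Proof.
move=> gE; have := @unit_itv_near_covering _ (nbhs x) (fun y s => valid (ival y s) E) (nbhs_filter x).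
move=> h; have FF : Filter (nbhs x) by exact: nbhs_filter.
apply: filterS (h _) => [y hy s|s sI]; first exact: hy.
exact: near_valid (ival_cvg x s) (gE s sI).
Qed.

Lemma open_good E : open [set x | good E x].
Proof. by rewrite openE => x /good_near. Qed.

Lemma good_D E v x : good E x -> good (D (idir v) E) x.
Proof. by move=> gE s sI; apply: valid_D; exact: gE. Qed.

Lemma good_continuous E x : good E x ->
  {within unit_itv, continuous (fun s => interp (ival x s) E)}.
Proof.
move=> gE; apply: continuous_in_subspaceT => s /set_mem sI.
by apply: interp_cvg (gE s sI) => i; exact: ival_cvgl.
Qed.

Lemma good_integrable E x : good E x ->
  lebesgue_measure.-integrable unit_itv (EFin \o (fun s => interp (ival x s) E)).
Proof.
move=> gE; apply: continuous_compact_integrable; first exact: segment_compact.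
exact: good_continuous.
Qed.

Lemma good_uniform E x (eps : R) : good E x -> 0 < eps -> \forall y \near x,
  forall s, unit_itv s -> `|interp (ival y s) E - interp (ival x s) E| <= eps.
Proof.
move=> gE e0; have := @unit_itv_near_covering _ (nbhs x)
  (fun y s => `|interp (ival y s) E - interp (ival x s) E| <= eps) (nbhs_filter x).
have FF : Filter (nbhs x) by exact: nbhs_filter.
apply=> s sI; have e20 : 0 < eps / 2 by rewrite divr_gt0.
have FP : Filter (filter_prod (nbhs s) (nbhs x)) by exact: filter_prod_filter.
have h1 := interp_cvg FP (ival_cvg x s) (gE s sI).
have h2 := interp_cvg (nbhs_filter s) (ival_cvgl x s) (gE s sI).
have {}h2 : (fun p : R * 'rV[R]_n => interp (ival x p.1) E) @ filter_prod (nbhs s) (nbhs x)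
    --> interp (ival x s) E.
  have h3 : (fun p : R * 'rV[R]_n => p.1) @ filter_prod (nbhs s) (nbhs x) --> s by exact: cvg_fst.
exact: cvg_comp h3 h2.
have /cvgrPdist_le/(_ _ e0) := @cvgB _ _ _ _ FP _ _ _ _ h1 h2; apply: filterS => p /=.
by rewrite subrr add0r normrN.
Qed.

Lemma unit_itvM : measurable unit_itv. Proof. exact: measurable_itv. Qed.

Lemma unit_itv_measure : lebesgue_measure unit_itv = 1%E :> \bar R.
Proof. by rewrite lebesgue_measure_itv/= lte_fin ltr01 oppr0 adde0. Qed.

Lemma integral_interp_continuous E x : good E x ->
  {for x, continuous (integral_interp E)}.
Proof.
move=> gE; have FF : Filter (nbhs x) by exact: nbhs_filter.
apply/cvgrPdist_le => eps e0; near=> y.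
have gy : good E y by near: y; exact: good_near.
rewrite distrC -RintegralB; [|exact: unit_itvM|exact: good_integrable|exact: good_integrable].
have ig : lebesgue_measure.-integrable unit_itv (EFin \o
    (fun s => interp (ival y s) E - interp (ival x s) E)).
  rewrite (_ : _ \o _ = ((EFin \o (fun s => interp (ival y s) E)) \-
    (EFin \o (fun s => interp (ival x s) E)))%E)//.
  by apply: integrableB; [exact: unit_itvM|exact: good_integrable|exact: good_integrable].
apply: (le_trans (@le_normr_Rintegral _ (measurableTypeR R) R lebesgue_measure unit_itv _ unit_itvM ig)).
have -> : eps = (\int[lebesgue_measure]_(s in unit_itv) (fun=> eps) s)%R.
  by rewrite (@Rintegral_cst _ (measurableTypeR R) R lebesgue_measure _ unit_itvM) [X in fine X]unit_itv_measure mulr1.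
apply: le_Rintegral.
- exact: unit_itvM.
- exact: integrable_norm ig.
- by apply: continuous_compact_integrable; [exact: segment_compact|
    apply: continuous_subspaceT => ?; exact: cvg_cst].
- by near: y; exact: good_uniform.
Unshelve. all: by end_near. Qed.

Lemma is_derive_ival x v s E : valid (ival x s) E ->
  is_derive x v (fun y => interp (ival y s) E) (interp (ival x s) (D (idir v) E)).
Proof.
move=> vE; have vF := valid_freeze vE.
rewrite -D_freeze -derive_interp//.
rewrite (_ : (fun y => _) = (fun y : 'rV[R]_n => interp (rval y) (subst (freeze s) E))).
  by apply: derivableP; exact: derivable_interp.
by apply/funext => y; rewrite interp_freeze.
Qed.

Lemma is_derive_integral_interp E x v : good E x ->
  is_derive x v (integral_interp E) (integral_interp (D (idir v) E) x).
Proof.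
move=> gE; apply/is_derive_line.
pose f (h : R) (s : R) := interp (ival (h *: v + x) s) E.
have lc : (fun h : R => h *: v + x) @ 0 --> x.
  rewrite -[X in _ --> X]add0r -[X in X + _](scale0r v).
  by apply: cvgD; [apply: cvgZr_tmp; exact: cvg_id|exact: cvg_cst].
have [d d0 hd] : exists2 d : R, 0 < d & forall h, `]- d, d[%classic h ->
    good E (h *: v + x) /\ forall s, unit_itv s ->
      `|interp (ival (h *: v + x) s) (D (idir v) E) - interp (ival x s) (D (idir v) E)| <= 1.
  have n1 : \forall y \near x, good E y /\ forall s, unit_itv s ->
      `|interp (ival y s) (D (idir v) E) - interp (ival x s) (D (idir v) E)| <= 1.
    by apply: filterI; [exact: good_near|apply: good_uniform => //; exact: good_D].
  have := lc _ n1; rewrite near_simpl => /nbhs_ballP[d /= d0 hb]; exists d => // h.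
  rewrite /= in_itv/= => hI; apply: (hb h).
  by rewrite /ball/= sub0r normrN ltr_norml.
pose G s := `|interp (ival x s) (D (idir v) E)| + 1.
have I0 : `]- d, d[%classic (0 : R) by rewrite /= in_itv/= oppr_lt0 d0.
have fd h s : `]- d, d[%classic h -> unit_itv s ->
    is_derive h (1 : R) (f ^~ s) (interp (ival (h *: v + x) s) (D (idir v) E)).
  move=> /hd[gh _] sI; have := is_derive_ival v (gh s sI).
  move=> /is_derive_line => hh; apply/is_derive_line.
  rewrite (_ : (fun s0 : R => f (s0 *: 1 + h) s) =
    (fun s0 : R => interp (ival (s0 *: v + (h *: v + x)) s) E))//.
  by apply/funext => r; rewrite /f [r *: 1]mulr1 scalerDl addrA.
have int1 h : `]- d, d[%classic h -> lebesgue_measure.-integrable unit_itv (EFin \o f h).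
  by move=> /hd[gh _]; exact: good_integrable.
have der1 h s : `]- d, d[%classic h -> unit_itv s -> derivable (f ^~ s) h 1.
  by move=> hI sI; have [] := fd h s hI sI.
have G0 s : 0 <= G s by rewrite addr_ge0.
have cG : {within unit_itv, continuous G}.
  apply: continuous_in_subspaceT => s /set_mem sI.
  apply: cvgD; last exact: cvg_cst.
  by apply: cvg_norm; apply: interp_cvg (good_D v gE sI) => i; exact: ival_cvgl.
have iG : lebesgue_measure.-integrable unit_itv (EFin \o G).
  by apply: continuous_compact_integrable => //; exact: segment_compact.
have d1E h s : `]- d, d[%classic h -> unit_itv s ->
    partial1of2 f h s = interp (ival (h *: v + x) s) (D (idir v) E).
  by move=> hI sI; rewrite partial1of2E; have [_] := fd h s hI sI.
have Gub h s : `]- d, d[%classic h -> unit_itv s -> `|partial1of2 f h s| <= G s.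
  move=> hI sI; rewrite d1E//; have [_ /(_ s sI)] := hd h hI.
  rewrite /G -lerBlDl; apply: le_trans; exact: lerB_dist.
apply: DeriveDef.
  exact: (@derivable_under_integral R _ (measurableTypeR R) lebesgue_measure f unit_itv unit_itvM 0 (- d) d I0 int1 der1 G G0 iG Gub).
rewrite -derive1E.
rewrite (@differentiation_under_integral R _ (measurableTypeR R) lebesgue_measure f unit_itv unit_itvM 0 (- d) d I0 int1 der1 G G0 iG Gub).
apply: eq_Rintegral => s /set_mem sI.
by rewrite d1E// scale0r add0r.
Qed.

Lemma Ck_on_integral_interp k (U : set 'rV[R]_n) E : open U ->
  (forall x, U x -> good E x) -> Ck_on k U (integral_interp E).
Proof.
move=> oU; elim: k E => [|k IH] E gE; split=> //.
- by move=> x /gE; exact: integral_interp_continuous.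
- by move=> x /gE; exact: integral_interp_continuous.
- move=> v; split; first by move=> x /gE/(is_derive_integral_interp v)[].
  apply: (@Ck_on_eq _ _ _ _ _ (integral_interp (D (idir v) E))) => //.
    by move=> x /gE/(is_derive_integral_interp v)[_ ->].
  by apply: IH => x /gE; exact: good_D.
Qed.

(* The parameter n appears in E as the variable of integration, so that
   E is the derivative of H in that direction. *)
Lemma integral_interp_FTC E H x : good H x -> good E x ->
  (forall s, unit_itv s -> interp (ival x s) (D (kron n) H) = interp (ival x s) E) ->
  integral_interp E x = interp (ival x 1) H - interp (ival x 0) H.
Proof.
move=> gH gE dH.
pose h r := interp (ival x r) H.
have dd s : unit_itv s -> is_derive s (1 : R) h (interp (ival x s) E).
  move=> sI; rewrite -dH//.
  (* All variables but the parameter are frozen at their values at [x], so that [H] becomes an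
     expression in one variable and the chain rule for curves applies. *)
  pose sb i : @expr R := if i == n then EVar 0 else ECst (rval x i).
  pose c (r : R) : 'rV[R]_1 := r *: delta_mx 0 0.
  have cE r : rval (c r) 0 = r by rewrite (rvalE _ 0) !mxE eqxx mulr1.
  have sbE r : (fun i => interp (rval (c r)) (sb i)) =1 ival x r.
    by move=> i; rewrite /sb /ival; case: eqP => //= _; rewrite cE.
  have dc : is_derive s (1 : R) c (delta_mx 0 0).
    have := is_derive_affine (delta_mx 0 0 : 'rV[R]_1) 0 s.
    by under [X in is_derive _ _ X _ -> _]eq_fun do rewrite addr0.
  have vs : valid (rval (c s)) (subst sb H).
    apply: valid_subst; first by move=> i; rewrite /sb; case: eqP.
    by apply: valid_eq (gH s sI) => i; rewrite sbE.
  have := is_derive_interp_curve dc vs.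
  rewrite D_subst (interp_eq _ (sbE s)).
  rewrite (@D_eq _ _ (kron n)); last first.
    move=> i; rewrite /sb /kron; case: eqP => //= _.
    by rewrite (rvalE _ 0) mxE eqxx.
  rewrite (_ : (fun r => interp (rval (c r)) (subst sb H)) = h)//.
  by apply/funext => r; rewrite interp_subst (interp_eq _ (sbE r)).
have ch s : unit_itv s -> {for s, continuous h}.
  by move=> /dd[dh _]; apply: differentiable_continuous; exact/derivable1_diffP.
rewrite /integral_interp /Rintegral (@continuous_FTC2 _ _ h 0 1).
- by rewrite -EFinB.
- exact: ltr01.
- exact: good_continuous.
- split; first by move=> s /subset_itv_oo_cc/dd[].
  + by apply: cvg_at_right_filter; apply: ch; rewrite /unit_itv/= in_itv/= lexx ler01.
  + by apply: cvg_at_left_filter; apply: ch; rewrite /unit_itv/= in_itv/= lexx ler01.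
- by move=> s /subset_itv_oo_cc/dd[_]; rewrite derive1E.
Qed.

End ParametricIntegral.

(** * The Hamilton-Jacobi equation *)

Section Action.
Context {R : realType}.
Implicit Types (w v : 'rV[R]_(4 + 4)) (N f : @expr R).

(* In f the variable 0 is the radial coordinate and the variables 4 to 7 are
   the constants of separation. *)
Definition at_radius N (i : nat) : expr :=
  if i == 0%N then N else if (4 <= i < 8)%N then EVar i else ECst 0.

Definition chord (n0 : R) N : expr := EAdd (ECst n0) (EMul (EVar 8) (Sub N (ECst n0))).

(* The integral over [0, 1] of the variable 8 is that of f from n0 to N. *)
Definition actionE (n0 : R) N f : expr :=
  EMul (Sub N (ECst n0)) (subst (at_radius (chord n0 N)) f).

Lemma ival_rval n (x : 'rV[R]_n) s i : (i < n)%N -> ival x s i = rval x i.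
Proof. by rewrite /ival => h; case: eqP => // e; rewrite e ltnn in h. Qed.

Lemma ival_last n (x : 'rV[R]_n) s : ival x s n = s.
Proof. by rewrite /ival eqxx. Qed.

Lemma vars_below_D n d (E : @expr R) : vars_below n E -> vars_below n (D d E).
Proof.
elim: E => //= [a IHa b IHb|a IHa b IHb|a IHa|a IHa|a IHa].
- by case/andP => /IHa-> /IHb->.
- by case/andP => ha hb; rewrite IHa// ha IHb// hb.
- by move=> ha; rewrite IHa// ha.
- by move=> ha; rewrite IHa// ha.
- by move=> ha; rewrite IHa// ha.
Qed.

Lemma D_at_radius (u : nat -> R) d N f : (forall i, (4 <= i < 8)%N -> d i = 0) ->
  interp u (D d (subst (at_radius N) f))
  = interp u (D d N) * interp (fun i => interp u (at_radius N i)) (D (kron 0) f).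
Proof.
move=> hd; rewrite D_subst.
rewrite (@D_eq _ _ (fun i => interp u (D d N) * kron 0 i + 0 * kron 0 i)).
  by rewrite D_linear mul0r addr0.
move=> i; rewrite /at_radius /kron mul0r addr0; case: eqP => [_|_]; first by rewrite mulr1.
by case: ifP => [/hd h|_] /=; rewrite ?h mulr0.
Qed.

Lemma is_derive_action (n0 : R) N f w v : vars_below 8 N ->
  (forall i, (4 <= i < 8)%N -> rval v i = 0) -> good (actionE n0 N f) w ->
  is_derive w v (integral_interp (actionE n0 N f))
    (interp (rval w) (D (rval v) N) * interp (rval w) (subst (at_radius N) f)).
Proof.
move=> N8 hv gA; set d := interp (rval w) (D (rval v) N).
pose fc := subst (at_radius (chord n0 N)) f.
have gf : good fc w by move=> s /gA [].
(* With d the derivative of N, the derivative of (N - n0) f(n0 + s (N - n0)) along [v] is the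
   s-derivative of d s f(n0 + s (N - n0)), so the integral telescopes to d f(N). *)
pose H := EMul (ECst d) (EMul (EVar 8) fc).
have gH : good H w by move=> s /gf ?.
have NE s : interp (ival w s) N = interp (rval w) N.
  by apply: interp_below N8 _ => i; exact: ival_rval.
have dNE s : interp (ival w s) (D (idir v) N) = d.
  rewrite (@D_eq_below _ 8 _ (rval v) _ _ N8); last first.
    by move=> i i8; rewrite /idir; case: eqP => // e; rewrite e in i8.
  by apply: interp_below (vars_below_D _ N8) _ => i; exact: ival_rval.
have dN0 u : interp u (D (kron 8) N) = 0.
  rewrite (@D_eq_below _ 8 _ (fun=> 0 * 0 + 0 * 0) _ _ N8); last first.
    by move=> i i8; rewrite /kron; case: eqP => [e|_]; [rewrite e in i8|rewrite mulr0 addr0].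
  by rewrite (D_linear 0 0 (fun=> 0) (fun=> 0)) !mul0r addr0.
have h8 i : (4 <= i < 8)%N -> idir (n := 8) v i = 0.
  by move=> hi; rewrite /idir; case: eqP => // _; exact: hv.
have k8 i : (4 <= i < 8)%N -> kron (R := R) 8 i = 0.
  by rewrite /kron; case: eqP => // ->.
have dH s : unit_itv s -> interp (ival w s) (D (kron 8) H)
    = interp (ival w s) (D (idir v) (actionE n0 N f)).
  move=> sI; rewrite /H /actionE -/fc /= (D_at_radius _ _ _ k8) (D_at_radius _ _ _ h8).
  rewrite /= dN0 !dNE NE [idir v 8]/idir eqxx [ival w s 8]ival_last [kron 8 8]/kron eqxx.
  by rewrite !(mul0r, add0r, addr0, mul1r, subr0, oppr0); ring.
apply: (is_derive_eq (is_derive_integral_interp v gA)).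
rewrite (integral_interp_FTC gH (good_D v gA) dH) /H /= !ival_last.
rewrite mul0r mulr0 subr0 mul1r; congr (_ * _).
rewrite /fc !interp_subst; apply: interp_eq => i; rewrite /at_radius.
case: eqP => [_|_] /=; first by rewrite NE ival_last mul1r addrC subrK.
by case: ifP => [/andP[_ i8]|_]; rewrite /= ?ival_rval.
Qed.

End Action.

Section Separation.
Context {R : realType}.
Variables (kappa e : R).
Hypothesis k0 : 0 <= kappa.
Implicit Types (w v : 'rV[R]_(4 + 4)) (y : 'rV[R]_4).

(* Squares of the radial momenta, the constants being (mu, L1, L2, K). *)
Definition R1E : expr :=
  Sub (EMul (EVar 0) (Sub (Sub (EMul (ECst kappa) (EMul (EVar 0) (sq (EVar 4)))) (EVar 7))
    (tau1 kappa e (EVar 0) (EVar 5) (EVar 6)))) (sq (EVar 5)).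
Definition R2E : expr :=
  Sub (EMul (EVar 0) (Sub (EAdd (EMul (EAdd (ECst 1) (EMul (ECst kappa) (EVar 0))) (sq (EVar 4)))
    (EVar 7)) (tau2 kappa e (EVar 0) (EVar 5) (EVar 6)))) (sq (EVar 6)).

(** A function S of N_1 alone has radial component y . dS = 2 N_1 S'(N_1), whence the density
    sqrt(Q) / (2 n) with the sign [sgn] of the radial momentum. *)
Definition rootE (sgn : R) (Q : expr) : expr :=
  EMul (ECst (sgn / 2)) (EMul (ESqrt Q) (EInv (EVar 0))).

Definition tan1 : @expr R := EMul (EVar 1) (EInv (EVar 0)).
Definition tan2 : @expr R := EMul (EVar 3) (EInv (EVar 2)).

Variables (n1 n2 s1 s2 : R).
Let A1 := actionE n1 N1 (rootE s1 R1E).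
Let A2 := actionE n2 N2 (rootE s2 R2E).
Let F1 := subst (at_radius N1) (rootE s1 R1E).
Let F2 := subst (at_radius N2) (rootE s2 R2E).

(** In each plane a radial integral plus the angular momentum times the polar angle, the latter as
    the arctangent of the ratio of the coordinates. *)
Definition action w : R :=
  (integral_interp A1 w + rval w 5 * atan (interp (rval w) tan1))
  + (integral_interp A2 w + rval w 6 * atan (interp (rval w) tan2)).

Definition action_gradE : seq expr :=
  [:: Sub (EMul (EMul (ECst 2) (EVar 0)) F1) (EMul (EMul (EVar 5) (EVar 1)) (EInv N1));
      EAdd (EMul (EMul (ECst 2) (EVar 1)) F1) (EMul (EMul (EVar 5) (EVar 0)) (EInv N1));
      Sub (EMul (EMul (ECst 2) (EVar 2)) F2) (EMul (EMul (EVar 6) (EVar 3)) (EInv N2));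
      EAdd (EMul (EMul (ECst 2) (EVar 3)) F2) (EMul (EMul (EVar 6) (EVar 2)) (EInv N2))].

(** The coordinates 0 and 2 are non-zero for the polar angles, mu is non-zero for the mixed Hessian,
    and [good] makes the radicands positive on the whole segments of integration. *)
Definition action_domain : set 'rV[R]_(4 + 4) := [set w |
  [/\ rval w 0 != 0, rval w 2 != 0, rval w 4 != 0, good A1 w & good A2 w]].

Lemma valid_subst_inv u (t : nat -> @expr R) E : valid u (subst t E) ->
  valid (fun i => interp u (t i)) E.
Proof.
elim: E => //= [a IHa b IHb|a IHa b IHb|a IHa|a IHa].
- by case=> /IHa ? /IHb.
- by case=> /IHa ? /IHb.
- by rewrite interp_subst => -[/IHa].
- by rewrite interp_subst => -[/IHa].
Qed.

Lemma at_radius_last (N : @expr R) f (a : R) w :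
  vars_below 8 N -> good (actionE a N f) w -> valid (rval w) N ->
  valid (rval w) (subst (at_radius N) f).
Proof.
move=> N8 gA vN; have I1 : unit_itv (1 : R) by rewrite /unit_itv/= in_itv/= ler01 lexx.
have [_ /valid_subst_inv h] := gA 1 I1.
apply: valid_subst; first by move=> i; rewrite /at_radius; case: eqP => // _; case: ifP.
apply: valid_eq h => i; rewrite /at_radius; case: eqP => [_|_] /=.
  by rewrite ival_last mul1r addrC subrK; apply: interp_below N8 _ => i'; exact: ival_rval.
by case: ifP => [/andP[_ i8]|_]; rewrite /= ?ival_rval.
Qed.

Lemma action_domain_facts w : action_domain w ->
  [/\ interp (rval w) N1 != 0, interp (rval w) N2 != 0,
      valid (rval w) F1 & valid (rval w) F2].
Proof.
case=> y0 y2 _ g1 g2; split.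
- rewrite /= gt_eqF// ltr_pwDl//; first by rewrite -expr2 exprn_even_gt0.
  by rewrite -expr2 sqr_ge0.
- rewrite /= gt_eqF// ltr_pwDl//; first by rewrite -expr2 exprn_even_gt0.
  by rewrite -expr2 sqr_ge0.
- exact: (at_radius_last _ g1).
- exact: (at_radius_last _ g2).
Qed.

Lemma valid_action_grad w c : action_domain w -> valid (rval w) (nth (ECst 0) action_gradE c).
Proof.
by move=> /action_domain_facts[? ? ? ?]; case: c => [|[|[|[|c]]]] //=; rewrite nth_nil.
Qed.

Lemma is_derive_action_total w v : action_domain w ->
  (forall i, (4 <= i < 8)%N -> rval v i = 0) ->
  is_derive w v action (\sum_(c < 4) rval v c * interp (rval w) (nth (ECst 0) action_gradE c)).
Proof.
move=> hw hv; have [N10 N20 v1 v2] := action_domain_facts hw.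
have [y0 y2 _ g1 g2] := hw.
have d1 := is_derive_action (N := N1) (isT : vars_below 8 N1) hv g1.
have d2 := is_derive_action (N := N2) (isT : vars_below 8 N2) hv g2.
have i_d E : valid (rval w) E -> is_derive w v (fun w => interp (rval w) E) (interp (rval w) (D (rval v) E)).
  by move=> vE; rewrite -derive_interp//; apply: derivableP; exact: derivable_interp.
have a1 := i_d (EMul (EVar 5) (EAtan tan1)) (conj I (conj I (conj I y0))).
have a2 := i_d (EMul (EVar 6) (EAtan tan2)) (conj I (conj I (conj I y2))).
apply: (is_derive_eq (is_deriveD (is_deriveD d1 a1) (is_deriveD d2 a2))).
have dom : interp (rval w) N1 != 0 /\ interp (rval w) N2 != 0 by [].
rewrite -/F1 -/F2.
pose f1 := interp (rval w) F1; pose f2 := interp (rval w) F2.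
transitivity (rval v 0 * (2 * rval w 0 * f1 - rval w 5 * rval w 1 * (interp (rval w) N1)^-1)
  + rval v 1 * (2 * rval w 1 * f1 + rval w 5 * rval w 0 * (interp (rval w) N1)^-1)
  + rval v 2 * (2 * rval w 2 * f2 - rval w 6 * rval w 3 * (interp (rval w) N2)^-1)
  + rval v 3 * (2 * rval w 3 * f2 + rval w 6 * rval w 2 * (interp (rval w) N2)^-1)); last first.
  by rewrite !big_ord_recl big_ord0 addr0 !addrA.
rewrite -/f1 -/f2; move: f1 f2 N10 N20 {dom} => f1 f2 /=; rewrite (hv 5%N)// (hv 6%N)//.
move: y0 y2; move: (rval w) (rval v) => a b y0 y2 N10 N20.
have t1 : 1 + a 1%N * (a 0%N)^-1 * (a 1%N * (a 0%N)^-1) != 0.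
  by rewrite -expr2 gt_eqF// ltr_pwDl// sqr_ge0.
have t2 : 1 + a 3%N * (a 2%N)^-1 * (a 3%N * (a 2%N)^-1) != 0.
  by rewrite -expr2 gt_eqF// ltr_pwDl// sqr_ge0.
by field; rewrite y0 y2 N10 N20.
Qed.

Lemma open_action_domain : open action_domain.
Proof.
rewrite (_ : action_domain = [set w : 'rV[R]_(4 + 4) | interp (rval w) (EMul (EVar 0) (EMul (EVar 2) (EVar 4))) != 0]
   `&` ([set w | good A1 w] `&` [set w | good A2 w])).
  apply: openI; first by apply: open_neq0.
  by apply: openI; exact: open_good.
apply/seteqP; split=> w /=.
  by case=> y0 y2 m0 g1 g2; rewrite !mulf_eq0 !negb_or y0 y2 m0.
by rewrite !mulf_eq0 !negb_or => -[/and3P[y0 y2 m0] [g1 g2]].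
Qed.

Lemma Ck_on_action k : Ck_on k action_domain action.
Proof.
have oD := open_action_domain.
apply: Ck_onD => //; apply: Ck_onD => //.
- by apply: Ck_on_integral_interp => // w [].
- by apply: (@Ck_on_interp _ _ _ _ (EMul (EVar 5) (EAtan tan1))) => // w [].
- by apply: Ck_on_integral_interp => // w [].
- by apply: (@Ck_on_interp _ _ _ _ (EMul (EVar 6) (EAtan tan2))) => // w [].
Qed.

(** The components of the one-form Phi whose coefficients are [half1] and [half2]; it is defined on
    the whole chart. *)
Definition potentialE : seq (@expr R) :=
  [:: EOpp (EMul (half1 kappa) (EVar 1)); EMul (half1 kappa) (EVar 0);
      EMul (half2 kappa) (EVar 3); EOpp (EMul (half2 kappa) (EVar 2))].

Definition kinetic_momentum w : 'rV[R]_4 := \row_c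
  (interp (rval w) (nth (ECst 0) action_gradE c) - e * interp (rval w) (nth (ECst 0) potentialE c)).

Definition tau1v (m l1 l2 : R) := interp (fun i => [:: m; l1; l2]`_i)
  (tau1 kappa e (EVar 0) (EVar 1) (EVar 2)).
Definition tau2v (m l1 l2 : R) := interp (fun i => [:: m; l1; l2]`_i)
  (tau2 kappa e (EVar 0) (EVar 1) (EVar 2)).

Definition Q1 n mu l1 l2 K : R := n * (kappa * (n * (mu * mu)) - K - tau1v n l1 l2) - l1 * l1.
Definition Q2 n mu l1 l2 K : R :=
  n * ((1 + kappa * n) * (mu * mu) + K - tau2v n l1 l2) - l2 * l2.

(** Pythagoras in each plane gives n_i E_i = radial_i^2 + L_i^2. The hypotheses then fix h_1 = kappa
    n_1 mu^2 - K and h_2 = (1 + kappa n_2) mu^2 + K, whose sum is w mu^2. *)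
Lemma energy_identity y (P : 'rV[R]_4) (z := row_mx y P) (mu l1 l2 K : R)
  (m1 := interp (rval z) N1) (m2 := interp (rval z) N2) :
  m1 != 0 -> m2 != 0 ->
  interp (rval z) (L1 kappa e) = l1 -> interp (rval z) (L2 kappa e) = l2 ->
  interp (rval z) radial1 ^+ 2 = Q1 m1 mu l1 l2 K ->
  interp (rval z) radial2 ^+ 2 = Q2 m2 mu l1 l2 K ->
  interp (rval z) (HE kappa e) = 2^-1 * mu ^+ 2.
Proof.
move=> m10 m20 h1 h2 r1 r2.
have e1 : m1 * interp (rval z) (E1 kappa e) = interp (rval z) radial1 ^+ 2 + l1 * l1.
  by rewrite -h1 /m1 /=; field.
have e2 : m2 * interp (rval z) (E2 kappa e) = interp (rval z) radial2 ^+ 2 + l2 * l2.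
  by rewrite -h2 /m2 /=; field.
have w0 : 1 + kappa * (m1 + m2) != 0 by exact: (w8_neq0 k0 z).
rewrite /HE /HsepE.
have -> : interp (rval z) (EMul (ECst (2^-1)) (EMul (EInv (wE8 kappa N1 N2))
  (EAdd (EAdd (E1 kappa e) (tau1 kappa e N1 (L1 kappa e) (L2 kappa e)))
        (EAdd (E2 kappa e) (tau2 kappa e N2 (L1 kappa e) (L2 kappa e))))))
  = 2^-1 * ((1 + kappa * (m1 + m2))^-1 * ((interp (rval z) (E1 kappa e) + tau1v m1 l1 l2)
     + (interp (rval z) (E2 kappa e) + tau2v m2 l1 l2))) by rewrite -h1 -h2.
have -> : interp (rval z) (E1 kappa e) = kappa * (m1 * (mu * mu)) - K - tau1v m1 l1 l2.
  by apply: (mulfI m10); rewrite e1 r1 /Q1 subrK.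
have -> : interp (rval z) (E2 kappa e) = (1 + kappa * m2) * (mu * mu) + K - tau2v m2 l1 l2.
  by apply: (mulfI m20); rewrite e2 r2 /Q2 subrK.
by field.
Qed.

Lemma Q1E w : interp (fun i => interp (rval w) (at_radius N1 i)) R1E
  = Q1 (interp (rval w) N1) (rval w 4) (rval w 5) (rval w 6) (rval w 7).
Proof. by []. Qed.

Lemma Q2E w : interp (fun i => interp (rval w) (at_radius N2 i)) R2E
  = Q2 (interp (rval w) N2) (rval w 4) (rval w 5) (rval w 6) (rval w 7).
Proof. by []. Qed.

Section Point.
Variable w : 'rV[R]_(4 + 4).
Hypothesis hw : action_domain w.
Let y := pos w.
Let z : 'rV[R]_(4 + 4) := row_mx y (kinetic_momentum w).
Let m1 := interp (rval w) N1.
Let m2 := interp (rval w) N2.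
Let q1 := Q1 m1 (rval w 4) (rval w 5) (rval w 6) (rval w 7).
Let q2 := Q2 m2 (rval w 4) (rval w 5) (rval w 6) (rval w 7).

Lemma root1E : interp (rval w) F1 = s1 / 2 * (Num.sqrt q1 * m1^-1).
Proof. by rewrite /F1 interp_subst. Qed.

Lemma root2E : interp (rval w) F2 = s2 / 2 * (Num.sqrt q2 * m2^-1).
Proof. by rewrite /F2 interp_subst. Qed.

Lemma rval_kinetic_pos i : (i < 4)%N -> rval z i = rval w i.
Proof. by move=> i4; rewrite -rval_pos// /pos row_mxKl rval_pos. Qed.

Lemma rval_kinetic_mom i : (i < 4)%N -> rval z (4 + i)%N =
  interp (rval w) (nth (ECst 0) action_gradE i) - e * interp (rval w) (nth (ECst 0) potentialE i).
Proof.
by move=> i4; rewrite -rval_mom// /mom row_mxKr -[i]/(nat_of_ord (Ordinal i4)) rvalE mxE.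
Qed.

Lemma momentum_values : [/\ interp (rval z) (L1 kappa e) = rval w 5,
  interp (rval z) (L2 kappa e) = rval w 6,
  interp (rval z) radial1 = s1 * Num.sqrt q1 & interp (rval z) radial2 = s2 * Num.sqrt q2].
Proof.
have [m10 m20 _ _] := action_domain_facts hw.
have p i : (i < 4)%N -> rval z (4 + i)%N =
    nth 0 [:: 2 * rval w 0 * (s1 / 2 * (Num.sqrt q1 * m1^-1)) - rval w 5 * rval w 1 * m1^-1;
      2 * rval w 1 * (s1 / 2 * (Num.sqrt q1 * m1^-1)) + rval w 5 * rval w 0 * m1^-1;
      2 * rval w 2 * (s2 / 2 * (Num.sqrt q2 * m2^-1)) - rval w 6 * rval w 3 * m2^-1;
      2 * rval w 3 * (s2 / 2 * (Num.sqrt q2 * m2^-1)) + rval w 6 * rval w 2 * m2^-1] i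
    - e * interp (rval w) (nth (ECst 0) potentialE i).
  move=> i4; rewrite rval_kinetic_mom// -root1E -root2E; congr (_ - _).
  by case: i i4 => [|[|[|[|//]]]] _.
have p4 := p 0%N isT; have p5 := p 1%N isT; have p6 := p 2%N isT; have p7 := p 3%N isT.
rewrite [(4 + _)%N]/= [nth 0 _ _]/= [interp _ (nth _ _ _)]/= in p4.
rewrite [(4 + _)%N]/= [nth 0 _ _]/= [interp _ (nth _ _ _)]/= in p5.
rewrite [(4 + _)%N]/= [nth 0 _ _]/= [interp _ (nth _ _ _)]/= in p6.
rewrite [(4 + _)%N]/= [nth 0 _ _]/= [interp _ (nth _ _ _)]/= in p7.
rewrite [interp _ (L1 _ _)]/= [interp _ (L2 _ _)]/= [interp _ radial1]/= [interp _ radial2]/=.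
rewrite p4 p5 p6 p7 !rval_kinetic_pos//.
move: (Num.sqrt q1) (Num.sqrt q2) m10 m20 => r1 r2; rewrite /m1 /m2 /=.
move: (rval w) => a m10 m20.
by split; field; rewrite ?m10 ?m20.
Qed.

Lemma hj_model : s1 ^+ 2 = 1 -> s2 ^+ 2 = 1 ->
  (kinetic_momentum w *m gmodV kappa J4 y *m (kinetic_momentum w)^T) 0 0 = rval w 4 ^+ 2.
Proof.
move=> s1s s2s; have [h1 h2 r1 r2] := momentum_values.
have [m10 m20 /valid_subst_inv v1 /valid_subst_inv v2] := action_domain_facts hw.
have m1E : interp (rval z) N1 = m1 by rewrite /m1 /= !rval_kinetic_pos.
have m2E : interp (rval z) N2 = m2 by rewrite /m2 /= !rval_kinetic_pos.
have q1p : 0 <= q1 by have [_ [[_ /ltW]]] := v1; rewrite Q1E.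
have q2p : 0 <= q2 by have [_ [[_ /ltW]]] := v2; rewrite Q2E.
have := @energy_identity y (kinetic_momentum w) (rval w 4) (rval w 5) (rval w 6) (rval w 7).
rewrite -/z m1E m2E r1 r2 !exprMn s1s s2s !mul1r !sqr_sqrtr// => /(_ m10 m20 h1 h2 erefl erefl).
rewrite -(hamiltonian_HE e k0) /hamiltonian (gmod_unit _ (@J4_orth R) k0).2.
rewrite /pos /mom row_mxKl row_mxKr => h.
have t0 : (2 : R)^-1 != 0 by rewrite invr_eq0 pnatr_eq0.
by apply: (mulfI t0); rewrite h.
Qed.

(** In a plane the gradient of the action is 2 f X plus (l / n) times X turned by a right angle.
    These two vectors are independent, so a variation fixing the gradient and the point fixes both
    coefficients. *)
Lemma block_kernel (X0 X1 L N Fx : @expr R) u d :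
  interp u (D d X0) = 0 -> interp u (D d X1) = 0 -> interp u (D d N) = 0 ->
  interp u N = interp u X0 * interp u X0 + interp u X1 * interp u X1 -> interp u N != 0 ->
  interp u (D d (Sub (EMul (EMul (ECst 2) X0) Fx) (EMul (EMul L X1) (EInv N)))) = 0 ->
  interp u (D d (EAdd (EMul (EMul (ECst 2) X1) Fx) (EMul (EMul L X0) (EInv N)))) = 0 ->
  interp u (D d L) = 0 /\ interp u (D d Fx) = 0.
Proof.
rewrite /= => -> -> ->; move: (interp u N) (interp u L) => n l.
move: (interp u X0) (interp u X1) (interp u Fx) => x0 x1 f.
move: (interp u (D d L)) (interp u (D d Fx)) => dl df nE n0.
rewrite !(mul0r, mulr0, add0r, addr0, oppr0) => a b; split.
  have -> : dl = x0 * (2 * x1 * df + dl * x0 * n^-1) - x1 * (2 * x0 * df - dl * x1 * n^-1).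
    by rewrite nE; rewrite nE in n0; field.
  by rewrite a b !mulr0 subr0.
have n20 : 2 * n != 0 by rewrite mulf_neq0 ?pnatr_eq0.
apply: (mulfI n20); rewrite mulr0 -[RHS]addr0.
have -> : 2 * n * df = x0 * (2 * x0 * df - dl * x1 * n^-1) + x1 * (2 * x1 * df + dl * x0 * n^-1).
  by rewrite nE; rewrite nE in n0; field.
by rewrite a b !mulr0.
Qed.

Lemma D_root (sgn : R) (N : @expr R) Q (d : nat -> R) : interp (rval w) (D d N) = 0 ->
  valid (rval w) (subst (at_radius N) (rootE sgn Q)) -> sgn ^+ 2 = 1 ->
  interp (rval w) (D d (subst (at_radius N) (rootE sgn Q))) = 0 ->
  interp (fun i => interp (rval w) (at_radius N i))
    (D (fun i => if (4 <= i < 8)%N then d i else 0) Q) = 0.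
Proof.
move=> dN /valid_subst_inv[_ [[_ Q0] N0]] s2n.
rewrite D_subst (@D_eq _ _ (fun i => if (4 <= i < 8)%N then d i else 0)); last first.
  by move=> i; rewrite /at_radius; case: eqP => [->|_]; [exact: dN|case: ifP].
have sn0 : sgn != 0 by apply: contra_eq_neq s2n => ->; rewrite expr0n /= eq_sym oner_eq0.
have r0 : Num.sqrt (interp (fun i => interp (rval w) (at_radius N i)) Q) != 0.
  by rewrite gt_eqF// sqrtr_gt0.
have N00 : interp (rval w) N != 0 by case: N0.
move: N00 r0; rewrite /=; set q := Num.sqrt _; set N' := interp _ N => {}N0 r0.
rewrite !(mul0r, add0r, oppr0, mulr0, addr0) => /eqP.
rewrite !mulf_eq0 !invr_eq0 mulf_eq0 (negbTE N0) (negbTE r0) (negbTE sn0) pnatr_eq0 /=.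
by rewrite !orbF => /eqP.
Qed.

(** A kernel vector is a variation of the constants that fixes the gradient. By [block_kernel] it
    fixes L_1, L_2 and both roots, so kappa n_1 d(mu^2) - dK and (1 + kappa n_2) d(mu^2) + dK
    vanish. Their sum is w d(mu^2), hence d mu = 0 because mu is non-zero, and then dK = 0. *)
Lemma mixed_unit : s1 ^+ 2 = 1 -> s2 ^+ 2 = 1 ->
  \matrix_(c < 4, b < 4) interp (rval w) (D (kron (4 + b)) (nth (ECst 0) action_gradE c))
    \in unitmx.
Proof.
move=> s1s s2s; set M := \matrix_(_, _) _.
have [m10 m20 v1 v2] := action_domain_facts hw.
have [y0 y2 mu0 _ _] := hw.
suff : M^T \in unitmx by rewrite unitmx_tr.
rewrite -row_free_unit; apply: inj_row_free => u hu.
pose d i := \sum_(b < 4) u 0 b * kron (4 + b) i.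
have dk i : (i < 4)%N -> d i = 0.
  move=> i4; rewrite /d big1// => b _; rewrite /kron; case: eqP => [ie|]; last by rewrite mulr0.
  by move: i4; rewrite ie ltnNge leq_addr.
have d4 (b : 'I_4) : d (4 + b)%N = u 0 b.
  rewrite /d (bigD1 b)//= /kron eqxx mulr1 big1 ?addr0// => b' nb.
  by rewrite eqn_add2l eq_sym val_eqE (negbTE nb) mulr0.
have G c : (c < 4)%N -> interp (rval w) (D d (nth (ECst 0) action_gradE c)) = 0.
  move=> c4; transitivity ((u *m M^T) 0 (Ordinal c4)); last by rewrite hu mxE.
  rewrite D_sum mxE; apply: eq_bigr => b _; congr (_ * _).
  by rewrite !mxE.
have g0 := G 0%N isT; have g1 := G 1%N isT; have g2 := G 2%N isT; have g3 := G 3%N isT.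
have dN1 : interp (rval w) (D d N1) = 0 by rewrite /= !dk// !(mul0r, mulr0, addr0).
have dN2 : interp (rval w) (D d N2) = 0 by rewrite /= !dk// !(mul0r, mulr0, addr0).
have [l5 f1] : interp (rval w) (D d (EVar 5)) = 0 /\ interp (rval w) (D d F1) = 0.
  by apply: block_kernel g0 g1; rewrite ?dN1//= dk.
have [l6 f2] : interp (rval w) (D d (EVar 6)) = 0 /\ interp (rval w) (D d F2) = 0.
  by apply: block_kernel g2 g3; rewrite ?dN2//= dk.
have c1 := @D_root s1 N1 R1E d dN1 v1 s1s f1; have c2 := @D_root s2 N2 R2E d dN2 v2 s2s f2.
have e1 : m1 * (kappa * m1 * (2 * rval w 4 * d 4%N) - d 7%N) = 0.
  move: c1 l5 l6; rewrite /= => + h5 h6; rewrite h5 h6 => <-; rewrite /m1 /=; by field.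
have e2 : m2 * ((1 + kappa * m2) * (2 * rval w 4 * d 4%N) + d 7%N) = 0.
  move: c2 l5 l6; rewrite /= => + h5 h6; rewrite h5 h6 => <-; rewrite /m2 /=; by field.
have wn0 : 1 + kappa * (m1 + m2) != 0 by exact: (w8_neq0 k0 w).
have d40 : d 4%N = 0.
  have e1' : kappa * m1 * (2 * rval w 4 * d 4%N) - d 7%N = 0.
    by apply: (mulfI m10); rewrite mulr0.
  have e2' : (1 + kappa * m2) * (2 * rval w 4 * d 4%N) + d 7%N = 0.
    by apply: (mulfI m20); rewrite mulr0.
  have : (1 + kappa * (m1 + m2)) * 2 * rval w 4 * d 4%N = 0.
    by rewrite -[RHS](addr0 0) -[in X in _ = X + _]e1' -e2'; ring.
  by move/eqP; rewrite !mulf_eq0 (negbTE wn0) (negbTE mu0) pnatr_eq0 => /eqP.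
have d70 : d 7%N = 0.
  move: e1; rewrite d40 !mulr0 sub0r mulrN => /eqP; rewrite oppr_eq0 mulf_eq0.
  by rewrite (negbTE m10) => /eqP.
apply/rowP => b; rewrite mxE -d4.
by case: b => [[|[|[|[|//]]]] Hb].
Qed.

End Point.

End Separation.

(** * The separation constants of a given phase-space point *)

Section InitialPoint.
Context {R : realType}.
Variables (kappa e : R).
Hypothesis k0 : 0 <= kappa.
Variable z : 'rV[R]_(4 + 4).
Hypotheses (z0 : rval z 0 != 0) (z2 : rval z 2 != 0)
  (r1 : interp (rval z) radial1 != 0) (r2 : interp (rval z) radial2 != 0).

Lemma radial_neq0_HE : 0 < interp (rval z) (HE kappa e).
Proof.
have w0 : 0 < wfun kappa (pos z) by exact: wfun_gt0.
rewrite -(hamiltonian_HE e k0) /hamiltonian (gmod_unit _ (@J4_orth R) k0).2 kinetic.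
rewrite !mulr_gt0 ?invr_gt0// ltr_pwDl//; last first.
  by rewrite mulr_ge0 ?sqr_ge0// mulr_ge0// addr_ge0// ltW.
rewrite dot4E !rval_mom// lt_neqAle; apply/andP; split; last first.
  by rewrite -!expr2 !addr_ge0// sqr_ge0.
rewrite eq_sym; apply: contra_neq r1 => /= h.
have [h4 h5] : rval z 4 = 0 /\ rval z 5 = 0.
  have := (sqr_ge0 (rval z 4), sqr_ge0 (rval z 5), sqr_ge0 (rval z 6), sqr_ge0 (rval z 7)).
  by case=> [[[a b] c] d]; split; apply/eqP; rewrite -sqrf_eq0; apply/eqP; move: h => /=; lra.
by rewrite h4 h5 !mulr0 addr0.
Qed.

Let H := interp (rval z) (HE kappa e).
Let m1 := interp (rval z) N1.
Let m2 := interp (rval z) N2.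
Let l1 := interp (rval z) (L1 kappa e).
Let l2 := interp (rval z) (L2 kappa e).
Let K := interp (rval z) (KE kappa e).
Let mu := Num.sqrt (2 * H).

Definition separation_constants : 'rV[R]_4 := \row_i [:: mu; l1; l2; K]`_i.
Let w : 'rV[R]_(4 + 4) := row_mx (pos z) separation_constants.
Let s1 := Num.sg (interp (rval z) radial1).
Let s2 := Num.sg (interp (rval z) radial2).

Lemma rval_start_pos i : (i < 4)%N -> rval w i = rval z i.
Proof. by move=> i4; rewrite -rval_pos// /pos row_mxKl rval_pos. Qed.

Lemma rval_start_mom i : (i < 4)%N -> rval w (4 + i) = [:: mu; l1; l2; K]`_i.
Proof.
by move=> i4; rewrite -rval_mom// /mom row_mxKr -[i]/(nat_of_ord (Ordinal i4)) rvalE mxE.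
Qed.

Lemma radius1_neq0 : m1 != 0.
Proof. by rewrite /m1 /= gt_eqF// ltr_pwDl// -expr2 ?exprn_even_gt0// sqr_ge0. Qed.

Lemma radius2_neq0 : m2 != 0.
Proof. by rewrite /m2 /= gt_eqF// ltr_pwDl// -expr2 ?exprn_even_gt0// sqr_ge0. Qed.

Lemma constant_mu_sq : mu * mu = 2 * H.
Proof. by rewrite -expr2 sqr_sqrtr// mulr_ge0// ltW// radial_neq0_HE. Qed.

Lemma Q1_start : Q1 kappa e m1 mu l1 l2 K = interp (rval z) radial1 ^+ 2.
Proof.
have e1 : m1 * interp (rval z) (E1 kappa e) = interp (rval z) radial1 ^+ 2 + l1 * l1.
  by rewrite /l1 /m1 /=; field.
have KE' : K = 2 * kappa * (m1 * H) - (interp (rval z) (E1 kappa e) + tau1v kappa e m1 l1 l2) by [].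
rewrite /Q1 constant_mu_sq KE'.
transitivity (m1 * interp (rval z) (E1 kappa e) - l1 * l1); last by rewrite e1 addrK.
by ring.
Qed.

Lemma Q2_start : Q2 kappa e m2 mu l1 l2 K = interp (rval z) radial2 ^+ 2.
Proof.
have e2 : m2 * interp (rval z) (E2 kappa e) = interp (rval z) radial2 ^+ 2 + l2 * l2.
  by rewrite /l2 /m2 /=; field.
have KE' : K = 2 * kappa * (m1 * H) - (interp (rval z) (E1 kappa e) + tau1v kappa e m1 l1 l2) by [].
have w0 : 1 + kappa * (m1 + m2) != 0 by exact: (w8_neq0 k0 z).
have HE' : H = 2^-1 * ((1 + kappa * (m1 + m2))^-1 * ((interp (rval z) (E1 kappa e) + tau1v kappa e m1 l1 l2)
     + (interp (rval z) (E2 kappa e) + tau2v kappa e m2 l1 l2))) by [].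
have HE2 : 2 * H * (1 + kappa * (m1 + m2)) = (interp (rval z) (E1 kappa e) + tau1v kappa e m1 l1 l2)
     + (interp (rval z) (E2 kappa e) + tau2v kappa e m2 l1 l2) by rewrite HE'; field.
rewrite /Q2 constant_mu_sq KE'.
transitivity (m2 * interp (rval z) (E2 kappa e) - l2 * l2); last by rewrite e2 addrK.
congr (_ - _); congr (_ * _).
transitivity (2 * H * (1 + kappa * (m1 + m2)) - (interp (rval z) (E1 kappa e) + tau1v kappa e m1 l1 l2)
   - tau2v kappa e m2 l1 l2); first by ring.
by rewrite HE2; ring.
Qed.

Lemma sg_sq (x : R) : x != 0 -> Num.sg x ^+ 2 = 1.
Proof. by move=> x0; rewrite sqr_sg x0. Qed.

Lemma radius1_start : interp (rval w) N1 = m1. Proof. by rewrite /= !rval_start_pos. Qed.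
Lemma radius2_start : interp (rval w) N2 = m2. Proof. by rewrite /= !rval_start_pos. Qed.

(** The radii of the point itself are the lower limits of integration, so the segments are
    degenerate and the radicands are needed only at this point, where they equal the squared radial
    momenta. *)
Lemma action_domain_start : action_domain kappa e m1 m2 s1 s2 w.
Proof.
have lam := (rval_start_mom (isT : (0 < 4)%N), rval_start_mom (isT : (1 < 4)%N),
   rval_start_mom (isT : (2 < 4)%N), rval_start_mom (isT : (3 < 4)%N)).
split.
- by rewrite rval_start_pos.
- by rewrite rval_start_pos.
- rewrite (rval_start_mom (isT : (0 < 4)%N)) /= gt_eqF// sqrtr_gt0.
  by rewrite mulr_gt0// radial_neq0_HE.
- move=> s sI; split=> //; apply: valid_subst.
    by move=> i; rewrite /at_radius; case: eqP => // _; case: ifP.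
  apply: (@valid_eq _ (fun i => interp (rval w) (at_radius N1 i))).
    move=> i; rewrite /at_radius; case: eqP => [_|_].
      have e1 : interp (ival w s) N1 = m1.
        by rewrite -radius1_start; apply: (@interp_below R 8) => // i' i8; exact: ival_rval.
      rewrite radius1_start; transitivity (m1 + ival w s 8 * (interp (ival w s) N1 - m1)) => //.
      by rewrite e1 subrr mulr0 addr0.
    by case: ifP => [/andP[_ i8]|_]; rewrite /= ?ival_rval.
  split=> //; split.
    split; first by [].
    by rewrite Q1E radius1_start !lam Q1_start exprn_even_gt0.
  by split=> //; rewrite [interp _ _]radius1_start radius1_neq0.
- move=> s sI; split=> //; apply: valid_subst.
    by move=> i; rewrite /at_radius; case: eqP => // _; case: ifP.
  apply: (@valid_eq _ (fun i => interp (rval w) (at_radius N2 i))).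
    move=> i; rewrite /at_radius; case: eqP => [_|_].
      have e1 : interp (ival w s) N2 = m2.
        by rewrite -radius2_start; apply: (@interp_below R 8) => // i' i8; exact: ival_rval.
      rewrite radius2_start; transitivity (m2 + ival w s 8 * (interp (ival w s) N2 - m2)) => //.
      by rewrite e1 subrr mulr0 addr0.
    by case: ifP => [/andP[_ i8]|_]; rewrite /= ?ival_rval.
  split=> //; split.
    split; first by [].
    by rewrite Q2E radius2_start !lam Q2_start exprn_even_gt0.
  by split=> //; rewrite [interp _ _]radius2_start radius2_neq0.
Qed.

Lemma plane_eq (x0 x1 p0 p1 p0' p1' : R) : x0 * x0 + x1 * x1 != 0 ->
  x0 * p0 + x1 * p1 = x0 * p0' + x1 * p1' -> x0 * p1 - x1 * p0 = x0 * p1' - x1 * p0' ->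
  p0 = p0' /\ p1 = p1'.
Proof.
move=> n0 a b; split; apply: (mulfI n0).
  transitivity (x0 * (x0 * p0 + x1 * p1) - x1 * (x0 * p1 - x1 * p0)); first by ring.
  by rewrite a b; ring.
transitivity (x1 * (x0 * p0 + x1 * p1) + x0 * (x0 * p1 - x1 * p0)); first by ring.
by rewrite a b; ring.
Qed.

(** In each plane the position, the radial momentum and L_i determine the momentum; the signs [s1]
    and [s2] select the branches of the roots that reproduce the given radial momenta. *)
Lemma kinetic_momentum_start : kinetic_momentum kappa e s1 s2 w = mom z.
Proof.
have [h1 h2 h3 h4] := momentum_values action_domain_start.
move: h1 h2 h3 h4; set z' := row_mx _ _.
have zp i : (i < 4)%N -> rval z' i = rval z i.
  by move=> i4; rewrite /z' (rval_kinetic_pos _ _ _ _ _ i4) rval_start_pos.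
have lam := (rval_start_mom (isT : (0 < 4)%N), rval_start_mom (isT : (1 < 4)%N),
   rval_start_mom (isT : (2 < 4)%N), rval_start_mom (isT : (3 < 4)%N)).
rewrite radius1_start radius2_start !lam [nth _ _ _]/= [nth _ _ 0]/= [nth _ _ 2]/= [nth _ _ 3]/=.
rewrite Q1_start Q2_start !sqrtr_sqr !mulr_sg_norm => h1 h2 h3 h4.
have j1 : interp (rval z') J1 = interp (rval z) J1.
  have hN : interp (rval z') N1 = interp (rval z) N1 by rewrite /= !zp.
  have hh : interp (rval z') (half1 kappa) = interp (rval z) (half1 kappa) by rewrite /= !zp.
  have LJ u : interp u (L1 kappa e) = interp u J1 + e * (interp u N1 * interp u (half1 kappa)) by [].
  have : interp (rval z') (L1 kappa e) = interp (rval z) (L1 kappa e) by [].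
  by rewrite !LJ hN hh; exact: addIr.
have j2 : interp (rval z') J2 = interp (rval z) J2.
  have hN : interp (rval z') N2 = interp (rval z) N2 by rewrite /= !zp.
  have hh : interp (rval z') (half2 kappa) = interp (rval z) (half2 kappa) by rewrite /= !zp.
  have LJ u : interp u (L2 kappa e) = interp u J2 - e * (interp u N2 * interp u (half2 kappa)) by [].
  have : interp (rval z') (L2 kappa e) = interp (rval z) (L2 kappa e) by [].
  by rewrite !LJ hN hh; exact: addIr.
have [p4 p5] : rval z' 4 = rval z 4 /\ rval z' 5 = rval z 5.
  apply: (@plane_eq (rval z 0) (rval z 1)); [exact: radius1_neq0| |];
    by move: h3 j1; rewrite /= (zp 0%N)// (zp 1%N).
have [p6 p7] : rval z' 6 = rval z 6 /\ rval z' 7 = rval z 7.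
  apply: (@plane_eq (rval z 2) (rval z 3)); [exact: radius2_neq0| |];
    by move: h4 j2; rewrite /= (zp 2%N)// (zp 3%N).
have -> : kinetic_momentum kappa e s1 s2 w = mom z' by rewrite /mom row_mxKr.
apply/rowP => i; rewrite -!rvalE !rval_mom//.
by case: i => [[|[|[|[|//]]]] Hi].
Qed.

End InitialPoint.

Section LinearChange.
Context {R : realType}.

Lemma Ck_on_linear (V V' W : normedModType R) (L : V -> V') k (U : set V') (f : V' -> W) :
  (forall (s : R) x y, L (s *: x + y) = s *: L x + L y) -> continuous L ->
  Ck_on k U f -> Ck_on k (L @^-1` U) (f \o L).
Proof.
move=> lin cL; elim: k f => [|k IH] f [cf df]; split=> //.
- by move=> x Ux; apply: continuous_comp; [exact: cL|exact: cf].
- by move=> x Ux; apply: continuous_comp; [exact: cL|exact: cf].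
- move=> v; have [d1 d2] := df (L v); split.
    by move=> x Ux; apply/(derive_linear f x v lin).2; exact: d1.
  have -> : 'D_v (f \o L) = ('D_(L v) f) \o L.
    by apply/funext => x; exact: (derive_linear f x v lin).1.
  exact: IH.
Qed.

Lemma is_derive_linear (V V' W : normedModType R) (L : V -> V') (f : V' -> W) x v l :
  (forall (s : R) x y, L (s *: x + y) = s *: L x + L y) ->
  is_derive (L x) (L v) f l -> is_derive x v (f \o L) l.
Proof.
move=> lin [d e]; have [e' d'] := derive_linear f x v lin.
by apply: DeriveDef; [apply/d'|rewrite e'].
Qed.

Lemma D_row n (x v : 'rV[R]_n) E : vars_below n E ->
  interp (rval x) (D (rval v) E) = \sum_c v 0 c * interp (rval x) (D (kron c) E).
Proof.
move=> nE; rewrite -D_sum; apply: D_eq_below nE _ => i ni.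
rewrite (bigD1 (Ordinal ni))//= /kron eqxx mulr1 big1 ?addr0; last first.
  by move=> j; rewrite -val_eqE /= eq_sym => /negbTE->; rewrite mulr0.
by rewrite -[in LHS](erefl : nat_of_ord (Ordinal ni) = i) rvalE.
Qed.

Lemma unitmx_frame n (B : 'M[R]_n) : B *m B^T = 1%:M -> B \in unitmx.
Proof. by move=> /mulmx1_unit[]. Qed.

Lemma is_derive_interp n (x v : 'rV[R]_n) E : valid (rval x) E ->
  is_derive x v (fun y : 'rV[R]_n => interp (rval y) E) (interp (rval x) (D (rval v) E)).
Proof. by move=> vE; rewrite -derive_interp//; apply: derivableP; exact: derivable_interp. Qed.

Lemma mul_frame_lin n k (B : 'M[R]_(n, k)) (s : R) (x y : 'rV[R]_n) :
  (s *: x + y) *m B = s *: (x *m B) + y *m B.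
Proof. by rewrite mulmxDl scalemxAl. Qed.

Lemma mul_frame_continuous n k (B : 'M[R]_(n, k)) : continuous (fun q : 'rV[R]_n => q *m B).
Proof. by apply: elementary_continuous => i; exact: elementary_mul_row. Qed.

Lemma open_preimage_frame n k (B : 'M[R]_(n, k)) (O : set 'rV[R]_k) :
  open O -> open ((fun q : 'rV[R]_n => q *m B) @^-1` O).
Proof. by move=> oO; apply: open_comp => // x _; exact: mul_frame_continuous. Qed.

End LinearChange.

(** * Potential and separating coordinates *)

Section ModelPotential.
Context {R : realType}.
Variable kappa : R.
Implicit Types q y : 'rV[R]_4.

Definition potential y : 'rV[R]_4 := \row_c interp (rval y) (nth (ECst 0) (potentialE kappa) c).

Lemma potential_polynomial c : polynomial (nth (ECst 0) (potentialE kappa) c).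
Proof. by case: c => [|[|[|[|[|c]]]]]. Qed.

Lemma potential_below c : vars_below 4 (nth (ECst 0) (potentialE kappa) c).
Proof. by case: c => [|[|[|[|[|c]]]]]. Qed.

Lemma ext_deriv_potential y : ext_deriv potential y = Fmod kappa (J4 (R := R)) (S4 ord_max) y.
Proof.
have pdE (a b : 'I_4) : pd a (fun p => potential p 0 b) y
    = interp (rval y) (D (kron a) (nth (ECst 0) (potentialE kappa) b)).
  rewrite (_ : (fun p => _) = fun p => interp (rval p) (nth (ECst 0) (potentialE kappa) b)).
    by apply: pd_interp_below; [exact: potential_below|apply: polynomial_valid; exact: potential_polynomial].
  by apply/funext => p; rewrite mxE.
apply/matrixP => a b; rewrite mxE (pdE a b) (pdE b a) -interp_FE.
by case: a => [[|[|[|[|//]]]] Ha]; case: b => [[|[|[|[|//]]]] Hb]; rewrite /= /kron /=; field.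
Qed.

(** Signed radius and tangent of the polar angle in each plane. The sign of the first coordinate of
    the plane is kept so that the chart is injective on the whole dense domain; the square of the
    signed radius is N_i. *)
Definition coordE : seq (@expr R) :=
  [:: EMul (EVar 0) (ESqrt (EAdd (ECst 1) (sq tan1))); tan1;
      EMul (EVar 2) (ESqrt (EAdd (ECst 1) (sq tan2))); tan2].

Definition chart_domain : set 'rV[R]_4 := [set y | rval y 0 != 0 /\ rval y 2 != 0].

Definition coord y : 'rV[R]_4 := \row_i interp (rval y) (nth (ECst 0) coordE i).

Lemma valid_coord y i : chart_domain y -> valid (rval y) (nth (ECst 0) coordE i).
Proof.
move=> [y0 y2]; have h (t : R) : 0 < 1 + t * t by rewrite -expr2 ltr_pwDl// sqr_ge0.
by case: i => [|[|[|[|[|i]]]]] //=; do ![split=> //].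
Qed.

Lemma coord_below i : vars_below 4 (nth (ECst 0) coordE i).
Proof. by case: i => [|[|[|[|[|i]]]]]. Qed.

Lemma chart_domainE : chart_domain =
  [set y : 'rV[R]_4 | interp (rval y) (EMul (EVar 0) (EVar 2)) != 0].
Proof.
apply/seteqP; split=> y /=; rewrite /chart_domain /= mulf_eq0 negb_or.
  by case=> -> ->.
by move/andP.
Qed.

Lemma open_chart_domain : open chart_domain.
Proof. by rewrite chart_domainE; exact: open_neq0. Qed.

Lemma coord_smooth k : Ck_on k chart_domain coord.
Proof.
have oU := open_chart_domain; apply: Ck_on_mx => // i.
apply: (@Ck_on_eq _ _ _ _ _ (fun y => interp (rval y) (nth (ECst 0) coordE i))) => //.
  by move=> y _; rewrite mxE.
by apply: Ck_on_interp => // y; exact: valid_coord.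
Qed.

Lemma coord_inj : {in chart_domain &, injective coord}.
Proof.
move=> y y' /set_mem[y0 y2] /set_mem[y0' y2'] /rowP h.
have := (h 0, h 1, h 2, h 3); rewrite !mxE /= => -[[[h0 h1] h2] h3].
have pos1 : Num.sqrt (1 + rval y 1 / rval y 0 * (rval y 1 / rval y 0)) != 0.
  by rewrite gt_eqF// sqrtr_gt0 -expr2 ltr_pwDl// sqr_ge0.
have pos2 : Num.sqrt (1 + rval y 3 / rval y 2 * (rval y 3 / rval y 2)) != 0.
  by rewrite gt_eqF// sqrtr_gt0 -expr2 ltr_pwDl// sqr_ge0.
have e0 : rval y 0 = rval y' 0 by move: h0; rewrite -h1; apply: mulIf.
have e2 : rval y 2 = rval y' 2 by move: h2; rewrite -h3; apply: mulIf.
have e1 : rval y 1 = rval y' 1.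
  by move: h1; rewrite -e0; apply: mulIf; rewrite invr_eq0.
have e3 : rval y 3 = rval y' 3.
  by move: h3; rewrite -e2; apply: mulIf; rewrite invr_eq0.
apply/rowP => i; rewrite -!rvalE.
by case: i => [[|[|[|[|//]]]] Hi].
Qed.

Lemma coord_jacobian y : chart_domain y ->
  \matrix_(a < 4, b < 4) interp (rval y) (D (kron a) (nth (ECst 0) coordE b)) \in unitmx.
Proof.
move=> [y0 y2]; set M := \matrix_(_, _) _.
have pos1 : Num.sqrt (1 + rval y 1 / rval y 0 * (rval y 1 / rval y 0)) != 0.
  by rewrite gt_eqF// sqrtr_gt0 -expr2 ltr_pwDl// sqr_ge0.
have pos2 : Num.sqrt (1 + rval y 3 / rval y 2 * (rval y 3 / rval y 2)) != 0.
  by rewrite gt_eqF// sqrtr_gt0 -expr2 ltr_pwDl// sqr_ge0.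
rewrite -row_free_unit; apply: inj_row_free => u hu.
have C b : (b < 4)%N -> interp (rval y) (D (rval u) (nth (ECst 0) coordE b)) = 0.
  move=> b4; transitivity ((u *m M) 0 (Ordinal b4)); last by rewrite hu mxE.
  rewrite (D_row _ _ (coord_below b)) mxE; apply: eq_bigr => a _; congr (_ * _).
  by rewrite mxE.
have solve (x0 x1 d0 d1 r : R) : x0 != 0 -> r != 0 ->
   d1 / x0 - x1 * (d0 / (x0 * x0)) = 0 ->
   d0 * r + x0 * ((d1 / x0 - x1 * (d0 / (x0 * x0))) * (x1 / x0) + x1 / x0 * (d1 / x0 - x1 * (d0 / (x0 * x0)))) / (2 * r) = 0 ->
   d0 = 0 /\ d1 = 0.
  move=> x00 r0 h; rewrite h !(mul0r, mulr0, addr0) => /eqP.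
  rewrite mulf_eq0 (negbTE r0) orbF => /eqP d00; split=> //; move: h.
  by rewrite d00 mul0r mulr0 subr0 => /eqP; rewrite mulf_eq0 invr_eq0 (negbTE x00) orbF => /eqP.
have c0 := C 0%N isT; have c1 := C 1%N isT; have c2 := C 2%N isT; have c3 := C 3%N isT.
have [u0 u1] : rval u 0 = 0 /\ rval u 1 = 0.
  apply: (solve (rval y 0) (rval y 1) _ _ _ y0 pos1); move: c0 c1 => /= c0 c1.
    by rewrite -[RHS]c1; field.
  by rewrite -[RHS]c0; field; rewrite y0 pos1.
have [u2 u3] : rval u 2 = 0 /\ rval u 3 = 0.
  apply: (solve (rval y 2) (rval y 3) _ _ _ y2 pos2); move: c2 c3 => /= c2 c3.
    by rewrite -[RHS]c3; field.
  by rewrite -[RHS]c2; field; rewrite y2 pos2.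
apply/rowP => i; rewrite mxE -rvalE.
by case: i => [[|[|[|[|//]]]] Hi].
Qed.

End ModelPotential.

(** * Separability in an adapted frame *)

Section HamiltonJacobi.
Context {R : realType}.
Variables (m e : R) (c : 'rV[R]_3).
Hypotheses (m0 : 0 <= m) (cu : \sum_i c 0 i ^+ 2 = 1).
Let kappa := kap m.
Let k0 : 0 <= kappa := kap_ge0 m.

Variable B : 'M[R]_4.
Hypotheses (BB : B *m B^T = 1%:M)
  (gE : forall q, tn_metric m q = B *m gmod kappa J4 (q *m B) *m B^T)
  (FE : forall q, tn_F m c q = B *m Fmod kappa J4 (S4 ord_max) (q *m B) *m B^T).
Let BB' : B^T *m B = 1%:M := mulmx1C BB.
Let gU q : gmod kappa J4 q \in unitmx := (gmod_unit q (@J4_orth R) k0).1.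

Definition frame_domain : set 'rV[R]_4 := (fun q => q *m B) @^-1` @chart_domain R.
Definition frame_potential (q : 'rV[R]_4) : 'rV[R]_4 := potential kappa (q *m B) *m B^T.
Definition frame_coord (q : 'rV[R]_4) : 'rV[R]_4 := coord (q *m B).

Lemma open_frame_domain : open frame_domain.
Proof. exact/open_preimage_frame/open_chart_domain. Qed.

Lemma potential_elementary i : elementary (fun y => potential kappa y 0 i).
Proof.
exists (nth (ECst 0) (potentialE kappa) i) => y; rewrite mxE; split=> //.
exact/polynomial_valid/potential_polynomial.
Qed.

Lemma frame_potential_elementary i : elementary (fun y => frame_potential y 0 i).
Proof.
rewrite (_ : (fun y => _) = fun y => \sum_j potential kappa (y *m B) 0 j * B^T j i).
  apply: elementary_sum => j; apply: elementaryM; last exact: elementary_cst.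
  by apply: (@elementary_comp R 4 4 (fun p => p *m B) (fun y => potential kappa y 0 j));
    [move=> k; exact: elementary_mul_row|exact: potential_elementary].
by apply/funext => y; rewrite mxE.
Qed.

Lemma pd_frame (f : 'rV[R]_4 -> R) q a : elementary f ->
  pd a (fun q => f (q *m B)) q = \sum_b B a b * pd b f (q *m B).
Proof.
move=> ef; rewrite /pd.
have [h _] := derive_linear f q (delta_mx 0 a) (@mul_frame_lin R 4 4 B).
rewrite [LHS]h derive_sum_pd//; apply: eq_bigr => b _; congr (_ * _).
by rewrite -rowE mxE.
Qed.

Lemma ext_deriv_frame q : ext_deriv frame_potential q = tn_F m c q.
Proof.
rewrite FE -ext_deriv_potential.
pose X : 'M[R]_4 := \matrix_(a, b) pd a (fun p => potential kappa p 0 b) (q *m B).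
have XE (a b : 'I_4) : pd a (fun p => frame_potential p 0 b) q = (B *m X *m B^T) a b.
  rewrite (_ : (fun p => _) = fun p => \sum_j potential kappa (p *m B) 0 j * B^T j b); last first.
    by apply/funext => y; rewrite mxE.
  have el j : elementary (fun p : 'rV[R]_4 => potential kappa (p *m B) 0 j).
    by apply: (@elementary_comp R 4 4 (fun p => p *m B) (fun y => potential kappa y 0 j));
    [move=> k; exact: elementary_mul_row|exact: potential_elementary].
  rewrite pd_sum; last by move=> j; apply: elementaryM => //; exact: elementary_cst.
  rewrite [RHS]mxE; apply: eq_bigr => j _; rewrite pdM//; last exact: elementary_cst.
  rewrite pd_cst mulr0 addr0; congr (_ * _).
  rewrite (pd_frame q a (potential_elementary j)) [RHS]mxE; apply: eq_bigr => b' _.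
  by rewrite [X _ _]mxE.
have skewE (A : 'M[R]_4) a b : (A - A^T) a b = A a b - A b a by rewrite !mxE.
have -> : ext_deriv frame_potential q = B *m X *m B^T - (B *m X *m B^T)^T.
  by apply/matrixP => a b; rewrite skewE [LHS]mxE (XE a b) (XE b a).
have -> : ext_deriv (potential kappa) (q *m B) = X - X^T.
  by apply/matrixP => a b; rewrite skewE [LHS]mxE [X a b]mxE [X b a]mxE.
by rewrite !trmx_mul trmxK mulmxBr mulmxBl !mulmxA.
Qed.

Lemma frame_chart : local_chart frame_domain frame_coord.
Proof.
have oU := open_frame_domain; split.
- move=> k; apply: Ck_on_linear; [exact: mul_frame_lin|exact: mul_frame_continuous|].
  exact: coord_smooth.
- move=> q q' /set_mem Uq /set_mem Uq' /coord_inj h.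
  have {}h : q *m B = q' *m B by apply: h; exact/mem_set.
  by rewrite -[q]mulmx1 -BB mulmxA h -mulmxA BB mulmx1.
- move=> q Uq.
  have -> : \matrix_(a, b) pd a frame_coord q 0 b = B *m
      \matrix_(a < 4, b < 4) interp (rval (q *m B)) (D (kron a) (nth (ECst 0) coordE b)).
    apply/matrixP => a b; rewrite [LHS]mxE [RHS]mxE.
    have h : is_derive q (delta_mx 0 a) frame_coord
        (\row_b interp (rval (q *m B)) (D (rval (row a B)) (nth (ECst 0) coordE b))).
      apply: (is_derive_linear (L := fun q => q *m B)); first exact: mul_frame_lin.
      rewrite -rowE; apply: is_derive_rV => i; rewrite mxE.
      rewrite (_ : (fun x => _) = fun x : 'rV[R]_4 => interp (rval x) (nth (ECst 0) coordE i)).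
        exact: is_derive_interp (valid_coord _ Uq).
      by apply/funext => x; rewrite mxE.
    case: h => _ h; rewrite /pd h mxE (D_row _ _ (coord_below b)).
    by apply: eq_bigr => j _; rewrite !mxE.
  by rewrite unitmx_mul unitmx_frame// coord_jacobian.
Qed.

(** The second half of the row holds separation constants rather than momenta, hence only the
    position is rotated. *)
Definition phase_frame (w : 'rV[R]_(4 + 4)) : 'rV[R]_(4 + 4) := row_mx (pos w *m B) (mom w).

Lemma phase_frame_lin (s : R) x y :
  phase_frame (s *: x + y) = s *: phase_frame x + phase_frame y.
Proof. by rewrite /phase_frame pos_lin mom_lin mul_frame_lin scale_row_mx add_row_mx. Qed.

Lemma phase_frame_continuous : continuous phase_frame.
Proof.
rewrite (_ : phase_frame = fun w => w *m block_mx B 0 0 1%:M); first exact: mul_frame_continuous.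
apply/funext => z; rewrite /phase_frame -{3}[z]hsubmxK mul_row_block !mulmx0 addr0 add0r.
by rewrite mulmx1.
Qed.

Lemma rval_phase_mom w i : (i < 4)%N -> rval (phase_frame w) (4 + i) = rval (mom w) i.
Proof. by move=> i4; rewrite -rval_mom// /phase_frame [mom (row_mx _ _)]row_mxKr. Qed.

Lemma rval_phase_pos w i : (i < 4)%N -> rval (phase_frame w) i = rval (pos w *m B) i.
Proof. by move=> i4; rewrite -rval_pos// /phase_frame [pos (row_mx _ _)]row_mxKl. Qed.

Lemma integral_action_eq (n0 : R) N f w w' : vars_below 8 N ->
  interp (rval w) N = interp (rval w') N ->
  (forall i, (4 <= i < 8)%N -> rval w i = rval w' i) ->
  integral_interp (n := 4 + 4) (actionE n0 N f) w = integral_interp (n := 4 + 4) (actionE n0 N f) w'.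
Proof.
move=> N8 hN hl; apply: eq_Rintegral => s _.
have NE (x : 'rV[R]_(4 + 4)) : interp (ival x s) N = interp (rval x) N.
  by apply: interp_below N8 _ => i; exact: ival_rval.
have ch : interp (ival w s) (chord n0 N) = interp (ival w' s) (chord n0 N).
  by rewrite /chord /Sub /= !NE hN !ival_last.
rewrite /actionE /Sub /= !NE hN; congr (_ * _); rewrite !interp_subst.
apply: interp_eq => i; rewrite /at_radius; case: eqP => [_|_]; first exact: ch.
by case: ifP => [hi|//]; rewrite /= !ival_rval ?hl//; case/andP: hi.
Qed.

Section AtPoint.
Variables (n1 n2 s1 s2 : R).
Hypotheses (s1s : s1 ^+ 2 = 1) (s2s : s2 ^+ 2 = 1).
Let dom := action_domain kappa e n1 n2 s1 s2.
Let W : set 'rV[R]_(4 + 4) := phase_frame @^-1` dom.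
Let G c := nth (ECst 0) (action_gradE kappa e s1 s2) c.

(** The radial integral sees the position only through N_i. A point at signed distance x on an axis
    of the plane has N_i = x^2, so it can stand for the position and the summand depends on one
    coordinate. *)
Definition separated_action (i : 'I_4) (x : R) (lam : 'rV[R]_4) : R :=
  nth 0 [:: integral_interp (n := 4 + 4) (actionE n1 N1 (rootE s1 (R1E kappa e))) (row_mx (x *: delta_mx 0 0) lam);
    rval lam 1 * atan x;
    integral_interp (n := 4 + 4) (actionE n2 N2 (rootE s2 (R2E kappa e))) (row_mx (x *: delta_mx 0 2) lam);
    rval lam 2 * atan x] i.

Let Sw w := \sum_i separated_action i (frame_coord (pos w) 0 i) (mom w).

Lemma open_W : open W.
Proof.
apply: open_comp; last exact: open_action_domain.
by move=> x _; exact: phase_frame_continuous.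
Qed.

Lemma separated_actionE w : W w -> Sw w = action kappa e n1 n2 s1 s2 (phase_frame w).
Proof.
move=> Ww; have [y0 y2 _ _ _] := Ww.
rewrite /Sw !big_ord_recl big_ord0 addr0 addrA /action.
have l5 : rval (phase_frame w) 5 = rval (mom w) 1 by exact: (rval_phase_mom w (i := 1)).
have l6 : rval (phase_frame w) 6 = rval (mom w) 2 by exact: (rval_phase_mom w (i := 2)).
have rm (x : R) j i (lam : 'rV[R]_4) : (i < 4)%N ->
    rval (row_mx (x *: delta_mx 0 j) lam : 'rV[R]_(4 + 4)) i = x * (i == j :> nat)%:R.
  move=> i4; rewrite -rval_pos// /pos row_mxKl -[i]/(nat_of_ord (Ordinal i4)) rvalE !mxE.
  by rewrite eqxx.
have rl (u lam : 'rV[R]_4) i : (4 <= i < 8)%N ->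
    rval (row_mx u lam : 'rV[R]_(4 + 4)) i = rval lam (i - 4).
  move=> /andP[i4 i8]; rewrite -{1}(subnKC i4) -rval_mom ?ltn_subLR//.
  by rewrite /mom row_mxKr.
apply: (f_equal2 +%R); apply: (f_equal2 +%R).
- apply: integral_action_eq => //; last first.
    move=> i hi; rewrite rl//; case/andP: hi => i4 i8.
    by rewrite -{2}(subnKC i4) rval_phase_mom ?ltn_subLR.
  rewrite /= !rm//= mulr0 mulr1 mul0r addr0 mxE /=.
  rewrite !(rval_phase_pos w)//.
  set a0 := rval _ 0; set a1 := rval _ 1.
  have a00 : a0 != 0 by rewrite /a0 -rval_phase_pos.
  have h : 0 <= 1 + a1 / a0 * (a1 / a0) by rewrite -expr2 addr_ge0// sqr_ge0.
  have := sqr_sqrtr h; set r := Num.sqrt _ => hr.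
  transitivity (a0 * a0 * r ^+ 2); first by ring.
  by rewrite hr; field.
- by rewrite l5 /= mxE /= !(rval_phase_pos w).
- apply: integral_action_eq => //; last first.
    move=> i hi; rewrite rl//; case/andP: hi => i4 i8.
    by rewrite -{2}(subnKC i4) rval_phase_mom ?ltn_subLR.
  rewrite /= !rm//= mulr0 mulr1 mul0r addr0 mxE /=.
  rewrite !(rval_phase_pos w)//.
  set a0 := rval _ 2; set a1 := rval _ 3.
  have a00 : a0 != 0 by rewrite /a0 -rval_phase_pos.
  have h : 0 <= 1 + a1 / a0 * (a1 / a0) by rewrite -expr2 addr_ge0// sqr_ge0.
  have := sqr_sqrtr h; set r := Num.sqrt _ => hr.
  transitivity (a0 * a0 * r ^+ 2); first by ring.
  by rewrite hr; field.
- by rewrite l6 /= mxE /= !(rval_phase_pos w).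
Qed.

Lemma phase_frame_delta_l a : phase_frame (delta_mx 0 (lshift 4 a)) = row_mx (row a B) 0.
Proof.
rewrite /phase_frame; congr row_mx; last by apply/rowP => j; rewrite !mxE eq_rlshift andbF.
rewrite [pos _](_ : _ = delta_mx 0 a) -?rowE//.
by apply/rowP => j; rewrite !mxE (inj_eq (@lshift_inj _ _)).
Qed.

Lemma phase_frame_delta_r b : phase_frame (delta_mx 0 (rshift 4 b)) = delta_mx 0 (rshift 4 b).
Proof.
rewrite /phase_frame -[RHS]hsubmxK [pos _](_ : _ = 0) ?mul0mx; last first.
  by apply/rowP => j; rewrite !mxE eq_lrshift andbF.
by congr row_mx; apply/rowP => j; rewrite !mxE eq_lrshift andbF.
Qed.

Lemma pd_separated_action w a : W w -> pd (lshift 4 a) Sw w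
  = \sum_b B a b * interp (rval (phase_frame w)) (G b).
Proof.
move=> Ww; rewrite /pd.
have [-> _] := eq_on_derive open_W separated_actionE (delta_mx 0 (lshift 4 a)) Ww.
have [|_] := @is_derive_action_total R kappa e n1 n2 s1 s2 (phase_frame w) (row_mx (row a B) 0) Ww.
  move=> i /andP[i4 i8]; rewrite -{1}(subnKC i4) -rval_mom ?ltn_subLR//.
  by rewrite /mom row_mxKr /rval; case: insubP => // j _ _; rewrite mxE.
move=> h; have [h' _] := derive_linear (action kappa e n1 n2 s1 s2) w
  (delta_mx 0 (lshift 4 a)) phase_frame_lin.
rewrite [LHS]h' phase_frame_delta_l h; apply: eq_bigr => b _; congr (_ * _).
rewrite -rval_pos// /pos row_mxKl rvalE mxE.
by [].
Qed.

Lemma separated_momentum w : W w ->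
  \row_a pd (lshift 4 a) Sw w - e *: frame_potential (pos w)
  = kinetic_momentum kappa e s1 s2 (phase_frame w) *m B^T.
Proof.
move=> Ww; apply/rowP => a; rewrite [LHS]mxE [X in X + _]mxE pd_separated_action//.
rewrite [X in _ + X]mxE [X in - X]mxE /frame_potential [X in e * X]mxE [RHS]mxE.
rewrite mulr_sumr -sumrB; apply: eq_bigr => b _; rewrite [B^T b a]mxE [potential _ _ _ _]mxE.
rewrite [kinetic_momentum _ _ _ _ _ _ _]mxE.
have -> : interp (rval (pos w *m B)) (nth (ECst 0) (potentialE kappa) b)
   = interp (rval (phase_frame w)) (nth (ECst 0) (potentialE kappa) b).
  by apply: (interp_below (potential_below kappa b)) => i i4; rewrite rval_phase_pos.
by rewrite mulrBl mulrA [B a b * _]mulrC.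
Qed.

Lemma complete_separated : complete_integral (tn_metric m) e frame_potential 0 W Sw.
Proof.
split.
- apply: (@Ck_on_eq _ _ _ _ _ (action kappa e n1 n2 s1 s2 \o phase_frame)); first exact: open_W.
    by move=> w Ww; rewrite separated_actionE.
  apply: Ck_on_linear; [exact: phase_frame_lin|exact: phase_frame_continuous|].
  exact: Ck_on_action.
- move=> w Ww p; rewrite /p (separated_momentum Ww) (invmx_transport BB gE gU).
  rewrite trmx_mul trmxK !mulmxA -(mulmxA _ B^T) BB' mulmx1 -(mulmxA _ B^T) BB' mulmx1.
  have := hj_model k0 Ww s1s s2s; rewrite (gmod_unit _ (@J4_orth R) k0).2.
  rewrite [pos (phase_frame w)]row_mxKl => ->.
  by rewrite (rval_phase_mom w (isT : (0 < 4)%N)) -[0%N]/(nat_of_ord (0 : 'I_4)) rvalE.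
- move=> w Ww.
  have -> : \matrix_(a, b) pd (rshift 4 b) (pd (lshift 4 a) Sw) w = B *m
      \matrix_(a < 4, b < 4) interp (rval (phase_frame w)) (D (kron (4 + b)) (G a)).
    apply/matrixP => a b; rewrite [LHS]mxE [RHS]mxE.
    pose T w := \sum_b B a b * interp (rval (phase_frame w)) (G b).
    have hT w' : W w' -> pd (lshift 4 a) Sw w' = T w' by exact: pd_separated_action.
    rewrite {1}/pd; have [-> _] := eq_on_derive open_W hT (delta_mx 0 (rshift 4 b)) Ww.
    have h : is_derive w (delta_mx 0 (rshift 4 b)) T
        (\sum_j B a j * interp (rval (phase_frame w)) (D (kron (4 + b)) (G j))).
      apply: (is_derive_linear (L := phase_frame)
        (f := fun w => \sum_j B a j * interp (rval w) (G j))); first exact: phase_frame_lin.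
      rewrite phase_frame_delta_r; apply/is_derive_line.
      apply: is_derive_sumr => j.
      have vG : valid (rval (phase_frame w)) (G j) by exact: valid_action_grad Ww.
      have := is_derive_interp (delta_mx 0 (rshift 4 b)) vG.
      rewrite (@D_eq_below _ 8 _ (kron (4 + b))); last first.
      - by move=> i i8; rewrite rval_delta i8.
      - by case: j {vG} => [[|[|[|[|//]]]] Hj].
      move=> /is_derive_line hh; apply: (is_derive_eq (is_deriveMr (is_derive_cst (B a j) _ _) hh)).
      by rewrite mul0r add0r.
    case: h => _ ->; apply: eq_bigr => j _.
    by rewrite [X in _ = _ * X]mxE.
  rewrite det_mulmx mulf_neq0// -unitfE.
    by rewrite -[_ \in _]/(B \in unitmx); exact: unitmx_frame.
  by have := mixed_unit k0 Ww s1s s2s; rewrite unitmxE.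
Qed.

End AtPoint.

Definition frame_generic : set 'rV[R]_(4 + 4) := lift_frame B @^-1`
  [set z | interp (rval z) (EMul (EMul (EVar 0) (EVar 2)) radial) != 0].

Lemma frame_hj_separable : hj_separable (tn_metric m) (tn_F m c) e.
Proof.
have o1 : interp (rval (const_mx 1 : 'rV[R]_(4 + 4))) (EMul (EMul (EVar 0) (EVar 2)) radial) != 0.
  have o k : (k < 8)%N -> rval (const_mx 1 : 'rV[R]_(4 + 4)) k = 1.
    by move=> k8; rewrite -[k]/(nat_of_ord (Ordinal k8 : 'I_(4 + 4))) rvalE mxE.
  by rewrite /= !o// !mulf_neq0 ?oner_eq0//; rewrite mulr1 -natrD pnatr_eq0.
have [oO dO] := dense_lift BB (open_neq0 (E := EMul (EMul (EVar 0) (EVar 2)) radial) isT)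
  (@dense_neq0 R _ (EMul (EMul (EVar 0) (EVar 2)) radial) _ isT o1).
exists frame_domain, frame_potential, frame_coord, frame_generic.
have genE z : frame_generic z -> let z' := lift_frame B z in
    [/\ rval z' 0 != 0, rval z' 2 != 0, interp (rval z') radial1 != 0 & interp (rval z') radial2 != 0].
  by rewrite /frame_generic /= !mulf_eq0 !negb_or => /andP[/andP[-> ->] /andP[-> ->]].
have lp z i : (i < 4)%N -> rval (pos z *m B) i = rval (lift_frame B z) i.
  by move=> i4; rewrite -rval_pos// pos_lift.
split.
- split; first exact: open_frame_domain.
  have dU : dense [set y : 'rV[R]_4 | interp (rval y) (EMul (EVar 0) (EVar 2)) != 0].
    apply: (@dense_neq0 _ _ _ (const_mx 1)) => //=.
    by rewrite -[0%N]/(nat_of_ord (0 : 'I_4)) -[2%N]/(nat_of_ord (2 : 'I_4)) !rvalE !mxE mulr1 oner_eq0.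
  move=> V [x Vx] oV.
  have oV' : open ((fun q => q *m B^T) @^-1` V) by exact: open_preimage_frame.
  have [|y [Vy Uy]] := dU _ _ oV'.
    by exists (x *m B); rewrite /= -mulmxA BB mulmx1.
  exists (y *m B^T); split=> //; rewrite /frame_domain /= -mulmxA BB' mulmx1.
  by rewrite chart_domainE.
- split; last by move=> q _; exact: ext_deriv_frame.
  move=> k; apply: Ck_on_mx; first exact: open_frame_domain.
  move=> i; apply: elementary_smooth; first exact: open_frame_domain.
  exact: frame_potential_elementary.
- exact: frame_chart.
- split=> // z /genE[z0 z2 _ _]; split; rewrite /= lp//.
move=> z /genE; set z' := lift_frame B z => -[z0 z2 r1 r2].
pose n1 := interp (rval z') N1; pose n2 := interp (rval z') N2.
pose s1 := Num.sg (interp (rval z') radial1); pose s2 := Num.sg (interp (rval z') radial2).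
have s1s : s1 ^+ 2 = 1 by exact: sg_sq.
have s2s : s2 ^+ 2 = 1 by exact: sg_sq.
have w0E : phase_frame (row_mx (pos z) (separation_constants kappa e z'))
    = row_mx (pos z') (separation_constants kappa e z').
  by rewrite /phase_frame /z' pos_lift /pos /mom row_mxKl row_mxKr.
exists 0, (separation_constants kappa e z'),
  (phase_frame @^-1` action_domain kappa e n1 n2 s1 s2), (separated_action n1 n2 s1 s2) => S w0.
have Ww0 : (phase_frame @^-1` action_domain kappa e n1 n2 s1 s2) w0.
  by rewrite /= /w0 w0E; exact: action_domain_start.
split=> //.
- exact: open_W.
- move=> w [y0 y2 _ _ _]; split; rewrite -(rval_phase_pos w)//.
- exact: complete_separated.
- have := separated_momentum Ww0; rewrite {2}/w0 [pos (row_mx _ _)]row_mxKl.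
  move=> ->; rewrite /w0 w0E kinetic_momentum_start//.
  by rewrite /z' mom_lift -mulmxA BB mulmx1.
Qed.

End HamiltonJacobi.

Lemma tn_hj_separable (R : realType) (m e : R) (c : 'rV[R]_3) : 0 <= m ->
  \sum_i c 0 i ^+ 2 = 1 -> hj_separable (tn_metric m) (tn_F m c) e.
Proof.
move=> m0 c1; have [p hp] := adapted_point c1.
have [|B [BB gE FE _ _]] := @tn_adapted R m c (p *m (frame0 m)^T) m0 c1.
  by rewrite -mulmxA (mulmx1C (frame0_orth m)) mulmx1.
exact: frame_hj_separable BB gE FE.
Qed.

(** * Quadratures *)

Section OneVariable.
Context {R : realType}.
Implicit Types (I J : set R) (f h : R -> R).

Lemma open_interval_nbhd J t : open_interval J -> J t ->
  exists a b : R, [/\ a < t, t < b & `[a, b]%classic `<=` J].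
Proof.
move=> [oJ iJ] Jt; have /nbhs_ballP[d /= d0 hb] : nbhs t J by exact: open_nbhs_nbhs.
have ball_ x : `|t - x| < d -> J x by move=> h; exact: hb.
exists (t - d / 2), (t + d / 2); split.
- by rewrite ltrBlDr ltrDl divr_gt0.
- by rewrite ltrDl divr_gt0.
- move=> x; rewrite /= in_itv/= => /andP[ax xb]; apply: ball_.
  rewrite ltr_norml; apply/andP; split; move: ax xb d0; lra.
Qed.

Lemma open_interval_oo (a b : R) : open_interval `]a, b[%classic.
Proof. by split; [exact: itv_open|exact: interval_is_interval]. Qed.

Lemma open_interval_setT : open_interval (setT : set R).
Proof. by split; [exact: openT|move=> ? ? ? ?]. Qed.

Lemma primitive_exists J f t : open_interval J -> J t ->
  (forall s, J s -> {for s, continuous f}) ->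
  exists (I : set R) (F : R -> R), [/\ open_interval I, I t, I `<=` J &
    forall s, I s -> is_derive s (1 : R) F (f s)].
Proof.
move=> oJ Jt cf; have [a [b [at_ tb abJ]]] := open_interval_nbhd oJ Jt.
pose F x := (\int[lebesgue_measure]_(s in `[a, x]) f s)%R.
exists `]a, b[%classic, F; split=> //.
- exact: open_interval_oo.
- by rewrite /= in_itv/= at_ tb.
- by move=> x /subset_itv_oo_cc; exact: abJ.
- move=> s; rewrite /= in_itv/= => /andP[as_ sb].
  have fi : lebesgue_measure.-integrable `[a, b] (EFin \o f).
    apply: continuous_compact_integrable; first exact: segment_compact.
    by apply: continuous_in_subspaceT => x /set_mem/abJ; exact: cf.
  have [|d e] := continuous_FTC1_closed sb fi as_.
    by apply: cf; apply: abJ; rewrite /= in_itv/= !ltW.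
  by apply: DeriveDef; [exact: d|rewrite -derive1E].
Qed.

(** The factor [sgn] treats increasing and decreasing functions together. The image is an interval
    by the intermediate value theorem, and it is open by strict monotonicity on small segments. *)
Lemma inverse_function I f f' (sgn : R) : open_interval I ->
  (forall t, I t -> is_derive t (1 : R) f (f' t)) ->
  (forall t, I t -> 0 < sgn * f' t) ->
  exists h : R -> R, [/\ open_interval (f @` I), (forall t, I t -> h (f t) = t) &
    forall t, I t -> is_derive (f t) (1 : R) h (f' t)^-1].
Proof.
move=> oI df f0.
have cf t : I t -> {for t, continuous f}.
  by move=> /df[d _]; apply: differentiable_continuous; exact/derivable1_diffP.
have sub a b : I a -> I b -> forall x, x \in `[a, b] -> I x.
  by move=> Ia Ib x; rewrite in_itv/= => /andP[ax xb]; apply: (oI.2 a b) => //; rewrite ax xb.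
have cab a b : I a -> I b -> {within `[a, b], continuous f}.
  move=> Ia Ib; apply: continuous_in_subspaceT => x /set_mem/(sub _ _ Ia Ib); exact: cf.
have mono a b : a < b -> I a -> I b -> sgn * f a < sgn * f b.
  move=> ab Ia Ib.
  have hd x : x \in `]a, b[ -> is_derive x (1 : R) f (f' x).
    by move=> /subset_itv_oo_cc/(sub _ _ Ia Ib); exact: df.
  have [x /subset_itv_oo_cc/(sub _ _ Ia Ib) Ix e] := MVT ab hd (cab _ _ Ia Ib).
  by rewrite -subr_gt0 -mulrBr e mulrA mulr_gt0 ?f0// subr_gt0.
have inj a b : I a -> I b -> f a = f b -> a = b.
  move=> Ia Ib e; case: (ltgtP a b) => // [/mono|/mono].
    by move=> /(_ Ia Ib); rewrite e ltxx.
  by move=> /(_ Ib Ia); rewrite e ltxx.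
have ivt a b y : a <= b -> I a -> I b -> Num.min (f a) (f b) <= y <= Num.max (f a) (f b) ->
    (f @` I) y.
  move=> ab Ia Ib /(IVT ab (cab _ _ Ia Ib))[x xab <-].
  by exists x => //; exact: sub xab.
pose h y := xget 0 [set t | I t /\ f t = y].
have hK t : I t -> h (f t) = t.
  move=> It; have [] : I (h (f t)) /\ f (h (f t)) = f t.
    by apply: (@xgetPex _ _ [set s | I s /\ f s = f t]); exists t.
  by move=> Ih /inj; apply.
exists h; split=> //.
- split; last first.
    move=> _ _ [a Ia <-] [b Ib <-] y /andP[ay yb].
    case: (leP a b) => [ab|/ltW ba].
      by apply: (ivt a b) => //; rewrite ge_min ay le_max yb orbT.
    by apply: (ivt b a) => //; rewrite ge_min ay orbT le_max yb.
  rewrite openE => _ [t It <-].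
  have [a [b [at_ tb abI]]] := open_interval_nbhd oI It.
  have Ia : I a by apply: abI; rewrite /= in_itv/= lexx ltW// (lt_trans at_).
  have Ib : I b by apply: abI; rewrite /= in_itv/= lexx andbT ltW// (lt_trans at_).
  have m1 := mono _ _ at_ Ia It; have m2 := mono _ _ tb It Ib.
  have c : (fun y : R => sgn * y) @ f t --> sgn * f t by apply: cvgMr; exact: cvg_id.
  have n1 := cvgr_gt _ c _ m1; have n2 := cvgr_lt _ c _ m2.
  rewrite /interior; near=> y; apply: (ivt a b) => //; first by rewrite ltW// (lt_trans at_).
  have y1 : sgn * f a < sgn * y by near: y; exact: n1.
  have y2 : sgn * y < sgn * f b by near: y; exact: n2.
  have [s0|s0|s0] := ltrgtP sgn 0.
  + by move: y1 y2; rewrite !ltr_nM2l// => y1 y2; rewrite ge_min le_max (ltW y1) (ltW y2) orbT.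
  + by move: y1 y2; rewrite !ltr_pM2l// => y1 y2; rewrite ge_min le_max (ltW y1) (ltW y2) orbT.
  + by move: y1; rewrite s0 !mul0r ltxx.
- move=> t It; have nI : \forall s \near t, I s by exact: open_nbhs_nbhs (conj oI.1 It).
  apply: (@is_derive_inverse R f h); last by have := f0 t It; case: eqP => [->|//]; rewrite mulr0 ltxx.
  + by apply: filterS nI => s; exact: hK.
  + by apply: filterS nI => s; exact: cf.
  + exact: df.
Unshelve. all: by end_near. Qed.

End OneVariable.

Section Schemes.
Context {R : realType}.
Variable k : nat -> R.
Implicit Types (I J : set R) (f h : R -> R).

Lemma by_schemeD s1 s2 I f h : by_scheme k s1 I f -> by_scheme k s2 I h ->
  by_scheme k (SAdd s1 s2) I (fun x => f x + h x).
Proof. by move=> hf hh; exists f, h. Qed.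

Lemma by_schemeM s1 s2 I f h : by_scheme k s1 I f -> by_scheme k s2 I h ->
  by_scheme k (SMul s1 s2) I (fun x => f x * h x).
Proof. by move=> hf hh; exists f, h. Qed.

Lemma by_schemeN s I f : by_scheme k s I f -> by_scheme k (SOpp s) I (fun x => - f x).
Proof. by move=> hf; exists f. Qed.

Lemma by_schemeV s I f : by_scheme k s I f -> (forall x, I x -> f x != 0) ->
  by_scheme k (SInv s) I (fun x => (f x)^-1).
Proof. by move=> hf f0; exists f => // x /f0. Qed.

Lemma by_scheme_cst i I c : k i = c -> by_scheme k (SConst i) I (fun=> c).
Proof. by move=> <-. Qed.

Lemma by_scheme_prim s I F f : by_scheme k s I f ->
  (forall x, I x -> is_derive x (1 : R) F (f x)) -> by_scheme k (SPrim s) I F.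
Proof. by move=> hf dF; exists f. Qed.

Lemma by_scheme_eq s I f h : open I -> (forall x, I x -> f x = h x) ->
  by_scheme k s I f -> by_scheme k s I h.
Proof.
move=> oI fh; case: s => [|i|s|s1 s2|s1 s2|s|d s|s1 s2|s|s] /=.
- by move=> e x Ix; rewrite -fh ?e.
- by move=> e x Ix; rewrite -fh ?e.
- by move=> [f1 h1 e]; exists f1 => // x Ix; rewrite -fh ?e.
- by move=> [f1 [f2 [h1 h2 e]]]; exists f1, f2; split=> // x Ix; rewrite -fh ?e.
- by move=> [f1 [f2 [h1 h2 e]]]; exists f1, f2; split=> // x Ix; rewrite -fh ?e.
- by move=> [f1 h1 e]; exists f1 => // x Ix; rewrite -fh ?e//; exact: e.
- by move=> [f1 h1 e]; exists f1 => // x Ix; rewrite -fh ?e//; exact: e.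
- move=> [J [f1 [f2 [oJ h1 h2 e]]]]; exists J, f1, f2; split=> // x Ix.
  by rewrite -fh//; exact: e.
- move=> [f1 h1 e]; exists f1 => // x Ix; have [d de] := e x Ix.
  have [e1 d1] := eq_on_derive oI fh 1 Ix.
  by apply: DeriveDef; [exact/d1|rewrite -e1].
- by move=> [J [f1 [oJ h1 i e]]]; exists J, f1; split=> // x Ix; rewrite -fh//; exact: e.
Qed.

End Schemes.

(** * Generic initial data *)

Section Generic.
Context {R : realType}.
Variable m : R.
Hypothesis m0 : 0 <= m.
Let kappa := kap m.
Let k0 : 0 <= kappa := kap_ge0 m.
Local Notation data := ('rV[R]_4 * 'rV[R]_4 * 'rV[R]_4)%type.
Implicit Types d : data.
Local Notation f0 := (frame0 m).
Local Notation g := (tn_metric m).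

(* The components of the acceleration along the three rotated velocities. *)
Definition rotated (i : 'I_3) (q u a : 'rV[R]_4) : R := (a *m tn_Omega m i q *m u^T) 0 0.

(** For unit u and a = e F u the components [rotated i] are e c_i, and this is e^2 ((q . u)^2 - (q
    S_c . u)^2) in the coordinates turned by [frame0 m]. In a frame adapted to c it is 4 e^2 times
    the product of the two radial velocities. Written through a, it does not refer to c. *)
Definition generic (q u a : 'rV[R]_4) : R :=
  (\sum_i rotated i q u a ^+ 2) * dot (q *m f0) (u *m f0) ^+ 2
  - (\sum_i rotated i q u a * dot (q *m f0 *m S4 i) (u *m f0)) ^+ 2.

Lemma rotatedZ i q r u a : rotated i q (r *: u) a = r * rotated i q u a.
Proof. by rewrite /rotated linearZ/= -scalemxAr [LHS]mxE. Qed.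

Lemma rotated_shift i q u a lam : rotated i q u (a - lam *: u) = rotated i q u a.
Proof.
rewrite /rotated !mulmxBl [LHS]mxE -!scalemxAl [X in _ + X]mxE [X in _ - X]mxE.
suff -> : (u *m tn_Omega m i q *m u^T) 0 0 = 0 by rewrite mulr0 subr0.
have tr00 (M : 'M[R]_1) : M 0 0 = M^T 0 0 by rewrite mxE.
have h : (u *m tn_Omega m i q *m u^T) 0 0 = - (u *m tn_Omega m i q *m u^T) 0 0.
  rewrite [LHS]tr00 !trmx_mul trmxK tn_Omega_skew// mulmxA mulmxN mulNmx [LHS]mxE.
  by [].
by move: h; move: (_ 0 0) => x; lra.
Qed.

(** Together with the invariance under adding multiples of u to a, this homogeneity allows u to be
    normalised and a to be made orthogonal to u without losing non-vanishing. *)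
Lemma genericZ q r u a : generic q (r *: u) a = r ^+ 4 * generic q u a.
Proof.
have d1 : dot (q *m f0) (r *: u *m f0) = r * dot (q *m f0) (u *m f0).
  by rewrite -scalemxAl dotZr.
have d2 i : dot (q *m f0 *m S4 i) (r *: u *m f0) = r * dot (q *m f0 *m S4 i) (u *m f0).
  by rewrite -scalemxAl dotZr.
rewrite /generic d1.
have -> : \sum_i rotated i q (r *: u) a ^+ 2 = r ^+ 2 * \sum_i rotated i q u a ^+ 2.
  by rewrite mulr_sumr; apply: eq_bigr => i _; rewrite rotatedZ exprMn.
have -> : \sum_i rotated i q (r *: u) a * dot (q *m f0 *m S4 i) (r *: u *m f0)
    = r ^+ 2 * \sum_i rotated i q u a * dot (q *m f0 *m S4 i) (u *m f0).
  by rewrite mulr_sumr; apply: eq_bigr => i _; rewrite rotatedZ d2; ring.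
by ring.
Qed.

Lemma generic_shift q u a lam : generic q u (a - lam *: u) = generic q u a.
Proof.
rewrite /generic; congr (_ * _ - _ ^+ 2); apply: eq_bigr => i _; by rewrite rotated_shift.
Qed.

Definition pack d : 'rV[R]_(4 + (4 + 4)) :=
  row_mx (d.1.1 *m f0) (row_mx (d.1.2 *m f0) (d.2 *m f0)).

Definition sum4E (h : nat -> @expr R) : expr := EAdd (EAdd (h 0%N) (h 1%N)) (EAdd (h 2%N) (h 3%N)).
Definition rotatedE (i : nat) : expr := sum4E (fun k => sum4E (fun l =>
  EMul (EMul (EVar (8 + k)) (FE kappa i k l)) (EVar (4 + l)))).
Definition genericE : expr := Sub
  (EMul (EAdd (EAdd (sq (rotatedE 0)) (sq (rotatedE 1))) (sq (rotatedE 2)))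
    (sq (sum4E (fun k => EMul (EVar k) (EVar (4 + k))))))
  (sq (EAdd (EAdd (EMul (rotatedE 0) (sum4E (fun k => EMul (SE 0 k) (EVar (4 + k)))))
     (EMul (rotatedE 1) (sum4E (fun k => EMul (SE 1 k) (EVar (4 + k))))))
     (EMul (rotatedE 2) (sum4E (fun k => EMul (SE 2 k) (EVar (4 + k))))))).

Lemma rval_pack d k : (k < 12)%N -> rval (pack d) k =
  if (k < 4)%N then rval (d.1.1 *m f0) k else
  if (k < 8)%N then rval (d.1.2 *m f0) (k - 4) else rval (d.2 *m f0) (k - 8).
Proof.
move=> k12; rewrite -{1}[k]/(nat_of_ord (Ordinal k12 : 'I_(4 + (4 + 4)))) rvalE mxE.
case: splitP => j /= kj; first by rewrite kj ltn_ord rvalE.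
rewrite mxE; case: splitP => l lj.
  rewrite kj lj ltnNge leq_addr /= (_ : (4 + l < 8)%N) ?addKn ?rvalE//.
  by rewrite -[8%N]/(4 + 4)%N ltn_add2l.
have -> : (k < 4)%N = false by rewrite kj lj.
have -> : (k < 8)%N = false by rewrite kj lj.
by rewrite kj lj addnA addKn rvalE.
Qed.

Lemma interp_rotatedE (i : 'I_3) d :
  interp (rval (pack d)) (rotatedE i) = rotated i d.1.1 d.1.2 d.2.
Proof.
rewrite /rotated tn_OmegaE// !mulmxA -mulmxA -trmx_mul -/(dot _ _) dot4E.
set q := d.1.1 *m f0; set u := d.1.2 *m f0; set a := d.2 *m f0.
have aF l : (l < 4)%N -> rval (a *m Fmod kappa J4 (S4 i) q) l =
    rval a 0 * interp (rval q) (FE kappa i 0 l) + rval a 1 * interp (rval q) (FE kappa i 1 l)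
    + rval a 2 * interp (rval q) (FE kappa i 2 l) + rval a 3 * interp (rval q) (FE kappa i 3 l).
  by move=> l4; rewrite -[X in rval _ X]/(nat_of_ord (Ordinal l4)) rvalE mulrow4E -!interp_FE.
rewrite !aF//.
have FB (k l : nat) : (k < 4)%N -> (l < 4)%N ->
    interp (rval (pack d)) (FE kappa i k l) = interp (rval q) (FE kappa i k l).
  move=> k4 l4; apply: (@interp_below R 4).
    by case: i {aF} => [[|[|[|//]]] Hi]; move: k l k4 l4 => [|[|[|[|//]]]] [|[|[|[|//]]]].
  by move=> j j4; rewrite rval_pack ?(ltn_trans j4 (isT : 4 < 12)%N)// ifT.
rewrite /rotatedE /sum4E.
have e8 k : (k < 4)%N -> rval (pack d) (8 + k) = rval a k.
  move=> k4; rewrite rval_pack; last by rewrite -[12%N]/(8 + 4)%N ltn_add2l.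
  by have -> : (8 + k < 4)%N = false by []; have -> : (8 + k < 8)%N = false by []; rewrite addKn.
have e4 k : (k < 4)%N -> rval (pack d) (4 + k) = rval u k.
  move=> k4; rewrite rval_pack; last by rewrite (@leq_trans (4 + 4))// ltn_add2l.
  by rewrite ltnNge leq_addr /= -[8%N]/(4 + 4)%N ltn_add2l k4 addKn.
have te k l : (k < 4)%N -> (l < 4)%N -> interp (rval (pack d))
    (EMul (EMul (EVar (8 + k)) (FE kappa i k l)) (EVar (4 + l)))
    = rval a k * interp (rval q) (FE kappa i k l) * rval u l.
  move=> k4 l4.
  transitivity (rval (pack d) (8 + k) * interp (rval (pack d)) (FE kappa i k l) * rval (pack d) (4 + l)) => //.
  by rewrite e8// e4// FB.
pose t k l := interp (rval (pack d)) (EMul (EMul (EVar (8 + k)) (FE kappa i k l)) (EVar (4 + l))).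
have -> : interp (rval (pack d)) (rotatedE i) =
    (((t 0%N 0%N + t 0%N 1%N) + (t 0%N 2%N + t 0%N 3%N)) + ((t 1%N 0%N + t 1%N 1%N) + (t 1%N 2%N + t 1%N 3%N)))
  + (((t 2%N 0%N + t 2%N 1%N) + (t 2%N 2%N + t 2%N 3%N)) + ((t 3%N 0%N + t 3%N 1%N) + (t 3%N 2%N + t 3%N 3%N))) by [].
rewrite /t !te//.
by ring.
Qed.

Lemma interp_genericE d : interp (rval (pack d)) genericE = generic d.1.1 d.1.2 d.2.
Proof.
rewrite /generic !big_ord_recl !big_ord0 -!interp_rotatedE.
rewrite !dot4E.
set q := d.1.1 *m f0; set u := d.1.2 *m f0.
have e4 k : (k < 4)%N -> rval (pack d) (4 + k) = rval u k.
  move=> k4; rewrite rval_pack; last by rewrite (@leq_trans (4 + 4))// ltn_add2l.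
  by rewrite ltnNge leq_addr /= -[8%N]/(4 + 4)%N ltn_add2l k4 addKn.
have e0 k : (k < 4)%N -> rval (pack d) k = rval q k.
  by move=> k4; rewrite rval_pack ?(ltn_trans k4 (isT : 4 < 12)%N)// ifT.
pose ID E := interp (rval (pack d)) E.
have gE : interp (rval (pack d)) genericE =
   ((ID (rotatedE 0) * ID (rotatedE 0) + ID (rotatedE 1) * ID (rotatedE 1)) + ID (rotatedE 2) * ID (rotatedE 2))
   * (ID (sum4E (fun k => EMul (EVar k) (EVar (4 + k)))) * ID (sum4E (fun k => EMul (EVar k) (EVar (4 + k)))))
   - ((ID (rotatedE 0) * ID (sum4E (fun k => EMul (SE 0 k) (EVar (4 + k))))
     + ID (rotatedE 1) * ID (sum4E (fun k => EMul (SE 1 k) (EVar (4 + k)))))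
     + ID (rotatedE 2) * ID (sum4E (fun k => EMul (SE 2 k) (EVar (4 + k)))))
   * ((ID (rotatedE 0) * ID (sum4E (fun k => EMul (SE 0 k) (EVar (4 + k))))
     + ID (rotatedE 1) * ID (sum4E (fun k => EMul (SE 1 k) (EVar (4 + k)))))
     + ID (rotatedE 2) * ID (sum4E (fun k => EMul (SE 2 k) (EVar (4 + k))))) by [].
rewrite gE /ID.
have -> : rotatedE (lift ord0 ord0 : 'I_3) = rotatedE 1 by [].
have -> : rotatedE (lift ord0 (lift ord0 ord0) : 'I_3) = rotatedE 2 by [].
have -> : rotatedE (ord0 : 'I_3) = rotatedE 0 by [].
move: (rotatedE 0) (rotatedE 1) (rotatedE 2) => r0 r1 r2.
have -> : interp (rval (pack d)) (sum4E (fun k => EMul (EVar k) (EVar (4 + k))))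
   = rval q 0 * rval u 0 + rval q 1 * rval u 1 + rval q 2 * rval u 2 + rval q 3 * rval u 3.
  by rewrite /= (e4 0%N isT) (e4 1%N isT) (e4 2%N isT) (e4 3%N isT) !e0// addrA.
have hS (i : 'I_3) : interp (rval (pack d)) (sum4E (fun k => EMul (SE i k) (EVar (4 + k))))
   = rval (q *m S4 i) 0 * rval u 0 + rval (q *m S4 i) 1 * rval u 1
     + rval (q *m S4 i) 2 * rval u 2 + rval (q *m S4 i) 3 * rval u 3.
  rewrite !rvalS4; case: i => [[|[|[|//]]] Hi];
    by rewrite /= (e4 0%N isT) (e4 1%N isT) (e4 2%N isT) (e4 3%N isT) !e0// addrA.
have -> := hS ord0; have -> := hS (lift ord0 ord0); have -> := hS (lift ord0 (lift ord0 ord0)).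
by rewrite !addr0; ring.
Qed.

Lemma genericE_polynomial : polynomial genericE.
Proof. by []. Qed.

Lemma inner_cvg (T : Type) (G : set_system T) (FG : Filter G) (Q X Y : T -> 'rV[R]_4) q x y :
  Q @ G --> q -> X @ G --> x -> Y @ G --> y ->
  (fun s => inner g (Q s) (X s) (Y s)) @ G --> inner g q x y.
Proof.
move=> cQ cX cY.
have e (q' x' y' : 'rV[R]_4) : inner g q' x' y' = \sum_j (\sum_i x' 0 i * g q' i j) * y' 0 j.
  by rewrite /inner mxE; apply: eq_bigr => j _; rewrite !mxE.
rewrite e (_ : (fun s => _) = fun s => \sum_j (\sum_i X s 0 i * g (Q s) i j) * Y s 0 j); last first.
  by apply/funext => s; rewrite e.
have cc (Z : T -> 'rV[R]_4) (z : 'rV[R]_4) i : Z @ G --> z -> (fun s => Z s 0 i) @ G --> z 0 i.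
  by move=> cZ; apply: (@cvg_comp _ _ _ _ (fun z : 'rV[R]_4 => z 0 i) _ _ _ cZ); exact: coord_continuous.
have [ge _ _ _] := tn_elementary m0.
have cg i j : (fun s => g (Q s) i j) @ G --> g q i j.
  have [h _] := elementary_smooth openT (ge i j) 0%N.
  exact: (@cvg_comp _ _ _ _ (fun p => g p i j) _ _ _ cQ (h q I)).
have sum4 (f : 'I_4 -> T -> R) (l : 'I_4 -> R) : (forall i, f i @ G --> l i) ->
    (fun s => \sum_i f i s) @ G --> \sum_i l i.
  move=> hf; rewrite !big_ord_recl big_ord0.
  rewrite (_ : (fun s => _) = fun s => f ord0 s + (f (lift ord0 ord0) s +
    (f (lift ord0 (lift ord0 ord0)) s + (f (lift ord0 (lift ord0 (lift ord0 ord0))) s + 0)))).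
    by do ![apply: cvgD; first exact: hf]; exact: cvg_cst.
  by apply/funext => s; rewrite !big_ord_recl big_ord0.
apply: (sum4 (fun j s => (\sum_i X s 0 i * g (Q s) i j) * Y s 0 j)) => j.
apply: cvgM; last exact: cc.
apply: (sum4 (fun i s => X s 0 i * g (Q s) i j)) => i.
by apply: cvgM; [exact: cc|exact: cg].
Qed.

Definition generic_data : set data := [set d | generic d.1.1 d.1.2 d.2 != 0].

Lemma open_generic_data : open generic_data.
Proof.
have -> : generic_data = pack @^-1` [set x | interp (rval x) genericE != 0].
  by apply/funext => d; rewrite /generic_data /preimage /mkset interp_genericE.
apply: open_comp; last exact: (open_neq0 genericE_polynomial).
move=> d _; apply: (@cvg_mx _ _ (nbhs d)) => i j; rewrite ord1.
have cf (P : data -> 'rV[R]_4) (l : 'I_4) : P @ d --> P d -> (fun d => (P d *m f0) 0 l) @ d --> (P d *m f0) 0 l.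
  move=> cP; have h := @mul_frame_continuous R 4 4 f0 (P d).
  have cP2 := @cvg_comp _ _ _ _ (fun q => q *m f0) _ _ _ cP h.
  by apply: (@cvg_comp _ _ _ _ (fun z : 'rV[R]_4 => z 0 l) _ _ _ cP2); exact: coord_continuous.
have c1 : (fun d : data => d.1.1) @ d --> d.1.1.
  by apply: (@cvg_comp _ _ _ fst fst _ (nbhs d.1) (nbhs d.1.1)); [exact: cvg_fst|exact: cvg_fst].
have c2 : (fun d : data => d.1.2) @ d --> d.1.2.
  by apply: (@cvg_comp _ _ _ fst snd _ (nbhs d.1) (nbhs d.1.2)); [exact: cvg_fst|exact: cvg_snd].
have c3 : (fun d : data => d.2) @ d --> d.2 by exact: cvg_snd.
rewrite -[j]splitK; case: (fintype.split j) => [l|l].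
  have -> : (fun d => pack d 0 (unsplit (inl l))) = fun d => (d.1.1 *m f0) 0 l.
    by apply/funext => x; rewrite /pack row_mxEl.
  by rewrite /pack row_mxEl; exact: (cf (fun d => d.1.1)).
rewrite -[l]splitK; case: (fintype.split l) => [l'|l'].
  have -> : (fun d => pack d 0 (unsplit (inr (unsplit (inl l'))))) = fun d => (d.1.2 *m f0) 0 l'.
    by apply/funext => x; rewrite /pack row_mxEr row_mxEl.
  by rewrite /pack row_mxEr row_mxEl; exact: (cf (fun d => d.1.2)).
have -> : (fun d => pack d 0 (unsplit (inr (unsplit (inr l'))))) = fun d => (d.2 *m f0) 0 l'.
  by apply/funext => x; rewrite /pack row_mxEr row_mxEr.
by rewrite /pack row_mxEr row_mxEr; exact: (cf (fun d => d.2)).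
Qed.

(** Chosen for the non-vanishing of the polynomial alone; the constraints of [initial_data] are
    restored by normalisation in the density argument. *)
Definition witness : data :=
  (delta_mx 0 0 *m f0^T, delta_mx 0 0 *m f0^T, delta_mx 0 3 *m f0^T).

Lemma generic_witness : interp (rval (pack witness)) genericE != 0.
Proof.
have ff : f0^T *m f0 = 1%:M := mulmx1C (frame0_orth m).
have v k : (k < 12)%N -> rval (pack witness) k = if [|| k == 0, k == 4 | k == 11]%N then 1 else 0.
  move=> k12; rewrite rval_pack// /witness /= -!mulmxA !ff !mulmx1.
  by move: k k12 => [|[|[|[|[|[|[|[|[|[|[|[|k]]]]]]]]]]]] // _; rewrite !rval_delta.
have -> : interp (rval (pack witness)) genericE = (1 + kappa) ^+ 2.
  rewrite (@interp_below R 12 _ (fun k => if [|| k == 0, k == 4 | k == 11]%N then 1 else 0))//.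
  by rewrite /=; ring.
by rewrite expf_neq0// gt_eqF// ltr_pwDl.
Qed.

End Generic.

Section GenericDense.
Context {R : realType}.
Variable m : R.
Hypothesis m0 : 0 <= m.
Let kappa := kap m.
Let k0 : 0 <= kappa := kap_ge0 m.
Local Notation data := ('rV[R]_4 * 'rV[R]_4 * 'rV[R]_4)%type.
Local Notation f0 := (frame0 m).
Local Notation g := (tn_metric m).
Local Notation generic_data := (generic_data m).
Local Notation generic := (generic m).
Local Notation pack := (pack m).
Local Notation witness := (witness m).
Local Notation genericE := (genericE m).

(** Move the data on a straight line towards [witness], then normalise u and subtract from a its
    component along u. The corrected curve stays in [initial_data] near 0 and tends to the given
    data, while [generic] changes only by a non-zero factor from a polynomial in the line
    parameter. *)
Lemma generic_data_dense : initial_data g `<=` closure (initial_data g `&` generic_data).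
Proof.
move=> [[q u] a]; rewrite /initial_data /= => -[uu ua] B nB.
pose qs s := q + s *: (witness.1.1 - q).
pose vs s := u + s *: (witness.1.2 - u).
pose as_ s := a + s *: (witness.2 - a).
pose rs s := (Num.sqrt (inner g (qs s) (vs s) (vs s)))^-1.
pose us s := rs s *: vs s.
pose ls s := inner g (qs s) (us s) (as_ s).
pose ds s : data := ((qs s, us s), as_ s - ls s *: us s).
have lc (x y : 'rV[R]_4) : (fun s : R => x + s *: (y - x)) @ 0 --> x.
  rewrite -[X in _ --> X]addr0; apply: cvgD; first exact: cvg_cst.
  by rewrite -[X in _ --> X](scale0r (y - x)); apply: cvgZr_tmp; exact: cvg_id.
have cq : qs @ 0 --> q by exact: lc.
have cv : vs @ 0 --> u by exact: lc.
have ca : as_ @ 0 --> a by exact: lc.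
have cn : (fun s => inner g (qs s) (vs s) (vs s)) @ 0 --> (1 : R).
  by rewrite -uu; exact: inner_cvg.
have cr : rs @ 0 --> (1 : R).
  have cs : (fun s => Num.sqrt (inner g (qs s) (vs s) (vs s))) @ 0 --> Num.sqrt (1 : R).
    by apply: (cvg_comp _ _ cn); exact: sqrt_continuous.
  rewrite sqrtr1 in cs; rewrite -[X in _ --> X]invr1; apply: cvgV => //.
have cu : us @ 0 --> u by rewrite -[X in _ --> X]scale1r; exact: cvgZ.
have cl : ls @ 0 --> (0 : R) by rewrite -[X in _ --> X]ua; exact: inner_cvg.
have cds : ds @ 0 --> (q, u, a).
  have cas : (fun s => as_ s - ls s *: us s) @ 0 --> a.
    have cz : (fun s => ls s *: us s) @ 0 --> (0 : 'rV[R]_4).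
      by rewrite -[X in _ --> X](scale0r u); exact: cvgZ.
    by rewrite -[X in _ --> X]subr0; apply: cvgB.
  exact: (cvg_pair (cvg_pair cq cu) cas).
have nn : \forall s \near (0 : R)^', B (ds s) by apply: nbhs_dnbhs; exact: cds.
have np : \forall s \near (0 : R)^', 0 < inner g (qs s) (vs s) (vs s).
  by apply: nbhs_dnbhs; apply: (cvgr_gt _ cn); exact: ltr01.
have ng : \forall s \near (0 : R)^', generic (qs s) (vs s) (as_ s) != 0.
  pose x0 := pack (q, u, a); pose x1 := pack witness.
  have hx : interp (fun i => rval x0 i + rval (x1 - x0) i) genericE != 0.
    have := generic_witness m; congr (_ != 0); apply: interp_eq => i.
    have := rval_lin x0 (x1 - x0) 1 i.
    by rewrite scale1r addrC subrK mul1r => ->.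
  have h := @polynomial_near R (rval x0) (rval (x1 - x0)) genericE (genericE_polynomial m) hx.
  apply: filterS h => s; rewrite (@interp_eq _ _ (rval (pack (qs s, vs s, as_ s)))).
    by rewrite interp_genericE//.
  move=> i; rewrite -rval_lin; congr (rval _ i).
  rewrite /x0 /x1 /pack /= opp_row_mx add_row_mx scale_row_mx add_row_mx.
  rewrite opp_row_mx add_row_mx scale_row_mx add_row_mx.
  by rewrite -!mulmxBl !scalemxAl -!mulmxDl.
have [s [h1 [h2 h3]]] := filter_ex (filterI nn (filterI np ng)).
exists (ds s); split=> //; split.
  have r2 : rs s * rs s * inner g (qs s) (vs s) (vs s) = 1.
    rewrite /rs -invfM -expr2 sqr_sqrtr ?ltW// mulVf// gt_eqF//.
  have u1 : inner g (qs s) (us s) (us s) = 1.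
    rewrite -[RHS]r2 /inner /us linearZ/= -!scalemxAl -scalemxAr scalerA [LHS]mxE.
    by [].
  split=> //=.
  have lin x y z l : inner g (qs s) x (y - l *: z) = inner g (qs s) x y - l * inner g (qs s) x z.
    rewrite /inner linearB/= linearZ/= mulmxBr -scalemxAr [LHS]mxE; congr (_ + _).
    by rewrite [LHS]mxE; congr (- _); rewrite mxE.
  by rewrite lin u1 mulr1 subrr.
rewrite /generic_data /= generic_shift// /us genericZ mulf_neq0// expf_neq0// invr_eq0.
by rewrite gt_eqF// sqrtr_gt0.
Qed.

End GenericDense.

(** * The frame adapted to the initial data of a curve *)

Section Adapted.
Context {R : realType}.
Variable m : R.
Hypothesis m0 : 0 <= m.
Local Notation g := (tn_metric m).
Local Notation f0 := (frame0 m).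

Lemma endo_orthogonal (G Ai Aj : 'M[R]_4) (u : 'rV[R]_4) : G^T = G ->
  (Ai *m G)^T = - (Ai *m G) -> (Aj *m G)^T = - (Aj *m G) -> Ai *m Aj = - (Aj *m Ai) ->
  (u *m (Aj *m Ai *m G) *m u^T) 0 0 = 0.
Proof.
move=> gT hi hj ij.
have e1 : (Aj *m Ai *m G)^T = - (Aj *m Ai *m G).
  rewrite -(mulmxA Aj) trmx_mul hi mulNmx -(mulmxA Ai); congr (- _).
  have -> : G *m Aj^T = - (Aj *m G) by rewrite -hj trmx_mul gT.
  by rewrite mulmxN !mulmxA ij mulNmx opprK.
have tr00 (M : 'M[R]_1) : M 0 0 = M^T 0 0 by rewrite mxE.
have h : (u *m (Aj *m Ai *m G) *m u^T) 0 0 = - (u *m (Aj *m Ai *m G) *m u^T) 0 0.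
  by rewrite {1}tr00 [(_ *m u^T)^T]trmx_mul [(u *m _)^T]trmx_mul trmxK e1 mulNmx mulmxN [LHS]mxE mulmxA.
by move: h; move: (_ 0 0) => x; lra.
Qed.

Lemma rotated_magnetic e (c : 'rV[R]_3) q u a i : inner g q u u = 1 ->
  a = e *: sharp g q (u *m (tn_F m c q)^T) -> rotated m i q u a = e * c 0 i.
Proof.
move=> uu ->.
have Ag k : tn_Omega m k q = - (tn_endo m k q *m g q).
  rewrite tn_endoE// mulNmx opprK -mulmxA mulVmx ?mulmx1// .
  exact: (tn_metric_unit m0 q).1.
have -> : sharp g q (u *m (tn_F m c q)^T) = \sum_j c 0 j *: (u *m tn_endo m j q).
  rewrite /sharp tn_FsumE linear_sum/= mulmx_sumr mulmx_suml; apply: eq_bigr => j _.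
  by rewrite linearZ/= -scalemxAr -scalemxAl tn_Omega_skew// mulmxN mulNmx tn_endoE// mulmxN mulmxA.
rewrite /rotated -!scalemxAl [LHS]mxE !mulmx_suml summxE; congr (_ * _).
rewrite (bigD1 i)//= big1 ?addr0; last first.
  move=> j ji; rewrite -!scalemxAl mxE.
  have AO k : tn_endo m k q *m g q = - tn_Omega m k q by rewrite Ag opprK.
  have sk k : (tn_endo m k q *m g q)^T = - (tn_endo m k q *m g q).
    by rewrite AO linearN/= tn_Omega_skew.
  have ij : i != j by rewrite eq_sym.
  have h := endo_orthogonal u (tn_metric_sym m0 q) (sk i) (sk j) (tn_endo_anti m q ij).
  have -> : (u *m tn_endo m j q *m tn_Omega m i q *m u^T) 0 0 = 0.
    have -> : u *m tn_endo m j q *m tn_Omega m i q *m u^T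
        = - (u *m (tn_endo m j q *m tn_endo m i q *m g q) *m u^T).
      by rewrite Ag mulmxN mulNmx !mulmxA.
    by rewrite mxE h oppr0.
  by rewrite mulr0.
rewrite -!scalemxAl mxE.
have -> : u *m tn_endo m i q *m tn_Omega m i q *m u^T
   = - (u *m (tn_endo m i q *m tn_endo m i q) *m g q *m u^T).
  by rewrite Ag mulmxN mulNmx !mulmxA.
by rewrite tn_endo_sq// mulmxN mulmx1 !mulNmx opprK [X in _ * X]uu mulr1.
Qed.

(** Non-vanishing prevents q from being an eigenvector of [Scomb c], so a frame can be adapted at q
    itself. There q . u and q S_c . u are the sum and the difference of the two radial velocities,
    and the difference of their squares is four times the product. *)
Lemma generic_adapted e (c : 'rV[R]_3) q u a : \sum_i c 0 i ^+ 2 = 1 -> inner g q u u = 1 ->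
  a = e *: sharp g q (u *m (tn_F m c q)^T) -> generic m q u a != 0 ->
  exists B : 'M[R]_4, [/\ B *m B^T = 1%:M,
    forall q, g q = B *m gmod (kap m) J4 (q *m B) *m B^T,
    forall q, tn_F m c q = B *m Fmod (kap m) J4 (S4 ord_max) (q *m B) *m B^T &
    let y := q *m B in let v := u *m B in
    [/\ 0 < rval y 0, 0 < rval y 2, rval y 0 * rval v 0 + rval y 1 * rval v 1 != 0 &
        rval y 2 * rval v 2 + rval y 3 * rval v 3 != 0]].
Proof.
move=> c1 uu aE gn; set q' := q *m f0; set u' := u *m f0.
have neq : dot q' u' ^+ 2 != dot u' (q' *m Scomb c) ^+ 2.
  apply: contra_neq gn => h; rewrite /generic.
  under eq_bigr do rewrite (rotated_magnetic _ uu aE) exprMn.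
  rewrite -mulr_sumr c1 mulr1.
  under eq_bigr do rewrite (rotated_magnetic _ uu aE) -mulrA dotC.
  by rewrite -mulr_sumr -dot_Scomb exprMn -h subrr.
have SS : Scomb c *m Scomb c = 1%:M by rewrite SScomb c1 scale1r.
have St := trScomb c.
(* Cauchy-Schwarz through |q' S - s q'|^2 = 2 (|q'|^2 - s q' . q' S) for s = 1 and s = -1. Equality
   would give q' S = s q' and make the two squares in [neq] agree. *)
have cs : dot q' (q' *m Scomb c) ^+ 2 < dot q' q' ^+ 2.
  have sq0 (x : 'rV[R]_4) : 0 <= dot x x by exact: sqn_ge0.
  have SqSq : dot (q' *m Scomb c) (q' *m Scomb c) = dot q' q'.
    by rewrite dotMl St -mulmxA SS mulmx1.
  have ex (s : R) : s ^+ 2 = 1 -> dot (q' *m Scomb c - s *: q') (q' *m Scomb c - s *: q')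
      = 2 * (dot q' q' - s * dot q' (q' *m Scomb c)).
    move=> s2; rewrite dotDl !dotDr !dotNl !dotNr !dotZl !dotZr SqSq.
    rewrite [dot (q' *m Scomb c) q']dotC.
    move: s2; move: (dot q' q') (dot q' (q' *m Scomb c)) => x y s2.
    transitivity (x + s ^+ 2 * x - 2 * s * y); first by ring.
    by rewrite s2; ring.
  have ns (s : R) : s ^+ 2 = 1 -> dot q' q' != s * dot q' (q' *m Scomb c).
    move=> s2; apply: contra_neq neq => h.
    have := ex s s2; rewrite h subrr mulr0 => /sqn_eq0/eqP; rewrite subr_eq0 => /eqP ->.
    by rewrite dotZr exprMn s2 mul1r dotC.
  have sN1 : (-1 : R) ^+ 2 = 1 by rewrite sqrrN expr1n.
  have n1 := ns 1 (expr1n _ _); have n2 := ns (-1) sN1.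
  have p1 := ex 1 (expr1n _ _); have p2 := ex (-1) sN1.
  have := sq0 (q' *m Scomb c - 1 *: q'); have := sq0 (q' *m Scomb c - -1 *: q').
  rewrite p1 p2; move: n1 n2 {ex p1 p2 ns}; rewrite mul1r mulN1r.
  move: (dot q' q') (dot q' (q' *m Scomb c)) => x y n1 n2 h1 h2.
  have xy : y < x by rewrite lt_neqAle eq_sym n1 /=; lra.
  have yx : 0 < x + y by rewrite lt_neqAle eq_sym addr_eq0 n2 /=; lra.
  by rewrite -subr_gt0 subr_sqr mulr_gt0//; lra.
have [B [BB gE FE BS [y0 y2]]] := tn_adapted m0 c1 cs.
exists B; split=> // y v.
have BB' : B^T *m B = 1%:M := mulmx1C BB.
have ff := frame0_orth m.
have d1 : dot q' u' = dot y v.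
  by rewrite /dot /q' /u' /y /v !trmx_mul !mulmxA -(mulmxA q) ff mulmx1 -(mulmxA q) BB mulmx1.
have d2 : dot u' (q' *m Scomb c) = dot v (y *m S4 ord_max).
  rewrite dotC [RHS]dotC /dot /q' /u' /y /v !trmx_mul !mulmxA.
  by congr (fun_of_matrix _ 0 0); rewrite -!(mulmxA q) mulmxA -(mulmxA f0) (mulmxA f0 _ f0^T) BS !mulmxA.
move: neq; rewrite d1 d2 !dot4E !rvalS4 /= => neq.
split=> //; apply: contra_neq neq => h.
- set x0 := rval y 0 in h *; set x1 := rval y 1 in h *.
  rewrite (_ : rval v 0 * x0 + rval v 1 * x1 + rval v 2 * - rval y 2 + rval v 3 * - rval y 3
    = (x0 * rval v 0 + x1 * rval v 1) - (rval y 2 * rval v 2 + rval y 3 * rval v 3)); last by ring.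
  by rewrite h; ring.
- rewrite (_ : rval v 0 * rval y 0 + rval v 1 * rval y 1 + rval v 2 * - rval y 2 + rval v 3 * - rval y 3
    = (rval y 0 * rval v 0 + rval y 1 * rval v 1) - (rval y 2 * rval v 2 + rval y 3 * rval v 3)); last by ring.
  by rewrite -addrA h; ring.
Qed.

End Adapted.

(** * Conserved quantities along a magnetic geodesic *)

Section Motion.
Context {R : realType}.
Variables (m e : R) (c : 'rV[R]_3).
Hypotheses (m0 : 0 <= m) (cu : \sum_i c 0 i ^+ 2 = 1).
Let kappa := kap m.
Let k0 : 0 <= kappa := kap_ge0 m.
Variable B : 'M[R]_4.
Hypotheses (BB : B *m B^T = 1%:M)
  (gE : forall q, tn_metric m q = B *m gmod kappa J4 (q *m B) *m B^T)
  (FE : forall q, tn_F m c q = B *m Fmod kappa J4 (S4 ord_max) (q *m B) *m B^T).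
Let BB' : B^T *m B = 1%:M := mulmx1C BB.
Let gU q : gmod kappa J4 q \in unitmx := (gmod_unit q (@J4_orth R) k0).1.
Local Notation g := (tn_metric m).
Variables (J : set R) (gamma : R -> 'rV[R]_4).
Hypotheses (oJ : open_interval J) (unit : unit_speed_curve g J gamma)
  (mag : magnetic_geodesic g (tn_F m c) e J gamma).

(** The Legendre lift P = g u, which turns the curve into a solution of Hamilton's equations. *)
Definition momentum_curve t : 'rV[R]_(4 + 4) :=
  row_mx (gamma t) (derive1 gamma t *m g (gamma t)).
Let Z t := lift_frame B (momentum_curve t).
Let dgamma t (Jt : J t) : is_derive t (1 : R) gamma (derive1 gamma t) :=
  (Ck_on_curve oJ.1 unit.1).2 t Jt.
Let du t (Jt : J t) : is_derive t (1 : R) (derive1 gamma) (derive1 (derive1 gamma) t) :=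
  (Ck_on_curve oJ.1 (Ck_on_curve oJ.1 unit.1).1).2 t Jt.

Lemma is_derive_row_mx (X Y : R -> 'rV[R]_4) X' Y' t :
  is_derive t (1 : R) X X' -> is_derive t (1 : R) Y Y' ->
  is_derive t (1 : R) (fun s => row_mx (X s) (Y s) : 'rV[R]_(4 + 4)) (row_mx X' Y').
Proof.
move=> dX dY; apply: is_derive_rV => i; rewrite -[i]splitK; case: (fintype.split i) => j /=.
  rewrite row_mxEl (_ : (fun s => _) = fun s => X s 0 j); first exact: is_derive_coord.
  by apply/funext => s; rewrite row_mxEl.
rewrite row_mxEr (_ : (fun s => _) = fun s => Y s 0 j); first exact: is_derive_coord.
by apply/funext => s; rewrite row_mxEr.
Qed.

Lemma momentum_curve_derivable t : J t ->
  is_derive t (1 : R) momentum_curve (derive1 momentum_curve t).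
Proof.
move=> Jt; have [ge _ _ _] := tn_elementary m0.
have h := is_derive_row_mx (dgamma Jt) (is_derive_mulmx (du Jt) (curve_dmx ge (dgamma Jt))).
by apply: derive1P; case: h.
Qed.

Lemma pos_momentum_curve t : pos (momentum_curve t) = gamma t.
Proof. by rewrite /pos row_mxKl. Qed.

Lemma mom_momentum_curve t : mom (momentum_curve t) = derive1 gamma t *m g (gamma t).
Proof. by rewrite /mom row_mxKr. Qed.

Lemma momentum_hamilton t : J t -> derive1 momentum_curve t
  = ham_vec (tn_F m c) e (hamiltonian g) (momentum_curve t).
Proof.
have [ge gVe _ _] := tn_elementary m0.
have gu q := (tn_metric_unit m0 q).1.
have Fs q : (tn_F m c q)^T = - tn_F m c q by exact: tn_F_skew.
have pE : (fun t => pos (momentum_curve t)) = gamma by apply/funext => s; exact: pos_momentum_curve.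
have [_ H] := hamilton_equations_iff e ge gVe (tn_metric_sym m0) gu Fs oJ momentum_curve_derivable.
move: t; apply: H; rewrite pE; split=> // t Jt.
by rewrite mom_momentum_curve pos_momentum_curve /sharp -mulmxA mulmxV// mulmx1.
Qed.

Lemma Z_derivable t : J t -> is_derive t (1 : R) Z (lift_frame B (derive1 momentum_curve t)).
Proof.
move=> Jt; have d := momentum_curve_derivable Jt.
have E : lift_frame B = fun z : 'rV[R]_(4 + 4) => z *m block_mx B 0 0 B.
  apply/funext => z; rewrite /lift_frame -{3}[z]hsubmxK mul_row_block !mulmx0 addr0 add0r.
  by [].
rewrite /Z E; apply: (is_derive_eq (is_derive_mulmx d (is_derive_cst (block_mx B 0 0 B) _ _))).
by rewrite mulmx0 addr0.
Qed.

Lemma is_derive_observable E t : vars_below 8 E -> (forall z : 'rV[R]_(4 + 4), valid (rval z) E) ->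
  J t -> is_derive t (1 : R) (fun s => interp (rval (Z s)) E)
    (bracket kappa e (rval (Z t)) (grad (rval (Z t)) E) (grad (rval (Z t)) (HE kappa e))).
Proof.
move=> E8 vE Jt; apply: (is_derive_eq (is_derive_interp_curve (Z_derivable Jt) (vE _))).
pose f (z : 'rV[R]_(4 + 4)) := interp (rval z) E.
have ef : elementary f by exists E.
have eh : elementary (hamiltonian (gmod kappa J4)).
  by exists (HE kappa e) => z; split; [exact: valid_HE|exact: hamiltonian_HE].
have hh : hamiltonian g = hamiltonian (gmod kappa J4) \o lift_frame B.
  by apply/funext => z; exact: (hamiltonian_lift BB gE gU).
rewrite -poisson_bracket//; last exact: valid_HE.
rewrite (_ : (fun z => interp (rval z) (HE kappa e)) = hamiltonian (gmod kappa J4)); last first.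
  by apply/funext => z; rewrite -hamiltonian_HE.
rewrite -(poisson_lift e BB FE _ ef eh) -hh /poisson -momentum_hamilton//.
have [d _] := momentum_curve_derivable Jt.
set w := derive1 momentum_curve t; set z := momentum_curve t.
have ef' : elementary (f \o lift_frame B).
  by apply: (@elementary_comp R _ _ (lift_frame B) f) => // i; exact: lift_frame_elementary.
transitivity ('D_w (f \o lift_frame B) z).
  have [-> _] := derive_linear f z w (lift_frame_lin B).
  by rewrite derive_interp.
rewrite (derive_sum_pd _ _ ef') mxE; apply: eq_bigr => i _.
by rewrite [in RHS]mxE [(w^T) i 0]mxE mulrC.
Qed.

Lemma observable_constant i s t : (i < 4)%N -> J s -> J t ->
  interp (rval (Z s)) (integralE kappa e i) = interp (rval (Z t)) (integralE kappa e i).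
Proof.
move=> i4 Js Jt; apply: (@zero_derive_constant _ J (fun t => interp (rval (Z t)) (integralE kappa e i)) oJ _ s t Js Jt) => r Jr.
apply: (is_derive_eq (is_derive_observable _ _ Jr)).
- exact: integral_below.
- by move=> z; exact: valid_integral.
- by rewrite (integrals_involution e k0 (Z r) i4 (isT : (0 < 4)%N)).
Qed.

(** Unit speed fixes 2 H = 1, which is why mu = 1 in the quartics of the quadratures. *)
Lemma energy_half t : J t -> interp (rval (Z t)) (HE kappa e) = 2^-1.
Proof.
move=> Jt; rewrite -(hamiltonian_HE e k0) -(hamiltonian_lift BB gE gU) /hamiltonian.
rewrite mom_momentum_curve pos_momentum_curve.
rewrite -(mulmxA (derive1 gamma t)) mulmxV ?mulmx1; last exact: (tn_metric_unit m0 _).1.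
rewrite trmx_mul tn_metric_sym// mulmxA.
by have := unit.2 t Jt; rewrite /inner => ->; rewrite mulr1.
Qed.

Let N1c t := interp (rval (Z t)) N1.
Let N2c t := interp (rval (Z t)) N2.
Let r1 t := interp (rval (Z t)) radial1.
Let r2 t := interp (rval (Z t)) radial2.
Let w t := 1 + kappa * (N1c t + N2c t).

End Motion.

(** * Integration of the separated radial equations *)

Section SeparatedMotion.
Context {R : realType}.
Variable k : nat -> R.

(** As dn / dtau = 2 p and s p = sqrt(q(n)), one has dtau / dn = 1 / (2 s sqrt(q)); the constant [i]
    is 2 s. A primitive gives tau(n), its inverse n(tau). Then t is a primitive of w in tau, and
    inverting it gives tau(t). *)
Definition inverse_momentumS (i : nat) (S : scheme) : scheme := SInv (SMul (SConst i) (SRoot 1 S)).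
Definition radius_of_timeS (i : nat) (S : scheme) : scheme := SInvf (SPrim (inverse_momentumS i S)).
Definition timeS (one kap i1 i2 : nat) (S1 S2 : scheme) : scheme :=
  SInvf (SPrim (SAdd (SConst one) (SMul (SConst kap)
    (SAdd (radius_of_timeS i1 S1) (radius_of_timeS i2 S2))))).
Definition radiusS (one kap i1 i2 : nat) (S1 S2 : scheme) (i : nat) (S : scheme) : scheme :=
  SComp (radius_of_timeS i S) (timeS one kap i1 i2 S1 S2).

(* In the time tau with dtau = dt / w both radii satisfy autonomous equations
   n' = 2 p, with p^2 a function of n. *)
Lemma separated_motion (I : set R) (t0 kappa : R) (n1 n2 p1 p2 q1 q2 : R -> R)
    (one kap i1 i2 : nat) (s1 s2 : R) (S1 S2 : scheme) (w := fun t => 1 + kappa * (n1 t + n2 t)) :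
  open_interval I -> I t0 -> k one = 1 -> k kap = kappa -> k i1 = 2 * s1 -> k i2 = 2 * s2 ->
  s1 ^+ 2 = 1 -> s2 ^+ 2 = 1 ->
  (forall t, I t -> 0 < w t) ->
  (forall t, I t -> is_derive t (1 : R) n1 (2 * p1 t / w t)) ->
  (forall t, I t -> is_derive t (1 : R) n2 (2 * p2 t / w t)) ->
  (forall t, I t -> 0 < s1 * p1 t) -> (forall t, I t -> 0 < s2 * p2 t) ->
  (forall t, I t -> p1 t ^+ 2 = q1 (n1 t)) -> (forall t, I t -> p2 t ^+ 2 = q2 (n2 t)) ->
  (forall K, by_scheme k S1 K q1) -> (forall K, by_scheme k S2 K q2) ->
  exists I' : set R, [/\ open_interval I', I' t0, I' `<=` I,
    by_scheme k (radiusS one kap i1 i2 S1 S2 i1 S1) I' n1 &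
    by_scheme k (radiusS one kap i1 i2 S1 S2 i2 S2) I' n2].
Proof.
move=> oI It0 k1 kk ki1 ki2 s1s s2s w0 dn1 dn2 sp1 sp2 pq1 pq2 h1 h2.
have cn (n dn : R -> R) t : is_derive t (1 : R) n (dn t) -> {for t, continuous n}.
  by move=> [d _]; apply: differentiable_continuous; exact/derivable1_diffP.
have cw t : I t -> {for t, continuous (fun t => (w t)^-1)}.
  move=> It; apply: cvgV; first by rewrite gt_eqF// w0.
  apply: cvgD; first exact: cvg_cst.
  apply: cvgMr; apply: cvgD.
    exact: (cn n1 (fun t => 2 * p1 t / w t) t (dn1 t It)).
  exact: (cn n2 (fun t => 2 * p2 t / w t) t (dn2 t It)).
(* Along the given curve the new time is at hand as a primitive of 1/w. The scheme goes the other
   way, from the radii as functions of tau to t as a function of tau, and [tau] is what both are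
   compared with. *)
have [I' [tau [oI' I't0 I'I dtau]]] := primitive_exists oI It0 cw.
have tau0 t : I' t -> 0 < 1 * (w t)^-1 by move=> /I'I It; rewrite mul1r invr_gt0 w0.
have [ht [oK hK dh]] := inverse_function oI' dtau tau0.
have step (n p q : R -> R) (s : R) i S : k i = 2 * s -> s ^+ 2 = 1 ->
    (forall t, I t -> is_derive t (1 : R) n (2 * p t / w t)) ->
    (forall t, I t -> 0 < s * p t) -> (forall t, I t -> p t ^+ 2 = q (n t)) ->
    (forall K, by_scheme k S K q) ->
    by_scheme k (radius_of_timeS i S) (tau @` I') (fun x => n (ht x)).
  move=> ki ss dn sp pq hS.
  have dn' t : I' t -> is_derive t (1 : R) n (2 * p t / w t) by move=> /I'I; exact: dn.
  have sp' t : I' t -> 0 < s * (2 * p t / w t).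
    move=> /I'I It; rewrite (_ : s * _ = 2 * (s * p t) * (w t)^-1); last by ring.
    by rewrite mulr_gt0//; [rewrite mulr_gt0// sp|rewrite invr_gt0 w0].
  have [h [oN hN dN]] := inverse_function oI' dn' sp'.
  (* The new time as a function of the radius. Its derivative 1 / (2 p) is a function of n alone,
     because s p is the positive root of q(n). *)
  exists (n @` I'), (tau \o h); split=> //.
  - apply: (by_scheme_prim (f := fun x => (2 * s * Num.sqrt (q x))^-1)).
      apply: by_schemeV.
        apply: by_schemeM; first exact: by_scheme_cst.
        exists q => // _ [t I't <-]; rewrite sqrtr_ge0 sqr_sqrtr// -pq ?sqr_ge0//.
        exact: I'I.
      move=> _ [t I't <-]; rewrite -pq; last exact: I'I.
      have := sp t (I'I t I't); rewrite sqrtr_sqr !mulf_eq0 normr_eq0 pnatr_eq0 /=.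
      by rewrite -mulf_eq0 => /gt_eqF ->.
    move=> _ [t I't <-].
    have st := sp t (I'I t I't).
    have pE : Num.sqrt (q (n t)) = s * p t.
      rewrite -pq ?sqrtr_sqr; last exact: I'I.
      have ns : `|s| = 1.
        by apply/eqP; rewrite -(@sqrp_eq1 _ `|s|)// -normrX ss normr1.
      by rewrite -(gtr0_norm st) normrM ns mul1r.
    have dt : is_derive (h (n t)) (1 : R) tau (w t)^-1 by rewrite hN//; exact: dtau.
    apply: (is_derive_eq (is_derive1_comp dt (dN t I't))).
    have wt0 : w t != 0 by rewrite gt_eqF// w0//; exact: I'I.
    have pt0 : p t != 0 by apply: contraTneq st => ->; rewrite mulr0 ltxx.
    have -> : 2 * s * Num.sqrt (q (n t)) = 2 * p t 
      by rewrite pE; transitivity (2 * s ^+ 2 * p t); [ring|rewrite ss mulr1].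
    by field; rewrite wt0 pt0.
  - move=> _ _ /set_mem[t I't <-] /set_mem[r I'r <-] /=; rewrite !hN// => tt.
    by rewrite -[t](hK _ I't) tt hK.
  - move=> _ [t I't <-]; rewrite hK//; split; first by exists t.
    by rewrite /= hN.
have s1' := step n1 p1 q1 s1 i1 S1 ki1 s1s dn1 sp1 pq1 h1.
have s2' := step n2 p2 q2 s2 i2 S2 ki2 s2s dn2 sp2 pq2 h2.
have ts : by_scheme k (timeS one kap i1 i2 S1 S2) I' tau.
  exists (tau @` I'), ht; split=> //.
  - apply: (by_scheme_prim (f := fun x => 1 + kappa * (n1 (ht x) + n2 (ht x)))).
      apply: by_schemeD; first exact: by_scheme_cst.
      by apply: by_schemeM; [exact: by_scheme_cst|exact: by_schemeD].
    move=> _ [t I't <-]; rewrite hK//.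
    by apply: (is_derive_eq (dh t I't)); rewrite invrK.
  - by move=> _ _ /set_mem[t I't <-] /set_mem[r I'r <-]; rewrite !hK// => ->.
  - by move=> t I't; rewrite hK//; split=> //; exists t.
exists I'; split=> //.
- by exists (tau @` I'), (fun x => n1 (ht x)), tau; split=> // t I't; rewrite hK//; split=> //; exists t.
- by exists (tau @` I'), (fun x => n2 (ht x)), tau; split=> // t I't; rewrite hK//; split=> //; exists t.
Qed.

End SeparatedMotion.

(* Constants: 0 to 5 are 1, kappa, e, L1, L2, 1/2; 6 to 10 and 11 to 15 are the
   coefficients of the two quartics; 16 and 17 are twice the signs of the radial
   momenta; 18 to 33 are the entries of the frame. *)
Definition quarticS (j : nat) : scheme :=
  let c i := SConst (i + j) in
  SAdd (c 0%N) (SMul SVar (SAdd (c 1%N) (SMul SVar (SAdd (c 2%N)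
    (SMul SVar (SAdd (c 3%N) (SMul SVar (c 4%N)))))))).
Definition radius1S : scheme := radiusS 0 1 16 17 (quarticS 6) (quarticS 11) 16 (quarticS 6).
Definition radius2S : scheme := radiusS 0 1 16 17 (quarticS 6) (quarticS 11) 17 (quarticS 11).
Definition weightS : scheme := SAdd (SConst 0) (SMul (SConst 1) (SAdd radius1S radius2S)).
Definition half_weightS (r : scheme) : scheme :=
  SAdd (SConst 5) (SMul (SMul (SConst 1) (SConst 5)) r).
Definition angular1S : scheme :=
  SAdd (SConst 3) (SOpp (SMul (SConst 2) (SMul radius1S (half_weightS radius2S)))).
Definition angular2S : scheme :=
  SAdd (SConst 4) (SMul (SConst 2) (SMul radius2S (half_weightS radius1S))).
Definition angleS (r J : scheme) : scheme := SPrim (SMul (SInv weightS) (SAdd (SMul J (SInv r))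
  (SMul (SMul (SConst 1) (SAdd weightS (SConst 0))) (SAdd angular1S angular2S)))).
(** The tangent enters as the inverse of the arctangent, which is a primitive of 1 / (1 + x^2). *)
Definition tangentS (a : scheme) : scheme :=
  SComp (SInvf (SPrim (SInv (SAdd (SConst 0) (SMul SVar SVar))))) a.
Definition tangent1S : scheme := tangentS (angleS radius1S angular1S).
Definition tangent2S : scheme := tangentS (angleS radius2S angular2S).
(** With u = y_1 / y_0 one has n = y_0^2 (1 + u^2), so the positive coordinate y_0 is a square root;
    [SRoot 1] is the root of degree 2. *)
Definition legS (r u : scheme) : scheme := SRoot 1 (SMul r (SInv (SAdd (SConst 0) (SMul u u)))).
Definition frame_coordS (j : nat) : scheme := nth SVar
  [:: legS radius1S tangent1S; SMul tangent1S (legS radius1S tangent1S);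
      legS radius2S tangent2S; SMul tangent2S (legS radius2S tangent2S)] j.
Definition coordinateS (i : nat) : scheme :=
  let c j := SMul (SConst (4 * i + j + 18)) (frame_coordS j) in
  SAdd (SAdd (c 0%N) (c 1%N)) (SAdd (c 2%N) (c 3%N)).

Section SchemeSteps.
Context {R : realType}.
Variable k : nat -> R.
Implicit Types (I : set R).

Definition quartic (c : seq R) (x : R) : R :=
  c`_0 + x * (c`_1 + x * (c`_2 + x * (c`_3 + x * c`_4))).

Lemma by_scheme_quartic j (c : seq R) I : (forall i, (i < 5)%N -> k (i + j) = c`_i) ->
  by_scheme k (quarticS j) I (quartic c).
Proof.
move=> kc; apply: by_schemeD; first by apply: by_scheme_cst; exact: kc.
apply: by_schemeM => //; apply: by_schemeD; first by apply: by_scheme_cst; exact: kc.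
apply: by_schemeM => //; apply: by_schemeD; first by apply: by_scheme_cst; exact: kc.
apply: by_schemeM => //; apply: by_schemeD; first by apply: by_scheme_cst; exact: kc.
by apply: by_schemeM => //; apply: by_scheme_cst; exact: kc.
Qed.

Lemma by_scheme_tangent a I (u : R -> R) : k 0%N = 1 ->
  by_scheme k a I (fun t => atan (u t)) -> by_scheme k (tangentS a) I u.
Proof.
move=> k1 ha; exists `](- (pi / 2)), (pi / 2)[%classic, tan, (fun t => atan (u t)).
split=> //; first exact: open_interval_oo; last first.
  by move=> t It; rewrite atanK /= in_itv/= atan_gtNpi2 atan_ltpi2.
exists setT, atan; split.
- exact: open_interval_setT.
- apply: (by_scheme_prim (f := fun x => (1 + x * x)^-1)).
    apply: by_schemeV.
      by apply: by_schemeD; [exact: by_scheme_cst|exact: by_schemeM].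
    by move=> x _; rewrite gt_eqF// -expr2 ltr_pwDl// sqr_ge0.
- by move=> x y _ _ /(congr1 tan); rewrite !atanK.
- by move=> x xI; split=> //; exact: tanK.
Qed.

Lemma by_scheme_leg r u I (n a x : R -> R) : k 0%N = 1 ->
  by_scheme k r I n -> by_scheme k u I a ->
  (forall t, I t -> 0 <= x t /\ x t ^+ 2 = n t * (1 + a t * a t)^-1) ->
  by_scheme k (legS r u) I x.
Proof.
move=> k1 hr hu hx; exists (fun t => n t * (1 + a t * a t)^-1) => //.
apply: by_schemeM => //; apply: by_schemeV.
  by apply: by_schemeD; [exact: by_scheme_cst|exact: by_schemeM].
by move=> t _; rewrite gt_eqF// -expr2 ltr_pwDl// sqr_ge0.
Qed.

End SchemeSteps.

Lemma near_open_interval (R : realType) (J : set R) (t0 : R) (P : set R) :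
  open_interval J -> J t0 -> (\forall t \near t0, P t) ->
  exists I : set R, [/\ open_interval I, I t0, I `<=` J & I `<=` P].
Proof.
move=> oJ Jt nP; have nJ : \forall t \near t0, J t by exact: open_nbhs_nbhs (conj oJ.1 Jt).
have nPJ : nbhs t0 (P `&` J) by exact: filterI.
have /nbhs_ballP[d /= d0 hd] := nPJ.
have hb t : t \in `]t0 - d, t0 + d[ -> P t /\ J t.
  rewrite in_itv/= => /andP[a b]; apply: hd; rewrite /ball/= ltr_norml; apply/andP; split; lra.
exists `]t0 - d, t0 + d[%classic; split.
- exact: open_interval_oo.
- by rewrite /= in_itv/= ltrBlDr ltrDl d0.
- by move=> t /hb[].
- by move=> t /hb[].
Qed.

(** * The coordinates of a generic conformal geodesic by schemes *)

Section Coordinates.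
Context {R : realType}.
Variables (m e : R) (c : 'rV[R]_3).
Hypotheses (m0 : 0 <= m) (cu : \sum_i c 0 i ^+ 2 = 1).
Let kappa := kap m.
Let k0 : 0 <= kappa := kap_ge0 m.
Variable B : 'M[R]_4.
Hypotheses (BB : B *m B^T = 1%:M)
  (gE : forall q, tn_metric m q = B *m gmod kappa J4 (q *m B) *m B^T)
  (FE : forall q, tn_F m c q = B *m Fmod kappa J4 (S4 ord_max) (q *m B) *m B^T).
Let BB' : B^T *m B = 1%:M := mulmx1C BB.
Local Notation g := (tn_metric m).
Variables (J : set R) (gamma : R -> 'rV[R]_4).
Hypotheses (oJ : open_interval J) (unit : unit_speed_curve g J gamma)
  (mag : magnetic_geodesic g (tn_F m c) e J gamma).
Let Z t := lift_frame B (momentum_curve m gamma t).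
Let y t := gamma t *m B.
Let v t := derive1 gamma t *m B.
Let n1 t := interp (rval (Z t)) N1.
Let n2 t := interp (rval (Z t)) N2.
Let r1 t := interp (rval (Z t)) radial1.
Let r2 t := interp (rval (Z t)) radial2.
Let j1 t := interp (rval (Z t)) J1.
Let j2 t := interp (rval (Z t)) J2.
Let w t := 1 + kappa * (n1 t + n2 t).

Lemma Z_pos t i : (i < 4)%N -> rval (Z t) i = rval (y t) i.
Proof. by move=> i4; rewrite -rval_pos// pos_lift pos_momentum_curve. Qed.

Lemma Z_pos4 t : (rval (Z t) 0 = rval (y t) 0) * (rval (Z t) 1 = rval (y t) 1)
  * (rval (Z t) 2 = rval (y t) 2) * (rval (Z t) 3 = rval (y t) 3).
Proof. by rewrite !Z_pos. Qed.

Lemma wfun_y t : wfun kappa (y t) = w t.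
Proof. by rewrite /w /n1 /n2 /wfun sqnE /= !Z_pos4; ring. Qed.

Lemma w_pos t : 0 < w t. Proof. by rewrite -wfun_y wfun_gt0. Qed.

Lemma outer_row (p a : 'rV[R]_4) : p *m (a^T *m a) = dot p a *: a.
Proof. by rewrite mulmxA /dot [p *m a^T]mx11_scalar mul_scalar_mx !mxE. Qed.

(** The inverse metric is 1/w times the identity plus a rank-one term along [y *m J4], and the
    pairing of the momentum with this row is J_1 + J_2. *)
Lemma velocity t i : (i < 4)%N -> rval (v t) i = (w t)^-1 * (rval (Z t) (4 + i)
  + kappa * (w t + 1) * (j1 t + j2 t) * rval (y t *m J4) i).
Proof.
move=> i4; have -> : v t = mom (Z t) *m gmodV kappa J4 (y t).
  rewrite mom_lift mom_momentum_curve gE !mulmxA -(mulmxA _ B^T) BB' mulmx1.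
  by rewrite -(mulmxA (derive1 gamma t *m B)) (gmodE (y t) (@J4_orth R) k0) mulmx1.
have PA : dot (mom (Z t)) (y t *m J4) = j1 t + j2 t.
  by rewrite dot4E !rval_mulJ// !rval_mom// /j1 /j2 /= !Z_pos4; ring.
rewrite -rval_mom// -wfun_y -PA.
rewrite -[i]/(nat_of_ord (Ordinal i4)) !rvalE /gmodV -scalemxAr [LHS]mxE; congr (_ * _).
rewrite mulmxDr mulmx1 [LHS]mxE; congr (_ + _).
rewrite -scalemxAr [LHS]mxE -mulrA; congr (_ * _).
by rewrite outer_row [LHS]mxE.
Qed.

Lemma y_derivable t : J t -> is_derive t (1 : R) y (v t).
Proof.
move=> Jt; have d := (Ck_on_curve oJ.1 unit.1).2 t Jt.
apply: (is_derive_eq (is_derive_mulmx d (is_derive_cst B _ _))).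
by rewrite mulmx0 addr0.
Qed.

Lemma y_observable E t : valid (rval (y t)) E -> J t ->
  is_derive t (1 : R) (fun s => interp (rval (y s)) E) (interp (rval (y t)) (D (rval (v t)) E)).
Proof. by move=> vE Jt; exact: is_derive_interp_curve (y_derivable Jt) vE. Qed.

Lemma radial_velocity1 t : rval (y t) 0 * rval (v t) 0 + rval (y t) 1 * rval (v t) 1
  = r1 t / w t.
Proof.
rewrite !velocity// !rval_mulJ// /r1 /= !Z_pos4.
by ring.
Qed.

Lemma radial_velocity2 t : rval (y t) 2 * rval (v t) 2 + rval (y t) 3 * rval (v t) 3
  = r2 t / w t.
Proof.
rewrite !velocity// !rval_mulJ// /r2 /= !Z_pos4.
by ring.
Qed.

Lemma angular_velocity1 t : rval (y t) 0 * rval (v t) 1 - rval (y t) 1 * rval (v t) 0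
  = (w t)^-1 * (j1 t + kappa * (w t + 1) * (j1 t + j2 t) * n1 t).
Proof.
rewrite !velocity// !rval_mulJ//; move: (w t)^-1 (w t) (j1 t + j2 t) => wi ww jj.
rewrite /j1 /n1 /= !Z_pos4.
by ring.
Qed.

Lemma angular_velocity2 t : rval (y t) 2 * rval (v t) 3 - rval (y t) 3 * rval (v t) 2
  = (w t)^-1 * (j2 t + kappa * (w t + 1) * (j1 t + j2 t) * n2 t).
Proof.
rewrite !velocity// !rval_mulJ//; move: (w t)^-1 (w t) (j1 t + j2 t) => wi ww jj.
rewrite /j2 /n2 /= !Z_pos4.
by ring.
Qed.

Lemma is_derive_n1 t : J t -> is_derive t (1 : R) n1 (2 * r1 t / w t).
Proof.
move=> Jt; have vN : valid (rval (y t)) N1 by do ?split.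
have := y_observable vN Jt.
rewrite (_ : (fun s => _) = n1); last by apply/funext => s; rewrite /n1 /= !Z_pos4.
by move=> h; apply: (is_derive_eq h); rewrite -mulrA -radial_velocity1 /=; ring.
Qed.

Lemma is_derive_n2 t : J t -> is_derive t (1 : R) n2 (2 * r2 t / w t).
Proof.
move=> Jt; have vN : valid (rval (y t)) N2 by do ?split.
have := y_observable vN Jt.
rewrite (_ : (fun s => _) = n2); last by apply/funext => s; rewrite /n2 /= !Z_pos4.
by move=> h; apply: (is_derive_eq h); rewrite -mulrA -radial_velocity2 /=; ring.
Qed.

Lemma angle_rate (a0 a1 d0 d1 : R) : a0 != 0 -> a0 * a0 + a1 * a1 != 0 ->
  (d1 * a0^-1 + a1 * - (d0 * (a0^-1 * a0^-1))) * (1 + a1 * a0^-1 * (a1 * a0^-1))^-1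
  = (a0 * d1 - a1 * d0) * (a0 * a0 + a1 * a1)^-1.
Proof.
move=> a00 n0; have t1 : 1 + a1 * a0^-1 * (a1 * a0^-1) != 0.
  by rewrite -expr2 gt_eqF// ltr_pwDl// sqr_ge0.
have -> : 1 + a1 * a0^-1 * (a1 * a0^-1) = (a0 * a0 + a1 * a1) * (a0 * a0)^-1 by field.
by field; rewrite a00 n0.
Qed.

Lemma is_derive_angle1 t : J t -> rval (y t) 0 != 0 ->
  is_derive t (1 : R) (fun s => atan (rval (y s) 1 / rval (y s) 0))
    ((w t)^-1 * (j1 t * (n1 t)^-1 + kappa * (w t + 1) * (j1 t + j2 t))).
Proof.
move=> Jt y0; have h : is_derive t (1 : R) (fun s => atan (rval (y s) 1 / rval (y s) 0)) _ :=
  @y_observable (EAtan tan1) t (conj I (conj I y0)) Jt.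
have nE : n1 t = rval (y t) 0 * rval (y t) 0 + rval (y t) 1 * rval (y t) 1.
  by rewrite /n1 /= !Z_pos4.
have n0 : n1 t != 0 by rewrite nE gt_eqF// ltr_pwDl -?expr2 ?exprn_even_gt0// sqr_ge0.
apply: (is_derive_eq h); rewrite /= angle_rate// -?nE// angular_velocity1.
have := gt_eqF (w_pos t); move: n0; move: (n1 t) (w t) => n ww n0 w0.
by field; rewrite n0 w0.
Qed.

Lemma is_derive_angle2 t : J t -> rval (y t) 2 != 0 ->
  is_derive t (1 : R) (fun s => atan (rval (y s) 3 / rval (y s) 2))
    ((w t)^-1 * (j2 t * (n2 t)^-1 + kappa * (w t + 1) * (j1 t + j2 t))).
Proof.
move=> Jt y0; have h : is_derive t (1 : R) (fun s => atan (rval (y s) 3 / rval (y s) 2)) _ :=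
  @y_observable (EAtan tan2) t (conj I (conj I y0)) Jt.
have nE : n2 t = rval (y t) 2 * rval (y t) 2 + rval (y t) 3 * rval (y t) 3.
  by rewrite /n2 /= !Z_pos4.
have n0 : n2 t != 0 by rewrite nE gt_eqF// ltr_pwDl -?expr2 ?exprn_even_gt0// sqr_ge0.
apply: (is_derive_eq h); rewrite /= angle_rate// -?nE// angular_velocity2.
have := gt_eqF (w_pos t); move: n0; move: (n2 t) (w t) => n ww n0 w0.
by field; rewrite n0 w0.
Qed.

Lemma interp_continuous E t : (forall z : 'rV[R]_(4 + 4), valid (rval z) E) -> J t ->
  {for t, continuous (fun s => interp (rval (Z s)) E)}.
Proof.
move=> vE Jt; have [d _] := is_derive_interp_curve (Z_derivable m0 B oJ unit Jt) (vE _).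
by apply: differentiable_continuous; exact/derivable1_diffP.
Qed.

(** Coefficients of [Q1] at mu = 1, in increasing powers of the radius variable n. *)
Definition quartic1 (l1 l2 K : R) : seq R :=
  [:: - (l1 * l1); e * l1 - K;
      kappa - (kappa * e * l2 + e ^+ 2 / 4 + kappa ^+ 2 * (l1 + l2) ^+ 2 - 2 * kappa * e * (l1 + l2));
      e * (l1 + l2) * kappa ^+ 2 - e ^+ 2 * kappa / 2; - (e ^+ 2 * kappa ^+ 2 / 4)].
Definition quartic2 (l1 l2 K : R) : seq R :=
  [:: - (l2 * l2); 1 + K - (e * l2 + 2 * kappa * (l1 + l2) ^+ 2);
      kappa - (- (kappa * e * l1) + e ^+ 2 / 4 + kappa ^+ 2 * (l1 + l2) ^+ 2 + 2 * kappa * e * (l1 + l2));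
      - (e * (l1 + l2) * kappa ^+ 2) - e ^+ 2 * kappa / 2; - (e ^+ 2 * kappa ^+ 2 / 4)].

Lemma quartic1E n l1 l2 K : Q1 kappa e n 1 l1 l2 K = quartic (quartic1 l1 l2 K) n.
Proof. by rewrite /Q1 /tau1v /quartic /=; field. Qed.

Lemma quartic2E n l1 l2 K : Q2 kappa e n 1 l1 l2 K = quartic (quartic2 l1 l2 K) n.
Proof. by rewrite /Q2 /tau2v /quartic /=; field. Qed.

Section AtTime.
Variable t0 : R.
Hypotheses (Jt0 : J t0) (y00 : 0 < rval (y t0) 0) (y20 : 0 < rval (y t0) 2)
  (r10 : r1 t0 != 0) (r20 : r2 t0 != 0).
Let l1 := interp (rval (Z t0)) (L1 kappa e).
Let l2 := interp (rval (Z t0)) (L2 kappa e).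
Let K := interp (rval (Z t0)) (KE kappa e).
Let s1 := Num.sg (r1 t0).
Let s2 := Num.sg (r2 t0).

Lemma constant_L1 t : J t -> interp (rval (Z t)) (L1 kappa e) = l1.
Proof. by move=> Jt; exact: (observable_constant m0 BB gE FE oJ unit mag (isT : (1 < 4)%N) Jt Jt0). Qed.

Lemma constant_L2 t : J t -> interp (rval (Z t)) (L2 kappa e) = l2.
Proof. by move=> Jt; exact: (observable_constant m0 BB gE FE oJ unit mag (isT : (2 < 4)%N) Jt Jt0). Qed.

Lemma constant_K t : J t -> interp (rval (Z t)) (KE kappa e) = K.
Proof. by move=> Jt; exact: (observable_constant m0 BB gE FE oJ unit mag (isT : (3 < 4)%N) Jt Jt0). Qed.

Lemma radial1_sq t : J t -> r1 t != 0 -> r1 t ^+ 2 = quartic (quartic1 l1 l2 K) (n1 t).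
Proof.
move=> Jt r0; have := Q1_start e k0 r0.
have hE : interp (rval (Z t)) (HE kappa e) = 2^-1 := energy_half e m0 BB gE unit Jt.
rewrite hE mulfV ?pnatr_eq0// sqrtr1 constant_L1// constant_L2// constant_K//.
by rewrite quartic1E.
Qed.

Lemma radial2_sq t : J t -> r1 t != 0 -> r2 t ^+ 2 = quartic (quartic2 l1 l2 K) (n2 t).
Proof.
move=> Jt r0; have := Q2_start e k0 r0.
have hE : interp (rval (Z t)) (HE kappa e) = 2^-1 := energy_half e m0 BB gE unit Jt.
rewrite hE mulfV ?pnatr_eq0// sqrtr1 constant_L1// constant_L2// constant_K//.
by rewrite quartic2E.
Qed.

Lemma angular1E t : J t -> j1 t = l1 + - (e * (n1 t * (2^-1 + kappa * 2^-1 * n2 t))).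
Proof.
move=> Jt; rewrite -(constant_L1 Jt).
have -> : interp (rval (Z t)) (L1 kappa e) = j1 t + e * (n1 t * (2^-1 + kappa * 2^-1 * n2 t)) by [].
by rewrite addrK.
Qed.

Lemma angular2E t : J t -> j2 t = l2 + e * (n2 t * (2^-1 + kappa * 2^-1 * n1 t)).
Proof.
move=> Jt; rewrite -(constant_L2 Jt).
have -> : interp (rval (Z t)) (L2 kappa e) = j2 t - e * (n2 t * (2^-1 + kappa * 2^-1 * n1 t)) by [].
by rewrite subrK.
Qed.

Definition scheme_constants (i : nat) : R :=
  if (i < 18)%N then nth 0 ([:: 1; kappa; e; l1; l2; 2^-1] ++ quartic1 l1 l2 K
    ++ quartic2 l1 l2 K ++ [:: 2 * s1; 2 * s2]) i
  else B (inord ((i - 18) %/ 4)) (inord ((i - 18) %% 4)).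

Lemma scheme_constants_frame (i j : 'I_4) : scheme_constants (4 * i + j + 18) = B i j.
Proof.
rewrite /scheme_constants ltnNge leq_addl /= addnK mulnC divnMDl// modnMDl.
by rewrite divn_small ?ltn_ord// addn0 modn_small ?ltn_ord// !inord_val.
Qed.

Lemma coordinates_by_schemes : exists (k : nat -> R) (I : set R),
  [/\ open_interval I, I t0, I `<=` J &
    forall i : 'I_4, by_scheme k (coordinateS i) I (fun t => gamma t 0 i)].
Proof.
set k := scheme_constants.
have pos0 E (x : R) : (forall z : 'rV[R]_(4 + 4), valid (rval z) E) ->
    0 < x * interp (rval (Z t0)) E -> \forall t \near t0, 0 < x * interp (rval (Z t)) E.
  move=> vE h; have hc : (fun t => x * interp (rval (Z t)) E) @ t0 --> x * interp (rval (Z t0)) E.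
    by apply: cvgMr; exact: interp_continuous.
  exact: cvgr_gt _ hc _ h.
have sg0 (x : R) : x != 0 -> 0 < Num.sg x * x.
  by move=> x0; rewrite -normrEsg normr_gt0.
(* The branches are fixed by the positivity of y_0 and y_2 and by the signs of the radial momenta;
   these four conditions are open in t and hold on a smaller interval. *)
have a1 : \forall t \near t0, 0 < 1 * interp (rval (Z t)) (EVar 0).
  by apply: pos0 => //; rewrite mul1r /= Z_pos4.
have a2 : \forall t \near t0, 0 < 1 * interp (rval (Z t)) (EVar 2).
  by apply: pos0 => //; rewrite mul1r /= Z_pos4.
have a3 : \forall t \near t0, 0 < s1 * r1 t.
  by apply: pos0 => //; exact: sg0.
have a4 : \forall t \near t0, 0 < s2 * r2 t.
  by apply: pos0 => //; exact: sg0.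
have [I0 [oI0 I0t I0J I0P]] := near_open_interval oJ Jt0 (filterI (filterI a1 a2) (filterI a3 a4)).
have P t : I0 t -> [/\ 0 < rval (y t) 0, 0 < rval (y t) 2, 0 < s1 * r1 t & 0 < s2 * r2 t].
  by move=> /I0P[[]]; rewrite !mul1r /= !Z_pos4 => ? ? [].
have r1n t : I0 t -> r1 t != 0.
  by move=> /P[_ _ + _]; apply: contraTneq => ->; rewrite mulr0 ltxx.
have s1s : s1 ^+ 2 = 1 by exact: sg_sq.
have s2s : s2 ^+ 2 = 1 by exact: sg_sq.
have hq1 i : (i < 5)%N -> k (i + 6) = (quartic1 l1 l2 K)`_i.
  by case: i => [|[|[|[|[|i]]]]].
have hq2 i : (i < 5)%N -> k (i + 11) = (quartic2 l1 l2 K)`_i.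
  by case: i => [|[|[|[|[|i]]]]].
have [I [oI It IJ0 hn1 hn2]] := @separated_motion R k I0 t0 kappa n1 n2 r1 r2
  (quartic (quartic1 l1 l2 K)) (quartic (quartic2 l1 l2 K)) 0 1 16 17 s1 s2
  (quarticS 6) (quarticS 11) oI0 I0t erefl erefl erefl erefl s1s s2s
  (fun t _ => w_pos t) (fun t It => is_derive_n1 (I0J t It)) (fun t It => is_derive_n2 (I0J t It))
  (fun t It => let: And4 _ _ h _ := P t It in h) (fun t It => let: And4 _ _ _ h := P t It in h)
  (fun t It => radial1_sq (I0J t It) (r1n t It)) (fun t It => radial2_sq (I0J t It) (r1n t It))
  (fun K' => by_scheme_quartic K' hq1) (fun K' => by_scheme_quartic K' hq2).
have IJ t : I t -> J t by move=> /IJ0/I0J.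
have y0p t : I t -> 0 < rval (y t) 0 by move=> /IJ0/P[].
have y2p t : I t -> 0 < rval (y t) 2 by move=> /IJ0/P[].
have nE1 t : n1 t = rval (y t) 0 * rval (y t) 0 + rval (y t) 1 * rval (y t) 1.
  by rewrite /n1 /= !Z_pos4.
have nE2 t : n2 t = rval (y t) 2 * rval (y t) 2 + rval (y t) 3 * rval (y t) 3.
  by rewrite /n2 /= !Z_pos4.
have n1p t : I t -> n1 t != 0.
  by move=> /y0p h; rewrite nE1 gt_eqF// ltr_pwDl ?mulr_gt0// -expr2 sqr_ge0.
have n2p t : I t -> n2 t != 0.
  by move=> /y2p h; rewrite nE2 gt_eqF// ltr_pwDl ?mulr_gt0// -expr2 sqr_ge0.
have cst i x J' : k i = x -> by_scheme k (SConst i) J' (fun=> x) by exact: by_scheme_cst.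
have hw : by_scheme k weightS I w.
  by apply: by_schemeD; [exact: cst|apply: by_schemeM; [exact: cst|exact: by_schemeD]].
have hj1 : by_scheme k angular1S I (fun t => l1 + - (e * (n1 t * (2^-1 + kappa * 2^-1 * n2 t)))).
  apply: by_schemeD; first exact: cst.
  apply: by_schemeN; apply: by_schemeM; first exact: cst.
  apply: by_schemeM => //; apply: by_schemeD; first exact: cst.
  by apply: by_schemeM => //; apply: by_schemeM; exact: cst.
have hj2 : by_scheme k angular2S I (fun t => l2 + e * (n2 t * (2^-1 + kappa * 2^-1 * n1 t))).
  apply: by_schemeD; first exact: cst.
  apply: by_schemeM; first exact: cst.
  apply: by_schemeM => //; apply: by_schemeD; first exact: cst.
  by apply: by_schemeM => //; apply: by_schemeM; exact: cst.
have {}hj1 : by_scheme k angular1S I j1.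
  by apply: by_scheme_eq hj1 => [|t /IJ/angular1E->//]; exact: oI.1.
have {}hj2 : by_scheme k angular2S I j2.
  by apply: by_scheme_eq hj2 => [|t /IJ/angular2E->//]; exact: oI.1.
have hangle (r jj : scheme) (n j al : R -> R) : by_scheme k r I n -> by_scheme k jj I j ->
    (forall t, I t -> n t != 0) ->
    (forall t, I t -> is_derive t (1 : R) al
      ((w t)^-1 * (j t * (n t)^-1 + kappa * (w t + 1) * (j1 t + j2 t)))) ->
    by_scheme k (angleS r jj) I al.
  move=> hr hj n0 dal; apply: by_scheme_prim dal.
  apply: by_schemeM; first by apply: by_schemeV => // t _; rewrite gt_eqF// w_pos.
  apply: by_schemeD; first by apply: by_schemeM => //; exact: by_schemeV.
  apply: by_schemeM; last exact: by_schemeD.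
  apply: by_schemeM; first exact: cst.
  by apply: by_schemeD => //; exact: cst.
have hu1 : by_scheme k tangent1S I (fun t => rval (y t) 1 / rval (y t) 0).
  apply: by_scheme_tangent => //; apply: hangle hn1 hj1 n1p _ => t It'.
  by apply: is_derive_angle1; [exact: IJ|rewrite gt_eqF// y0p].
have hu2 : by_scheme k tangent2S I (fun t => rval (y t) 3 / rval (y t) 2).
  apply: by_scheme_tangent => //; apply: hangle hn2 hj2 n2p _ => t It'.
  by apply: is_derive_angle2; [exact: IJ|rewrite gt_eqF// y2p].
have leg (x0 x1 n : R) : 0 < x0 -> n = x0 * x0 + x1 * x1 ->
    0 <= x0 /\ x0 ^+ 2 = n * (1 + x1 / x0 * (x1 / x0))^-1.
  move=> x00 ->; split; first exact: ltW.
  have x0n : x0 != 0 by rewrite gt_eqF.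
  have nn : x0 * x0 + x1 * x1 != 0.
    by rewrite gt_eqF// ltr_pwDl ?mulr_gt0// -expr2 sqr_ge0.
  have -> : 1 + x1 / x0 * (x1 / x0) = (x0 * x0 + x1 * x1) * (x0 * x0)^-1 by field.
  by field; rewrite nn x0n.
have hy0 : by_scheme k (legS radius1S tangent1S) I (fun t => rval (y t) 0).
  by apply: by_scheme_leg hn1 hu1 _ => // t It'; apply: leg; [exact: y0p|exact: nE1].
have hy2 : by_scheme k (legS radius2S tangent2S) I (fun t => rval (y t) 2).
  by apply: by_scheme_leg hn2 hu2 _ => // t It'; apply: leg; [exact: y2p|exact: nE2].
have hy1 : by_scheme k (SMul tangent1S (legS radius1S tangent1S)) I (fun t => rval (y t) 1).
  apply: by_scheme_eq (by_schemeM hu1 hy0); first exact: oI.1.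
  by move=> t It' /=; rewrite divfK// gt_eqF// y0p.
have hy3 : by_scheme k (SMul tangent2S (legS radius2S tangent2S)) I (fun t => rval (y t) 3).
  apply: by_scheme_eq (by_schemeM hu2 hy2); first exact: oI.1.
  by move=> t It' /=; rewrite divfK// gt_eqF// y2p.
exists k, I; split=> // i.
have kB n (n4 : (n < 4)%N) : k (4 * i + n + 18)%N = B i (Ordinal n4).
  exact: (scheme_constants_frame i (Ordinal n4)).
have sum : by_scheme k (coordinateS i) I (fun t =>
    (B i (Ordinal (isT : 0 < 4)%N) * rval (y t) 0 + B i (Ordinal (isT : 1 < 4)%N) * rval (y t) 1)
  + (B i (Ordinal (isT : 2 < 4)%N) * rval (y t) 2 + B i (Ordinal (isT : 3 < 4)%N) * rval (y t) 3)).
  apply: by_schemeD; apply: by_schemeD; (apply: by_schemeM; [exact: cst (kB _ _)|]).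
  - exact: hy0.
  - exact: hy1.
  - exact: hy2.
  - exact: hy3.
apply: by_scheme_eq sum; first exact: oI.1.
move=> t It'; have -> : gamma t = y t *m B^T by rewrite /y -mulmxA BB mulmx1.
rewrite mulrow4E ![B^T _ _]mxE.
have -> : Ordinal (isT : 0 < 4)%N = 0 :> 'I_4 by exact/val_inj.
have -> : Ordinal (isT : 1 < 4)%N = 1 :> 'I_4 by exact/val_inj.
have -> : Ordinal (isT : 2 < 4)%N = 2 :> 'I_4 by exact/val_inj.
have -> : Ordinal (isT : 3 < 4)%N = 3 :> 'I_4 by exact/val_inj.
by ring.
Qed.

End AtTime.

End Coordinates.

(** Although e, c and the frame depend on the curve, they enter [coordinateS] only through the
    values of the constants, so the schemes are the same for all generic curves. *)
Lemma tn_quadratures (R : realType) (m : R) : 0 <= m ->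
  conformal_geodesics_by_quadratures (tn_metric m).
Proof.
move=> m0; exists coordinateS, (generic_data m); split.
- exact: open_generic_data.
- exact: generic_data_dense.
move=> J gamma t0 oJ unit cg Jt0 gen.
have [iff _] := conformal_geodesic_iff m0 oJ unit; have [e [c [e0 c1 mag]]] := iff.1 cg.
have [B [BB gE FE [y0 y2 r1 r2]]] := generic_adapted m0 c1 (unit.2 t0 Jt0) (mag t0 Jt0) gen.
apply: (coordinates_by_schemes m0 BB gE FE oJ unit mag Jt0 y0 y2).
- apply: contra_neq r1 => h; have := radial_velocity1 BB gE gamma t0.
  by rewrite h mul0r.
- apply: contra_neq r2 => h; have := radial_velocity2 BB gE gamma t0.
  by rewrite h mul0r.
Qed.

Theorem theorem1p1 (R : realType) (m : R) (hm : 0 <= m) :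
  let g := tn_metric m in
  let unit_vector := fun c : 'rV[R]_3 => \sum_i c 0 i ^+ 2 = 1 in
  (* (1): reduction to a magnetic geodesic equation *)
  (forall (J : set R) (gamma : R -> 'rV[R]_4),
     open_interval J -> unit_speed_curve g J gamma ->
     (conformal_geodesic g J gamma <->
      exists (e : R) (c : 'rV[R]_3),
        [/\ 0 <= e, unit_vector c & magnetic_geodesic g (tn_F m c) e J gamma])
     /\
     (forall (e : R) (c : 'rV[R]_3), 0 <= e -> unit_vector c ->
        magnetic_geodesic g (tn_F m c) e J gamma ->
        forall t, J t ->
          let a := acceleration g gamma t in
          e = Num.sqrt (inner g (gamma t) a a)))
  /\
  (forall (e : R) (c : 'rV[R]_3), 0 <= e -> unit_vector c ->
     (* (1): the Hamiltonian system describes the magnetic motion *)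
     (forall (J : set R) (z : R -> 'rV[R]_(4 + 4)),
        open_interval J -> Ck_on 1 J z ->
        let q := fun t => pos (z t) in
        hamilton_equations (tn_F m c) e (hamiltonian g) J z <->
        (forall t, J t -> derive1 q t = sharp g (q t) (mom (z t)))
        /\ magnetic_geodesic g (tn_F m c) e J q)
     (* (1): Arnold-Liouville integrability *)
     /\ liouville_integrable (tn_F m c) e (hamiltonian g)
     (* (2): separability of the Hamilton-Jacobi equation *)
     /\ hj_separable g (tn_F m c) e)
  /\
  (* (2): reduction to quadratures *)
  conformal_geodesics_by_quadratures g.
Proof.
move=> g unit_vector; split; last split; last exact: tn_quadratures.
  by move=> J gamma oJ un; exact: conformal_geodesic_iff.
move=> e c e0 c1; split; last by split; [exact: tn_liouville|exact: tn_hj_separable].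
move=> J z oJ Cz q; have [ge gVe _ _] := tn_elementary hm.
have Fs p : (tn_F m c p)^T = - tn_F m c p by exact: tn_F_skew.
exact: (hamilton_equations_iff e ge gVe (tn_metric_sym hm) (fun p => (tn_metric_unit hm p).1)
  Fs oJ (Ck_on_curve oJ.1 Cz).2).
Qed.
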